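(* Let $S$ be a smooth complex projective surface and $f:S\dashrightarrow S$ a rational map preserving a meromorphic two-form $\eta$ such that $-\mathrm{Div}(\eta)$ is effective. If there exists a modification $\pi:X\to S$ lifting $f$ to an algebraically stable map on $X$, then there exists a modification $\pi:X\to S$ lifting $f$ to an algebraically stable map on $X$ for which, in addition, $-\mathrm{Div}(\pi^*\eta)$ is effective.
   Context: $f$ preserves $\eta$ if $f^*\eta=\delta\eta$ for some $\delta\in\mathbf{C}^*$ (pullback defined off the finite indeterminacy set of $f$ and extended meromorphically). A modification $\pi:X\to S$ is a composition of finitely many point blowups (between smooth projective surfaces). The lift of $f$ to $X$ is $f_X=\pi^{-1}\circ f\circ\pi:X\dashrightarrow X$. Writing a rational self-map as $g=\pi_2\circ\pi_1^{-1}$ with $\pi_1:\Gamma\to X$ a modification and $\pi_2:\Gamma\to X$ holomorphic, pullback on $\mathrm{Pic}(X)$ is $g^*=\pi_{1*}\pi_2^*$; $g$ is algebraically stable if $(g^n)^*=(g^* )^n$ on $\mathrm{Pic}(X)$ for all $n\in\mathbf{N}$. $\mathrm{Div}(\eta)$ is the divisor (zeros minus poles) of $\eta$; the zero divisor counts as effective. *)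

(* Defs.v *)
From HB Require Import structures.
From mathcomp Require Export all_boot all_order all_algebra.
From mathcomp Require Export reals classical_sets cardinality complex mpoly.

Set Implicit Arguments.
Unset Strict Implicit.
Unset Printing Implicit Defensive.
Import GRing.Theory Num.Theory.
Local Open Scope ring_scope.

(* Irreducible projective varieties are presented by a generic point.  With   *)
(* x_0, ..., x_{n-1} the coordinates vgen, X is the closed subvariety of      *)
(* P^{n-1} whose homogeneous ideal is generated by the homogeneous F with     *)
(* F(x) = 0; under the conditions [generates_field] and [vgen_neq0] below,    *)
(* vfield is the function field k(X).  Every irreducible projective variety   *)
(* arises in this way (x_i := X_i / X_j for some X_j not vanishing on X).     *)
Record pvar (k : fieldType) := PVar {
  vcoords : nat;
  vfield : fieldType;
  viota : {rmorphism k -> vfield};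
  vgen : 'I_vcoords -> vfield
}.

Definition vgen_neq0 (k : fieldType) (X : pvar k) : Prop :=
  exists i, vgen (p := X) i != 0.

Definition generates_field (k : fieldType) (X : pvar k) : Prop :=
  forall h : vfield X, exists d (F G : {mpoly k[vcoords X]}),
    [/\ F \is d.-homog, G \is d.-homog, mmap (viota X) (@vgen k X) G != 0
      & h = mmap (viota X) (@vgen k X) F / mmap (viota X) (@vgen k X) G].

(* Points of X with values in an extension j : k -> L, given by homogeneous   *)
(* coordinates; proportional vectors are the same point, and every notion     *)
(* below is invariant under rescaling.                                        *)
Record point (k : fieldType) (X : pvar k) (L : fieldType) (j : k -> L) :=
  Point {
    pt_coord :> 'I_(vcoords X) -> L;
    pt_neq0 : exists i, pt_coord i != 0;
    pt_on : forall d (F : {mpoly k[vcoords X]}), F \is d.-homog ->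
      mmap (viota X) (@vgen k X) F = 0 -> mmap j pt_coord F = 0
  }.

(* For k algebraically closed these are all the closed points of X. *)
Definition cpoint (k : fieldType) (X : pvar k) := point X (idfun : k -> k).

(* A rational map X --> Y, not necessarily dominant, is a point of Y with     *)
(* values in the function field of X.                                         *)
Definition ratmap (k : fieldType) (X Y : pvar k) := point Y (viota X).

Definition same_point (k : fieldType) (X : pvar k) (L : fieldType)
    (y z : 'I_(vcoords X) -> L) : Prop :=
  exists2 c : L, c != 0 & forall i, y i = c * z i.

(* The rational function h on X is defined at y, with value t.  For y a       *)
(* closed point this is evaluation; for y a rational map to X, t is the       *)
(* pullback of h by y.                                                        *)
Definition eval_at (k : fieldType) (X : pvar k) (L : fieldType) (j : k -> L)
    (y : point X j) (h : vfield X) (t : L) : Prop :=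
  exists d (F G : {mpoly k[vcoords X]}),
    [/\ F \is d.-homog, G \is d.-homog, mmap j y G != 0,
        h = mmap (viota X) (@vgen k X) F / mmap (viota X) (@vgen k X) G
      & t = mmap j y F / mmap j y G].

(* Membership in the local ring of X at (the image of) y. *)
Definition regular_at (k : fieldType) (X : pvar k) (L : fieldType)
    (j : k -> L) (y : point X j) (h : vfield X) : Prop :=
  exists t, eval_at y h t.

(* g is defined at y and g(y) = z: after rescaling by c, the coordinates of g *)
(* are regular at y and their values are coordinates of z.                    *)
Definition maps_to (k : fieldType) (X Y : pvar k) (g : ratmap X Y)
    (L : fieldType) (j : k -> L) (y : point X j) (z : point Y j) : Prop :=
  exists (c : vfield X) (e : L),
    e != 0 /\ forall i, eval_at y (c * g i) (e * z i).

(* h = g \o f, as g evaluated at the generic point of f. *)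
Definition is_comp (k : fieldType) (X Y Z : pvar k)
    (g : ratmap Y Z) (f : ratmap X Y) (h : ratmap X Z) : Prop :=
  maps_to g f h.

Definition is_id (k : fieldType) (X : pvar k) (h : ratmap X X) : Prop :=
  same_point h (@vgen k X).

Fixpoint is_iter (k : fieldType) (X : pvar k) (g : ratmap X X) (n : nat)
    (h : ratmap X X) : Prop :=
  if n is m.+1 then exists2 h', is_iter g m h' & is_comp g h' h else is_id h.

Definition morphism (k : fieldType) (X Y : pvar k) (g : ratmap X Y) : Prop :=
  forall a : cpoint X, exists b : cpoint Y, maps_to g a b.

Definition inverse_maps (k : fieldType) (X Y : pvar k)
    (g : ratmap X Y) (g' : ratmap Y X) : Prop :=
  (exists2 h, is_id h & is_comp g' g h) /\ (exists2 h, is_id h & is_comp g g' h).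

Definition isomorphism (k : fieldType) (X Y : pvar k) (g : ratmap X Y) : Prop :=
  morphism g /\ exists2 g' : ratmap Y X, morphism g' & inverse_maps g g'.

Definition alg_indep (k K : fieldType) (iota : k -> K) (n : nat)
    (z : 'I_n -> K) : Prop :=
  forall F : {mpoly k[n]}, mmap iota z F = 0 -> F = 0.

Definition has_trdeg (k K : fieldType) (iota : k -> K) (n : nat) : Prop :=
  (exists z : 'I_n -> K, alg_indep iota z)
  /\ ~ (exists z : 'I_n.+1 -> K, alg_indep iota z).

(* u and w generate the maximal ideal of the local ring at a. *)
Definition local_params (k : fieldType) (X : pvar k) (a : cpoint X)
    (u w : vfield X) : Prop :=
  [/\ eval_at a u 0, eval_at a w 0
    & forall h, eval_at a h 0 -> exists r s,
        [/\ regular_at a r, regular_at a s & h = r * u + s * w]].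

(* Smooth: the local ring at each closed point is regular (of dimension 2). *)
Record surface (k : fieldType) := Surface {
  svar :> pvar k;
  s_neq0 : vgen_neq0 svar;
  s_gen : generates_field svar;
  s_dim : has_trdeg (viota svar) 2;
  s_smooth : forall a : cpoint svar, exists u w, local_params a u w
}.

(* The blowup of Y at p, as the closure of the graph of the projection from   *)
(* p, y |-> (y, [p_a y_b - p_b y_a]_{a,b}), in its Segre embedding.           *)
Definition blowup_model (k : fieldType) (Y : surface k) (p : cpoint Y) :
    pvar k :=
  let I := ('I_(vcoords Y) * 'I_(vcoords Y) * 'I_(vcoords Y))%type in
  let y := @vgen k Y in
  @PVar k #|{: I}| (vfield Y) (viota Y)
    (fun m => let: (i, a, b) := enum_val m in
       y i * (viota Y (p a) * y b - viota Y (p b) * y a)).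

Definition blowdown (k : fieldType) (Y : surface k) (p : cpoint Y) :
    ratmap (blowup_model p) Y :=
  @Point k Y (vfield Y) (viota Y) (@vgen k Y) (s_neq0 Y) (fun d F _ F0 => F0).

Definition point_blowup (k : fieldType) (X Y : surface k) (p : cpoint Y)
    (beta : ratmap X Y) : Prop :=
  exists2 theta : ratmap X (blowup_model p),
    isomorphism theta & is_comp (blowdown p) theta beta.

(* Surfaces are only given up to isomorphism, so the composition of zero      *)
(* blowups is an isomorphism.                                                 *)
Inductive modification (k : fieldType) (S : surface k) :
    forall X : surface k, ratmap X S -> Prop :=
| modification_iso (X : surface k) (pi : ratmap X S) :
    isomorphism pi -> @modification k S X pi
| modification_blowup (X Y : surface k) (p : cpoint Y) (rho : ratmap Y S)
    (beta : ratmap X Y) (pi : ratmap X S) :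
    @modification k S Y rho -> point_blowup p beta -> is_comp rho beta pi ->
    @modification k S X pi.

(* fX = pi^-1 \o f \o pi *)
Definition is_lift (k : fieldType) (X S : pvar k) (pi : ratmap X S)
    (f : ratmap S S) (fX : ratmap X X) : Prop :=
  exists (pi' : ratmap S X) (h : ratmap X S),
    [/\ inverse_maps pi pi', is_comp f pi h & is_comp pi' h fX].

(* Irreducible curves on X, as the associated order functions: normalized     *)
(* discrete valuations whose ring is the local ring of X along a subvariety   *)
(* (the closure of the image of c).  This ring being a discrete valuation     *)
(* ring forces the subvariety to have codimension 1.  By convention the value *)
(* at 0 is 0.                                                                 *)
Record primediv (k : fieldType) (X : pvar k) := PrimeDiv {
  ord :> vfield X -> int;
  ord0 : ord 0 = 0;
  ordM : forall g h, g != 0 -> h != 0 -> ord (g * h) = ord g + ord h;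
  ordD : forall g h, g != 0 -> h != 0 -> g + h != 0 ->
    Num.min (ord g) (ord h) <= ord (g + h);
  ord_norm : exists t, ord t = 1;
  ord_ring : exists (L : fieldType) (j : {rmorphism k -> L}) (c : point X j),
    forall h, 0 <= ord h <-> regular_at c h
}.

Definition passes_through (k : fieldType) (X : pvar k) (v : primediv X)
    (a : cpoint X) : Prop :=
  forall h, regular_at a h -> 0 <= v h.

Record divisor (k : fieldType) (X : pvar k) := Divisor {
  mult :> primediv X -> int;
  mult_finite : finite_set [set v | mult v <> 0]
}.

(* Equality in Pic(X), identified with divisors modulo principal divisors. *)
Definition lin_equiv (k : fieldType) (X : pvar k) (D E : divisor X) : Prop :=
  exists2 h : vfield X, h != 0 & forall v : primediv X, D v = E v + v h.

Definition local_equation (k : fieldType) (X : pvar k) (D : divisor X)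
    (a : cpoint X) (h : vfield X) : Prop :=
  h != 0 /\ forall v : primediv X, passes_through v a -> D v = v h.

(* E = g^* D for g a morphism: g pulls back local equations of D to local     *)
(* equations of E.                                                            *)
Definition pullback_div (k : fieldType) (X Y : pvar k) (g : ratmap X Y)
    (D : divisor Y) (E : divisor X) : Prop :=
  forall (a : cpoint X) (b : cpoint Y), maps_to g a b ->
  forall h, local_equation D b h ->
  exists2 h', eval_at g h h' & local_equation E a h'.

(* E = pi_* D for pi : X -> Y a modification: the multiplicity of E along a   *)
(* curve is that of D along its strict transform; curves contracted by pi     *)
(* contribute 0.                                                              *)
Definition pushforward_div (k : fieldType) (X Y : pvar k) (pi : ratmap X Y)
    (D : divisor X) (E : divisor Y) : Prop :=
  forall (v : primediv Y) (w : primediv X),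
    (forall h h', eval_at pi h h' -> w h' = v h) -> E v = D w.

(* The graph of g^* = pi1_* pi2^* on Pic(X), as a relation between            *)
(* representatives that is saturated under linear equivalence.                *)
Definition pullback_Pic (k : fieldType) (X : surface k) (g : ratmap X X)
    (D E : divisor X) : Prop :=
  exists (Gamma : surface k) (pi1 pi2 : ratmap Gamma X),
    [/\ modification pi1, morphism pi2, is_comp g pi1 pi2
      & exists (D1 : divisor X) (D2 : divisor Gamma) (D3 : divisor X),
          [/\ lin_equiv D D1, pullback_div pi2 D1 D2,
              pushforward_div pi1 D2 D3 & lin_equiv D3 E]].

Fixpoint iter_Pic (k : fieldType) (X : pvar k)
    (T : divisor X -> divisor X -> Prop) (n : nat) (D E : divisor X) : Prop :=
  if n is m.+1 then exists2 D', iter_Pic T m D D' & T D' E else lin_equiv D E.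

Definition alg_stable (k : fieldType) (X : surface k) (g : ratmap X X) : Prop :=
  forall n, exists2 gn, is_iter g n gn &
    forall D E, pullback_Pic gn D E <-> iter_Pic (pullback_Pic g) n D E.

Record derivation (k : fieldType) (X : pvar k) := Derivation {
  der :> vfield X -> vfield X;
  derD : forall g h, der (g + h) = der g + der h;
  derM : forall g h, der (g * h) = g * der h + der g * h;
  derC : forall c, der (viota X c) = 0
}.

(* Meromorphic two-forms on a projective surface are rational; they are the   *)
(* alternating bilinear forms on the rational vector fields (derivations of   *)
(* the function field).  Additivity and homogeneity refer to the values of    *)
(* the derivations, so a two-form does not distinguish extensionally equal    *)
(* derivations.                                                               *)
Record two_form (k : fieldType) (X : pvar k) := TwoForm {
  form :> derivation X -> derivation X -> vfield X;
  form_linl : forall (c : vfield X) (D1 D2 D3 E : derivation X),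
    (forall h, D3 h = c * D1 h + D2 h) ->
    form D3 E = c * form D1 E + form D2 E;
  form_linr : forall (c : vfield X) (D1 D2 D3 E : derivation X),
    (forall h, D3 h = c * D1 h + D2 h) ->
    form E D3 = c * form E D1 + form E D2;
  form_alt : forall D, form D D = 0
}.

(* eta = h da /\ db *)
Definition form_is (k : fieldType) (X : pvar k) (eta : two_form X)
    (h a b : vfield X) : Prop :=
  forall D E : derivation X, eta D E = h * (D a * E b - D b * E a).

(* eta' = f^* eta, i.e. f^*(h da /\ db) = (f^*h) d(f^*a) /\ d(f^*b). *)
Definition pullback_form (k : fieldType) (X Y : pvar k) (f : ratmap X Y)
    (eta : two_form Y) (eta' : two_form X) : Prop :=
  exists h a b h' a' b',
    [/\ form_is eta h a b,
        [/\ eval_at f h h', eval_at f a a' & eval_at f b b']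
      & form_is eta' h' a' b'].

Definition preserves (k : fieldType) (X : pvar k) (f : ratmap X X)
    (eta : two_form X) : Prop :=
  exists2 delta : k, delta != 0 &
    exists2 eta', pullback_form f eta eta'
      & forall D E, eta' D E = viota X delta * eta D E.

(* D = Div(eta): writing eta = h du /\ dw in local parameters u, w at a, h is *)
(* a local equation of D at a.  No D exists for eta = 0.                      *)
Definition is_Div (k : fieldType) (X : pvar k) (eta : two_form X)
    (D : divisor X) : Prop :=
  forall (a : cpoint X) u w, local_params a u w ->
  exists2 h, form_is eta h u w & local_equation D a h.

Definition neg_Div_effective (k : fieldType) (X : pvar k) (eta : two_form X) :
    Prop :=
  exists2 D : divisor X, is_Div eta D & forall v : primediv X, 0 <= - D v.

(* Main.v *)
(* Let pi : X -> S lift f to an algebraically stable map.  Follow pi blowup by   *)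

(* Write the form locally as c du /\ dw. Blowing up a point replaces c by c u, with u an exceptional
   equation ([feq_blow]). If 1/c vanishes at the center, then 1/(c u) is still regular
   ([lanti_blow]); if c is regular there, the exceptional curve is a zero of the form
   ([exceptional_case]). Where -Div is effective one of the two always happens. So following the
   tower X -> S and keeping only the blowups at poles gives X' on which -Div stays effective, and
   the curves of X lost on X' are curves of positive order. [adapted_modification] runs this
   induction, with [adapted_pole] and [adapted_free] as its two cases. It needs X -> X' to be a
   local isomorphism over the poles, so that a center lying over a pole is the same point on both
   surfaces.

   Stability descends because the positive curves are respected by pullback: f multiplies the form
   by a constant, so a curve mapped into a positive curve is positive. Hence the multiplicities of a
   pullback along non-positive curves depend only on multiplicities along non-positive curves
   ([pullback_nonpos], [gval_compatible]). [divisor_transfer] turns this into a pushforward of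
   classes from X to X' that commutes with pullbacks and has a section, and [alg_stable_contraction]
   concludes.

   The supporting theory has three layers. Local: the partial derivatives for local parameters
   preserve the local ring ([dual_local]), which with Krull's theorem yields unique factorization
   ([factorization]) and extension across points ([hartogs], [hartogs_gen]). Global:
   [nullstellensatz] provides closed points on curves, [near_cover] finiteness of divisors, and
   [gval_le] shows that total transforms do not depend on the local equation. Resolution: [lam_drop]
   and [resolved_lam] give [indeterminacy], hence a pullback on Pic for every dominant map. The map
   f is dominant because its pullback of the nonzero form is nonzero ([dominant]). *)
(* blowup, performing only the blowups centered at poles of eta: this gives a    *)
(* modification pi' : X' -> S dominated by X.  A blowup centered at a pole       *)
(* lowers its order by at most one, so -Div(pi'^* eta) is still effective, while *)
(* every curve created by one of the other blowups is a zero of pi^* eta.  Thus  *)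
(* X -> X' contracts exactly the zero curves of pi^* eta.                        *)
(*   As f multiplies eta by a constant, a curve mapped into a zero curve is a    *)
(* zero curve.  Hence the span of the zero curves in Pic X is stable under the   *)
(* pullbacks by the iterates of f, the pullbacks on Pic X' are those induced on  *)
(* the quotient, and algebraic stability descends from X to X'.                  *)
(*   Curves are handled as discrete valuations of the function field, and points *)
(* through their local rings.  For a rational map g and a curve v, the pullback  *)
(* of a divisor D has multiplicity v(g^* h) along v, for h a local equation of D *)
(* at the center of v \o g^*, so that no resolution of g enters the comparison.  *)
(* For the pullback on Pic to exist at all g must be resolved: blowing up a      *)
(* point of indeterminacy lowers the colength of the base ideal above it.        *)
From HB Require Import structures.
Require Import Defs.
From mathcomp Require Import boolp functions ring zify.
Set Implicit Arguments.
Unset Strict Implicit.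
Unset Printing Implicit Defensive.
Import Order.TTheory GRing.Theory Num.Theory.
Local Open Scope ring_scope.
Local Notation o0 := fintype.ord0.

(** * Derivations of function fields *)

Section MpolyInd.
Variables (n : nat) (k : comNzRingType) (P : {mpoly k[n]} -> Prop).
Hypotheses (PC : forall c, P c%:MP) (PX : forall i, P 'X_i).
Hypotheses (PD : forall F G, P F -> P G -> P (F + G)).
Hypotheses (PM : forall F G, P F -> P G -> P (F * G)).

Lemma mpoly_ring_ind F : P F.
Proof.
elim/mpolyind: F => [|c m p _ _ Pp]; first by rewrite -mpolyC0.
apply: PD => //; rewrite -mul_mpolyC; apply: PM => //.
rewrite mpolyXE_id; elim/big_ind: _ => //; first by rewrite -mpolyC1.
move=> i _; elim: (m i) => [|e IH]; first by rewrite expr0 -mpolyC1.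
by rewrite exprS; apply: PM.
Qed.
End MpolyInd.

Section MpolyDeriv.
Variables (n : nat) (k : numFieldType).

Lemma msize_mderiv (F : {mpoly k[n]}) i :
  F != 0 -> (msize F^`M(i) < msize F)%N.
Proof.
move=> F0; rewrite [X in (X < _)%N]msizeE.
have: (0 < msize F)%N by rewrite lt0n msize_poly_eq0.
case E: (msize F) => [|s] // _; rewrite ltnS; apply/bigmax_leqP_seq => m.
rewrite mcoeff_msupp mcoeff_mderiv => Fm _.
have : (m + U_(i))%MM \in msupp F.
  by rewrite mcoeff_msupp; apply: contra_neq Fm => ->; rewrite mul0rn.
by move/msize_mdeg_lt; rewrite E mdegD mdeg1 addn1 ltnS.
Qed.

(** Characteristic zero enters here: a partial derivative multiplies the coefficient of a monomial
    containing the variable by a nonzero integer. *)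
Lemma mderiv_eq0 (F : {mpoly k[n]}) :
  (forall i, F^`M(i) = 0) -> F = (F@_0)%:MP.
Proof.
move=> dF; apply/mpolyP => m; rewrite mcoeffC.
have [->|m0] := eqVneq 0%MM m; first by rewrite mulr1.
rewrite mulr0; have [i mi] : exists i, m i != 0%N.
  apply/existsP; rewrite -negb_forall; apply: contra m0 => /forallP h.
  by apply/eqP/mnmP => i; rewrite mnm0E; apply/esym/eqP/h.
have mE : m = (m - U_(i) + U_(i))%MM.
  apply/mnmP => j; rewrite mnmDE mnmBE mnm1E subnK //.
  by case: eqP => [<-|]//; rewrite lt0n.
have := mcoeff_mderiv i F (m - U_(i)); rewrite -mE dF mcoeff0.
by move/esym/eqP; rewrite mulrn_eq0 /= => /eqP.
Qed.
End MpolyDeriv.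

Section Gder.
Variable k : numFieldType.

(** Derivations with values in N, on which M acts through [g]. For [g = idfun] these are the vector
    fields of a function field; for [g] a pullback they include the composites of a vector field
    with [g], which [feq_map] uses. *)
Definition gder (M N : fieldType) (i : {rmorphism k -> M})
    (g : {rmorphism M -> N}) (T : M -> N) :=
  [/\ {morph T : x y / x + y},
      forall x y, T (x * y) = g x * T y + T x * g y & forall c, T (i c) = 0].

Lemma gder_chain (M N : fieldType) (i : {rmorphism k -> M})
    (g : {rmorphism M -> N}) T n (z : 'I_n -> M) (F : {mpoly k[n]}) :
  gder i g T ->
  T (mmap i z F) = \sum_j g (mmap i z F^`M(j)) * T (z j).
Proof.
move=> [TD TM TC]; elim/mpoly_ring_ind: F => [c|j|F G IF IG|F G IF IG].
- rewrite mmapC TC big1 // => j _; by rewrite mderivC mmap0 rmorph0 mul0r.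
- rewrite mmapX mmap1U (bigD1 j) //= big1 ?addr0 => [|l /negPf lj].
    rewrite mderivX mnm1E eqxx scale1r.
    have -> : (U_(j) - U_(j) = 0 :> 'X_{1..n})%MM by apply/mnmP => l; rewrite mnmBE subnn mnm0E.
    by rewrite mmapX mmap11 rmorph1 mul1r.
  by rewrite mderivX mnm1E eq_sym lj scale0r mmap0 rmorph0 mul0r.
- rewrite mmapD TD IF IG -big_split /=; apply: eq_bigr => j _.
  by rewrite mderivD mmapD rmorphD mulrDl.
- rewrite rmorphM /= TM IF IG mulr_sumr mulr_suml -big_split /=.
  apply: eq_bigr => j _; rewrite mderivM mmapD !rmorphM rmorphD !rmorphM /=.
  ring.
Qed.

Lemma gder0 (M N : fieldType) (i : {rmorphism k -> M})
    (g : {rmorphism M -> N}) T : gder i g T -> T 0 = 0.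
Proof. by case=> _ _ TC; rewrite -(rmorph0 i) TC. Qed.

Lemma gderN (M N : fieldType) (i : {rmorphism k -> M})
    (g : {rmorphism M -> N}) T x : gder i g T -> T (- x) = - T x.
Proof.
move=> dT; have [TD _ _] := dT.
by apply/eqP; rewrite -addr_eq0 -TD addNr (gder0 dT).
Qed.

Lemma gderV (M N : fieldType) (i : {rmorphism k -> M})
    (g : {rmorphism M -> N}) T x : gder i g T -> 
    T (x^-1) = - T x / g x ^+ 2.
Proof.
move=> dT; have [->|x0] := eqVneq x 0.
  by rewrite invr0 rmorph0 (gder0 dT) oppr0 mul0r.
have [_ TM TC] := dT; have := TM x x^-1.
rewrite divff // -(rmorph1 i) TC fmorphV => /eqP.
rewrite eq_sym addr_eq0 => /eqP h; have gx : g x != 0 by rewrite fmorph_eq0.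
apply: (mulfI gx); rewrite h; field.
by rewrite gx.
Qed.

Lemma gder_div (M N : fieldType) (i : {rmorphism k -> M})
    (g : {rmorphism M -> N}) T x y : gder i g T -> y != 0 ->
    T (x / y) = (g y * T x - g x * T y) / g y ^+ 2.
Proof.
move=> dT y0; have [_ TM TC] := dT; rewrite TM (gderV _ dT) fmorphV.
have gy : g y != 0 by rewrite fmorph_eq0.
by field.
Qed.
End Gder.

(** * Derivations and two-forms in transcendence degree two *)

Section Trdeg2.
Variables (k : numFieldType) (L : fieldType) (iota : {rmorphism k -> L}).

Definition der_on (D : L -> L) := gder iota idfun D.
Definition det2 (D E : L -> L) (a b : L) := D a * E b - D b * E a.
Definition no_indep3 := ~ exists z : 'I_3 -> L, alg_indep iota z.

Lemma der_lin (D E : L -> L) c d : der_on D -> der_on E ->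
  der_on (fun x => c * D x + d * E x).
Proof.
move=> [DD DM DC] [ED EM EC]; split => [x y|x y|z] /=.
- by rewrite DD ED; ring.
- by rewrite DM EM /=; ring.
- by rewrite DC EC !mulr0 addr0.
Qed.

Section Dual.
Variables (D E : L -> L) (dD : der_on D) (dE : der_on E) (a b : L).
Hypothesis ab0 : det2 D E a b != 0.

(** Cramer's rule for the 2x2 matrix of the values of D, E at a, b; the results play the part of
    d/da and d/db. *)
Lemma dual_ders : exists d1 d2 : L -> L, [/\ der_on d1, der_on d2,
  d1 a = 1 /\ d1 b = 0 & d2 a = 0 /\ d2 b = 1].
Proof.
exists (fun x => (E b / det2 D E a b) * D x + (- D b / det2 D E a b) * E x).
exists (fun x => (- E a / det2 D E a b) * D x + (D a / det2 D E a b) * E x).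
split; [exact: der_lin|exact: der_lin| |]; move: ab0; rewrite /det2 => h;
 by split; field.
Qed.
End Dual.

Section Dual2.
Variables (d1 d2 : L -> L) (dd1 : der_on d1) (dd2 : der_on d2) (a b : L).
Hypotheses (d1a : d1 a = 1) (d1b : d1 b = 0) (d2a : d2 a = 0) (d2b : d2 b = 1).

(** Applying [d1] and [d2] to a relation gives relations with both partial derivatives, which have
    smaller size and vanish by induction; then F is constant. *)
Lemma alg_indep_ab (F : {mpoly k[2]}) :
  mmap iota (fun i : 'I_2 => if i == 0 then a else b) F = 0 -> F = 0.
Proof.
set z := fun _ => _.
have [s] := ubnP (msize F); elim: s F => // s IH F; rewrite ltnS => sF F0.
have [//|nF] := eqVneq F 0.
have dF0 j : F^`M(j) = 0.
  apply: IH; first exact: leq_trans (msize_mderiv j nF) sF.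
  have h1 := gder_chain z F dd1; have h2 := gder_chain z F dd2.
  rewrite F0 (gder0 dd1) (gder0 dd2) !big_ord_recl !big_ord0 in h1 h2.
  move: h1 h2; rewrite /z /= d1a d1b d2a d2b !mulr1 !mulr0 !addr0 add0r.
  by case: j => [[|[|//]] lj] h1 h2; rewrite -/z; [rewrite [RHS]h1|rewrite [RHS]h2];
    congr (mmap _ _ (mderiv _ _)); exact/val_inj.
have e := mderiv_eq0 dF0.
move: F0; rewrite e mmapC => /eqP; rewrite fmorph_eq0 => /eqP ->.
by rewrite mpolyC0.
Qed.

Hypothesis n3 : no_indep3.

(** Since a, b, f are dependent, some F(a, b, f) = 0, and applying T leaves F_3(a, b, f) T(f) = 0.
    If F_3 vanishes at the point, F is replaced by a nonzero partial derivative vanishing there, of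
    smaller size. *)
Lemma gder_eq0 (N : fieldType) (g : {rmorphism L -> N}) T :
  gder iota g T -> T a = 0 -> T b = 0 -> forall f, T f = 0.
Proof.
move=> dT Ta Tb f.
pose z (i : 'I_3) := [:: a; b; f]`_i.
have [F [F0 nF]] : exists F : {mpoly k[3]}, mmap iota z F = 0 /\ F <> 0.
  apply: contrapT => h; apply: n3; exists z => F F0; apply: contrapT => nF.
  by apply: h; exists F.
have [s] := ubnP (msize F); elim: s F F0 nF => // s IH F F0 /eqP nF; rewrite ltnS => sF.
have IHd j : mmap iota z F^`M(j) = 0 -> F^`M(j) <> 0 -> T f = 0.
  move=> h1 h2; apply: (IH _ h1 h2); exact: leq_trans (msize_mderiv j nF) sF.
have [h3|/eqP h3] := eqVneq (mmap iota z F^`M(@Ordinal 3 2 isT)) 0.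
  (* If F_3 is the zero polynomial, [d1] and [d2] show that the other two derivatives vanish at the
     point as well. Were all three zero polynomials, F would be constant of value 0. *)
  have [d3|/eqP/(IHd _ h3)//] := eqVneq (F^`M(@Ordinal 3 2 isT)) 0.
  have h1 := gder_chain z F dd1; have h2 := gder_chain z F dd2.
  rewrite F0 (gder0 dd1) (gder0 dd2) !big_ord_recl !big_ord0 /= in h1 h2.
  have e3 : lift o0 (lift o0 o0) = @Ordinal 3 2 isT by exact/val_inj.
  move: h1 h2; rewrite /= e3 d3 !mmap0 !mul0r !addr0 /z /= d1a d1b d2a d2b.
  rewrite !mulr1 !mulr0 !addr0 add0r -/z => h1 h2.
  have [d10|/eqP/(IHd _ (esym h1))//] := eqVneq (F^`M(o0)) 0.
  have [d20|/eqP/(IHd _ (esym h2))//] := eqVneq (F^`M(lift o0 o0)) 0.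
  have dF j : F^`M(j) = 0.
    case: j => [[|[|[|//]]] lj]; [rewrite -[RHS]d10|rewrite -[RHS]d20|rewrite -[RHS]d3];
      congr (mderiv _ _); exact/val_inj.
  have e := mderiv_eq0 dF; exfalso; move/eqP: nF; apply.
  move: F0; rewrite e mmapC => /eqP; rewrite fmorph_eq0 => /eqP ->.
  by rewrite mpolyC0.
have := gder_chain z F dT; rewrite F0 (gder0 dT) !big_ord_recl big_ord0 /=.
rewrite /z /= Ta Tb !mulr0 !add0r addr0 -/z => /esym/eqP.
rewrite mulf_eq0 fmorph_eq0 => /orP[/eqP e|/eqP //].
exfalso; apply: h3; rewrite -[RHS]e; congr (mmap _ _ (mderiv _ _)); exact/val_inj.
Qed.

Lemma der_dual T : der_on T -> forall f, T f = d1 f * T a + d2 f * T b.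
Proof.
move=> dT f; pose U x := 1 * T x + (-1) * (T a * d1 x + T b * d2 x).
have dU : der_on U by apply: der_lin => //; exact: der_lin.
have := gder_eq0 dU _ _ f; rewrite /U d1a d1b d2a d2b !mulr1 !mulr0 addr0 add0r.
rewrite !mul1r !mulN1r !subrr => /(_ erefl erefl)/eqP; rewrite subr_eq0 => /eqP ->.
by rewrite mulrC [T b * _]mulrC.
Qed.

Lemma det2_dual T U x y : der_on T -> der_on U ->
  det2 T U x y = det2 d1 d2 x y * det2 T U a b.
Proof.
by move=> dT dU; rewrite /det2 !(der_dual dT x, der_dual dT y, der_dual dU x, der_dual dU y); ring.
Qed.
End Dual2.
End Trdeg2.

(** * Hilbert's basis theorem *)

Section Hilbert.

Definition ideal (R : comNzRingType) (I : R -> Prop) :=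
  [/\ I 0, forall x y, I x -> I y -> I (x + y) & forall a x, I x -> I (a * x)].

(** Generation is phrased by containment in every ideal through [s], which spares linear
    combinations: to prove a property on I, one shows that it defines an ideal and checks it on
    [s]. *)
Definition fin_gen (R : comNzRingType) (I : R -> Prop) :=
  exists s : seq R, {in s, forall y, I y} /\
    forall J, ideal J -> {in s, forall y, J y} -> forall x, I x -> J x.

Definition noetherian (R : comNzRingType) :=
  forall I : R -> Prop, ideal I -> fin_gen I.

Lemma field_noetherian (k : fieldType) : noetherian k.
Proof.
move=> I [I0 ID IM]; have [[x [Ix x0]]|h] := pselect (exists x, I x /\ x <> 0).
  exists [:: x]; split=> [y|J [_ _ JM] Js y _]; first by rewrite inE => /eqP ->.
  rewrite -[y](divfK (_ : x != 0)); last exact/eqP.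
  by apply: JM; apply: Js; rewrite inE.
exists [::]; split=> // J [J0 _ _] _ x Ix.
by have [->//|/eqP x0] := eqVneq x 0; case: h; exists x.
Qed.

Lemma noetherian_image (A B : comNzRingType) (f : {rmorphism A -> B}) :
  (forall b, exists a, f a = b) -> noetherian A -> noetherian B.
Proof.
move=> fs nA I [I0 ID IM].
have [|s [sI sJ]] := nA (fun a => I (f a)).
  split=> [|x y|a x]; rewrite ?rmorph0 ?rmorphD ?rmorphM //; [exact: ID|exact: IM].
exists (map f s); split=> [y /mapP[x xs ->]|J [J0 JD JM] Js b Ib]; first exact: sI.
have [a ab] := fs b; rewrite -ab; apply: (sJ (fun a => J (f a))).
- split=> [|x y|c x]; rewrite ?rmorph0 ?rmorphD ?rmorphM //; [exact: JD|exact: JM].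
- by move=> y ys; apply/Js/map_f.
- by rewrite ab.
Qed.

(** Hilbert's argument: the ideals [J d] of coefficients in degree d of elements of I of degree at
    most d increase and all lie in [J N]. Finitely many elements of I realize generators of [J 0],
    ..., [J N]; beyond N one multiplies by a power of X. *)
Lemma poly_noetherian (R : comNzRingType) : noetherian R -> noetherian {poly R}.
Proof.
move=> nR I [I0 ID IM].
pose J d a := exists f : {poly R}, [/\ I f, (size f <= d.+1)%N & f`_d = a].
have IN f : I f -> I (- f) by rewrite -mulN1r; apply: IM.
have Jid d : ideal (J d).
  split=> [|x y [f [If sf <-]] [g [Ig sg <-]]|a x [f [If sf <-]]].
  - by exists 0; rewrite size_poly0 coef0.
  - exists (f + g); rewrite coefD; split=> //; first exact: ID.
    by rewrite (leq_trans (size_polyD _ _)) // geq_max sf.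
  - exists (a%:P * f); rewrite coefCM; split=> //; first exact: IM.
    by rewrite mul_polyC (leq_trans (size_scale_leq _ _)).
have JS d e a : (d <= e)%N -> J d a -> J e a.
  move=> /subnK <-; elim: (e - d)%N => // m IH /IH [f [If sf fa]].
  exists ('X * f); split; first exact: IM.
    have [->|f0] := eqVneq f 0; first by rewrite mulr0 size_poly0.
    by rewrite mulrC size_mulX // ltnS.
  by rewrite mulrC coefMX /= fa.
have [|s [sJ sK]] := nR (fun a => exists d, J d a).
  split=> [|x y [d Jx] [e Jy]|a x [d Jx]]; first by exists 0%N; case: (Jid 0%N).
    exists (maxn d e); have [_ h _] := Jid (maxn d e).
    by apply: h; [apply: JS Jx|apply: JS Jy]; rewrite ?leq_maxl ?leq_maxr.
  by exists d; have [_ _ h] := Jid d; apply: h.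
have [N sN] : exists N, {in s, forall y, J N y}.
  elim: s sJ {sK} => [|y s IH] sJ; first by exists 0%N.
  have [|N hN] := IH; first by move=> z zs; apply: sJ; rewrite inE zs orbT.
  have [|d Jd] := sJ y; first by rewrite inE eqxx.
  exists (maxn d N) => z; rewrite inE => /predU1P[->|/hN].
    by apply: JS Jd; rewrite leq_maxl.
  by apply: JS; rewrite leq_maxr.
have JN d a : J d a -> J N a by move=> Jd; apply: (sK _ (Jid N) sN); exists d.
have [t tI tJ] : exists2 t : seq {poly R}, {in t, forall f, I f} &
    forall K, ideal K -> {in t, forall f, K f} -> forall d a, (d < N.+1)%N -> J d a ->
    exists f, [/\ I f, K f, (size f <= d.+1)%N & f`_d = a].
  elim: N.+1 => [|M [t tI tJ]]; first by exists [::].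
  have [r [rJ rK]] := nR _ (Jid M).
  have [u [uI uJ]] : exists u : seq {poly R}, {in u, forall f, I f} /\
     {in r, forall a, exists f, [/\ f \in u, I f, (size f <= M.+1)%N & f`_M = a]}.
    elim: r rJ {rK} => [|y r IH] rJ; first by exists [::].
    have [|u [uI uJ]] := IH; first by move=> z zs; apply: rJ; rewrite inE zs orbT.
    have [|f [If sf fy]] := rJ y; first by rewrite inE eqxx.
    exists (f :: u); split=> [g|a]; first by rewrite inE => /predU1P[->//|/uI].
    rewrite inE => /predU1P[->|/uJ[g [gu Ig sg ga]]].
      by exists f; rewrite inE eqxx.
    by exists g; rewrite inE gu orbT.
  exists (t ++ u) => [f|K Kid Kt d a].
    by rewrite mem_cat => /orP[/tI|/uI].
  have [K0 KD KM] := Kid.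
  rewrite ltnS leq_eqVlt => /predU1P[-> Ja|dM Ja]; last first.
    by apply: tJ => // f ft; apply: Kt; rewrite mem_cat ft.
  apply: (rK (fun a => exists f, [/\ I f, K f, (size f <= M.+1)%N & f`_M = a])) Ja.
    split=> [|x y [f [If Kf sf <-]] [g [Ig Kg sg <-]]|c x [f [If Kf sf <-]]].
    - by exists 0; rewrite size_poly0 coef0.
    - exists (f + g); rewrite coefD; split=> //; [exact: ID|exact: KD|].
      by rewrite (leq_trans (size_polyD _ _)) // geq_max sf.
    - exists (c%:P * f); rewrite coefCM; split=> //; [exact: IM|exact: KM|].
      by rewrite mul_polyC (leq_trans (size_scale_leq _ _)).
  move=> y /uJ[f [fu If sf fy]]; exists f; split=> //.
  by apply: Kt; rewrite mem_cat fu orbT.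
exists t; split=> // K Kid Kt f If.
have [K0 KD KM] := Kid.
have [d] := ubnP (size f); elim: d f If => // d IH f If; rewrite ltnS => sf.
case: d => [|d] in IH sf *; first by move: sf; rewrite leqn0 size_poly_eq0 => /eqP ->.
have Jf : J d f`_d by exists f.
have [h [Ih Kh sh hE]] : exists h, [/\ I h, K h, (size h <= d.+1)%N & h`_d = f`_d].
  have [dN|Nd] := ltnP d N.+1; first exact: tJ dN Jf.
  have [h [Ih Kh sh hE]] := tJ K Kid Kt N _ (leqnn _) (JN _ _ Jf).
  exists ('X^(d - N) * h); split; [exact: IM|exact: KM| |].
    rewrite (leq_trans (size_polyMleq _ _)) // size_polyXn addSn /=.
    by rewrite (leq_trans (leq_add (leqnn _) sh)) // addnS subnK // ltnW.
  by rewrite coefXnM ltnNge leq_subr /= subKn // ltnW.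
rewrite -[f](subrK h) addrC; apply: KD => //; apply: IH; first by apply: ID => //; apply: IN.
rewrite ltnS; apply/leq_sizeP => j; rewrite leq_eqVlt => /predU1P[<-|dj].
  by rewrite coefB hE subrr.
by rewrite coefB !nth_default ?subrr // (leq_trans _ dj).
Qed.

Lemma mpoly_noetherian (k : fieldType) n : noetherian {mpoly k[n]}.
Proof.
elim: n => [|n IH].
  pose f : {rmorphism k -> {mpoly k[0]}} := @mpolyC 0 k.
  apply: (@noetherian_image _ _ f) (@field_noetherian k) => F.
  exists F@_0; apply/mpolyP => m; rewrite mcoeffC.
  have -> : m = 0%MM by apply/mnmP => -[].
  by rewrite eqxx mulr1.
pose z (i : 'I_n) : {mpoly k[n.+1]} := 'X_(widen_ord (leqnSn n) i).
pose w : {rmorphism {mpoly k[n]} -> {mpoly k[n.+1]}} := mmap (@mpolyC n.+1 k) z.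
have cw (p : {mpoly k[n]}) : GRing.comm 'X_(ord_max : 'I_n.+1) (w p) by exact: mulrC.
pose f : {rmorphism {poly {mpoly k[n]}} -> {mpoly k[n.+1]}} := horner_morph cw.
apply: (@noetherian_image _ _ f) (poly_noetherian IH) => F.
elim/mpoly_ring_ind: F => [c|i|F G [a <-] [b <-]|F G [a <-] [b <-]].
- exists (c%:MP)%:P; rewrite /f /= horner_morphC /w /=; exact: mmapC.
- have [j ij|] := unliftP ord_max i; last by move=> ->; exists 'X; rewrite /f /= horner_morphX.
  exists ('X_j)%:P; rewrite /f /= horner_morphC /w /= mmapX mmap1U /z.
  by congr ('X__); rewrite ij; apply: val_inj; rewrite /= /bump leqNgt ltn_ord.
- by exists (a + b); rewrite rmorphD.
- by exists (a * b); rewrite rmorphM.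
Qed.
End Hilbert.

(** * Regular local rings of dimension two *)

(** Local subrings of L with residue field k: [lr_ev] is the residue map, and [lr_V] makes its
    kernel the only maximal ideal. Nothing is imposed on [lr_ev] outside [lr_car]. Points of
    different surfaces with one function field are compared as such subrings. *)
Record lring (k L : fieldType) (iota : {rmorphism k -> L}) := LRing {
  lr_car :> L -> Prop;
  lr_ev : L -> k;
  lr_C : forall c, lr_car (iota c);
  lr_evC : forall c, lr_ev (iota c) = c;
  lr_D : forall x y, lr_car x -> lr_car y -> lr_car (x + y);
  lr_evD : forall x y, lr_car x -> lr_car y -> lr_ev (x + y) = lr_ev x + lr_ev y;
  lr_M : forall x y, lr_car x -> lr_car y -> lr_car (x * y);
  lr_evM : forall x y, lr_car x -> lr_car y -> lr_ev (x * y) = lr_ev x * lr_ev y;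
  lr_V : forall x, lr_car x -> lr_ev x != 0 -> lr_car x^-1
}.

Section LRing.
Variables (k L : fieldType) (iota : {rmorphism k -> L}) (O : lring iota).
Local Notation ev := (lr_ev O).

Lemma lr_0 : O 0. Proof. rewrite -(rmorph0 iota); exact: lr_C. Qed.
Lemma lr_1 : O 1. Proof. rewrite -(rmorph1 iota); exact: lr_C. Qed.
Lemma lr_N x : O x -> O (- x).
Proof.
by move=> Ox; rewrite -mulN1r -(rmorph1 iota) -rmorphN; apply: lr_M => //; apply: lr_C.
Qed.
Lemma lr_B x y : O x -> O y -> O (x - y).
Proof. by move=> Ox Oy; apply: lr_D => //; apply: lr_N. Qed.
Lemma lr_ev0 : ev 0 = 0. Proof. by rewrite -(rmorph0 iota) lr_evC. Qed.
Lemma lr_ev1 : ev 1 = 1. Proof. by rewrite -(rmorph1 iota) lr_evC. Qed.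
Lemma lr_evN x : O x -> ev (- x) = - ev x.
Proof.
move=> Ox; apply/eqP; rewrite -addr_eq0 -lr_evD ?addNr ?lr_ev0 //; exact: lr_N.
Qed.
Lemma lr_evB x y : O x -> O y -> ev (x - y) = ev x - ev y.
Proof. by move=> Ox Oy; rewrite lr_evD ?lr_evN //; apply: lr_N. Qed.
Lemma lr_X x n : O x -> O (x ^+ n).
Proof.
by move=> Ox; elim: n => [|n IH]; [exact: lr_1|rewrite exprS; apply: lr_M].
Qed.
Lemma lr_evX x n : O x -> ev (x ^+ n) = ev x ^+ n.
Proof.
move=> Ox; elim: n => [|n IH]; first by rewrite lr_ev1.
by rewrite !exprS lr_evM ?IH //; apply: lr_X.
Qed.
Lemma lr_sum (I : Type) (r : seq I) (P : pred I) F :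
  (forall i, O (F i)) -> O (\sum_(i <- r | P i) F i).
Proof. by move=> OF; apply: (big_ind (lr_car O)) => //; [exact: lr_0|exact: lr_D]. Qed.
Lemma lr_neq0 x : ev x != 0 -> x != 0.
Proof. by apply: contra_neq => ->; rewrite lr_ev0. Qed.
Lemma lr_evV x : O x -> ev x != 0 -> ev x^-1 = (ev x)^-1.
Proof.
move=> Ox ex; apply: (mulfI ex); rewrite -lr_evM ?divff ?lr_ev1 //; last exact: lr_V.
exact: lr_neq0.
Qed.
Lemma lr_div x y : O x -> O y -> ev y != 0 -> O (x / y).
Proof. by move=> Ox Oy ey; apply: lr_M => //; apply: lr_V. Qed.
Lemma lr_evdiv x y : O x -> O y -> ev y != 0 -> ev (x / y) = ev x / ev y.
Proof. by move=> Ox Oy ey; rewrite lr_evM ?lr_evV //; apply: lr_V. Qed.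
Lemma lr_unit1B t : O t -> ev t = 0 -> ev (1 - t) != 0.
Proof.
by move=> Ot et; rewrite lr_evB ?lr_ev1 ?et ?subr0 ?oner_eq0 //; apply: lr_1.
Qed.

Lemma lr_mmap n (z : 'I_n -> L) (F : {mpoly k[n]}) : (forall i, O (z i)) ->
  O (mmap iota z F) /\ ev (mmap iota z F) = mmap idfun (fun i => ev (z i)) F.
Proof.
move=> Oz; elim/mpoly_ring_ind: F => [c|i|F G [IF eF] [IG eG]|F G [IF eF] [IG eG]].
- by rewrite !mmapC; split; [exact: lr_C|rewrite lr_evC].
- by rewrite !mmapX !mmap1U.
- by rewrite !mmapD; split; [exact: lr_D|rewrite lr_evD ?eF ?eG].
- by rewrite !rmorphM; split; [exact: lr_M|rewrite lr_evM ?eF ?eG].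
Qed.

Definition lideal (I : L -> Prop) :=
  [/\ forall x, I x -> O x, I 0, forall x y, I x -> I y -> I (x + y)
    & forall a x, O a -> I x -> I (a * x)].

Lemma lidealB I x y : lideal I -> I x -> I y -> I (x - y).
Proof.
move=> [_ _ ID IM] Ix Iy; apply: ID => //; rewrite -mulN1r; apply: IM => //.
by apply: lr_N; apply: lr_1.
Qed.

Definition lnoeth := forall I, lideal I -> exists s : seq L,
  {in s, forall y, I y} /\
  forall J, lideal J -> {in s, forall y, J y} -> forall x, I x -> J x.

Definition gen_by n (z : 'I_n -> L) := (forall i, O (z i)) /\
  forall h, O h -> exists F G : {mpoly k[n]},
    ev (mmap iota z G) != 0 /\ h = mmap iota z F / mmap iota z G.

Definition ess_ft := exists n (z : 'I_n -> L), gen_by z.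

Lemma ess_ft_noeth : ess_ft -> lnoeth.
Proof.
move=> [n [z [Oz zg]]] I [IO I0 ID IM].
have [|s [sI sJ]] := mpoly_noetherian (k := k) (n := n) (I := fun F => I (mmap iota z F)).
  split=> [|F G IF IG|F G IG]; rewrite ?mmap0 ?mmapD ?rmorphM //; first exact: ID.
  by apply: IM => //; apply: (lr_mmap _ _).1.
exists (map (mmap iota z) s); split=> [_ /mapP[F /sI Fs ->]//|J [JO J0 JD JM] Js x Ix].
have [F [G [eG xE]]] := zg x (IO _ Ix); have G0 := lr_neq0 eG.
have OG := (lr_mmap G Oz).1.
have : J (mmap iota z F).
  apply: (sJ (fun F => J (mmap iota z F))).
  - split=> [|F1 G1 IF IG|F1 G1 IG]; rewrite ?mmap0 ?mmapD ?rmorphM //; first exact: JD.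
    by apply: JM => //; apply: (lr_mmap _ _).1.
  - by move=> y ys; apply/Js/map_f.
  - by rewrite -[mmap _ _ _](divfK G0) -xE mulrC; apply: IM.
by rewrite xE mulrC => JF; apply: JM => //; apply: lr_V.
Qed.

Definition params u w := [/\ O u, O w, ev u = 0, ev w = 0
  & forall h, O h -> ev h = 0 -> exists r s, [/\ O r, O s & h = r * u + s * w]].

Lemma params_sym u w : params u w -> params w u.
Proof.
move=> [Ou Ow eu ew h]; split=> // x Ox ex.
by have [r [s [Or Os ->]]] := h x Ox ex; exists s, r; rewrite addrC.
Qed.

(* Krull's intersection theorem for the quotient by c *)
Lemma noeth_descent c (P : L -> Prop) : lnoeth -> O c ->
  (forall y, P y -> O y) ->
  (forall y, P y -> exists a t y', [/\ O a, O t, ev t = 0, P y' & y = a * c + t * y']) ->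
  forall y, P y -> exists2 a, O a & y = a * c.
Proof.
move=> nO Oc PO step y0 Py0.
have [f fP] : exists f : L -> L, forall y, P y -> P (f y) /\
    exists a t, [/\ O a, O t, ev t = 0 & y = a * c + t * f y].
  have /choice[f fP] : forall y, exists y', P y -> P y' /\
    exists a t, [/\ O a, O t, ev t = 0 & y = a * c + t * y'].
    move=> y; have [Py|nP] := pselect (P y); last by exists 0.
    by have [a [t [y' [Oa Ot et Py' yE]]]] := step y Py; exists y'; split=> //; exists a, t.
  by exists f.
pose y n := iter n f y0.
have Py n : P (y n) by elim: n => //= n /fP[].
(* The ideals (c, y_n) increase because y_n lies in (c, y_(n+1)). Once they are stationary, y_(N+1)
   = a c + b y_N, and inserting y_N = a' c + t y_(N+1) puts (1 - b t) y_(N+1) in (c), with 1 - b t a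
   unit. *)
pose K n x := exists a b, [/\ O a, O b & x = a * c + b * y n].
have KS n m x : (n <= m)%N -> K n x -> K m x.
  move/subnK <-; elim: (m - n)%N => // d IH /IH [a [b [Oa Ob ->]]].
  have [_ [a' [t [Oa' Ot _ yE]]]] := fP _ (Py (d + n)%N).
  exists (a + b * a'), (b * t); split; [|exact: lr_M|rewrite {1}yE /y /=; ring].
  by apply: lr_D => //; apply: lr_M.
have Kid n : lideal (K n).
  split=> [x [a [b [Oa Ob ->]]]||x x' [a [b [Oa Ob ->]]] [a' [b' [Oa' Ob' ->]]]|e x Oe [a [b [Oa Ob ->]]]].
  - by apply: lr_D; apply: lr_M => //; apply: PO.
  - by exists 0, 0; split; [exact: lr_0|exact: lr_0|ring].
  - exists (a + a'), (b + b'); split; [exact: lr_D|exact: lr_D|ring].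
  - exists (e * a), (e * b); split; [exact: lr_M|exact: lr_M|ring].
have [|s [sI sJ]] := nO (fun x => exists n, K n x).
  split=> [x [n]||x x' [n Kx] [n' Kx']|e x Oe [n Kx]].
  - by have [h _ _ _] := Kid n; apply: h.
  - by exists 0%N; case: (Kid 0%N).
  - exists (maxn n n'); have [_ _ h _] := Kid (maxn n n').
    by apply: h; [apply: KS Kx|apply: KS Kx']; rewrite ?leq_maxl ?leq_maxr.
  - by exists n; have [_ _ _ h] := Kid n; apply: h.
have [N sN] : exists N, {in s, forall x, K N x}.
  elim: s sI {sJ} => [|x s IH] sI; first by exists 0%N.
  have [|N hN] := IH; first by move=> z zs; apply: sI; rewrite inE zs orbT.
  have [|d Kd] := sI x; first by rewrite inE eqxx.
  exists (maxn d N) => z; rewrite inE => /predU1P[->|/hN].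
    by apply: KS Kd; rewrite leq_maxl.
  by apply: KS; rewrite leq_maxr.
have [a [b [Oa Ob yE]]] : K N (y N.+1).
  apply: (sJ _ (Kid N) sN); exists N.+1, 0, 1.
  by split; [exact: lr_0|exact: lr_1|ring].
have [_ [a' [t [Oa' Ot et yE']]]] := fP _ (Py N).
have Obt : O (b * t) by exact: lr_M.
have u1 : ev (1 - b * t) != 0 by rewrite lr_unit1B // lr_evM // et mulr0.
have cN : exists2 a, O a & y N.+1 = a * c.
  exists ((a + b * a') / (1 - b * t)).
    apply: lr_div => //; last by apply: lr_B => //; apply: lr_1.
    by apply: lr_D => //; apply: lr_M.
  have n0 := lr_neq0 u1.
  apply: (mulfI n0); rewrite [RHS]mulrA mulrCA divff // mulr1 mulrDl.
  by rewrite {1}yE {1}yE' /y /=; ring: yE.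
elim: (N.+1) cN => [//|n IH] [e Oe eE]; apply: IH.
have [_ [a1 [t1 [Oa1 Ot1 _ yE1]]]] := fP _ (Py n).
exists (a1 + t1 * e); first by apply: lr_D => //; apply: lr_M.
by rewrite {1}yE1 -[f _]/(y n.+1) eE; ring.
Qed.

Section Nakayama.
Variable (V : lmodType L).

Fixpoint ospan (C : L -> Prop) (s : seq V) (v : V) : Prop :=
  if s is y :: s' then exists a v', [/\ C a, ospan C s' v' & v = a *: y + v'] else v = 0.

Definition lmax x := O x /\ ev x = 0.

Definition osub (B : V -> Prop) :=
  [/\ B 0, forall x y, B x -> B y -> B (x + y) & forall a x, O a -> B x -> B (a *: x)].

Lemma ospan_sub (C B : _ -> Prop) s v : (forall x, C x -> O x) -> osub B ->
  {in s, forall y, B y} -> ospan C s v -> B v.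
Proof.
move=> CO [B0 BD BM]; elim: s v => [|y s IH] v Bs /=; first by move=> ->.
move=> [a [v' [Ca sv ->]]]; apply: BD; first by apply: BM; [exact: CO|apply: Bs; rewrite inE eqxx].
by apply: IH => // z zs; apply: Bs; rewrite inE zs orbT.
Qed.

Lemma lmaxD x y : lmax x -> lmax y -> lmax (x + y).
Proof. by move=> [Ox ex] [Oy ey]; split; [exact: lr_D|rewrite lr_evD // ex ey addr0]. Qed.

Lemma lmaxM x y : O x -> lmax y -> lmax (x * y).
Proof. by move=> Ox [Oy ey]; split; [exact: lr_M|rewrite lr_evM // ey mulr0]. Qed.

Lemma mspanD s v v' : ospan lmax s v -> ospan lmax s v' -> ospan lmax s (v + v').
Proof.
elim: s v v' => [|y s IH] v v' /=; first by move=> -> ->; rewrite addr0.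
move=> [a [w [Ca sv ->]]] [a' [w' [Ca' sv' ->]]].
exists (a + a'), (w + w'); split; [exact: lmaxD|exact: IH|].
by rewrite scalerDl addrACA.
Qed.

Lemma mspanM s v a : O a -> ospan lmax s v -> ospan lmax s (a *: v).
Proof.
move=> Oa; elim: s v => [|y s IH] v /=; first by move=> ->; rewrite scaler0.
move=> [b [w [Ca sv ->]]]; exists (a * b), (a *: w).
by split; [exact: lmaxM|exact: IH|rewrite scalerDr scalerA].
Qed.

(** In its own expression the first generator has a coefficient t in the maximal ideal; dividing by
    1 - t eliminates it, and induction treats the others. *)
Lemma nakayama s (B : V -> Prop) : osub B ->
  {in s, forall y, exists b v, [/\ B b, ospan lmax s v & y = b + v]} ->
  {in s, forall y, B y}.
Proof.
move=> Bs; have [B0 BD BM] := Bs; elim: s => [|y s IH] //= h.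
have [|b [v [Bb [t [v' [[Ot et] sv' vE]] yE]]]] := h y; first by rewrite inE eqxx.
have u1 := lr_unit1B Ot et; have n0 := lr_neq0 u1.
pose e := (1 - t)^-1; have Oe : O e by apply: lr_V => //; apply: lr_B => //; exact: lr_1.
have yE' : y = e *: b + e *: v'.
  have : (1 - t) *: y = b + v' by rewrite scalerBl scale1r {1}yE vE -addrA [t *: y + _]addrC addrK.
  by move/(congr1 (fun x => e *: x)); rewrite scalerA mulVf // scale1r scalerDr.
have sB : {in s, forall y, B y}.
  apply: IH => x xs; have [|b1 [v1 [Bb1 [t1 [v1' [Ct1 sv1 v1E]] xE]]]] := h x.
    by rewrite inE xs orbT.
  have [Ot1 _] := Ct1.
  exists (b1 + t1 *: (e *: b)), (t1 *: (e *: v') + v1'); split.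
  - by apply: BD => //; apply: (BM) => //; apply: (BM).
  - by apply: mspanD => //; apply: mspanM => //; apply: mspanM.
  - by rewrite xE v1E {1}yE' scalerDr !addrA.
move=> x; rewrite inE => /predU1P[->|/sB//].
rewrite yE'; apply: BD; first exact: BM.
by apply: BM => //; apply: (ospan_sub _ Bs sB sv') => z [].
Qed.
End Nakayama.

End LRing.

(** * Partial derivatives with respect to local parameters *)

Section LocalDer.
Variables (k : numFieldType) (L : fieldType) (iota : {rmorphism k -> L}).

Definition two_ders := exists D E a b,
  [/\ der_on iota D, der_on iota E & det2 D E a b != 0].

Variable O : lring iota.
Local Notation ev := (lr_ev O).

Definition lfrac := forall h, exists F G, [/\ O F, O G, G != 0 & h = F / G].

Lemma ospan_sum (V : lmodType L) C (I : Type) (r : seq I) (c : I -> L) (f : I -> V) :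
  (forall i, C (c i)) -> ospan C (map f r) (\sum_(i <- r) c i *: f i).
Proof.
move=> Cc; elim: r => [|i r IH] /=; first by rewrite big_nil.
by exists (c i), (\sum_(j <- r) c j *: f j); rewrite big_cons.
Qed.

Lemma gen_by_der n (z : 'I_n -> L) h : gen_by O z -> O h ->
  exists A : 'I_n -> L, (forall i, O (A i)) /\
    forall T, der_on iota T -> T h = \sum_i A i * T (z i).
Proof.
move=> [Oz zg] Oh; have [F [G [eG ->]]] := zg h Oh.
have G0 := lr_neq0 eG.
have OM P := (lr_mmap (P : {mpoly k[n]}) Oz).1.
exists (fun i => (mmap iota z G * mmap iota z F^`M(i) - mmap iota z F * mmap iota z G^`M(i))
  / mmap iota z G ^+ 2); split=> [i|T dT].
  apply: lr_div; [by apply: lr_B; apply: lr_M|exact: lr_X|].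
  by rewrite lr_evX // expf_neq0.
rewrite (gder_div _ dT G0) /= (gder_chain z F dT) (gder_chain z G dT) /=.
rewrite !mulr_sumr -sumrB mulr_suml; apply: eq_bigr => i _; field.
by rewrite G0.
Qed.

Hypotheses (fO : ess_ft O) (qO : lfrac) (nz : two_ders) (n3 : no_indep3 iota).

(** A generator z_j minus its value is r u + s w, so its differential lies in O du + O dw up to
    maximal-ideal multiples of the dz_i. By Nakayama du and dw generate the differentials over O,
    and the coefficients of dh are the partial derivatives of h. *)
Lemma dual_local u w : params O u w -> exists d1 d2 : L -> L,
  [/\ der_on iota d1, der_on iota d2, d1 u = 1 /\ d1 w = 0, d2 u = 0 /\ d2 w = 1
    & forall h, O h -> O (d1 h) /\ O (d2 h)].
Proof.
move=> [Ou Ow eu ew huw].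
have [D [E [a [b [dD dE ab0]]]]] := nz.
have [n [z zg]] := fO; have [Oz _] := zg.
have [DD DM DC] := dD; have [ED EM EC] := dE.
pose B (v : L^o * L^o) := exists p q, [/\ O p, O q & v = (p * D u + q * D w, p * E u + q * E w)].
have sB : osub O B.
  split=> [|_ _ [p [q [Op Oq ->]]] [p' [q' [Op' Oq' ->]]]|c _ Oc [p [q [Op Oq ->]]]].
  - by exists 0, 0; rewrite !mul0r !addr0; split; [exact: lr_0|exact: lr_0|].
  - exists (p + p'), (q + q'); split; [exact: lr_D|exact: lr_D|].
    by congr (_, _) => /=; ring.
  - exists (c * p), (c * q); split; [exact: lr_M|exact: lr_M|].
    by congr (_, _) => /=; rewrite /GRing.scale /=; ring.
pose Vz i : L^o * L^o := (D (z i), E (z i)).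
have zB i : B (Vz i).
  apply: (@nakayama _ _ _ O _ (map Vz (enum 'I_n)) B sB); last by rewrite map_f ?mem_enum.
  move=> _ /mapP[j _ ->].
  have OBj : O (z j - iota (ev (z j))) by apply: lr_B => //; apply: lr_C.
  have [|r [s [Or Os zE]]] := huw _ OBj.
    by rewrite lr_evB ?lr_evC ?subrr //; apply: lr_C.
  have TE T : der_on iota T -> T (z j) = r * T u + s * T w + (u * T r + w * T s).
    move=> dT; have [TD TM TC] := dT.
    have -> : z j = r * u + s * w + iota (ev (z j)) by rewrite -zE subrK.
    by rewrite !TD !TM TC /=; ring.
  have [A [OA AE]] := gen_by_der zg Or; have [A' [OA' AE']] := gen_by_der zg Os.
  exists (r * D u + s * D w, r * E u + s * E w), (u * D r + w * D s, u * E r + w * E s).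
  split; [by exists r, s| |by rewrite /Vz !TE].
  have -> : (u * D r + w * D s, u * E r + w * E s) =
     \sum_(i <- enum 'I_n) (u * A i + w * A' i) *: Vz i.
    have SE T : der_on iota T ->
       u * T r + w * T s = \sum_(i <- enum 'I_n) (u * A i + w * A' i) * T (z i).
      move=> dT; rewrite (AE T dT) (AE' T dT) !mulr_sumr -big_split /= big_enum /=.
      by apply: eq_bigr => l _; ring.
    rewrite !SE //; by elim: (enum _) => [|j0 r0 IH]; rewrite ?big_nil // !big_cons -IH.
  apply: ospan_sum => l; split; first by apply: lr_D; apply: lr_M.
  by rewrite lr_evD ?lr_evM ?eu ?ew ?mul0r ?addr0 //; apply: lr_M.
have hB h : O h -> B (D h, E h).
  move=> Oh; have [A [OA AE]] := gen_by_der zg Oh; rewrite !AE //.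
  have [B0 BD BM] := sB; elim/big_rec2: _ => // i x y _ IH.
  by have := BD _ _ (BM _ _ (OA i) (zB i)) IH.
(* If du /\ dw vanished on (D, E), so would dh /\ dh' for regular h, h', and then for all fractions,
   against the choice of D and E. *)
have uw0 : det2 D E u w != 0.
  apply: contra_neq ab0 => uw0.
  have OO h h' : O h -> O h' -> det2 D E h h' = 0.
    move=> /hB[p [q [_ _ [e1 e2]]]] /hB[p' [q' [_ _ [e3 e4]]]]; rewrite {1}/det2 e1 e2 e3 e4.
    by transitivity ((p * q' - q * p') * det2 D E u w); [rewrite /det2; ring|rewrite uw0 mulr0].
  have [F [G [OF OG G0 ->]]] := qO a; have [F' [G' [OF' OG' G0' ->]]] := qO b.
  rewrite /det2 !(gder_div _ dD) // !(gder_div _ dE) //=.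
  transitivity ((G * G' * det2 D E F F' - G * F' * det2 D E F G' - F * G' * det2 D E G F'
     + F * F' * det2 D E G G') / (G ^+ 2 * G' ^+ 2)).
    by rewrite /det2; field; rewrite G0 G0'.
  by rewrite !OO //; ring.
have [d1 [d2 [dd1 dd2 [d1u d1w] [d2u d2w]]]] := dual_ders dD dE uw0.
exists d1, d2; split=> // h Oh.
have [p [q [Op Oq [Dh Eh]]]] := hB h Oh.
have dh T : der_on iota T -> T h = d1 h * T u + d2 h * T w.
  by move=> dT; apply: (der_dual dd1 dd2 d1u d1w d2u d2w n3 dT).
rewrite (dh D dD) in Dh; rewrite (dh E dE) in Eh.
have [-> -> //] : d1 h = p /\ d2 h = q.
split; apply/eqP; rewrite -subr_eq0; apply/eqP; apply: (mulIf uw0); rewrite mul0r.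
  transitivity ((d1 h * D u + d2 h * D w - (p * D u + q * D w)) * E w
    - (d1 h * E u + d2 h * E w - (p * E u + q * E w)) * D w); first by rewrite /det2; ring.
  by rewrite Dh Eh !subrr !mul0r subr0.
transitivity (- (d1 h * D u + d2 h * D w - (p * D u + q * D w)) * E u
    + (d1 h * E u + d2 h * E w - (p * E u + q * E w)) * D u); first by rewrite /det2; ring.
by rewrite Dh Eh !subrr oppr0 !mul0r addr0.
Qed.
End LocalDer.

(** * Unique factorization in two-dimensional regular local rings *)

Section LocalUFD.
Variables (k : numFieldType) (L : fieldType) (iota : {rmorphism k -> L}).
Variable O : lring iota.
Local Notation ev := (lr_ev O).

Definition ldvd p x := exists2 r, O r & x = r * p.

Lemma ldvdM p x y : O x -> ldvd p y -> ldvd p (x * y).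
Proof. by move=> Ox [r Or ->]; exists (x * r); [exact: lr_M|rewrite mulrA]. Qed.
Lemma ldvdD p x y : ldvd p x -> ldvd p y -> ldvd p (x + y).
Proof. by move=> [r Or ->] [s Os ->]; exists (r + s); [exact: lr_D|rewrite mulrDl]. Qed.
Lemma ldvd0 p : ldvd p 0. Proof. by exists 0; [exact: lr_0|rewrite mul0r]. Qed.
Lemma ldvd_refl p : ldvd p p. Proof. by exists 1; [exact: lr_1|rewrite mul1r]. Qed.
Lemma ldvd_trans p q x : ldvd p q -> ldvd q x -> ldvd p x.
Proof. by move=> [r Or ->] [s Os ->]; exists (s * r); [exact: lr_M|rewrite mulrA]. Qed.
Lemma ldvdB p x y : ldvd p x -> ldvd p y -> ldvd p (x - y).
Proof.
by move=> [r Or ->] [s Os ->]; exists (r - s); [exact: lr_B|rewrite mulrBl].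
Qed.

Definition lprime p := [/\ O p, p != 0, ev p = 0
  & forall x y, O x -> O y -> ldvd p (x * y) -> ldvd p x \/ ldvd p y].

(* the regular local rings of dimension 2 that occur on surfaces *)
Record regular2 := Regular2 {
  r2_noeth : lnoeth O;
  r2_frac : lfrac O;
  r2_params : exists u w, params O u w;
  r2_der : forall u w, params O u w -> exists d1 d2 : L -> L,
    [/\ der_on iota d1, der_on iota d2, d1 u = 1 /\ d1 w = 0, d2 u = 0 /\ d2 w = 1
      & forall h, O h -> O (d1 h) /\ O (d2 h)]
}.

Hypothesis rO : regular2.

Section Uw.
Variables (u w : L).
Hypothesis uw : params O u w.

Lemma params_neq0 : u != 0.
Proof.
have [d1 [d2 [dd1 _ [d1u _] _ _]]] := r2_der rO uw.
by apply: contra_eq_neq d1u => ->; rewrite (gder0 dd1) eq_sym oner_neq0.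
Qed.

(** Applying d/dw to w^(n+1) = r u keeps the factor u on the right and gives (n+1) w^n on the left,
    so in characteristic zero the exponent descends to 0. *)
Lemma pow_ndvd n : ~ ldvd u (w ^+ n).
Proof.
have [Ou Ow eu ew huw] := uw.
have [d1 [d2 [dd1 dd2 [d1u d1w] [d2u d2w] Od]]] := r2_der rO uw.
elim: n => [|n IH] [r Or].
  by move=> h; have := oner_eq0 k; rewrite -(lr_ev1 O) -[1](expr0 w) h lr_evM // eu mulr0 eqxx.
move=> h; apply: IH; have [_ dM dC] := dd2.
have dX m : d2 (w ^+ m.+1) = m.+1%:R * w ^+ m.
  elim: m => [|m IH]; first by rewrite expr1 d2w expr0 mulr1.
  by rewrite exprS dM IH d2w /= -[m.+2]addn1 natrD exprS; ring.
have /(congr1 d2) := h; rewrite dX dM d2u mulr0 add0r /= => e.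
have n0 : n.+1%:R != 0 :> L by rewrite -(rmorph_nat iota) fmorph_eq0 pnatr_eq0.
exists (d2 r / n.+1%:R); last by apply: (mulfI n0); rewrite e mulrAC mulrCA divff // mulr1.
apply: lr_M; first by case: (Od r Or).
by rewrite -(rmorph_nat iota) -fmorphV; apply: lr_C.
Qed.

(* modulo u, every element is a unit times a power of w *)
Lemma mod_param r : O r -> ldvd u r \/
  exists n e s, [/\ O e, ev e != 0, O s & r = w ^+ n * e + s * u].
Proof.
move=> Or; have [//|nd] := pselect (ldvd u r); first by left.
right; apply: contrapT => nr; apply: nd.
have [Ou Ow eu ew huw] := uw.
pose P r := O r /\ ~ exists n e s, [/\ O e, ev e != 0, O s & r = w ^+ n * e + s * u].
apply: (noeth_descent (P := P) (r2_noeth rO) Ou) => // [y []//|y [Oy ny]].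
have ey : ev y = 0.
  apply: contrapT => /eqP ey; apply: ny; exists 0%N, y, 0.
  by split; rewrite ?expr0 //; [exact: lr_0|ring].
have [a [t [Oa Ot yE]]] := huw y Oy ey.
exists a, w, t; split; rewrite // ?[w * t]mulrC //; split=> // -[n [e [s [Oe ee Os tE]]]]; apply: ny.
exists n.+1, e, (a + s * w); split=> //; first by apply: lr_D => //; apply: lr_M.
by rewrite yE tE exprS; ring.
Qed.

(** Modulo u the ring is a discrete valuation ring with uniformizer w, by [mod_param] and
    [pow_ndvd]. *)
Lemma param_prime : lprime u.
Proof.
have [Ou Ow eu ew huw] := uw; split=> //; first exact: params_neq0.
move=> x y Ox Oy dxy.
have [|[n [e [s [Oe ee Os xE]]]]] := mod_param Ox; first by left.
have [|[m [f [t [Of ef Ot yE]]]]] := mod_param Oy; first by right.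
exfalso; apply: (@pow_ndvd (n + m)).
have ef0 : ev (e * f) != 0 by rewrite lr_evM // mulf_neq0.
have Oef : O (e * f) by exact: lr_M.
have -> : w ^+ (n + m) = (e * f)^-1 * (x * y - (w ^+ n * e * t + s * w ^+ m * f + s * t * u) * u).
  rewrite xE yE exprD; field; have := lr_neq0 ef0.
  by rewrite mulf_eq0 negb_or andbC.
apply: ldvdM; first exact: lr_V.
apply: ldvdB => //; apply: ldvdM; last exact: ldvd_refl.
by do ?[apply: lr_D|apply: lr_M|apply: lr_X].
Qed.

(** Take c in I of least w-order modulo u. Any element of I is a multiple of c plus some u y',
    saturation puts y' in I, and Krull's theorem gives I inside (c). If I lies in (u), then I = u I,
    so I is zero. *)
Lemma sat_principal (I : L -> Prop) : lideal O I ->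
  (forall x, O x -> I (u * x) -> I x) -> exists2 c, I c & forall x, I x -> ldvd c x.
Proof.
move=> lI sat; have [IO I0 ID IM] := lI; have [Ou Ow eu ew huw] := uw.
have [[x [Ix nx]]|h] := pselect (exists x, I x /\ ~ ldvd u x); last first.
  exists 0 => // x Ix; apply: (noeth_descent (P := I) (r2_noeth rO) (lr_0 O)) => // y Iy.
  have [r Or yE] : ldvd u y by apply: contrapT => ny; apply: h; exists y.
  exists 0, u, r; split; rewrite // ?mulr0 ?add0r ?[u * r]mulrC //; first exact: lr_0.
  by apply: sat => //; rewrite mulrC -yE.
pose Q n := exists c e s, [/\ I c, O e, ev e != 0, O s & c = w ^+ n * e + s * u].
have [n Qn minn] : exists2 n, Q n & forall m, Q m -> (n <= m)%N.
  have /ex_minnP[] : exists n, `[< Q n >].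
    have [//|[n [e [s [Oe ee Os xE]]]]] := mod_param (IO _ Ix).
    by exists n; apply/asboolP; exists x, e, s.
  by move=> n /asboolP Qn h; exists n => // m Qm; apply/h/asboolP.
have [c [e [s [Ic Oe ee Os cE]]]] := Qn.
exists c => // y; apply: (noeth_descent (r2_noeth rO) (IO _ Ic)) => // {}y Iy.
have [a [y' [Oa Oy' yE]]] : exists a y', [/\ O a, O y' & y = a * c + u * y'].
  have [[r Or ->]|[m [f [t [Of ef Ot yE]]]]] := mod_param (IO _ Iy).
    by exists 0, r; split=> //; [exact: lr_0|ring].
  have nm : (n <= m)%N by apply: minn; exists y, f, t.
  exists (w ^+ (m - n) * f / e), (t - w ^+ (m - n) * f / e * s).
  have Oa : O (w ^+ (m - n) * f / e).
    by apply: lr_div => //; apply: lr_M => //; apply: lr_X.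
  split=> //; first by apply: lr_B => //; apply: lr_M.
  rewrite yE cE -{1}(subnKC nm) exprD; field.
  exact: lr_neq0 ee.
exists a, u, y'; split=> //; apply: sat => //.
have -> : u * y' = y - a * c by rewrite yE; ring.
by apply: lidealB lI _ _ => //; apply: IM.
Qed.
End Uw.

(** If u divides q, then q is an associate of the prime u. Otherwise the colon ideal (q : b) is
    saturated for u, hence generated by some c with q = d c. One of c, d is a unit: if it is c, then
    q divides b; if it is d, then q divides x. *)
Lemma irred_prime q : O q -> q != 0 -> ev q = 0 ->
  (forall c d, O c -> O d -> q = c * d -> ev c != 0 \/ ev d != 0) -> lprime q.
Proof.
move=> Oq q0 eq irr; have [u [w uw]] := r2_params rO; have [Ou _ eu _ _] := uw.
have pu := param_prime uw; have u0 := params_neq0 uw.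
have [[r Or qE]|nq] := pselect (ldvd u q).
  have [er|] := irr _ _ Or Ou qE; last by rewrite eu eqxx.
  have r0 := lr_neq0 er; have [_ _ _ prU] := pu.
  have eqd x : ldvd q x <-> ldvd u x.
    split=> [[t Ot ->]|[t Ot ->]]; first by rewrite qE mulrA; exists (t * r) => //; apply: lr_M.
    by exists (t / r); [apply: lr_div|rewrite qE; field].
  by split=> // x y Ox Oy /eqd/(prU x y Ox Oy)[/eqd|/eqd]; [left|right].
split=> // b x Ob Ox [r Or bxE].
pose I y := O y /\ ldvd q (b * y).
have lI : lideal O I.
  split=> [y []//||y y' [Oy dy] [Oy' dy']|a y Oa [Oy dy]].
  - by split; [exact: lr_0|rewrite mulr0; exact: ldvd0].
  - by split; [exact: lr_D|rewrite mulrDr; apply: ldvdD].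
  - by split; [exact: lr_M|rewrite mulrCA; apply: ldvdM].
have [|c [Oc [s Os bcE]] cI] := sat_principal uw lI.
  move=> y Oy [_ [s Os sE]]; split=> //.
  have [_ _ _ prU] := pu.
  have [|[t Ot tE]|//] := prU s q Os Oq.
    by rewrite -sE mulrCA mulrC; exists (b * y) => //; apply: lr_M.
  exists t => //; apply: (mulfI u0); rewrite mulrCA sE tE; ring.
have Iq : I q by split=> //; apply: ldvdM => //; apply: ldvd_refl.
have [d Od qE] := cI q Iq.
have [ed|ec] := irr d c Od Oc qE.
  right; have d0 := lr_neq0 ed.
  have [t Ot ->] : ldvd c x by apply: cI; split=> //; exists r.
  by exists (t / d); [apply: lr_div|rewrite qE; field].
left; exists (s / c); first exact: lr_div.
by rewrite mulrAC -bcE mulfK // (lr_neq0 ec).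
Qed.

Definition lunit e := O e /\ ev e != 0.

(** An element without factorization is a product of two non-units, one of which again has none;
    Krull's theorem with c = 0 then makes it zero. *)
Lemma factorization h : O h -> h != 0 -> exists e (s : seq L),
  [/\ lunit e, {in s, forall p, lprime p} & h = e * \prod_(p <- s) p].
Proof.
move=> Oh h0; apply: contrapT => nh; move/eqP: (h0); apply.
pose F h := exists e (s : seq L),
  [/\ lunit e, {in s, forall p, lprime p} & h = e * \prod_(p <- s) p].
pose P h := [/\ O h, h != 0 & ~ F h].
have [||||a _ ->] := @noeth_descent _ _ _ O 0 (fun h => h = 0 \/ P h) (r2_noeth rO) _ _ _ h; last by rewrite mulr0.
- exact: lr_0.
- by move=> y [->|[]//]; exact: lr_0.
- move=> y [->|[Oy y0 ny]].
    exists 0, 0, 0; split; rewrite ?mulr0 ?addr0 ?lr_ev0 //; [exact: lr_0|exact: lr_0|by left].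
  have ey : ev y = 0.
    apply: contrapT => /eqP ey; apply: ny; exists y, [::].
    by rewrite big_nil mulr1; split.
  have [c [d [Oc Od yE ec ed]]] : exists c d, [/\ O c, O d, y = c * d, ev c = 0 & ev d = 0].
    apply: contrapT => nirr; apply: ny; exists 1, [:: y].
    rewrite big_seq1 mul1r; split=> //; first by split; [exact: lr_1|rewrite lr_ev1 oner_neq0].
    move=> p; rewrite inE => /eqP ->; apply: irred_prime => // c d Oc Od yE.
    have [ec|] := eqVneq (ev c) 0; last by left.
    have [ed|] := eqVneq (ev d) 0; last by right.
    by case: nirr; exists c, d.
  have : ~ (F c /\ F d).
    move=> [[e [s [[Oe ee] ps cE]]] [f [t [[Of ef] pt dE]]]]; apply: ny.
    exists (e * f), (s ++ t); split=> [|p|].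
    - by split; [exact: lr_M|rewrite lr_evM // mulf_neq0].
    - by rewrite mem_cat => /orP[/ps|/pt].
    - by rewrite yE cE dE big_cat /=; ring.
  have [c0 d0] : c != 0 /\ d != 0 by apply/andP; rewrite -negb_or -mulf_eq0 -yE.
  move=> /not_andP[nc|nd].
    by exists 0, d, c; split; rewrite // ?mulr0 ?add0r 1?mulrC //; [exact: lr_0|right].
  by exists 0, c, d; split; rewrite // ?mulr0 ?add0r //; [exact: lr_0|right].
- by right.
Qed.
End LocalUFD.

(** * Discrete valuations *)

Section Nval.
Variable L : fieldType.

Record nval (v : L -> int) : Prop := NVal {
  nv0 : v 0 = 0;
  nvM : forall g h, g != 0 -> h != 0 -> v (g * h) = v g + v h;
  nvD : forall g h, g != 0 -> h != 0 -> g + h != 0 -> Num.min (v g) (v h) <= v (g + h);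
  nv_norm : exists t, v t = 1
}.

Variable v : L -> int.
Hypothesis nv : nval v.

Lemma nv1 : v 1 = 0.
Proof.
have h := nvM nv (oner_neq0 L) (oner_neq0 L); rewrite mulr1 in h.
by apply: (addrI (v 1)); rewrite addr0; exact: esym.
Qed.
Lemma nvV x : v x^-1 = - v x.
Proof.
have [->|x0] := eqVneq x 0; first by rewrite invr0 (nv0 nv).
have := nvM nv x0 (invr_neq0 x0); rewrite divff // nv1; lia.
Qed.
Lemma nvdiv x y : x != 0 -> y != 0 -> v (x / y) = v x - v y.
Proof. by move=> x0 y0; rewrite (nvM nv) ?invr_eq0 // nvV. Qed.
Lemma nvX x n : v (x ^+ n) = v x *+ n.
Proof.
have [->|x0] := eqVneq x 0.
  by case: n => [|n]; rewrite ?expr0 ?nv1 ?mulr0n // exprS mul0r (nv0 nv) mul0rn.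
elim: n => [|n IH]; first by rewrite expr0 nv1.
by rewrite exprS (nvM nv) ?expf_neq0 // IH mulrS.
Qed.
Lemma nvM_ge0 x y : 0 <= v x -> 0 <= v y -> 0 <= v (x * y).
Proof.
have [->|x0] := eqVneq x 0; first by rewrite mul0r (nv0 nv).
have [->|y0] := eqVneq y 0; first by rewrite mulr0 (nv0 nv).
by rewrite (nvM nv) //; lia.
Qed.
Lemma nvD_ge0 x y : 0 <= v x -> 0 <= v y -> 0 <= v (x + y).
Proof.
have [->|x0] := eqVneq x 0; first by rewrite add0r.
have [->|y0] := eqVneq y 0; first by rewrite addr0.
have [->|xy0] := eqVneq (x + y) 0; first by rewrite (nv0 nv).
by move=> vx vy; apply: le_trans (nvD nv x0 y0 xy0); rewrite le_min vx vy.
Qed.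
Lemma nvN1 : v (-1) = 0.
Proof.
have n1 : -1 != 0 :> L by rewrite oppr_eq0 oner_neq0.
have h : v (-1) + v (-1) = 0 by rewrite -(nvM nv n1 n1) mulrNN mulr1 nv1.
move: (v (-1)) h => a; lia.
Qed.
Lemma nvN x : v (- x) = v x.
Proof.
have [->|x0] := eqVneq x 0; first by rewrite oppr0.
by rewrite -mulN1r (nvM nv) ?oppr_eq0 ?oner_neq0 // nvN1 add0r.
Qed.
(* 0 has value 0, so positivity of the value is meaningful only off 0 *)
Definition vpos x := x = 0 \/ 0 < v x.
Lemma vposD x y : vpos x -> vpos y -> vpos (x + y).
Proof.
have [->|x0] := eqVneq x 0; first by rewrite add0r.
have [->|y0] := eqVneq y 0; first by rewrite addr0.
have [e|xy0] := eqVneq (x + y) 0; first by left.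
move=> [/eqP|vx]; first by rewrite (negPf x0).
move=> [/eqP|vy]; first by rewrite (negPf y0).
by right; apply: lt_le_trans (nvD nv x0 y0 xy0); rewrite lt_min vx vy.
Qed.
Lemma vposM x y : 0 <= v x -> vpos y -> vpos (x * y).
Proof.
have [->|x0] := eqVneq x 0; first by left; rewrite mul0r.
move=> vx [->|vy]; first by left; rewrite mulr0.
have [->|y0] := eqVneq y 0; first by left; rewrite mulr0.
by right; rewrite (nvM nv) //; lia.
Qed.
End Nval.

Section IsDiv.
Variables (k : numFieldType) (L : fieldType) (iota : {rmorphism k -> L}).
Variable O : lring iota.
Local Notation ev := (lr_ev O).

(* v is the valuation of a prime divisor of Spec O *)
Record isdiv (v : L -> int) : Prop := IsDiv {
  idv :> nval v;
  id_ge0 : forall h, O h -> 0 <= v h;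
  id_loc : forall h, 0 <= v h -> exists F G,
    [/\ O F, O G, G != 0, v G = 0 & h = F / G]
}.

Lemma isdiv_unit v e : isdiv v -> lunit O e -> v e = 0.
Proof.
move=> dv [Oe ee]; have h1 := id_ge0 dv Oe.
have := id_ge0 dv (lr_V Oe ee); rewrite (nvV dv); lia.
Qed.

(** With exponents chosen so that p^m / q^n has value 0, one gets q^n A = p^m B with v A = v B = 0.
    Then p does not divide A, so primality makes it divide q. *)
Lemma isdiv_pos v p q : isdiv v -> lprime O p -> 0 < v p -> O q ->
  0 < v q -> ldvd O p q.
Proof.
move=> dv [Op p0 ep prp] vp Oq vq.
have q0 : q != 0 by apply: contraTneq vq => ->; rewrite (nv0 dv).
pose n := `|v p|%N; pose m := `|v q|%N.
have vr : v (p ^+ m / q ^+ n) = 0.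
  by rewrite (nvdiv dv) ?expf_neq0 // !(nvX dv) /n /m; lia.
have [|A [B [OA OB B0 vB AB]]] := @id_loc _ dv (p ^+ m / q ^+ n); first by rewrite vr.
have A0 : A != 0.
  apply: contraTneq isT => A0; move/eqP: AB; rewrite A0 mul0r mulf_eq0 invr_eq0.
  by rewrite !expf_eq0 (negPf p0) (negPf q0) !andbF.
have vA : v A = 0.
  by have := nvdiv dv A0 B0; rewrite -AB vr vB; lia.
have e : q ^+ n * A = p ^+ m * B.
  have qn0 : q ^+ n != 0 by rewrite expf_neq0.
  have -> : A = p ^+ m / q ^+ n * B by rewrite AB divfK.
  by field.
have nA : ~ ldvd O p A.
  move=> [r Or AE]; have r0 : r != 0 by apply: contra_neq A0 => r0; rewrite AE r0 mul0r.
  by have := id_ge0 dv Or; have := vA; rewrite AE (nvM dv) //; lia.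
have : ldvd O p (q ^+ n * A).
  rewrite e /m; have : (0 < `|v q|)%N by lia.
  case: (`|v q|)%N => // m' _; rewrite exprS mulrAC -mulrA mulrC -mulrA mulrC.
  exists (p ^+ m' * B); last by ring.
  by apply: lr_M => //; apply: lr_X.
elim: n {vr AB e} => [|n IH]; first by rewrite expr0 mul1r => /nA.
rewrite exprS -mulrA => /prp[//||//|]; last exact: IH.
by apply: lr_M => //; apply: lr_X.
Qed.

Section Padic.
Variable p : L.
Hypotheses (pp : lprime O p) (nO : lnoeth O) (qO : lfrac O).

Lemma prime_nunit e : lunit O e -> ~ ldvd O p e.
Proof.
have [Op p0 ep _] := pp; move=> [Oe ee] [r Or h].
by move: ee; rewrite h lr_evM // ep mulr0 eqxx.
Qed.

(** The graph of the p-adic valuation; its laws are proved on the graph before a function is chosen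
    in [padic_ex]. *)
Definition pfac x n := exists F G, [/\ O F, O G, ~ ldvd O p F, ~ ldvd O p G & x = p ^ n * F / G].

Lemma ndvd_neq0 x : ~ ldvd O p x -> x != 0.
Proof. by move=> h; apply/eqP => x0; apply: h; rewrite x0; exact: ldvd0. Qed.

Lemma ndvdM x y : O x -> O y -> ~ ldvd O p x -> ~ ldvd O p y -> ~ ldvd O p (x * y).
Proof. by have [_ _ _ prp] := pp; move=> Ox Oy nx ny /(prp _ _ Ox Oy)[]. Qed.

Lemma ndvd1 : ~ ldvd O p 1.
Proof. by apply: prime_nunit; split; [exact: lr_1|rewrite lr_ev1 oner_neq0]. Qed.

Lemma pfac_O x : O x -> x != 0 -> exists n y, [/\ O y, ~ ldvd O p y & x = p ^+ n * y].
Proof.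
have [Op p0 ep _] := pp.
move=> Ox; apply: contraNP => nx.
pose P x := O x /\ ~ exists n y, [/\ O y, ~ ldvd O p y & x = p ^+ n * y].
have [||||a _ ->] := @noeth_descent _ _ _ O 0 P nO _ _ _ x; last by rewrite mulr0.
- exact: lr_0.
- by move=> y [].
- move=> y [Oy ny]; have [[r Or yE]|nd] := pselect (ldvd O p y).
    exists 0, p, r; split; rewrite // ?mulr0 ?add0r 1?mulrC //; first exact: lr_0.
    split=> // -[n [z [Oz nz rE]]]; apply: ny; exists n.+1, z; split=> //.
    by rewrite yE rE exprS; ring.
  by case: ny; exists 0%N, y; rewrite expr0 mul1r.
- by [].
Qed.

Lemma pfac_ex x : x != 0 -> exists n, pfac x n.
Proof.
move=> x0; have [F [G [OF OG G0 xE]]] := qO x.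
have F0 : F != 0 by apply: contra_neq x0 => F0; rewrite xE F0 mul0r.
have [n [A [OA nA FE]]] := pfac_O OF F0; have [m [B [OB nB GE]]] := pfac_O OG G0.
have [_ p0 _ _] := pp.
exists (n%:Z - m%:Z), A, B; split=> //; rewrite xE FE GE expfzDr // -exprnP -exprnN.
have B0 := ndvd_neq0 nB; have pm : p ^+ m != 0 by rewrite expf_neq0.
by field; rewrite B0.
Qed.

Lemma pfac_le x n m : pfac x n -> pfac x m -> n <= m.
Proof.
have [Op p0 _ _] := pp.
move=> [F [G [OF OG nF nG xE]]] [F' [G' [OF' OG' nF' nG' xE']]].
rewrite leNgt; apply/negP => mn; have G0 := ndvd_neq0 nG; have G0' := ndvd_neq0 nG'.
have [d dE] : exists d : nat, n = m + d.+1%:Z by exists (`|n - m|.-1)%N; lia.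
have pm : p ^ m != 0 by rewrite expfz_neq0.
apply: (ndvdM OF' OG nF' nG); exists (p ^+ d * F * G').
  by apply: lr_M => //; apply: lr_M => //; apply: lr_X.
apply: (mulfI pm).
transitivity (x * G * G'); first by rewrite xE'; field.
by rewrite xE dE expfzDr // -exprnP exprS; field.
Qed.

Lemma pfacM x y n m : pfac x n -> pfac y m -> pfac (x * y) (n + m).
Proof.
have [Op p0 _ _] := pp.
move=> [F [G [OF OG nF nG ->]]] [F' [G' [OF' OG' nF' nG' ->]]].
exists (F * F'), (G * G'); split; [exact: lr_M|exact: lr_M|exact: ndvdM|exact: ndvdM|].
have G0 := ndvd_neq0 nG; have G0' := ndvd_neq0 nG'.
by rewrite expfzDr //; field; rewrite ?G0 ?G0'.
Qed.

Lemma pfacD x y n m l : pfac x n -> pfac y m -> pfac (x + y) l -> n <= m -> n <= l.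
Proof.
have [Op p0 _ _] := pp.
move=> [F [G [OF OG nF nG xE]]] [F' [G' [OF' OG' nF' nG' yE]]] xyl nm.
have G0 := ndvd_neq0 nG; have G0' := ndvd_neq0 nG'.
have [d dE] : exists d : nat, m = n + d%:Z by exists `|m - n|%N; lia.
have xyE : x + y = p ^ n * (F * G' + p ^+ d * F' * G) / (G * G').
  by rewrite xE yE dE expfzDr // -exprnP; field; rewrite ?G0 ?G0'.
have xy0 : x + y != 0.
  have [A [B [_ _ nA nB ->]]] := xyl.
  by rewrite !mulf_neq0 ?invr_eq0 ?expfz_neq0 // ndvd_neq0.
have [||e [A [OA nA AE]]] := @pfac_O (F * G' + p ^+ d * F' * G).
- by do ?[apply: lr_D|apply: lr_M|apply: lr_X].
- by apply: contra_neq xy0 => e; rewrite xyE e mulr0 mul0r.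
have : pfac (x + y) (n + e%:Z).
  exists A, (G * G'); split; [by []|exact: lr_M|by []|exact: ndvdM|].
  by rewrite xyE AE expfzDr // -exprnP; field; rewrite ?G0 ?G0'.
move=> /pfac_le /(_ xyl); lia.
Qed.

(** By [isdiv_pos] elements prime to p have value 0, so v is v(p) times the p-adic valuation; since
    v takes the value 1, v(p) = 1. *)
Lemma isdiv_pfac v x n : isdiv v -> 0 < v p -> pfac x n -> v x = n.
Proof.
move=> dv vp.
have nv y m : pfac y m -> v y = m * v p.
  move=> [F [G [OF OG nF nG ->]]]; have [Op p0 _ _] := pp.
  have F0 := ndvd_neq0 nF; have G0 := ndvd_neq0 nG.
  rewrite (nvdiv dv) ?mulf_neq0 ?expfz_neq0 // (nvM dv) ?expfz_neq0 //.
  have vz z : O z -> ~ ldvd O p z -> v z = 0.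
    move=> Oz nz; have := id_ge0 dv Oz; rewrite le_eqVlt => /predU1P[//|vz].
    by case: nz; apply: isdiv_pos dv pp vp Oz vz.
  rewrite (vz F) // (vz G) // addr0 subr0; case: m => m.
    by rewrite -exprnP (nvX dv) -mulr_natl natz.
  by rewrite NegzE -exprnN (nvV dv) (nvX dv) mulNr -mulr_natl natz.
have [t vt] := nv_norm dv; have t0 : t != 0.
  by apply: contra_eq_neq vt => ->; rewrite (nv0 dv).
have [e te] := pfac_ex t0; have := nv _ _ te; rewrite vt => ve.
have e1 : 1 <= e.
  rewrite leNgt; apply/negP => e0; have : e * v p <= 0 by (apply: mulr_le0_ge0; lia).
  by rewrite -ve.
have vp1 : v p <= 1.
  have h : 0 <= (e - 1) * v p by (apply: mulr_ge0; lia).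
  by move: h; rewrite mulrBl mul1r -ve subr_ge0.
by move=> /nv ->; rewrite (_ : v p = 1) ?mulr1 //; lia.
Qed.

Lemma padic_ex : exists v, isdiv v /\ 0 < v p.
Proof.
have [Op p0 ep _] := pp.
have /choice[f fP] : forall x, exists n, x != 0 -> pfac x n.
  by move=> x; have [->|/pfac_ex[n]] := eqVneq x 0; [exists 0|exists n].
pose v x := if x == 0 then 0 else f x.
have vP x : x != 0 -> pfac x (v x) by move=> x0; rewrite /v (negPf x0); apply: fP.
have vE x n : x != 0 -> pfac x n -> v x = n.
  by move=> x0 xn; apply: le_anti; rewrite !(pfac_le _ xn, pfac_le xn) //; apply: vP.
have vp1 : v p = 1.
  apply: vE => //; exists 1, 1; rewrite expr1z mulr1 divr1.
  by split=> //; [exact: lr_1|exact: lr_1|exact: ndvd1|exact: ndvd1].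
have vnd y : O y -> ~ ldvd O p y -> v y = 0.
  move=> Oy ny; apply: vE; first exact: ndvd_neq0.
  by exists y, 1; rewrite mul1r divr1; split=> //; [exact: lr_1|exact: ndvd1].
exists v; split; last by rewrite vp1.
split.
- split.
  + by rewrite /v eqxx.
  + by move=> g h g0 h0; apply: vE; rewrite ?mulf_neq0 //; apply: pfacM; apply: vP.
  + move=> g h g0 h0 gh0; have [le|lt] := leP (v g) (v h).
      exact: pfacD (vP _ g0) (vP _ h0) (vP _ gh0) le.
    by rewrite addrC; apply: pfacD (vP _ h0) (vP _ g0) _ (ltW lt); rewrite addrC; apply: vP.
  + by exists p.
- move=> h Oh; have [->|h0] := eqVneq h 0; first by rewrite /v eqxx.
  have [n [y [Oy ny hE]]] := pfac_O Oh h0.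
  rewrite (vE h n) //; exists y, 1; rewrite divr1 -exprnP.
  by split=> //; [exact: lr_1|exact: ndvd1].
- move=> h vh; have [->|h0] := eqVneq h 0.
    exists 0, 1; rewrite mul0r oner_neq0; split; rewrite //; [exact: lr_0|exact: lr_1|].
    by apply: vnd; [exact: lr_1|exact: ndvd1].
  have [F [G [OF OG nF nG hE]]] := vP _ h0.
  exists (p ^+ `|v h| * F), G; split=> //; first by apply: lr_M => //; apply: lr_X.
  - exact: ndvd_neq0.
  - exact: vnd.
  - by rewrite {1}hE exprnP gez0_abs.
Qed.
End Padic.

Hypothesis rO : regular2 O.

Lemma isdiv_prime v : isdiv v -> exists p, lprime O p /\ 0 < v p.
Proof.
move=> dv; have [t vt] := nv_norm dv.
have [|F [G [OF OG G0 vG tE]]] := @id_loc _ dv t; first by rewrite vt.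
have t0 : t != 0 by apply: contra_eq_neq vt => ->; rewrite (nv0 dv).
have F0 : F != 0 by apply: contra_neq t0 => F0; rewrite tE F0 mul0r.
have vF : v F = 1 by move: vt; rewrite tE (nvdiv dv) // vG subr0.
have [e [s [ue ps FE]]] := factorization rO OF F0.
apply: contrapT => np; have e0 := lr_neq0 ue.2.
have vprod : v (\prod_(p <- s) p) = 0.
  elim: s ps {FE} => [|p s IH] ps; first by rewrite big_nil (nv1 dv).
  have pp : lprime O p by apply: ps; rewrite inE eqxx.
  have [Op p0 _ _] := pp.
  have ps' : {in s, forall p, lprime O p} by move=> q qs; apply: ps; rewrite inE qs orbT.
  have s0 : \prod_(q <- s) q != 0.
    by rewrite prodf_seq_neq0; apply/allP => q /ps'[].
  rewrite big_cons (nvM dv) // IH // addr0; have := id_ge0 dv Op.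
  by rewrite le_eqVlt => /predU1P[//|vp]; case: np; exists p.
have s0 : \prod_(q <- s) q != 0 by rewrite prodf_seq_neq0; apply/allP => q /ps[].
by move: vF; rewrite FE (nvM dv) // (isdiv_unit dv ue) vprod.
Qed.

Lemma isdiv_eq v v' p : isdiv v -> isdiv v' -> lprime O p -> 0 < v p -> 0 < v' p -> v =1 v'.
Proof.
move=> dv dv' pp vp vp' x; have [->|x0] := eqVneq x 0; first by rewrite (nv0 dv) (nv0 dv').
have [n xn] := pfac_ex pp (r2_noeth rO) (r2_frac rO) x0.
by rewrite !(isdiv_pfac pp (r2_noeth rO) (r2_frac rO) _ _ xn).
Qed.

Lemma isdiv_prime1 v p : isdiv v -> lprime O p -> 0 < v p -> v p = 1.
Proof.
move=> dv pp vp; have [Op p0 _ _] := pp.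
apply: (isdiv_pfac pp (r2_noeth rO) (r2_frac rO) dv vp).
exists 1, 1; rewrite expr1z mulr1 divr1.
by split=> //; [exact: lr_1|exact: lr_1|exact: ndvd1|exact: ndvd1].
Qed.

(** The prime factors of a denominator are cancelled one at a time: nonnegativity for the p-adic
    valuation makes p divide the numerator. *)
Lemma hartogs h : h != 0 -> (forall v, isdiv v -> 0 <= v h) -> O h.
Proof.
move=> h0 vh; have [F [G [OF OG G0 hE]]] := r2_frac rO h.
have F0 : F != 0 by apply: contra_neq h0 => F0; rewrite hE F0 mul0r.
have [e [s [ue ps GE]]] := factorization rO OG G0.
have e0 := lr_neq0 ue.2.
elim: s F G OF F0 {OG G0} hE GE ps => [|p s IH] F G OF F0 hE GE ps.
  by move: GE; rewrite big_nil mulr1 => GE; rewrite hE GE; case: ue => ? ?; apply: lr_div.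
have pp : lprime O p by apply: ps; rewrite inE eqxx.
have [Op p0 _ _] := pp.
have ps' : {in s, forall p, lprime O p} by move=> q qs; apply: ps; rewrite inE qs orbT.
have s0 : \prod_(q <- s) q != 0.
  by rewrite prodf_seq_neq0; apply/allP => q /ps'[].
have Os : O (\prod_(q <- s) q).
  rewrite big_seq; apply: (big_ind (lr_car O)); [exact: lr_1|exact: lr_M|].
  by move=> q /ps'[].
have [v [dv vp]] := padic_ex pp (r2_noeth rO) (r2_frac rO).
have [r Or FE] : ldvd O p F.
  apply: (isdiv_pos dv pp vp OF); have := vh v dv.
  rewrite hE GE big_cons (nvdiv dv) ?mulf_neq0 // (nvM dv) ?mulf_neq0 // (nvM dv) //.
  by have := id_ge0 dv Os; rewrite (isdiv_unit dv ue); lia.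
apply: (IH r (e * \prod_(q <- s) q)) => //.
  by apply: contra_neq F0 => r0; rewrite FE r0 mul0r.
rewrite hE GE FE big_cons; field.
by rewrite s0 e0.
Qed.

End IsDiv.

(** * Quotients by prime ideals *)

Section DomainField.
Variable A : comNzRingType.
Hypothesis dom : forall x y : A, x * y = 0 -> x = 0 \/ y = 0.

Definition domain_alias : Type := A.
HB.instance Definition _ := GRing.ComNzRing.on domain_alias.

Let unit : {pred domain_alias} := fun x => `[< exists y, y * x = 1 >].
Let inv (x : domain_alias) : domain_alias :=
  if pselect (exists y, y * x = 1) is left h then projT1 (cid h) else x.

Let mulVx : {in unit, left_inverse 1 inv *%R}.
Proof.
move=> x; rewrite unfold_in => /asboolP h; rewrite /inv; case: pselect => // h'.
by case: cid.
Qed.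
Let unitPl (x y : domain_alias) : y * x = 1 -> unit x.
Proof. by move=> h; apply/asboolP; exists y. Qed.
Let inv_out : {in [predC unit], inv =1 id}.
Proof.
move=> x; rewrite inE unfold_in => /asboolPn h; rewrite /inv.
by case: pselect.
Qed.
HB.instance Definition _ :=
  GRing.ComNzRing_hasMulInverse.Build domain_alias mulVx unitPl inv_out.

Let dom_axiom : GRing.integral_domain_axiom domain_alias.
Proof. by move=> x y /dom[->|->]; rewrite eqxx ?orbT. Qed.
HB.instance Definition _ := GRing.ComUnitRing_isIntegral.Build domain_alias dom_axiom.

Lemma domain_field : exists (K : fieldType) (f : {rmorphism A -> K}), forall x, f x = 0 -> x = 0.
Proof.
pose f0 : {rmorphism domain_alias -> {fraction domain_alias}} := @FracField.tofrac domain_alias.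
pose f : {rmorphism A -> {fraction domain_alias}} := f0.
by exists {fraction domain_alias}, f => x /eqP; rewrite /f /= tofrac_eq0 => /eqP.
Qed.
End DomainField.

Section PrimeQuotient.
Variables (R : comNzRingType) (P : R -> Prop).
Hypotheses (P0 : P 0) (P1 : ~ P 1) (PD : forall x y, P x -> P y -> P (x + y))
  (PM : forall a x, P x -> P (a * x)) (Pp : forall x y, P (x * y) -> P x \/ P y).

Definition ideal_pred : R -> bool := fun x => `[< P x >].
Local Notation I := ideal_pred.
Let Iideal : idealr_closed (I : {pred R}).
Proof.
split; rewrite ?unfold_in; [exact/asboolP|exact/asboolPn|].
move=> a x y; rewrite !unfold_in => /asboolP Px /asboolP Py; apply/asboolP.
by apply: PD => //; apply: PM.
Qed.
HB.instance Definition _ := isIdealr.Build R I Iideal.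

Lemma prime_field : exists (K : fieldType) (f : {rmorphism R -> K}), forall x, f x = 0 <-> P x.
Proof.
pose J : idealr R := I; pose Q := {ideal_quot J}; pose q : {rmorphism R -> Q} := \pi_Q%qT.
have q0 x : q x = 0 <-> P x.
  rewrite /q /= -(rmorph0 q) /q /=; split=> [/eqP|h].
    by rewrite -Quotient.idealrBE subr0 unfold_in => /asboolP.
  by apply/eqP; rewrite -Quotient.idealrBE subr0 unfold_in; apply/asboolP.
have [|K [f fi]] := @domain_field Q.
  move=> x y; rewrite -[x]reprK -[y]reprK => xy.
  have /q0/Pp[/q0 h|/q0 h] : q (repr x * repr y) = 0 by rewrite rmorphM.
    by left.
  by right.
exists K, (f \o q : {rmorphism R -> K}) => x /=; rewrite -q0.
by split=> [/fi|->]; rewrite // rmorph0.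
Qed.
End PrimeQuotient.

(** * Local rings of points *)

Section Homogeneous.
Variables (k : fieldType) (n : nat).

Lemma mmap_scale (L : fieldType) (j : k -> L) (y : 'I_n -> L) c d (F : {mpoly k[n]}) :
  F \is d.-homog -> mmap j (fun i => c * y i) F = c ^+ d * mmap j y F.
Proof.
move=> /dhomogP hF; rewrite /mmap mulr_sumr big_seq [RHS]big_seq.
apply: eq_bigr => m mF; have dm : mdeg m = d := hF m mF.
rewrite mulrCA; congr (_ * _); rewrite /mmap1 -dm mdegE -prodrXr -big_split /=.
by apply: eq_bigr => i _; rewrite exprMn.
Qed.

Lemma mmap_ext (L : fieldType) (j : k -> L) (y y' : 'I_n -> L) (F : {mpoly k[n]}) :
  y =1 y' -> mmap j y F = mmap j y' F.
Proof.
by move=> yy; rewrite /mmap; apply: eq_bigr => m _; rewrite (mmap1_eq _ yy).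
Qed.

Lemma mmap_comp (L M : fieldType) (j : {rmorphism k -> L}) (g : {rmorphism L -> M})
    (j' : {rmorphism k -> M}) (y : 'I_n -> L) (F : {mpoly k[n]}) :
  (forall c, g (j c) = j' c) -> g (mmap j y F) = mmap j' (fun i => g (y i)) F.
Proof.
move=> gj; rewrite /mmap rmorph_sum /=; apply: eq_bigr => m _.
rewrite rmorphM gj /mmap1 rmorph_prod /=; congr (_ * _).
by apply: eq_bigr => i _; rewrite rmorphXn.
Qed.

(** All large degrees are offered, so that a numerator and a denominator can be homogenized in the
    same degree. *)
Lemma homogenize (i : 'I_n) (F : {mpoly k[n]}) : exists d0, forall d, (d0 <= d)%N ->
  exists H, H \is d.-homog /\ forall (L : fieldType) (j : {rmorphism k -> L}) (y : 'I_n -> L),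
    y i != 0 -> mmap j y H = y i ^+ d * mmap j (fun l => y l / y i) F.
Proof.
have hX l d : 'X_l ^+ d \is [in k[n], d.-homog].
  have h : 'X_l \is [in k[n], 1.-homog] by rewrite dhomogX; apply/eqP; exact: mdeg1.
  by have := dhomogMn d h; rewrite mul1n.
elim/mpoly_ring_ind: F => [c|l|F G [d1 IF] [d2 IG]|F G [d1 IF] [d2 IG]].
- exists 0%N => d _; exists (c *: 'X_i ^+ d); split; first exact: dhomogZ.
  by move=> L j y _; rewrite mmapZ rmorphXn /= mmapX mmap1U mmapC mulrC.
- exists 1%N => -[//|d] _; exists ('X_i ^+ d * 'X_l); split.
    rewrite -addn1; apply: dhomogM; first exact: hX.
    by rewrite dhomogX; apply/eqP; exact: mdeg1.
  move=> L j y y0; rewrite rmorphM rmorphXn /= !mmapX !mmap1U exprSr.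
  by field.
- exists (maxn d1 d2) => d; rewrite geq_max => /andP[/IF[H [hH HE]] /IG[K [hK KE]]].
  exists (H + K); split; first exact: rpredD.
  by move=> L j y y0; rewrite !mmapD HE // KE // mulrDr.
- exists (d1 + d2)%N => d hd.
  have [H [hH HE]] := IF d1 (leqnn _).
  have [|K [hK KE]] := IG (d - d1)%N; first by lia.
  exists (H * K); split; first by rewrite -(@subnKC d1 d); [exact: dhomogM|lia].
  move=> L j y y0; rewrite !rmorphM /= HE // KE //.
  rewrite -{2}(@subnKC d1 d); last by lia.
  by rewrite exprD; ring.
Qed.
End Homogeneous.

Section EvalAt.
Variables (k : fieldType) (X : pvar k) (L : fieldType) (j : {rmorphism k -> L}).
Variable y : point X j.
Local Notation x := (@vgen k X).
Local Notation iota := (viota X).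

Lemma pt_ndef d (G : {mpoly k[vcoords X]}) : G \is d.-homog ->
  mmap j y G != 0 -> mmap iota x G != 0.
Proof. by move=> hG; apply: contra_neq; apply: pt_on hG. Qed.

Lemma pt_gen i : y i != 0 -> x i != 0.
Proof.
have := @pt_ndef 1 'X_i; rewrite !mmapX !mmap1U; apply.
by rewrite dhomogX; apply/eqP; exact: mdeg1.
Qed.

Section Aff.
Variable i : 'I_(vcoords X).
Hypothesis yi : y i != 0.
Let xi := pt_gen yi.
Local Notation z := (fun l => x l / x i).
Local Notation w := (fun l => y l / y i).

Lemma homog_aff d (M : fieldType) (l : {rmorphism k -> M}) (v : 'I_(vcoords X) -> M)
    (F : {mpoly k[vcoords X]}) : F \is d.-homog -> v i != 0 ->
  mmap l v F = v i ^+ d * mmap l (fun l => v l / v i) F.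
Proof.
move=> hF vi; rewrite -(mmap_scale _ _ _ hF); apply: mmap_ext => m.
by field.
Qed.

Lemma aff_van (F : {mpoly k[vcoords X]}) : mmap iota z F = 0 -> mmap j w F = 0.
Proof.
move=> F0; have [d /(_ d (leqnn _))[H [hH HE]]] := homogenize i F.
have : mmap j y H = 0 by apply: pt_on hH _; rewrite HE ?F0 ?mulr0.
rewrite HE // => /eqP; rewrite mulf_eq0 expf_eq0 (negPf yi) andbF /= => /eqP //.
Qed.

Lemma aff_nvan (F : {mpoly k[vcoords X]}) : mmap j w F != 0 -> mmap iota z F != 0.
Proof. by apply: contra_neq; exact: aff_van. Qed.

(** In an affine chart the fractions need not be homogeneous, which makes sums and products of
    evaluations immediate. *)
Lemma eval_affP h t : eval_at y h t <-> exists F G : {mpoly k[vcoords X]},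
  [/\ mmap j w G != 0, h = mmap iota z F / mmap iota z G & t = mmap j w F / mmap j w G].
Proof.
split=> [[d [F [G [hF hG G0 -> ->]]]]|[F [G [G0 -> ->]]]].
  exists F, G.
  have yd : y i ^+ d != 0 by rewrite expf_neq0.
  have xd : x i ^+ d != 0 by rewrite expf_neq0.
  move: G0; rewrite (homog_aff j hG yi) (homog_aff j hF yi) (homog_aff iota hF xi) (homog_aff iota hG xi) mulf_eq0 negb_or => /andP[_ G0].
  by split=> //; rewrite -mulf_div divff // mul1r.
have [d1 hF] := homogenize i F; have [d2 hG] := homogenize i G.
have [H [hH HE]] := hF (maxn d1 d2) (leq_maxl _ _).
have [K [hK KE]] := hG (maxn d1 d2) (leq_maxr _ _).
have yd : y i ^+ maxn d1 d2 != 0 by rewrite expf_neq0.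
have xd : x i ^+ maxn d1 d2 != 0 by rewrite expf_neq0.
exists (maxn d1 d2), H, K; rewrite !HE ?KE //.
by split; rewrite ?mulf_neq0 // -mulf_div divff // mul1r.
Qed.

Lemma eval_coord l : eval_at y (x l / x i) (y l / y i).
Proof.
apply/eval_affP; exists 'X_l, 1; rewrite !mmapX !mmap1U !rmorph1 !divr1.
by rewrite oner_neq0.
Qed.
End Aff.

Lemma eval_C c : eval_at y (iota c) (j c).
Proof.
have [i yi] := pt_neq0 y; apply/(eval_affP yi); exists c%:MP, 1.
by rewrite !(rmorph1 (mmap _ _)) !mmapC !divr1 oner_neq0.
Qed.

Lemma eval_uniq h t t' : eval_at y h t -> eval_at y h t' -> t = t'.
Proof.
have [i yi] := pt_neq0 y.
move=> /(eval_affP yi)[F [G [G0 hE ->]]] /(eval_affP yi)[F' [G' [G0' hE' ->]]].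
have n0 := aff_nvan yi G0; have n0' := aff_nvan yi G0'.
have /(aff_van yi) : mmap iota (fun l => x l / x i) (F * G' - F' * G) = 0.
  apply/eqP; rewrite rmorphB !rmorphM /= subr_eq0 -eqr_div //; apply/eqP.
  by rewrite -hE -hE'.
rewrite rmorphB !rmorphM /= => /eqP; rewrite subr_eq0 -eqr_div // => /eqP //.
Qed.

Lemma eval_D h t h' t' : eval_at y h t -> eval_at y h' t' -> eval_at y (h + h') (t + t').
Proof.
have [i yi] := pt_neq0 y.
move=> /(eval_affP yi)[F [G [G0 -> ->]]] /(eval_affP yi)[F' [G' [G0' -> ->]]].
have n0 := aff_nvan yi G0; have n0' := aff_nvan yi G0'.
apply/(eval_affP yi); exists (F * G' + F' * G), (G * G').
rewrite !rmorphD !rmorphM /= mulf_neq0 //; split=> //; field; by rewrite ?n0 ?n0' ?G0 ?G0'.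
Qed.

Lemma eval_M h t h' t' : eval_at y h t -> eval_at y h' t' -> eval_at y (h * h') (t * t').
Proof.
have [i yi] := pt_neq0 y.
move=> /(eval_affP yi)[F [G [G0 -> ->]]] /(eval_affP yi)[F' [G' [G0' -> ->]]].
have n0 := aff_nvan yi G0; have n0' := aff_nvan yi G0'.
apply/(eval_affP yi); exists (F * F'), (G * G').
rewrite !rmorphM /= mulf_neq0 //; split=> //; field; by rewrite ?n0 ?n0' ?G0 ?G0'.
Qed.

Lemma eval_V h t : eval_at y h t -> t != 0 -> eval_at y h^-1 t^-1.
Proof.
have [i yi] := pt_neq0 y.
move=> /(eval_affP yi)[F [G [G0 -> ->]]].
rewrite mulf_eq0 invr_eq0 (negPf G0) orbF => F0.
by apply/(eval_affP yi); exists G, F; rewrite !invf_div.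
Qed.
End EvalAt.

Section LocalRing.
Variables (k : numFieldType) (X : pvar k) (a : cpoint X).

Definition pt_ev (h : vfield X) : k :=
  if pselect (exists t, eval_at a h t) is left e then projT1 (cid e) else 0.

Lemma pt_evP h : regular_at a h -> eval_at a h (pt_ev h).
Proof. by rewrite /pt_ev => e; case: pselect => // e'; case: cid. Qed.

Let idk : {rmorphism k -> k} := idfun.
Let a' : point X idk := a.

Lemma pt_evE h t : eval_at a h t -> pt_ev h = t.
Proof.
move=> e; have e' : eval_at a h (pt_ev h) by apply: pt_evP; exists t.
exact: (@eval_uniq k X k idk a' _ _ _ e' e).
Qed.

Let regC c : eval_at a (viota X c) c. Proof. exact: (eval_C (j := idk) a'). Qed.

Lemma lr_at_subproof : [/\
  forall x y, regular_at a x -> regular_at a y -> regular_at a (x + y),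
  forall x y, regular_at a x -> regular_at a y -> pt_ev (x + y) = pt_ev x + pt_ev y,
  forall x y, regular_at a x -> regular_at a y -> regular_at a (x * y),
  forall x y, regular_at a x -> regular_at a y -> pt_ev (x * y) = pt_ev x * pt_ev y &
  forall x, regular_at a x -> pt_ev x != 0 -> regular_at a x^-1].
Proof.
have eD := @eval_D k X k idk a'; have eM := @eval_M k X k idk a'.
have eV := @eval_V k X k idk a'.
split.
- by move=> x y [t ex] [s ey]; exists (t + s); apply: eD.
- by move=> x y /pt_evP ex /pt_evP ey; apply: pt_evE; apply: eD.
- by move=> x y [t ex] [s ey]; exists (t * s); apply: eM.
- by move=> x y /pt_evP ex /pt_evP ey; apply: pt_evE; apply: eM.
- by move=> x /pt_evP ex ex0; exists (pt_ev x)^-1; apply: eV.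
Qed.

Let lr_C' c : regular_at a (viota X c). Proof. by exists c; apply: regC. Qed.
Let lr_evC' c : pt_ev (viota X c) = c. Proof. by apply: pt_evE; apply: regC. Qed.

Definition lr_at : lring (viota X) :=
  LRing lr_C' lr_evC' (let: And5 h _ _ _ _ := lr_at_subproof in h)
    (let: And5 _ h _ _ _ := lr_at_subproof in h)
    (let: And5 _ _ h _ _ := lr_at_subproof in h)
    (let: And5 _ _ _ h _ := lr_at_subproof in h)
    (let: And5 _ _ _ _ h := lr_at_subproof in h).

Lemma lr_at_evalP h t : eval_at a h t <-> lr_at h /\ lr_ev lr_at h = t.
Proof.
split=> [e|[r <-]]; last exact: pt_evP.
by split; [exists t|exact: pt_evE].
Qed.

Lemma local_paramsP u w : local_params a u w <-> params lr_at u w.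
Proof.
split=> [[/lr_at_evalP[Ou eu] /lr_at_evalP[Ow ew] h]|[Ou Ow eu ew h]].
  by split=> // f Of ef; apply: h; apply/lr_at_evalP.
split; [exact/lr_at_evalP|exact/lr_at_evalP|].
by move=> f /lr_at_evalP[Of ef]; apply: h.
Qed.

Lemma lr_at_gen i : a i != 0 -> gen_by lr_at (fun l => @vgen k X l / @vgen k X i).
Proof.
move=> ai; split=> [l|h [t /(eval_affP (j := idk) (y := a') ai)[F [G [G0 hE _]]]]].
  by exists (a l / a i); exact: (@eval_coord k X k idk a' i ai l).
exists F, G; split=> //; apply: contra_neq G0 => <-; apply/esym/pt_evE.
apply/(eval_affP (j := idk) (y := a') ai); exists G, 1.
by rewrite !rmorph1 !divr1 oner_neq0.
Qed.

Lemma lr_at_ess_ft : ess_ft lr_at.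
Proof.
have [i ai] := pt_neq0 a.
by exists _, (fun l => @vgen k X l / @vgen k X i); apply: lr_at_gen.
Qed.

Lemma lr_at_frac : generates_field X -> lfrac lr_at.
Proof.
move=> gX h; have [d [F [G [hF hG G0 ->]]]] := gX h.
have [i ai] := pt_neq0 a; have [Oz _] := lr_at_gen ai.
have xi := @pt_gen k X k idk a' i ai.
have xd : vgen i ^+ d != 0 :> vfield X by rewrite expf_neq0.
exists (mmap (viota X) (fun l => vgen l / vgen i) F), (mmap (viota X) (fun l => vgen l / vgen i) G).
move: G0; rewrite (homog_aff _ hF xi) (homog_aff _ hG xi) mulf_eq0 negb_or => /andP[_ G0].
split=> //; [exact: (lr_mmap _ _).1|exact: (lr_mmap _ _).1|].
by rewrite -mulf_div divff // mul1r.
Qed.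
End LocalRing.

Lemma surface_regular2 (k : numFieldType) (X : surface k) (a : cpoint X) :
  two_ders (viota X) -> regular2 (lr_at a).
Proof.
move=> nz; have qO := lr_at_frac a (s_gen (s := X)); split=> //.
- exact/ess_ft_noeth/lr_at_ess_ft.
- by have [u [w /local_paramsP]] := s_smooth a; exists u, w.
- move=> u w; apply: dual_local => //; first exact: lr_at_ess_ft.
  by case: (s_dim X).
Qed.

(** * Nullstellensatz *)

Section SpecStep.
Variables (k : numClosedFieldType) (A : comNzRingType) (K : fieldType).
Variables (ev : {rmorphism A -> K}) (t : K) (s : {poly A}).
Hypothesis st : (map_poly ev s).[t] != 0.

Lemma horner_map_sum (Q : {poly A}) (x : K) :
  (map_poly ev Q).[x] = \sum_(i < size Q) ev Q`_i * x ^+ i.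
Proof.
rewrite -{1}[Q]coefK poly_def rmorph_sum /= horner_sum; apply: eq_bigr => i _.
by rewrite map_polyZ /= map_polyXn hornerZ hornerXn.
Qed.

Lemma nz_const_rel (N : {poly A}) u : map_poly ev N != 0 -> (map_poly ev N).[u] = 0 ->
  u != 0 -> exists M : {poly A}, ev M`_0 != 0 /\ (map_poly ev M).[u] = 0.
Proof.
have [d] := ubnP (size N); elim: d N => // d IH N; rewrite ltnS => sN N0 Nu u0.
have [N00|N00] := eqVneq (ev N`_0) 0; last by exists N.
have NE : map_poly ev N = map_poly ev (Poly (behead N)) * 'X.
  apply/polyP => i; rewrite coefMX !coef_map /= coef_Poly.
  by case: i => [|i]; rewrite /= ?N00 // nth_behead.
have N'0 : map_poly ev (Poly (behead N)) != 0.
  by apply: contra_neq N0 => e; rewrite NE e mul0r.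
have nN : N != 0 by apply: contra_neq N0 => ->; rewrite rmorph0.
apply: (IH (Poly (behead N))) => //.
  apply: leq_ltn_trans (size_Poly _) _; rewrite size_behead.
  by apply: leq_trans sN; rewrite prednK // lt0n size_poly_eq0.
by move: Nu; rewrite NE hornerMX => /eqP; rewrite mulf_eq0 (negPf u0) orbF => /eqP.
Qed.

(** Extends a specialization of A to one more element t while keeping s(t) nonzero; d is the
    condition under which this is possible. *)
Lemma specialize_step : exists d : A, ev d != 0 /\
  forall ev0 : {rmorphism A -> k}, (forall F, ev F = 0 -> ev0 F = 0) -> ev0 d != 0 ->
  exists t0, (forall Q, (map_poly ev Q).[t] = 0 -> (map_poly ev0 Q).[t0] = 0) /\
    (map_poly ev0 s).[t0] != 0.
Proof.
have map0 (ev0 : {rmorphism A -> k}) (Q : {poly A}) :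
    (forall F, ev F = 0 -> ev0 F = 0) -> map_poly ev Q = 0 -> map_poly ev0 Q = 0.
  move=> e0 Q0; apply/polyP => i; rewrite coef_map coef0 /=; apply: e0.
  by have := coef_map ev Q i; rewrite Q0 coef0.
have [[P [P0 Pt]]|tr] := pselect (exists P, map_poly ev P != 0 /\ (map_poly ev P).[t] = 0); last first.
  have s0 : map_poly ev s != 0 by apply: contra_neq st => ->; rewrite horner0.
  (* For t transcendental any t0 off the roots of the specialized s works; d is the coefficient of s
     giving the leading one after [ev]. *)
  exists s`_(size (map_poly ev s)).-1; split.
    by have /= <- := coef_map ev s (size (map_poly ev s)).-1; rewrite -lead_coefE lead_coef_eq0.
  move=> ev0 e0 d0.
  have s00 : map_poly ev0 s != 0.
    by apply: contra_neq d0 => e; have := coef_map ev0 s (size (map_poly ev s)).-1; rewrite e coef0 /= => <-.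
  have [t0 t0P] : exists t0, ~~ root (map_poly ev0 s) t0.
    apply: contrapT => nt.
    pose r := [seq (i%:R : k) | i <- iota 0 (size (map_poly ev0 s))].
    suff : (size r < size (map_poly ev0 s))%N by rewrite size_map size_iota ltnn.
    apply: max_poly_roots => //.
      by apply/allP => x _; apply: contrapT => /negP nx; apply: nt; exists x.
    by rewrite map_inj_uniq ?iota_uniq // => i j /eqP; rewrite eqr_nat => /eqP.
  exists t0; split=> // Q Qt; rewrite (map0 ev0 Q) ?horner0 //.
  by apply: contrapT => /eqP Q0; apply: tr; exists Q.
pose rel n := `[< exists P, [/\ map_poly ev P != 0, (map_poly ev P).[t] = 0 & (size P <= n)%N] >].
have /ex_minnP[n /asboolP[{P0 Pt} {}P [P0 Pt sP]] minn] : exists n, rel n.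
  by exists (size P); apply/asboolP; exists P.
have minP Q : (map_poly ev Q).[t] = 0 -> (size Q < size P)%N -> map_poly ev Q = 0.
  move=> Qt sQ; apply: contrapT => /eqP Q0; have : (n <= size Q)%N by apply/minn/asboolP; exists Q.
  by rewrite leqNgt (leq_trans sQ).
have nP : P != 0 by apply: contra_neq P0 => ->; rewrite rmorph0.
set m := lead_coef P.
have m0 : ev m != 0.
  apply: contra_neq (P0) => m0; pose P' := P - m *: 'X^((size P).-1).
  have P'E : map_poly ev P' = map_poly ev P.
    apply/polyP => i; rewrite !coef_map /= coefB coefZ coefXn rmorphB rmorphM /= m0.
    by rewrite mul0r subr0.
  rewrite -P'E; apply: minP; rewrite ?P'E //.
  have szP : (size P = (size P).-1.+1)%N by rewrite prednK // lt0n size_poly_eq0.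
  rewrite szP ltnS; apply/leq_sizeP => i; rewrite leq_eqVlt => /predU1P[<-|hi].
    by rewrite coefB coefZ coefXn eqxx mulr1 subrr.
  rewrite coefB coefZ coefXn gtn_eqF // mulr0 subr0 nth_default //.
  by rewrite szP.
(* As m t is integral over the image of A, so is u = m^e s(t), e exceeding the degree of s. Factors
   X are removed from an integral equation of u to get M with nonzero constant term. *)
pose e := size s; pose u := ev m ^+ e * (map_poly ev s).[t].
have u0 : u != 0 by rewrite mulf_neq0 // expf_neq0.
have int_mt : integralOver ev (ev m * t).
  have sP1 : (1 < size P)%N.
    rewrite ltnNge; apply/negP => /size1_polyC Pc; move: Pt m0.
    by rewrite /m Pc lead_coefC map_polyC hornerC => ->; rewrite eqxx.
  pose q := \poly_(i < size P) (if i == (size P).-1 then 1 else P`_i * m ^+ ((size P).-2 - i)).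
  have szP : (size P = (size P).-2.+2)%N by case: (size P) sP1 => [|[]].
  have qm : q \is monic.
    rewrite monicE lead_coefE size_poly_eq ?coef_poly ?eqxx ?oner_neq0 //.
    by rewrite szP ltnSn.
  exists q => //; apply/rootP.
  rewrite /q poly_def rmorph_sum /= horner_sum.
  under eq_bigr do rewrite map_polyZ /= map_polyXn hornerZ hornerXn.
  transitivity (ev m ^+ (size P).-2 * (map_poly ev P).[t]); last by rewrite Pt mulr0.
  rewrite horner_map_sum mulr_sumr; apply: eq_bigr => i _; rewrite exprMn.
  case: eqP => [iE|/eqP iE].
    by rewrite rmorph1 mul1r iE -lead_coefE -/m szP /= exprS; ring.
  have ile : (i <= (size P).-2)%N.
    have h : ((size P).-2.+1 = (size P).-1)%N by rewrite {2}szP.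
    by rewrite -ltnS h ltn_neqAle iE /= -ltnS -h -szP.
  by rewrite rmorphM rmorphXn /= -[in RHS](subnK ile) exprD; ring.
have [N Nm /rootP Nu] : integralOver ev u.
  rewrite /u horner_map_sum mulr_sumr.
  apply: (big_ind (fun x => integralOver ev x)); [exact: integral0|exact: integral_add|].
  move=> i _; have -> : ev m ^+ e * (ev s`_i * t ^+ i) = ev (m ^+ (e - i) * s`_i) * (ev m * t) ^+ i.
    have -> : ev m ^+ e = ev m ^+ (e - i) * ev m ^+ i by rewrite -exprD subnK // ltnW.
    by rewrite rmorphM rmorphXn /= exprMn; ring.
  apply: integral_mul; first exact: integral_id.
  elim: (nat_of_ord i) => [|l IH]; first by rewrite expr0; exact: integral1.
  by rewrite exprS; apply: integral_mul.
have [M [M0 Mu]] : exists M : {poly A}, ev M`_0 != 0 /\ (map_poly ev M).[u] = 0.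
  apply: (nz_const_rel _ Nu u0); apply: contra_eq_neq (monicP Nm) => N0.
  apply: contraTneq isT => N1; have := coef_map ev N (size N).-1.
  by rewrite N0 coef0 /= -lead_coefE N1 (rmorph1 ev) => /esym/eqP; rewrite oner_eq0.
exists (m * M`_0); rewrite rmorphM mulf_neq0 //; split=> // ev0 e0.
rewrite rmorphM mulf_eq0 negb_or => /andP[m00 M00].
have [t0 /rootP t0P] : exists t0, root (map_poly ev0 P) t0.
  apply/closed_rootP; rewrite size_map_poly_id0 -/m //.
  rewrite neq_ltn; apply/orP; right.
  rewrite ltnNge; apply/negP => /size1_polyC Pc; move: Pt m0.
  by rewrite /m Pc lead_coefC map_polyC hornerC => ->; rewrite eqxx.
have spec Q : (map_poly ev Q).[t] = 0 -> (map_poly ev0 Q).[t0] = 0.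
  (* Pseudo-division by the relation P of least size: the remainder vanishes at t and is shorter, so
     [ev] kills it. *)
  move=> Qt; have QE := Pdiv.ComRing.rdivp_eq P Q; rewrite -/m in QE.
  have sR : (size (Pdiv.Ring.rmodp Q P) < size P)%N by rewrite Pdiv.Ring.ltn_rmodpN0.
  have /(congr1 (map_poly ev)) QE1 := QE; have /(congr1 (map_poly ev0)) QE0 := QE.
  rewrite !(map_polyZ, rmorphD, rmorphM, rmorphXn) /= in QE1 QE0.
  have R0 : map_poly ev0 (Pdiv.Ring.rmodp Q P) = 0.
    apply: map0 => //; apply: minP => //.
    have /(congr1 (fun p => p.[t])) := QE1; rewrite hornerZ hornerD hornerM Pt Qt mulr0 mulr0 add0r.
    by move=> <-.
  have /(congr1 (fun p => p.[t0])) := QE0; rewrite R0 addr0 hornerZ hornerM t0P mulr0.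
  by move=> /eqP; rewrite mulf_eq0 expf_eq0 (negPf m00) andbF /= => /eqP.
exists t0; split=> //; apply/eqP => s0.
(* If s(t0) were 0, this relation specialized at t0 would say that the constant term of M is killed
   by [ev0]. *)
have := spec (M \Po (m ^+ e *: s)).
rewrite !map_comp_poly !map_polyZ !horner_comp !hornerZ !rmorphXn /= -/u => /(_ Mu).
rewrite s0 mulr0 horner_coef0 coef_map /= => /eqP.
by rewrite (negPf M00).
Qed.
End SpecStep.

(** Induction on the number of variables: [specialize_step] handles the last one, and its d is the
    polynomial to be kept nonzero for the others. *)
Lemma nullstellensatz (k : numClosedFieldType) (K : fieldType) (j : {rmorphism k -> K}) n
    (c : 'I_n -> K) (s : {mpoly k[n]}) : mmap j c s != 0 ->
  exists b : 'I_n -> k, (forall F, mmap j c F = 0 -> mmap idfun b F = 0) /\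
    mmap idfun b s != 0.
Proof.
elim: n c s => [|n IH] c s.
  have mE (L : fieldType) (i : {rmorphism k -> L}) (v : 'I_0 -> L) (F : {mpoly k[0]}) :
      mmap i v F = i F@_0.
    rewrite {1}(_ : F = (F@_0)%:MP) ?mmapC //; apply/mpolyP => m; rewrite mcoeffC.
    by have -> : m = 0%MM; [apply/mnmP => -[]|rewrite eqxx mulr1].
  rewrite mE fmorph_eq0 => s0; exists (fun=> 0); split=> [F|]; rewrite !(mE, mE _ idfun) //.
  by move/eqP; rewrite fmorph_eq0 => /eqP.
pose wi := widen_ord (leqnSn n).
pose c' i := c (wi i).
have mE (L : fieldType) (i : {rmorphism k -> L}) (v : 'I_n.+1 -> L) (F : {mpoly k[n.+1]}) :
    mmap i v F = (map_poly (mmap i (fun l => v (wi l))) (muni F)).[v ord_max].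
  elim/mpoly_ring_ind: F => [a|l|F G IF IG|F G IF IG].
  - by rewrite muniC map_polyC hornerC /= !mmapC.
  - rewrite mmapX mmap1U muniE msuppX big_seq1 mcoeffX eqxx !scale1r map_polyZ map_polyXn.
    rewrite hornerZ hornerXn /= mmapX /mmap1.
    have [l' lE|->] := unliftP ord_max l.
      have -> : l = wi l' by rewrite lE; apply: val_inj; rewrite /= /bump leqNgt ltn_ord.
      rewrite (bigD1 l') //= !mnmE eqxx expr1 big1 => [|r /negPf rl].
        by rewrite mulr1 -val_eqE /= ltn_eqF ?ltn_ord // expr0 mulr1.
      by rewrite mnmE mnm1E -val_eqE /= val_eqE eq_sym rl.
    rewrite big1 ?mul1r ?mnm1E ?eqxx ?expr1 // => r _.
    by rewrite mnmE mnm1E -val_eqE /= gtn_eqF.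
  - by rewrite muniD mmapD rmorphD hornerD IF IG.
  - by rewrite muniM !rmorphM /= hornerM IF IG.
rewrite mE => st; have [d [d0 dP]] := specialize_step k st.
have [b [bs bd]] := IH c' d d0.
have [t0 [t0s t0n]] := dP (mmap idfun b) bs bd.
pose b' (i : 'I_n.+1) := if unlift ord_max i is Some l then b l else t0.
have b'w l : b' (wi l) = b l.
  rewrite /b'; have -> : wi l = lift ord_max l.
    by apply: val_inj; rewrite /= /bump leqNgt ltn_ord.
  by rewrite liftK.
have b'm : b' ord_max = t0 by rewrite /b' unlift_none.
have mE0 F : mmap idfun b' F = (map_poly (mmap idfun b) (muni F)).[t0].
  rewrite mE b'm; congr (_.[_]); apply: eq_map_poly => G.
  exact: mmap_ext.
by exists b'; split=> [F|]; rewrite mE0 // mE; apply: t0s.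
Qed.

(** * Prime divisors *)

Section PrimeDiv.
Variables (k : numClosedFieldType) (X : pvar k).
Local Notation x := (@vgen k X).
Local Notation iota := (viota X).
Let idk : {rmorphism k -> k} := idfun.

(** The Nullstellensatz applied to the coordinates of y, one nonzero coordinate being kept nonzero;
    a denominator not vanishing at the specialization does not vanish at y. *)
Lemma specialization (K : fieldType) (j : {rmorphism k -> K}) (y : point X j) :
  exists a : cpoint X, forall h, regular_at a h -> regular_at y h.
Proof.
have [i yi] := pt_neq0 y.
have [|b [bs bi]] := @nullstellensatz k K j _ y 'X_i; first by rewrite mmapX mmap1U.
have b0 : exists i, b i != 0 by exists i; move: bi; rewrite mmapX mmap1U.
have bon d (F : {mpoly k[vcoords X]}) : F \is d.-homog -> mmap iota x F = 0 -> mmap idfun b F = 0.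
  by move=> hF F0; apply/bs/(pt_on y hF).
exists (Point b0 bon) => h [t [d [F [G [hF hG G0 hE _]]]]].
exists (mmap j y F / mmap j y G), d, F, G; split=> //.
by apply: contra_neq G0 => /bs.
Qed.

Lemma primediv_ext (v w : primediv X) : (v : _ -> _) =1 w -> v = w.
Proof.
case: v w => [v v0 vM vD vn vr] [w w0 wM wD wn wr] /= /funext e.
move: w0 wM wD wn wr; rewrite -e => w0 wM wD wn wr.
by congr PrimeDiv; apply: Prop_irrelevance.
Qed.

Lemma primediv_nval (v : primediv X) : nval v.
Proof. by case: v => v v0 vM vD vn vr; split. Qed.

Lemma pass_isdiv (v : primediv X) (a : cpoint X) : passes_through v a ->
  isdiv (lr_at a) v.
Proof.
move=> va; have nv := primediv_nval v; split=> // h vh.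
have [K [j [c cE]]] := ord_ring v; have [i ai] := pt_neq0 a.
have [Oz _] := lr_at_gen ai.
have vz l : 0 <= v (x l / x i) by apply: va; apply: Oz.
(* Where c_l is nonzero, x_l / x_i and x_i / x_l are both regular at c; their product is 1, so the
   value c_i / c_l is nonzero. Hence c lies in the chart of a. *)
have ci : c i != 0.
  have [l cl] := pt_neq0 c; have /cE[s cs] := vz l.
  have e1 := eval_M cs (eval_coord cl i).
  have x1 : x l / x i * (x i / x l) = 1.
    by field; rewrite (pt_gen cl) (pt_gen (j := idk) (y := a) ai).
  have e2 := eval_C c 1; rewrite !rmorph1 in e2; rewrite x1 in e1.
  apply: contra_eq_neq (eval_uniq e1 e2) => ->.
  by rewrite mul0r mulr0 eq_sym oner_neq0.
have /cE[t /(eval_affP ci)[F [G [G0 hE _]]]] := vh.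
have n0 := aff_nvan ci G0.
exists (mmap iota (fun l => x l / x i) F), (mmap iota (fun l => x l / x i) G).
split; [exact: (lr_mmap _ _).1|exact: (lr_mmap _ _).1|by []| |by []].
have h1 : 0 <= v (mmap iota (fun l => x l / x i) G) by apply: va; exact: (lr_mmap G Oz).1.
have h2 : 0 <= v (mmap iota (fun l => x l / x i) G)^-1.
  apply/cE; exists (mmap j (fun l => c l / c i) G)^-1.
  apply/(eval_affP ci); exists 1, G.
  by rewrite !(rmorph1 (mmap _ _)) !div1r.
by move: h2; rewrite (nvV nv); lia.
Qed.

(** The generic point of the curve has its coordinates in a field containing the quotient of the
    polynomial ring by the prime P of polynomials of positive value; [vpos] puts 0 in P by hand
    because v 0 = 0. *)
Lemma isdiv_primediv (a : cpoint X) (v : vfield X -> int) : isdiv (lr_at a) v ->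
  exists w : primediv X, (w : _ -> _) =1 v.
Proof.
move=> dv; have [i ai] := pt_neq0 a; have [Oz zg] := lr_at_gen ai.
have xi : x i != 0 := pt_gen (j := idk) (y := a) ai.
pose z l := x l / x i; pose m := mmap iota z.
have Om F : lr_at a (m F) := (lr_mmap F Oz).1.
pose P F := vpos v (m F).
have [|||||K [f f0]] := @prime_field _ P.
- by left; rewrite /m rmorph0.
- by rewrite /P /m rmorph1 => -[/eqP|]; [rewrite oner_eq0|rewrite (nv1 dv)].
- by move=> F G PF PG; rewrite /P /m rmorphD; apply: (vposD dv).
- by move=> F G PG; rewrite /P /m rmorphM; apply: (vposM dv) => //; apply: (id_ge0 dv).
- move=> F G; rewrite /P /m rmorphM /= => FG.
  have [F0|F0] := eqVneq (m F) 0; first by left; left.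
  have [G0|G0] := eqVneq (m G) 0; first by right; left.
  case: FG => [/eqP|]; first by rewrite mulf_eq0 (negPf F0) (negPf G0).
  rewrite (nvM dv) // => h; have := id_ge0 dv (Om F); have := id_ge0 dv (Om G).
  have [vF|vF] := ltP 0 (v (m F)); first by left; right.
  right; right; have : 0 < v (m F) + v (m G) by exact: h.
  by rewrite -/(m _); lia.
pose j : {rmorphism k -> K} := f \o @mpolyC _ k.
pose c l := f 'X_l.
have mE F : mmap j c F = f F.
  elim/mpoly_ring_ind: F => [e|l|F G IF IG|F G IF IG].
  - by rewrite mmapC.
  - by rewrite mmapX mmap1U.
  - by rewrite mmapD IF IG rmorphD.
  - by rewrite !rmorphM /= IF IG.
have ci : c i = 1.
  apply/eqP; rewrite -subr_eq0; apply/eqP.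
  have : f ('X_i - 1) = 0.
    by apply/f0; left; rewrite /m rmorphB /= mmapX mmap1U (rmorph1 (mmap _ _)) /z divff // subrr.
  by rewrite rmorphB rmorph1.
have c0 : exists l, c l != 0 by exists i; rewrite ci oner_neq0.
have con d (F : {mpoly k[vcoords X]}) : F \is d.-homog -> mmap iota x F = 0 -> mmap j c F = 0.
  move=> hF F0; rewrite mE; apply/f0; left; apply/eqP.
  move/eqP: F0; rewrite (homog_aff _ hF xi) mulf_eq0 expf_eq0 (negPf xi) andbF /=.
  by [].
pose C := Point c0 con; have Ci : C i != 0 by rewrite /= ci oner_neq0.
have cm F : mmap j (fun l => C l / C i) F = f F.
  by rewrite -mE; apply: mmap_ext => l /=; rewrite ci divr1.
have fn F : f F != 0 -> m F != 0 /\ v (m F) = 0.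
  move=> fF; have nP : ~ P F by move/f0/eqP; rewrite (negPf fF).
  have mF : m F != 0 by apply/eqP => e; apply: nP; left.
  split=> //; have := id_ge0 dv (Om F); rewrite le_eqVlt => /predU1P[//|h].
  by case: nP; right.
have ring_ok : exists (L : fieldType) (j : {rmorphism k -> L}) (c : point X j),
    forall h, 0 <= v h <-> regular_at c h.
  exists K, j, C => h; split=> [vh|[t /(eval_affP Ci)[F [G [G0 -> _]]]]].
    have [F' [G' [OF OG G'0 vG ->]]] := id_loc dv vh.
    have [A [B [eB FE]]] := zg _ OF; have [A' [B' [eB' GE]]] := zg _ OG.
    have B0 := lr_neq0 eB; have B'0 := lr_neq0 eB'.
    have uB : v (m B) = 0 by apply: (isdiv_unit dv).
    have uB' : v (m B') = 0 by apply: (isdiv_unit dv).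
    have A'0 : m A' != 0 by apply: contra_neq G'0 => e; rewrite GE -/(m A') e mul0r.
    have vA' : v (m A') = 0.
      by move: vG; rewrite GE (nvdiv dv) // -/(m A') -/(m B') uB' subr0.
    have nf H : m H != 0 -> v (m H) = 0 -> f H != 0.
      by move=> m0 vm; apply/eqP => /f0[e|]; [rewrite e eqxx in m0|rewrite vm].
    exists (f (A * B') / f (B * A')); apply/(eval_affP Ci); exists (A * B'), (B * A').
    rewrite !cm; split=> //; first by rewrite rmorphM mulf_neq0 ?nf.
    by rewrite FE GE !rmorphM /=; field; rewrite B0 B'0 A'0.
  rewrite cm in G0; have [m0 vm] := fn _ G0.
  have := id_ge0 dv (Om F); rewrite -/z -/m.
  have [->|F0] := eqVneq (m F) 0; first by rewrite mul0r (nv0 dv).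
  by rewrite (nvdiv dv) // vm subr0.
by exists (PrimeDiv (nv0 dv) (nvM dv) (nvD dv) (nv_norm dv) ring_ok).
Qed.

Lemma primediv_point (v : primediv X) : exists a : cpoint X, passes_through v a.
Proof.
have [K [j [c cE]]] := ord_ring v; have [a ac] := specialization c.
by exists a => h /ac/cE.
Qed.

(* valuative criterion of properness, followed by the choice of a closed point *)
Lemma center_ex (v : vfield X -> int) (K : fieldType) (j : {rmorphism k -> K})
    (r : vfield X -> K) : vgen_neq0 X -> nval v ->
  (forall c, 0 <= v (iota c)) ->
  (forall f g, 0 <= v f -> 0 <= v g -> r (f + g) = r f + r g) ->
  (forall f g, 0 <= v f -> 0 <= v g -> r (f * g) = r f * r g) ->
  (forall c, r (iota c) = j c) -> (forall f, 0 < v f -> r f = 0) ->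
  exists a : cpoint X, forall h, regular_at a h -> 0 <= v h.
Proof.
move=> [i0 xi0] nv vC rD rM rC r0.
have [i [xi imin]] : exists i, x i != 0 /\ forall l, x l != 0 -> v (x i) <= v (x l).
  case: (@Order.TotalTheory.arg_minP _ _ _ i0 (fun l => x l != 0) (fun l => v (x l)) xi0) => i xi imin.
  by exists i.
pose z l := x l / x i.
have vz l : 0 <= v (z l).
  rewrite /z; have [->|xl] := eqVneq (x l) 0; first by rewrite mul0r (nv0 nv).
  by rewrite (nvdiv nv) // subr_ge0 imin.
have mz F : 0 <= v (mmap iota z F) /\ r (mmap iota z F) = mmap j (fun l => r (z l)) F.
  elim/mpoly_ring_ind: F => [e|l|F G [vF rF] [vG rG]|F G [vF rF] [vG rG]].
  - rewrite !mmapC; split; [exact: vC|exact: rC].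
  - by rewrite !mmapX !mmap1U.
  - by rewrite !mmapD rD // rF rG; split=> //; apply: (nvD_ge0 nv).
  - by rewrite !rmorphM /= rM // rF rG; split=> //; apply: (nvM_ge0 nv).
have c0 : exists l, r (z l) != 0.
  by exists i; rewrite /z divff // -(rmorph1 iota) rC rmorph1 oner_neq0.
have con d (F : {mpoly k[vcoords X]}) : F \is d.-homog -> mmap iota x F = 0 ->
    mmap j (fun l => r (z l)) F = 0.
  move=> hF F0; rewrite -(mz F).2.
  move/eqP: F0; rewrite (homog_aff _ hF xi) mulf_eq0 expf_eq0 (negPf xi) andbF /= => /eqP ->.
  by rewrite -(rmorph0 iota) rC rmorph0.
pose C := Point c0 con; have [a aC] := specialization C.
have zi1 : r (z i) = 1 by rewrite /z divff // -(rmorph1 iota) rC rmorph1.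
have Ci : C i != 0 by rewrite /= zi1 oner_neq0.
exists a => h /aC[t /(eval_affP Ci)[F [G [G0 -> _]]]].
have cm F' : mmap j (fun l => C l / C i) F' = r (mmap iota z F').
  by rewrite (mz F').2; apply: mmap_ext => l /=; rewrite zi1 divr1.
rewrite cm in G0; have [vF _] := mz F; have [vG _] := mz G.
rewrite -/z; have [->|F0] := eqVneq (mmap iota z F) 0; first by rewrite mul0r (nv0 nv).
have m0 : mmap iota z G != 0.
  by apply: contra_neq G0 => ->; rewrite -(rmorph0 iota) rC rmorph0.
apply: nvM_ge0 => //; rewrite leNgt; apply/negP => vneg.
have vG0 : 0 < v (mmap iota z G) by move: vneg; rewrite (nvV nv); lia.
by move: G0; rewrite r0 ?eqxx.
Qed.
End PrimeDiv.

(** * Rational maps and field homomorphisms *)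

Section DomBy.
Variable k : numClosedFieldType.
Implicit Types X Y Z : pvar k.
Let idk : {rmorphism k -> k} := idfun.

(* phi is the pullback of functions by the dominant rational map g *)
Definition dom_by X Y (g : ratmap X Y) (phi : {rmorphism vfield Y -> vfield X}) :=
  (forall c, phi (viota Y c) = viota X c) /\ same_point g (fun i => phi (@vgen k Y i)).

Lemma mmap_dom X Y (g : ratmap X Y) (phi : {rmorphism vfield Y -> vfield X}) n
    (z : 'I_n -> vfield Y) (F : {mpoly k[n]}) : dom_by g phi ->
  phi (mmap (viota Y) z F) = mmap (viota X) (fun i => phi (z i)) F.
Proof. by move=> [pc _]; apply: mmap_comp. Qed.

Lemma dom_homog X Y (g : ratmap X Y) (phi : {rmorphism vfield Y -> vfield X}) :
  dom_by g phi -> exists2 c, c != 0 & forall d (F : {mpoly k[vcoords Y]}), F \is d.-homog ->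
    mmap (viota X) g F = c ^+ d * phi (mmap (viota Y) (@vgen k Y) F).
Proof.
move=> gp; have [pc [c c0 gE]] := gp; exists c => // d F hF.
by rewrite (mmap_dom _ _ gp) -(mmap_scale _ _ _ hF); apply: mmap_ext.
Qed.

Lemma eval_dom X Y (g : ratmap X Y) (phi : {rmorphism vfield Y -> vfield X}) h :
  generates_field Y -> dom_by g phi -> eval_at g h (phi h).
Proof.
move=> gY gp; have [c c0 gE] := dom_homog gp; have [d [F [G [hF hG G0 ->]]]] := gY h.
have cd : c ^+ d != 0 by rewrite expf_neq0.
have pG : phi (mmap (viota Y) (vgen (p:=Y)) G) != 0 by rewrite fmorph_eq0.
exists d, F, G; rewrite !(gE d) // mulf_neq0 //; split=> //.
by rewrite fmorph_div -mulf_div divff // mul1r.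
Qed.

Lemma eval_domE X Y (g : ratmap X Y) (phi : {rmorphism vfield Y -> vfield X}) h t :
  generates_field Y -> dom_by g phi -> eval_at g h t -> t = phi h.
Proof. by move=> gY gp e; apply: (eval_uniq e); apply: eval_dom. Qed.

Lemma dom_by_ex X Y (g : ratmap X Y) : (forall h, regular_at g h) ->
  exists phi : {rmorphism vfield Y -> vfield X}, dom_by g phi.
Proof.
move=> /choice[f fP].
have fE h t : eval_at g h t -> f h = t by move=> e; apply: eval_uniq e.
have fz : zmod_morphism f.
  move=> x y; apply: fE.
  have eN : eval_at g (- y) (- f y).
    rewrite -mulN1r -[- f y]mulN1r; apply: eval_M => //.
    by have := eval_C g (-1); rewrite !rmorphN1.
  exact: eval_D.
have fm : monoid_morphism f.
  split; first by apply: fE; have := eval_C g 1; rewrite !rmorph1.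
  by move=> x y; apply: fE; apply: eval_M.
pose fA := GRing.isZmodMorphism.Build _ _ f fz.
pose fB := GRing.isMonoidMorphism.Build _ _ f fm.
pose phi : {rmorphism vfield Y -> vfield X} := HB.pack f fA fB.
exists phi; split=> [c|]; first by apply: fE; apply: eval_C.
have [i gi] := pt_neq0 g; have yi := pt_gen gi.
have pi : f (vgen i) != 0 by have : phi (vgen i) != 0 by rewrite fmorph_eq0.
exists (g i / f (vgen i)); first by rewrite mulf_neq0 ?invr_eq0.
move=> l; have e : f (vgen l / vgen i) = g l / g i by apply: fE; apply: eval_coord.
have : phi (vgen l / vgen i) = phi (vgen l) / phi (vgen i) by rewrite fmorph_div.
rewrite /= e => e2.
have -> : g l = g l / g i * g i by field.
by rewrite e2; field.
Qed.

Lemma dom_by_inj X Y (g : ratmap X Y) (phi psi : {rmorphism vfield Y -> vfield X}) :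
  generates_field Y -> dom_by g phi -> dom_by g psi -> phi =1 psi.
Proof.
by move=> gY gp gq h; apply: (eval_domE gY gq); apply: eval_dom.
Qed.

Definition dominates X Y (phi : vfield Y -> vfield X) (b : cpoint Y) (a : cpoint X) :=
  forall h, lr_at b h -> lr_at a (phi h) /\ lr_ev (lr_at a) (phi h) = lr_ev (lr_at b) h.

(** From here on images of closed points are handled through domination of local rings. *)
Lemma maps_to_dominates X Y (g : ratmap X Y) (phi : {rmorphism vfield Y -> vfield X}) a b :
  dom_by g phi -> maps_to g a b <-> dominates phi b a.
Proof.
move=> gp; split=> [[c [e [e0 ce]]] h [t [d [F [G [hF hG G0 hE tE]]]]]|db].
  have [c1 c10 gE] := dom_homog gp.
  have c0 : c != 0.
    have [l bl] := pt_neq0 b; apply: contraTneq isT => c0; have := ce l.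
    rewrite c0 mul0r => /lr_at_evalP[_].
    by rewrite lr_ev0 => /esym/eqP; rewrite mulf_eq0 (negPf e0) (negPf bl).
  have cP F' : lr_at a (mmap (viota X) (fun i => c * g i) F') /\
     lr_ev (lr_at a) (mmap (viota X) (fun i => c * g i) F') = mmap idfun (fun i => e * b i) F'.
    have Ocg i : lr_at a (c * g i) by have /lr_at_evalP[] := ce i.
    have [h1 h2] := lr_mmap F' Ocg; split=> //; rewrite h2; apply: mmap_ext => i.
    by have /lr_at_evalP[] := ce i.
  have [OF eF] := cP F; have [OG eG] := cP G.
  rewrite [RHS](mmap_scale _ _ _ hF) in eF; rewrite [RHS](mmap_scale _ _ _ hG) in eG.
  have eG0 : lr_ev (lr_at a) (mmap (viota X) (fun i => c * g i) G) != 0.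
    by rewrite eG mulf_neq0 ?expf_neq0.
  have pE : phi h = mmap (viota X) (fun i => c * g i) F / mmap (viota X) (fun i => c * g i) G.
    rewrite hE fmorph_div !(mmap_scale _ _ _ hF) !(mmap_scale _ _ _ hG).
    rewrite (gE d) // (gE d) // !mulrA -!exprMn -mulf_div divff ?mul1r //.
    by rewrite expf_neq0 // mulf_neq0.
  rewrite pE; split; first exact: lr_div.
  rewrite lr_evdiv // eF eG; have -> : lr_ev (lr_at b) h = t.
    by apply: pt_evE; exists d, F, G.
  by rewrite tE -mulf_div divff ?expf_neq0 // mul1r.
have [pc [c c0 gE]] := gp; have [i bi] := pt_neq0 b.
have yi : vgen i != 0 := pt_gen (j := idk) (y := b) bi.
have gi : g i != 0 by rewrite gE mulf_neq0 ?fmorph_eq0.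
exists (g i)^-1, (b i)^-1; rewrite invr_eq0; split=> // l.
have [Oz _] := lr_at_gen bi; have [h1 h2] := db _ (Oz l).
have -> : (g i)^-1 * g l = phi (vgen l / vgen i).
  rewrite !gE fmorph_div; have : phi (vgen i) != 0 by rewrite fmorph_eq0.
  by move=> p0; field; rewrite c0 p0.
apply/lr_at_evalP; split=> //; rewrite h2 [RHS]mulrC.
apply: pt_evE; exact: (@eval_coord k Y k idk b i bi l).
Qed.

Lemma comp_dom X Y Z (g : ratmap Y Z) (f : ratmap X Y) (h : ratmap X Z)
    (pf : {rmorphism vfield Y -> vfield X}) (pg : {rmorphism vfield Z -> vfield Y}) :
  generates_field Y -> dom_by f pf -> dom_by g pg ->
  is_comp g f h <-> dom_by h (pf \o pg).
Proof.
move=> gY fP gP; have [fc _] := fP; have [gc [c2 c20 gE]] := gP; split=> [[c [e [e0 ce]]]|[hc [c1 c10 hE]]].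
  have c0 : c != 0.
    have [l hl] := pt_neq0 h; apply: contraTneq isT => c0; have := ce l.
    rewrite c0 mul0r => /(eval_domE gY fP); rewrite rmorph0 => /eqP.
    by rewrite mulf_eq0 (negPf e0) (negPf hl).
  split=> [a|]; first by rewrite /= gc fc.
  exists (pf (c * c2) / e) => [|i]; first by rewrite mulf_neq0 ?invr_eq0 // fmorph_eq0 mulf_neq0.
  have := eval_domE gY fP (ce i); rewrite gE /= mulrA rmorphM => he.
  by apply: (mulfI e0); rewrite he; field.
exists (c2^-1), c1^-1; rewrite invr_eq0; split=> // i.
have -> : c1^-1 * h i = pf (c2^-1 * g i) by rewrite hE gE /= !mulKf.
exact: eval_dom.
Qed.

Lemma is_id_dom X (h : ratmap X X) : is_id h <-> dom_by h idfun.
Proof. by split=> [hi|[_ hi]]; [split|exact: hi]. Qed.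

(** A denominator vanishing along g would vanish along the composite g o f, which is the identity;
    thus a map with a right inverse is dominant. *)
Lemma comp_id_regular X Y (g : ratmap X Y) (f : ratmap Y X) (h : ratmap Y Y) :
  generates_field Y -> is_id h -> is_comp g f h -> forall u, regular_at g u.
Proof.
move=> gY [c1 c10 hE] [c [e [e0 ce]]] u; have [d [F [G [hF hG G0 uE]]]] := gY u.
exists (mmap (viota X) g F / mmap (viota X) g G), d, F, G; split=> //.
apply: contra_neq G0 => g0.
have ev P : eval_at f (mmap (viota X) (fun i => c * g i) P) (mmap (viota Y) (fun i => e * h i) P).
  elim/mpoly_ring_ind: P => [a|i|P Q eP eQ|P Q eP eQ].
  - by rewrite !mmapC; apply: eval_C.
  - by rewrite !mmapX !mmap1U.
  - by rewrite !mmapD; apply: eval_D.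
  - by rewrite !rmorphM; apply: eval_M.
have e1 := ev G; rewrite !(mmap_scale _ _ _ hG) g0 mulr0 in e1.
have z0 : eval_at f 0 0 by have := eval_C f 0; rewrite !rmorph0.
have /esym/eqP := eval_uniq z0 e1; rewrite mulf_eq0 expf_eq0 (negPf e0) andbF /=.
rewrite (mmap_ext _ _ hE) (mmap_scale _ _ _ hG) mulf_eq0 expf_eq0 (negPf c10) andbF /=.
by move/eqP.
Qed.

Lemma inverse_maps_dom X Y (g : ratmap X Y) (g' : ratmap Y X) :
  generates_field X -> generates_field Y -> inverse_maps g g' ->
  exists (phi : {rmorphism vfield Y -> vfield X}) (psi : {rmorphism vfield X -> vfield Y}),
  [/\ dom_by g phi, dom_by g' psi, cancel phi psi & cancel psi phi].
Proof.
move=> gX gY [[h hi hc] [h' hi' hc']].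
have [phi gp] := dom_by_ex (comp_id_regular gY hi' hc').
have [psi gq] := dom_by_ex (comp_id_regular gX hi hc).
exists phi, psi; split=> // u.
  have hd := (comp_dom h' gX gq gp).1 hc'.
  by have := dom_by_inj gY hd ((is_id_dom _).1 hi') u.
have hd := (comp_dom h gY gp gq).1 hc.
by have := dom_by_inj gX hd ((is_id_dom _).1 hi) u.
Qed.

Lemma dom_inverse_maps X Y (g : ratmap X Y) (g' : ratmap Y X) phi psi :
  generates_field X -> generates_field Y -> dom_by g phi -> dom_by g' psi ->
  cancel phi psi -> cancel psi phi -> vgen_neq0 X -> vgen_neq0 Y -> inverse_maps g g'.
Proof.
move=> gX gY gp gq c1 c2 nX nY.
have idd Z (nZ : vgen_neq0 Z) : exists2 h : ratmap Z Z, is_id h & forall f : {rmorphism vfield Z -> vfield Z},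
    f =1 id -> dom_by h f.
  pose h := @Point k Z (vfield Z) (viota Z) (@vgen k Z) nZ (fun d F _ F0 => F0).
  exists h; first by exists 1; rewrite ?oner_neq0 // => i; rewrite mul1r.
  move=> f f1; split=> [c|]; first by rewrite f1.
  by exists 1; rewrite ?oner_neq0 // => i; rewrite f1 mul1r.
split.
  by have [h hi hd] := idd X nX; exists h => //; apply/(comp_dom h gY gp gq)/hd => u /=; exact: c2.
by have [h hi hd] := idd Y nY; exists h => //; apply/(comp_dom h gX gq gp)/hd => u /=; exact: c1.
Qed.

Lemma dom_point X Y (phi : {rmorphism vfield Y -> vfield X}) : vgen_neq0 Y ->
  (forall c, phi (viota Y c) = viota X c) -> exists g : ratmap X Y, dom_by g phi.
Proof.
move=> nY pc.
have n0 : exists i, phi (@vgen k Y i) != 0 by case: nY => i yi; exists i; rewrite fmorph_eq0.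
have on d (F : {mpoly k[vcoords Y]}) : F \is d.-homog -> mmap (viota Y) (@vgen k Y) F = 0 ->
    mmap (viota X) (fun i => phi (@vgen k Y i)) F = 0.
  by move=> _ F0; rewrite -(mmap_comp (j := viota Y)) // F0 rmorph0.
exists (Point n0 on); split=> //; exists 1; rewrite ?oner_neq0 // => i.
by rewrite mul1r.
Qed.
End DomBy.

(** * Quasi-compactness *)

(* list membership over types without decidable equality *)
Fixpoint lin (T : Type) (x : T) (s : seq T) : Prop :=
  if s is y :: s' then y = x \/ lin x s' else False.

Lemma lin_cat T (x : T) s t : lin x (s ++ t) <-> lin x s \/ lin x t.
Proof.
elim: s => [|y s IH] /=; first by split; [right|case].
by rewrite IH; tauto.
Qed.

Lemma linP (T : eqType) (x : T) s : lin x s <-> x \in s.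
Proof.
elim: s => //= y s IH; rewrite inE IH; split=> [[->|->]|/predU1P[->|->]]; rewrite ?eqxx ?orbT //; by [left|right].
Qed.

Lemma finite_lin T (A : set T) : finite_set A <-> exists l, forall x, A x -> lin x l.
Proof.
elim/Pchoice: T => T in A *; split=> [/finite_seqP[s ->]|[l Al]].
  by exists s => x /linP.
apply: (@sub_finite_set _ A [set` l]%classic); last by apply/finite_seqP; exists l.
by move=> x /Al/linP.
Qed.

Section Near.
Variables (k : numClosedFieldType) (X : pvar k).
Let idk : {rmorphism k -> k} := idfun.
Local Notation x := (@vgen k X).

(** Zariski neighbourhoods: Q holds on the principal open set where G is nonzero. *)
Definition near (a : cpoint X) (Q : cpoint X -> Prop) :=
  exists d (G : {mpoly k[vcoords X]}), [/\ G \is d.-homog, mmap idfun a G != 0 &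
    forall b : cpoint X, mmap idfun b G != 0 -> Q b].

Lemma near_mono a (Q Q' : cpoint X -> Prop) : (forall b, Q b -> Q' b) -> near a Q -> near a Q'.
Proof. by move=> QQ [d [G [hG Ga GQ]]]; exists d, G; split=> // b /GQ/QQ. Qed.

Lemma near_and a Q Q' : near a Q -> near a Q' -> near a (fun b => Q b /\ Q' b).
Proof.
move=> [d [G [hG Ga GQ]]] [d' [G' [hG' Ga' GQ']]]; exists (d + d')%N, (G * G').
split=> [||b]; rewrite ?(rmorphM (mmap idk _)) /=; [exact: dhomogM|by rewrite mulf_neq0|].
by rewrite mulf_eq0 negb_or => /andP[/GQ ? /GQ'].
Qed.

Lemma near_true a (Q : cpoint X -> Prop) : (forall b, Q b) -> near a Q.
Proof.
move=> h; exists 0%N, 1; split=> //; first exact: dhomog1.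
by rewrite (rmorph1 (mmap (idk) _)) oner_neq0.
Qed.

Lemma near_seq a (T : eqType) (s : seq T) (Q : T -> cpoint X -> Prop) :
  {in s, forall t, near a (Q t)} -> near a (fun b => {in s, forall t, Q t b}).
Proof.
elim: s => [|t s IH] h; first exact: near_true.
have h1 : near a (Q t) by apply: h; rewrite inE eqxx.
have h2 : near a (fun b => {in s, forall t, Q t b}).
  by apply: IH => u us; apply: h; rewrite inE us orbT.
apply: near_mono (near_and h1 h2) => b [Qt Qs] u.
by rewrite inE => /predU1P[->//|/Qs].
Qed.

Lemma near_list a (T : Type) (s : seq T) (Q : T -> cpoint X -> Prop) :
  (forall t, lin t s -> near a (Q t)) -> near a (fun b => forall t, lin t s -> Q t b).
Proof.
elim: s => [|t s IH] h; first exact: near_true.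
have h1 : near a (Q t) by apply: h; left.
have h2 : near a (fun b => forall t, lin t s -> Q t b).
  by apply: IH => u us; apply: h; right.
by apply: near_mono (near_and h1 h2) => b [Qt Qs] u [<-//|/Qs].
Qed.

Lemma near_ord a n (Q : 'I_n -> cpoint X -> Prop) :
  (forall i, near a (Q i)) -> near a (fun b => forall i, Q i b).
Proof.
move=> h; have h1 : {in enum 'I_n, forall i, near a (Q i)} by move=> i _.
by apply: near_mono (near_seq h1) => b hb i; apply: hb; rewrite mem_enum.
Qed.

Lemma near_coord (a : cpoint X) i : a i != 0 -> near a (fun b => b i != 0).
Proof.
move=> ai; exists 1%N, 'X_i; split=> [||b]; rewrite ?(mmapX _ idk) ?mmap1U //.
by rewrite dhomogX; apply/eqP; exact: mdeg1.
Qed.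

(* quasi-compactness of the set of closed points *)
Lemma near_cover (Q : cpoint X -> cpoint X -> Prop) : (forall a, near a (Q a)) ->
  exists l : seq (cpoint X), forall b, exists2 a, lin a l & Q a b.
Proof.
move=> nQ; have /choice[G GQ] : forall a : cpoint X, exists G : {mpoly k[vcoords X]},
    mmap idfun a G != 0 /\ forall b : cpoint X, mmap idfun b G != 0 -> Q a b.
  by move=> a; have [d [G [_ Ga GQ]]] := nQ a; exists G.
pose J b F := mmap (idfun : k -> k) (b : cpoint X) F = 0.
have Jid b : ideal (J b).
  split=> [|F F'|F F']; rewrite /J ?(rmorph0 (mmap idk _)) // ?(rmorphD (mmap idk _)) ?(rmorphM (mmap idk _)) /=.
    by move=> -> ->; rewrite addr0.
  by move=> ->; rewrite mulr0.
pose I F := forall K, ideal K -> (forall a, K (G a)) -> K F.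
pose Fin F := exists l : seq (cpoint X), forall b : cpoint X, mmap idfun b F != 0 ->
  exists2 a, lin a l & Q a b.
have Iid : ideal I.
  split=> [K [K0 _ _] _//|F F' IF IF' K Kid KG|F F' IF K Kid KG].
    by have [_ KD _] := Kid; apply: KD; [exact: IF|exact: IF'].
  by have [_ _ KM] := Kid; apply: KM; exact: IF.
have Fid : ideal Fin.
  split=> [|F F' [l lP] [l' lP']|F F' [l lP]].
  - by exists [::] => b; rewrite (rmorph0 (mmap idk _)) eqxx.
  - exists (l ++ l') => b; rewrite (rmorphD (mmap idk _)) /= => FF.
    have [F0|/lP[a al ab]] := eqVneq (mmap (idfun : k -> k) b F) 0; last first.
      by exists a => //; apply/lin_cat; left.
    have [|a al ab] := lP' b; first by apply: contra_neq FF => F'0; rewrite -/idk F0 F'0 addr0.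
    by exists a => //; apply/lin_cat; right.
  - exists l => b; rewrite (rmorphM (mmap idk _)) mulf_eq0 negb_or => /andP[_].
    exact: lP.
have FinG a : Fin (G a).
  by exists [:: a] => b Gb; exists a; [left|exact: (GQ a).2].
have [s [sI sJ]] := mpoly_noetherian Iid.
have [l lP] : exists l : seq (cpoint X), forall F, F \in s -> forall b : cpoint X,
    mmap idfun b F != 0 -> exists2 a, lin a l & Q a b.
  have : {in s, forall F, Fin F} by move=> F /sI IF; apply: IF.
  elim: s {sI sJ} => [|F s IH] h; first by exists [::].
  have [|l lP] := IH; first by move=> F' F's; apply: h; rewrite inE F's orbT.
  have [|l' lP'] := h F; first by rewrite inE eqxx.
  exists (l' ++ l) => F'; rewrite inE => /predU1P[->|F's] b Fb.
    by have [a al ab] := lP' b Fb; exists a => //; apply/lin_cat; left.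
  by have [a al ab] := lP _ F's b Fb; exists a => //; apply/lin_cat; right.
exists l => b; apply: contrapT => nb.
have /eqP[] := (GQ b).1; apply: (sJ (J b) (Jid b)); last by move=> K Kid KG.
by move=> F Fs; apply: contrapT => /eqP Fb; apply: nb; apply: lP Fs b Fb.
Qed.

Lemma near_regular a h : lr_at a h -> near a (fun b => lr_at b h).
Proof.
move=> [t [d [F [G [hF hG G0 hE _]]]]]; exists d, G; split=> // b Gb.
by exists (mmap idfun b F / mmap idfun b G), d, F, G.
Qed.

Lemma near_unit a h : lunit (lr_at a) h -> near a (fun b => lunit (lr_at b) h).
Proof.
move=> [Oh eh]; have := near_and (near_regular Oh) (near_regular (lr_V Oh eh)).
apply: near_mono => b [Ob Ob']; split=> //.
have h0 := lr_neq0 eh.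
apply: contraTneq isT => e0; have := lr_ev1 (lr_at b).
by rewrite -(divff h0) lr_evM // e0 mul0r => /eqP; rewrite eq_sym oner_eq0.
Qed.
End Near.

Section GenHartogs.
Variables (k : numFieldType) (L : fieldType) (iota : {rmorphism k -> L}).
Variable O : lring iota.
Hypothesis rO : regular2 O.

(** For nu such as v o phi, whose center may be a closed point, only the primes with nu p > 0 have
    to be controlled: a prime factor p of the denominator with nu p = 0 disappears when r is
    multiplied by p, without changing nu r. *)
Lemma hartogs_gen (nu : L -> int) r : 
  (forall g h, g != 0 -> h != 0 -> nu (g * h) = nu g + nu h) ->
  nu 0 = 0 -> (forall h, O h -> 0 <= nu h) -> r != 0 ->
  (forall p v, lprime O p -> isdiv O v -> 0 < v p -> 0 < nu p -> 0 <= v r) -> 0 <= nu r.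
Proof.
move=> nuM nu0 nuO r0 vr; have [F [G [OF OG G0 hE]]] := r2_frac rO r.
have F0 : F != 0 by apply: contra_neq r0 => F0; rewrite hE F0 mul0r.
have [e [s [ue ps GE]]] := factorization rO OG G0.
have e0 := lr_neq0 ue.2; have [Oe ee] := ue.
have nu1 : nu 1 = 0.
  have h := nuM 1 1 (oner_neq0 L) (oner_neq0 L); rewrite mulr1 in h.
  by apply: (addrI (nu 1)); rewrite addr0; exact: esym.
have nuU u : lunit O u -> nu u = 0.
  move=> [Ou eu]; have u0 := lr_neq0 eu.
  have := nuM u u^-1 u0; rewrite invr_eq0 divff // nu1 => /(_ u0).
  have := nuO _ Ou; have := nuO _ (lr_V Ou eu); lia.
elim: s r r0 vr F G OF F0 {OG G0} hE GE ps => [|p s IH] r r0 vr F G OF F0 hE GE ps.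
  move: GE; rewrite big_nil mulr1 => GE; rewrite hE GE; apply: nuO.
  exact: lr_div.
have pp : lprime O p by apply: ps; rewrite inE eqxx.
have [Op p0 ep _] := pp.
have ps' : {in s, forall p, lprime O p} by move=> q qs; apply: ps; rewrite inE qs orbT.
have s0 : \prod_(q <- s) q != 0.
  by rewrite prodf_seq_neq0; apply/allP => q /ps'[].
have Os : O (\prod_(q <- s) q).
  rewrite big_seq; apply: (big_ind (lr_car O)); [exact: lr_1|exact: lr_M|].
  by move=> q /ps'[].
have := nuO _ Op; rewrite le_eqVlt => /predU1P[/esym nup|nup].
  have rpE : r * p = F / (e * \prod_(q <- s) q).
    by rewrite hE GE big_cons; field; rewrite s0 e0.
  have rp0 : r * p != 0 by rewrite mulf_neq0.
  have := IH (r * p) rp0 _ F _ OF F0 rpE erefl ps'.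
  rewrite nuM // nup addr0; apply=> q v qp dv vq nuq.
  by rewrite (nvM dv) //; have := vr q v qp dv vq nuq; have := id_ge0 dv Op; lia.
have [v [dv vp]] := padic_ex pp (r2_noeth rO) (r2_frac rO).
have [c Oc FE] : ldvd O p F.
  apply: (isdiv_pos dv pp vp OF); have := vr p v pp dv vp nup.
  rewrite hE GE big_cons (nvdiv dv) ?mulf_neq0 // (nvM dv) ?mulf_neq0 // (nvM dv) //.
  by have := id_ge0 dv Os; rewrite (isdiv_unit dv ue); lia.
have c0 : c != 0 by apply: contra_neq F0 => c0; rewrite FE c0 mul0r.
apply: (IH r r0 vr c (e * \prod_(q <- s) q)) => //.
rewrite hE GE FE big_cons; field.
by rewrite s0 e0.
Qed.
End GenHartogs.

(** * Local equations *)

Lemma cross_mul (L : fieldType) (P Q a1 a2 b1 b2 : L) : Q != 0 -> a2 != 0 -> b1 != 0 ->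
  b2 != 0 -> P / Q = a1 / a2 / (b1 / b2) -> Q * (a1 * b2) = P * (b1 * a2).
Proof.
move=> Q0 a0 b0 c0 e; have -> : P = a1 / a2 / (b1 / b2) * Q by rewrite -e divfK.
by field; rewrite a0 b0 c0.
Qed.

Lemma ge0_opp_eq0 (a : int) : 0 <= a -> 0 <= - a -> a = 0.
Proof. lia. Qed.

Lemma ge0_gt0_sum (a b : int) : 0 = a + b -> 0 <= a -> 0 < b -> False.
Proof. lia. Qed.

Section SurfaceDivisors.
Variables (k : numClosedFieldType) (X : surface k).
Local Notation plin v l := (@lin (primediv X) v l).
Hypothesis nz : two_ders (viota X).
Let idk : {rmorphism k -> k} := idfun.
Local Notation x := (@vgen k X).
Local Notation iota := (viota X).
Let rX (a : cpoint X) : regular2 (lr_at a) := surface_regular2 a nz.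

Lemma pass_isdivP (v : primediv X) (a : cpoint X) : passes_through v a <-> isdiv (lr_at a) v.
Proof. by split=> [/pass_isdiv|dv h Oh] //; apply: (id_ge0 dv). Qed.

(** The chart functions divisible by p at a are generated by finitely many, which remain multiples
    of p at nearby points b. A curve v through b with v p > 0 is thus positive on all of them; this
    forces v through a, where p determines it. *)
Lemma near_prime a p : lprime (lr_at a) p -> exists w : primediv X,
  [/\ passes_through w a, 0 < w p &
   near a (fun b => forall v : primediv X, passes_through v b -> 0 < v p -> v = w)].
Proof.
move=> pp; have [Op p0 ep prp] := pp.
have [w0 [dw0 w0p]] := padic_ex pp (r2_noeth (rX a)) (r2_frac (rX a)).
have [w wE] := isdiv_primediv dw0.
have dw : isdiv (lr_at a) w by rewrite (_ : (w : _ -> _) = w0) //; apply/funext.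
have wp : 0 < w p by rewrite wE.
exists w; split=> //; first exact/pass_isdivP.
have [i ai] := pt_neq0 a; have [Oz zg] := lr_at_gen ai.
pose z l := x l / x i; pose m := mmap iota z.
have Om F : lr_at a (m F) := (lr_mmap F Oz).1.
have [|s [sI sJ]] := mpoly_noetherian (k := k) (n := vcoords X) (I := fun F => ldvd (lr_at a) p (m F)).
  split=> [|F G dF dG|F G dG]; rewrite /m ?rmorph0 ?rmorphD ?rmorphM /=; [exact: ldvd0|exact: ldvdD|].
  by apply: ldvdM => //; exact: Om.
have n1 := near_coord ai.
have n2 := near_regular Op.
have n3 : near a (fun b => {in s, forall F, exists r, lr_at b r /\ m F = r * p}).
  apply: near_seq => F /sI[r Or mF].
  by apply: near_mono (near_regular Or) => b Ob; exists r.
apply: near_mono (near_and n1 (near_and n2 n3)) => b [bi [Obp sb]] v vb vp.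
have dv := pass_isdiv vb; have [Obz bzg] := lr_at_gen bi.
have Obm F : lr_at b (m F) := (lr_mmap F Obz).1.
have pv F : ldvd (lr_at a) p (m F) -> vpos v (m F).
  apply: (sJ (fun F => vpos v (m F))).
    split=> [|F1 F2 h1 h2|F1 F2 h2]; rewrite /m ?rmorph0 ?rmorphD ?rmorphM /=; [by left|exact: (vposD dv)|].
    by apply: (vposM dv) => //; apply: (id_ge0 dv (Obm F1)).
  move=> F1 /sb[r [Or ->]]; apply: (vposM dv); first exact: (id_ge0 dv).
  by right.
suff va : passes_through v a.
  by apply: primediv_ext; apply: (isdiv_eq (rX a) (pass_isdiv va) dw pp vp wp).
move=> r Or; have [F [G [eG ->]]] := zg _ Or; rewrite -/z -/(m F) -/(m G).
have G0 : m G != 0 := lr_neq0 eG.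
have vF := id_ge0 dv (Obm F); apply: (nvM_ge0 dv) => //; rewrite (nvV dv).
suff vG0 : v (m G) = 0 by rewrite vG0.
have := id_ge0 dv (Obm G); rewrite le_eqVlt => /predU1P[//|vG]; exfalso.
(* Now q is a unit at a with v q > 0. The fraction p^e / q^n has value 0, so it is a quotient of
   chart functions of value 0. In q^n A1 B2 = p^e B1 A2 the prime p must divide A1 B2, where v is
   then positive: a contradiction. *)
set q := m G in G0 vG *; have [n nE] : exists n, n = `|v p|%N by exists `|v p|%N.
have [e eE] : exists e, e = `|v q|%N by exists `|v q|%N.
have vr : v (p ^+ e / q ^+ n) = 0.
  by rewrite (nvdiv dv) ?expf_neq0 // !(nvX dv) nE eE; lia.
have [|A [B [OA OB B0 vB AB]]] := @id_loc _ _ _ _ _ dv (p ^+ e / q ^+ n); first by rewrite vr.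
have [A1 [A2 [eA2 AE]]] := bzg _ OA; have [B1 [B2 [eB2 BE]]] := bzg _ OB.
rewrite -/z -/m in AE eA2 BE eB2.
have vA2 : v (m A2) = 0 by apply: (isdiv_unit dv).
have vB2 : v (m B2) = 0 by apply: (isdiv_unit dv).
have A20 := lr_neq0 eA2; have B20 := lr_neq0 eB2.
rewrite -/(m A1) -/(m A2) in AE; rewrite -/(m B1) -/(m B2) in BE.
have pq0 : p ^+ e / q ^+ n != 0 by rewrite mulf_neq0 ?invr_eq0 ?expf_neq0.
have A0 : A != 0 by apply: contra_neq pq0 => A0; rewrite AB A0 mul0r.
have vA : v A = 0 by have := nvdiv dv A0 B0; rewrite -AB vr vB subr0 => <-.
have A10 : m A1 != 0 by apply: contra_neq A0 => h; rewrite AE h mul0r.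
have B10 : m B1 != 0 by apply: contra_neq B0 => h; rewrite BE h mul0r.
have vA1 : v (m A1) = 0 by move: vA; rewrite AE (nvdiv dv) // vA2 subr0.
have key : q ^+ n * m (A1 * B2) = p ^+ e * m (B1 * A2).
  rewrite /m !rmorphM /= -/(m A1) -/(m B2) -/(m B1) -/(m A2).
  by apply: cross_mul; rewrite ?expf_neq0 // -AE -BE.
have d1 : ldvd (lr_at a) p (q ^+ n * m (A1 * B2)).
  have e0 : (0 < e)%N by rewrite eE absz_gt0 gt_eqF.
  rewrite key; case: (e) e0 => // e' _.
  exists (p ^+ e' * m (B1 * A2)); last by rewrite exprSr mulrAC.
  by apply: lr_M => //; apply: lr_X.
have nq : ~ ldvd (lr_at a) p q by apply: (prime_nunit pp); split; [exact: Om|exact: eG].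
have d2 : ldvd (lr_at a) p (m (A1 * B2)).
  elim: (n) d1 => [|n' IH]; first by rewrite expr0 mul1r.
  rewrite exprS -mulrA => /prp[||/nq//|//]; first exact: Om.
  by apply: lr_M => //; apply: lr_X; exact: Om.
have [] := pv _ d2; rewrite /m rmorphM /= -/(m A1) -/(m B2).
  by move/eqP; rewrite mulf_eq0 (negPf A10) (negPf B20).
by rewrite (nvM dv) // vA1 vB2.
Qed.

Lemma prime_of (v : primediv X) (a : cpoint X) : passes_through v a ->
  exists p, [/\ lprime (lr_at a) p, v p = 1 &
    forall w : primediv X, passes_through w a -> 0 < w p -> w = v].
Proof.
move=> va; have dv := pass_isdiv va; have [p [pp vp]] := isdiv_prime (rX a) dv.
exists p; split=> //; first exact: (isdiv_prime1 (rX a) dv pp vp).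
move=> w wa wp; apply: primediv_ext.
exact: (isdiv_eq (rX a) (pass_isdiv wa) dv pp wp vp).
Qed.

(** Near each closed point, h is built from units and finitely many primes, each accounting for one
    curve; quasi-compactness leaves finitely many neighbourhoods. *)
Lemma finite_support h : h != 0 -> exists l : seq (primediv X), forall v : primediv X, v h != 0 -> plin v l.
Proof.
move=> h0.
have loc (a : cpoint X) : exists l : seq (primediv X), near a (fun b => forall v : primediv X,
    passes_through v b -> v h != 0 -> plin v l).
  pose Q h := exists l : seq (primediv X), near a (fun b => forall v : primediv X,
    passes_through v b -> v h != 0 -> plin v l).
  have QU e : lunit (lr_at a) e -> Q e.
    move=> /near_unit ne; exists [::]; apply: near_mono ne => b ub v /pass_isdiv dv.
    by rewrite (isdiv_unit dv ub) eqxx.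
  have QP p : lprime (lr_at a) p -> Q p.
    move=> pp; have [w [wa wp nw]] := near_prime pp; have [Op _ _ _] := pp.
    exists [:: w]; apply: near_mono (near_and nw (near_regular Op)) => b [nb Ob] v vb vp.
    left; apply/esym/nb => //; have := vb _ Ob; rewrite le_eqVlt => /predU1P[e|//].
    by rewrite -e eqxx in vp.
  have QM f g : f != 0 -> g != 0 -> Q f -> Q g -> Q (f * g).
    move=> f0 g0 [l nl] [l' nl']; exists (l ++ l').
    apply: near_mono (near_and nl nl') => b [nb nb'] v vb vfg; apply/lin_cat.
    have [e|] := eqVneq (v f) 0; last by move=> /(nb v vb); left.
    right; apply: (nb' v vb); apply: contra_neq vfg => e'.
    by rewrite (nvM (primediv_nval v)) // e e'.
  have QV f : Q f -> Q f^-1.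
    move=> [l nl]; exists l; apply: near_mono nl => b nb v vb.
    by rewrite (nvV (primediv_nval v)) oppr_eq0; apply: nb.
  have QO f : lr_at a f -> f != 0 -> Q f.
    move=> Of f0; have [e [s [ue ps fE]]] := factorization (rX a) Of f0.
    have e0 := lr_neq0 ue.2.
    have [s0 Qs] : \prod_(p <- s) p != 0 /\ Q (\prod_(p <- s) p).
      elim: s ps {fE} => [|p s IH] ps.
        rewrite big_nil oner_neq0; split=> //; apply: QU; split; first exact: lr_1.
        by rewrite lr_ev1 oner_neq0.
      have pp : lprime (lr_at a) p by apply: ps; rewrite inE eqxx.
      have [|s0 Qs] := IH; first by move=> q qs; apply: ps; rewrite inE qs orbT.
      have [_ p0 _ _] := pp; rewrite big_cons mulf_neq0 //; split=> //.
      by apply: QM => //; apply: QP.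
    by rewrite fE; apply: QM => //; apply: QU.
  have [F [G [OF OG G0 hE]]] := r2_frac (rX a) h; rewrite -/(Q h) hE.
  have F0 : F != 0 by apply: contra_neq h0 => F0; rewrite hE F0 mul0r.
  by apply: QM; rewrite ?invr_eq0 //; [apply: QO|apply/QV/QO].
have /choice[f fP] := loc.
have [l lP] := near_cover fP.
exists (flatten (map f l)) => v vh; have [b vb] := primediv_point v.
have [a al ab] := lP b; have := ab v vb vh.
elim: l al {lP} => //= c l IH; rewrite lin_cat => -[->|al] hh; [by left|right; exact: IH].
Qed.

Lemma local_equation_ex (D : divisor X) (a : cpoint X) : exists h, local_equation D a h.
Proof.
have [l lP] := (finite_lin _).1 (mult_finite D).
have [h [h0 hl]] : exists h, h != 0 /\ forall v : primediv X, passes_through v a ->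
    (plin v l -> v h = D v) /\ (~ plin v l -> v h = 0).
  elim: l {lP} => [|w l [h [h0 hl]]].
    by exists 1; rewrite oner_neq0; split=> // v va; rewrite (nv1 (primediv_nval v)).
  have [wl|wl] := pselect (plin w l).
    exists h; split=> // v va; have [h1 h2] := hl v va.
    split=> /= [[e|vl]|nv].
    - by apply: h1; rewrite -e.
    - exact: h1.
    - by apply: h2 => vl; apply: nv; right.
  have [wa|wa] := pselect (passes_through w a); last first.
    exists h; split=> // v va; have [h1 h2] := hl v va; split=> /= [[e|vl]|nv].
    - by case: wa; rewrite e.
    - exact: h1.
    - by apply: h2 => vl; apply: nv; right.
  have [p [pp wp pu]] := prime_of wa; have [Op p0 _ _] := pp.
  have p0' : p ^ D w != 0 by rewrite expfz_neq0.
  exists (h * p ^ D w); rewrite mulf_neq0 //; split=> // v va.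
  have nv := primediv_nval v; have [h1 h2] := hl v va.
  have vpow : v (p ^ D w) = D w * v p.
    case: (D w) => n; first by rewrite -exprnP (nvX nv) -mulr_natl natz.
    by rewrite NegzE -exprnN (nvV nv) (nvX nv) mulNr -mulr_natl natz.
  rewrite (nvM nv) // vpow.
  have [e|vw] := pselect (v = w).
    rewrite e wp mulr1 (hl w wa).2 // add0r; split=> // nl; case: nl; by left.
  have vp0 : v p = 0.
    have := va _ Op; rewrite le_eqVlt => /predU1P[//|vp]; case: vw.
    exact: pu.
  rewrite vp0 mulr0 addr0; split=> /= [[e|vl]|nvl]; [by case: vw|exact: h1|].
  by apply: h2 => vl; apply: nvl; right.
exists h; split=> // v va; have [h1 h2] := hl v va.
have [vl|vl] := pselect (plin v l); first by rewrite h1.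
by rewrite h2 //; apply: contrapT => Dv; apply/vl/lP.
Qed.

(** Only the finitely many curves of D and of the divisor of h matter. One that misses a is avoided
    on the neighbourhood where some function of negative value along it stays regular. *)
Lemma near_local_equation (D : divisor X) (a : cpoint X) h : local_equation D a h ->
  near a (fun b => local_equation D b h).
Proof.
move=> [h0 ha]; have [l lP] := (finite_lin _).1 (mult_finite D).
have [l' lP'] := finite_support h0.
have : near a (fun b => forall v, plin v (l ++ l') -> passes_through v b -> D v = v h).
  apply: near_list => v _; have [va|va] := pselect (passes_through v a).
    by apply: near_true => b _; apply: ha.
  have [r [Or vr]] : exists r, lr_at a r /\ ~ (0 <= v r).
    by apply: contrapT => nr; apply: va => r Or; apply: contrapT => vr; apply: nr; exists r.
  by apply: near_mono (near_regular Or) => b Ob /(_ _ Ob).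
apply: near_mono => b hb; split=> // v vb.
have [vl|vl] := pselect (plin v (l ++ l')); first exact: hb.
have -> : D v = 0 by apply: contrapT => Dv; apply: vl; apply/lin_cat; left; apply: lP.
apply/esym/eqP; apply: contrapT => /negP vh; apply: vl; apply/lin_cat; right; exact: lP'.
Qed.

Section Gval.
Variables (L : fieldType) (phi : {rmorphism vfield X -> L}).

(* the multiplicity along v of the total transform of D under the map of pullback phi *)
Definition gval (D : divisor X) (v : L -> int) (n : int) :=
  exists (b : cpoint X) h, [/\ forall r, lr_at b r -> 0 <= v (phi r),
    local_equation D b h & n = v (phi h)].

(** By [hartogs_gen] it suffices to compare h and h' along the curves w through b whose prime has
    positive nu. Such a w also passes through b', so both equations give the multiplicity of D along
    w. *)
Lemma gval_le (D : divisor X) v b b' h h' : nval v ->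
  (forall r, lr_at b r -> 0 <= v (phi r)) -> (forall r, lr_at b' r -> 0 <= v (phi r)) ->
  local_equation D b h -> local_equation D b' h' -> v (phi h') <= v (phi h).
Proof.
move=> nv vb vb' [h0 hD] [h'0 hD'].
pose nu r := v (phi r).
have nuM f g : f != 0 -> g != 0 -> nu (f * g) = nu f + nu g.
  by move=> f0 g0; rewrite /nu rmorphM (nvM nv) ?fmorph_eq0.
have nu0 : nu 0 = 0 by rewrite /nu rmorph0 (nv0 nv).
have nuV f : nu f^-1 = - nu f by rewrite /nu fmorphV (nvV nv).
have nu1 : nu 1 = 0 by rewrite /nu rmorph1 (nv1 nv).
have nuX f n : nu (f ^+ n) = nu f *+ n by rewrite /nu rmorphXn (nvX nv).
have nuU c u : (forall r, lr_at c r -> 0 <= nu r) -> lunit (lr_at c) u -> nu u = 0.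
  move=> hc [Ou eu]; have := hc _ Ou; have := hc _ (lr_V Ou eu); rewrite nuV; lia.
suff : 0 <= nu (h / h') by rewrite nuM ?invr_eq0 // nuV subr_ge0.
apply: (@hartogs_gen _ _ _ _ (rX b)) => //; first by rewrite mulf_neq0 ?invr_eq0.
move=> p v0 pp dv0 v0p nup; have [w wE] := isdiv_primediv dv0.
have dw : isdiv (lr_at b) w by rewrite (_ : (w : _ -> _) = v0) //; apply/funext.
rewrite -!wE in v0p *; have wb := (pass_isdivP _ _).2 dw.
suff wb' : passes_through w b'.
  by rewrite (nvdiv dw) // -hD // -hD' // subrr.
move=> r Or; have [i bi] := pt_neq0 b; have [i' bi'] := pt_neq0 b'.
have [Oz zg] := lr_at_gen bi; have [Oz' zg'] := lr_at_gen bi'.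
have xi : x i != 0 := pt_gen (j := idk) (y := b) bi.
have xi' : x i' != 0 := pt_gen (j := idk) (y := b') bi'.
have [t [d [F [G [hF hG G0 -> _]]]]] := Or.
have xd : x i ^+ d != 0 by rewrite expf_neq0.
rewrite (homog_aff iota hF xi) (homog_aff iota hG xi) // -mulf_div divff // mul1r.
set Fz := mmap iota _ F; set Gz := mmap iota _ G.
have OF : lr_at b Fz := (lr_mmap F Oz).1; have OG : lr_at b Gz := (lr_mmap G Oz).1.
(* Both points are centers of nu, so the coordinates defining their charts differ by a nu-unit. A
   denominator nonzero at b' then has nu-value 0 in the chart of b, hence is not divisible by p. *)
have xii : nu (x i / x i') = 0.
  have h1 : 0 <= nu (x i / x i') by apply: vb'.
  have : 0 <= nu (x i' / x i) by apply: vb.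
  by rewrite -(invf_div (x i)) nuV; apply: ge0_opp_eq0.
have Gx0 : mmap iota x G != 0 := pt_ndef (j := idk) (y := b') hG G0.
have GE : Gz = mmap iota (fun l => x l / x i') G / (x i / x i') ^+ d.
  move: (homog_aff iota hG xi) (homog_aff iota hG xi') => e e'.
  have -> : Gz = mmap iota x G / x i ^+ d by rewrite e mulrAC divff // mul1r.
  have xd' : x i' ^+ d != 0 by rewrite expf_neq0.
  have -> : mmap iota (fun l => x l / x i') G = mmap iota x G / x i' ^+ d.
    by rewrite e' mulrAC divff // mul1r.
  by rewrite expr_div_n; field; rewrite xd xd'.
have uG : lunit (lr_at b') (mmap iota (fun l => x l / x i') G).
  split; first exact: (lr_mmap G Oz').1.
  rewrite (lr_mmap G Oz').2 (@mmap_ext _ _ _ idk _ (fun l => b' l / b' i')).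
    have := homog_aff idk hG bi'; rewrite /= => e; move: G0; rewrite e mulf_eq0 negb_or.
    by case/andP.
  by move=> l; apply: pt_evE; apply: (@eval_coord k X k idk b' i' bi' l).
have Gz0 : Gz != 0 by rewrite GE mulf_neq0 ?invr_eq0 ?expf_neq0 ?mulf_neq0 ?invr_eq0 ?(lr_neq0 uG.2).
have nuG : nu Gz = 0.
  rewrite GE nuM ?invr_eq0 ?expf_neq0 ?mulf_neq0 ?invr_eq0 ?(lr_neq0 uG.2) //.
  by rewrite nuV nuX xii mul0rn oppr0 addr0 (nuU b' _ vb' uG).
apply: (nvM_ge0 dw); first exact: (id_ge0 dw).
rewrite (nvV dw); have := id_ge0 dw OG; rewrite le_eqVlt => /predU1P[<-//|wG].
have [c Oc GcE] := isdiv_pos dw pp v0p OG wG.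
have c0 : c != 0 by apply: contra_neq Gz0 => c0; rewrite GcE c0 mul0r.
have [_ p0 _ _] := pp.
have := nuM c p c0 p0; rewrite -GcE nuG => e.
by case: (ge0_gt0_sum e (vb _ Oc) nup).
Qed.

Lemma gval_uniq (D : divisor X) v n n' : nval v -> gval D v n -> gval D v n' -> n = n'.
Proof.
move=> nv [b [h [vb hb ->]]] [b' [h' [vb' hb' ->]]]; apply: le_anti.
by rewrite (gval_le nv vb' vb hb' hb) (gval_le nv vb vb' hb hb').
Qed.

Lemma gval_lin (D E : divisor X) v n h : nval v -> h != 0 ->
  (forall w : primediv X, E w = D w + w h) -> gval D v n -> gval E v (n + v (phi h)).
Proof.
move=> nv h0 DE [b [f [vb [f0 fb] ->]]]; exists b, (f * h); split=> //.
  split; first by rewrite mulf_neq0.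
  by move=> w wb; rewrite DE fb // (nvM (primediv_nval w)).
by rewrite rmorphM (nvM nv) ?fmorph_eq0.
Qed.
End Gval.
End SurfaceDivisors.

(** * Pullback of divisor classes *)

Lemma two_ders_iso (k : numFieldType) (M N : fieldType) (i : {rmorphism k -> M})
    (j : {rmorphism k -> N}) (phi : {rmorphism M -> N}) (psi : {rmorphism N -> M}) :
  (forall c, phi (i c) = j c) -> cancel phi psi -> cancel psi phi -> two_ders i -> two_ders j.
Proof.
move=> pc c1 c2 [D [E [a [b [dD dE ab]]]]].
have tr T : der_on i T -> der_on j (fun x => phi (T (psi x))).
  move=> [TD TM TC]; split=> [x y|x y|c].
  - by rewrite rmorphD TD rmorphD.
  - by rewrite rmorphM TM rmorphD !rmorphM /= !c2.
  - by rewrite -pc c1 TC rmorph0.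
exists (fun x => phi (D (psi x))), (fun x => phi (E (psi x))), (phi a), (phi b).
split; [exact: tr|exact: tr|].
by rewrite /det2 !c1 -!rmorphM -rmorphB fmorph_eq0.
Qed.

Section Birational.
Variable k : numClosedFieldType.
Let idk : {rmorphism k -> k} := idfun.

Definition birmor (X Y : pvar k) (p : ratmap X Y) (phi : {rmorphism vfield Y -> vfield X}) :=
  [/\ dom_by p phi, morphism p &
    exists psi : {rmorphism vfield X -> vfield Y}, cancel phi psi /\ cancel psi phi].

Lemma morphism_dominates (X Y : pvar k) (p : ratmap X Y) (phi : {rmorphism vfield Y -> vfield X}) :
  dom_by p phi -> morphism p <-> forall a, exists b, dominates phi b a.
Proof.
by move=> dp; split=> h a; have [b hb] := h a; exists b; apply/(maps_to_dominates a b dp).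
Qed.

Lemma dominates_comp (X Y Z : pvar k) (f : vfield Y -> vfield X) (g : vfield Z -> vfield Y)
    (a : cpoint X) (b : cpoint Y) (c : cpoint Z) :
  dominates f b a -> dominates g c b -> dominates (f \o g) c a.
Proof.
by move=> fb gc h /gc[Ob eb]; have [Oa ea] := fb _ Ob; rewrite ea eb.
Qed.

Lemma birmor_two_ders (X Y : pvar k) (p : ratmap X Y) phi : birmor p phi ->
  two_ders (viota Y) <-> two_ders (viota X).
Proof.
move=> [[pc _] _ [psi [c1 c2]]]; split; first exact: (two_ders_iso pc c1 c2).
by apply: (two_ders_iso _ c2 c1) => c; rewrite -pc c1.
Qed.

Section NearPull.
Variables (X Y : pvar k) (phi : {rmorphism vfield X -> vfield Y}).

(** Continuity: G becomes a unit at a, and regularity of the pulled back chart coordinates keeps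
    nearby images in the chart of b. *)
Lemma near_pull (a : cpoint Y) (b : cpoint X) Q : dominates phi b a -> near b Q ->
  near a (fun a' => forall b', dominates phi b' a' -> Q b').
Proof.
move=> db [d [G [hG Gb GQ]]]; have [i bi] := pt_neq0 b; have [Oz zg] := lr_at_gen bi.
have xi : vgen i != 0 := pt_gen (j := idk) (y := b) bi.
pose z l := @vgen k X l / @vgen k X i.
have zb (c : cpoint X) (ci : c i != 0) l : lr_ev (lr_at c) (z l) = c l / c i.
  by apply: pt_evE; exact: (@eval_coord k X k idk c i ci l).
have eG (c : cpoint X) (ci : c i != 0) :
    lr_ev (lr_at c) (mmap (viota X) z G) != 0 <-> mmap idfun c G != 0.
  have [Ocz _] := lr_at_gen ci; rewrite (lr_mmap G Ocz).2.
  rewrite (mmap_ext idk G (zb c ci)); have := homog_aff idk hG ci; rewrite /= => ->.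
  by rewrite mulf_eq0 expf_eq0 (negPf ci) andbF.
have uG : lunit (lr_at b) (mmap (viota X) z G).
  by split; [exact: (lr_mmap G Oz).1|apply/eG].
have uG' : lunit (lr_at a) (phi (mmap (viota X) z G)).
  by have [h1 h2] := db _ uG.1; split=> //; rewrite h2; exact: uG.2.
have n1 : near a (fun a' => forall l, lr_at a' (phi (z l))).
  by apply: near_ord => l; apply/near_regular/(db _ (Oz l)).1.
apply: near_mono (near_and n1 (near_unit uG')) => a' [Oz' [_ eG']] b' db'.
apply: GQ; have [i' bi'] := pt_neq0 b'.
have b'i : b' i != 0.
  have [Ob _] := lr_at_gen bi'; have [h1 h2] := db' _ (Ob i).
  have xi' : vgen i' != 0 := pt_gen (j := idk) (y := b') bi'.
  have e1 : phi (vgen i / vgen i') * phi (z i') = 1.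
    by rewrite -rmorphM /z -(rmorph1 phi); congr (phi _); field; rewrite xi xi'.
  have := lr_ev1 (lr_at a'); rewrite -e1 lr_evM // h2.
  have -> : lr_ev (lr_at b') (vgen i / vgen i') = b' i / b' i'.
    by apply: pt_evE; exact: (@eval_coord k X k idk b' i' bi' i).
  by apply: contra_eq_neq => ->; rewrite mul0r mul0r eq_sym oner_neq0.
apply/(eG b' b'i); have [Ob _] := lr_at_gen b'i.
by have [_ <-] := db' _ ((lr_mmap G Ob).1).
Qed.
End NearPull.

Section PullDivisor.
Variables (Y X : surface k) (phi : {rmorphism vfield X -> vfield Y}).
Hypotheses (nX : two_ders (viota X)) (nY : two_ders (viota Y)).
Hypothesis mor : forall a : cpoint Y, exists b : cpoint X, dominates phi b a.

Lemma gval_dominates (D : divisor X) (v : primediv Y) (a : cpoint Y) (b : cpoint X) h :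
  passes_through v a -> dominates phi b a -> local_equation D b h ->
  gval phi D v (v (phi h)).
Proof.
by move=> va db hb; exists b, h; split=> // r /db[Or _]; apply: va.
Qed.

Lemma gval_ex (D : divisor X) (v : primediv Y) : exists n, gval phi D v n.
Proof.
have [a va] := primediv_point v; have [b db] := mor a.
have [h hb] := local_equation_ex nX D b.
by exists (v (phi h)); apply: gval_dominates va db hb.
Qed.

Lemma pull_divisor_ex (D : divisor X) : exists E : divisor Y, forall v : primediv Y, gval phi D v (E v).
Proof.
have /choice[m mP] := gval_ex D.
suff fin : finite_set [set v | m v <> 0]%classic by exists (Divisor fin).
apply/finite_lin.
pose Q (a : cpoint Y) (a' : cpoint Y) := exists h : vfield X, h != 0 /\
  forall v : primediv Y, passes_through v a' -> m v = v (phi h).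
have nloc (a : cpoint Y) : exists h : vfield X, h != 0 /\
    near a (fun a' => forall v : primediv Y, passes_through v a' -> m v = v (phi h)).
  have [b db] := mor a; have [h hb] := local_equation_ex nX D b.
  exists h; split; first by case: hb.
  apply: near_mono (near_pull db (near_local_equation nX hb)) => a' ha' v va'.
  have [b' db'] := mor a'; apply: (gval_uniq nX (primediv_nval v) (mP v)).
  exact: gval_dominates va' db' (ha' b' db').
have /choice[f fP] := nloc.
have [l lP] := near_cover (fun a => (fP a).2).
have fs a : exists s : seq (primediv Y), forall v : primediv Y, v (phi (f a)) != 0 -> @lin (primediv Y) v s.
  by apply: finite_support => //; rewrite fmorph_eq0; case: (fP a).
have /choice[s sP] := fs.
exists (flatten (map s l)) => v vm; have [a' va'] := primediv_point v.
have [a al aa'] := lP a'; have vh : v (phi (f a)) != 0 by rewrite -(aa' v va'); apply/eqP.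
have := sP a v vh; elim: l al {lP} => //= c l IH; rewrite lin_cat => -[->|al] hh; [by left|right; exact: IH].
Qed.

Lemma pullback_div_gval (g : ratmap Y X) (D : divisor X) (E : divisor Y) : dom_by g phi ->
  pullback_div g D E <-> forall v : primediv Y, gval phi D v (E v).
Proof.
move=> gp; split=> [pD v|hE a b /(maps_to_dominates a b gp) db h hb].
  have [a va] := primediv_point v; have [b db] := mor a.
  have [h hb] := local_equation_ex nX D b.
  have [|h' e [_ hE]] := pD a b _ h hb; first exact/(maps_to_dominates a b gp).
  rewrite hE // (eval_domE (s_gen (s := X)) gp e).
  exact: gval_dominates va db hb.
exists (phi h); first by apply: eval_dom gp; exact: s_gen.
split; first by rewrite fmorph_eq0; case: hb.
move=> v va; apply: (gval_uniq nX (primediv_nval v) (hE v)).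
exact: gval_dominates va db hb.
Qed.
End PullDivisor.

Section Lift.
Variables (X Y : surface k) (p : ratmap X Y) (phi : {rmorphism vfield Y -> vfield X}).
Hypotheses (bp : birmor p phi) (nX : two_ders (viota X)).

(** Strict transform. By properness the valuation has a center a on X; its image b lies on v', and
    fractions of functions regular at b are fractions of functions regular at a, so the valuation is
    divisorial on X. *)
Lemma primediv_lift (v' : primediv Y) : exists v : primediv X, forall h, v (phi h) = v' h.
Proof.
have [dp mp [psi [c1 c2]]] := bp; have [pc _] := dp.
have sc c : psi (viota X c) = viota Y c by rewrite -pc c1.
have nv' := primediv_nval v'.
have [K [j [c cE]]] := ord_ring v'.
pose v h := v' (psi h).
have nv : nval v.
  split; rewrite /v.
  - by rewrite rmorph0 (nv0 nv').
  - by move=> g h g0 h0; rewrite rmorphM (nvM nv') ?fmorph_eq0.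
  - move=> g h g0 h0 gh0; rewrite rmorphD (nvD nv') ?fmorph_eq0 //.
    by rewrite -rmorphD fmorph_eq0.
  - by have [t vt] := nv_norm nv'; exists (phi t); rewrite c1.
have /choice[r rP] : forall h, exists t, 0 <= v h -> eval_at c (psi h) t.
  move=> h; have [vh|] := boolP (0 <= v h); last by exists 0.
  by have [t ht] := (cE _).1 vh; exists t.
have vC e : 0 <= v (viota X e).
  by rewrite /v sc; apply/cE; exists (j e); apply: eval_C.
have [||||a aP] := @center_ex k X v K j r (s_neq0 X) nv vC.
- move=> f g vf vg; apply: (eval_uniq (rP _ (nvD_ge0 nv vf vg))).
  by rewrite rmorphD; apply: eval_D; apply: rP.
- move=> f g vf vg; apply: (eval_uniq (rP _ (nvM_ge0 nv vf vg))).
  by rewrite rmorphM; apply: eval_M; apply: rP.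
- move=> e; apply: (eval_uniq (rP _ (vC e))); rewrite sc; exact: eval_C.
- move=> f vf; apply/eqP; apply: contrapT => /negP rf.
  have /cE : regular_at c (psi f)^-1.
    by exists (r f)^-1; apply: eval_V => //; apply/rP/ltW.
  by rewrite (nvV nv') -/(v f) oppr_ge0 leNgt vf.
have [b db] := (morphism_dominates dp).1 mp a.
have vb' : passes_through v' b by move=> h /db[Oh _]; have := aP _ Oh; rewrite /v c1.
have dv' := pass_isdiv vb'.
have dv : isdiv (lr_at a) v.
  split=> // h vh; have [F [G [OF OG G0 vG hE]]] := id_loc dv' vh.
  exists (phi F), (phi G); split; [exact: (db _ OF).1|exact: (db _ OG).1|by rewrite fmorph_eq0| |].
    by rewrite /v c1.
  by rewrite -fmorph_div -hE c2.
have [w wE] := isdiv_primediv dv.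
by exists w => h; rewrite wE /v c1.
Qed.

Lemma primediv_lift_uniq (v w : primediv X) : (forall h, v (phi h) = w (phi h)) -> v = w.
Proof.
by have [_ _ [psi [_ c2]]] := bp => vw; apply: primediv_ext => h; rewrite -[h]c2.
Qed.
End Lift.

Section PicChar.
Variables (X : surface k) (g : ratmap X X) (phi : {rmorphism vfield X -> vfield X}).
Hypotheses (nX : two_ders (viota X)) (gp : dom_by g phi).

(** The pullback on Pic computed on X alone by valuations. It is compared with [pullback_Pic] in
    this section, after which a resolution serves only for existence. *)
Definition pull_rel (D E : divisor X) := exists2 E' : divisor X, lin_equiv E' E &
  forall v : primediv X, gval phi D v (E' v).

Section OneModel.
Variables (G : surface k) (p1 p2 : ratmap G X) (psi : {rmorphism vfield X -> vfield G}).
Hypotheses (b1 : birmor p1 psi) (m2 : morphism p2) (cg : is_comp g p1 p2).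

Let dp1 : dom_by p1 psi. Proof. by case: b1. Qed.
Let dp2 : dom_by p2 (psi \o phi). Proof. by apply/(comp_dom p2 (s_gen (s := X)) dp1 gp). Qed.
Let nG : two_ders (viota G). Proof. by apply/(birmor_two_ders b1). Qed.
Let mor2 : forall a : cpoint G, exists b : cpoint X, dominates (psi \o phi) b a.
Proof. by apply/(morphism_dominates dp2). Qed.

Lemma gval_model (D : divisor X) (v : primediv X) (w : primediv G) n :
  (forall h, w (psi h) = v h) -> gval (psi \o phi) D w n -> gval phi D v n.
Proof.
move=> wv [b [h [wb hb ->]]]; exists b, h; split=> //; last by rewrite /= wv.
by move=> r /wb; rewrite /= wv.
Qed.

Lemma pullback_Pic_rel D1 D2 D3 D E : lin_equiv D D1 -> pullback_div p2 D1 D2 ->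
  pushforward_div p1 D2 D3 -> lin_equiv D3 E -> pull_rel D E.
Proof.
move=> [h h0 DD1] /(pullback_div_gval nX mor2 _ _ dp2) hD2 push [e e0 D3E].
have g3 (v : primediv X) : gval phi D1 v (D3 v).
  have [w wv] := primediv_lift b1 v; rewrite (push v w).
    exact: gval_model wv (hD2 w).
  by move=> t t' /(eval_domE (s_gen (s := X)) dp1) ->; exact: wv.
(* D is D1 plus the divisor of h, so its pullback is D3 plus the divisor of phi h. *)
have fE : finite_set [set v : primediv X | D3 v + v (phi h) <> 0]%classic.
  have [l lP] := (finite_lin _).1 (mult_finite D3).
  have [|l' lP'] := @finite_support _ _ nX (phi h); first by rewrite fmorph_eq0.
  apply/finite_lin; exists (l ++ l') => v /= vn; apply/lin_cat.
  have [d0|d0] := pselect (D3 v = 0); last by left; apply: lP.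
  by right; apply: lP'; apply/eqP => e1; apply: vn; rewrite d0 e1.
exists (Divisor fE).
  exists (e * phi h) => [|v]; first by rewrite mulf_neq0 ?fmorph_eq0.
  rewrite /= D3E (nvM (primediv_nval v)) ?fmorph_eq0 //; by rewrite addrA.
by move=> v /=; apply: (gval_lin (primediv_nval v) h0 DD1); exact: g3.
Qed.

Lemma rel_pullback_Pic D E : modification p1 -> pull_rel D E -> pullback_Pic g D E.
Proof.
move=> mo [E' EE' hE']; exists G, p1, p2; split=> //.
have [D2 hD2] := pull_divisor_ex nX nG mor2 D.
exists D, D2, E'; split=> //.
- exists 1; rewrite ?oner_neq0 // => v; by rewrite (nv1 (primediv_nval v)) addr0.
- exact/(pullback_div_gval nX mor2 _ _ dp2).
- move=> v w wv.
  have wv' h : w (psi h) = v h by apply: wv; apply: eval_dom dp1; exact: s_gen.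
  apply: (gval_uniq nX (primediv_nval v) (hE' v)); exact: gval_model wv' (hD2 w).
Qed.

Lemma gval_total (D : divisor X) : exists E : divisor X, forall v : primediv X, gval phi D v (E v).
Proof.
have [D2 hD2] := pull_divisor_ex nX nG mor2 D.
have /choice[f fP] : forall v : primediv X, exists w : primediv G, forall h, w (psi h) = v h.
  by move=> v; apply: primediv_lift b1 v.
have fin : finite_set [set v | D2 (f v) <> 0]%classic.
  have [l lP] := (finite_lin _).1 (mult_finite D2).
  have [s sP] : exists s : seq (primediv X), forall v, @lin (primediv G) (f v) l -> @lin (primediv X) v s.
    elim: l {lP} => [|w l [s sP]]; first by exists [::].
    have [[v vw]|nv] := pselect (exists v, f v = w); last first.
      by exists s => v /= [e|/sP//]; case: nv; exists v.
    exists (v :: s) => u /= [e|/sP]; last by right.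
    left; apply: primediv_ext => h; rewrite -!fP vw e.
    by [].
  by apply/finite_lin; exists s => v /lP/sP.
by exists (Divisor fin) => v; apply: gval_model (fP v) (hD2 (f v)).
Qed.
End OneModel.
End PicChar.
End Birational.

(** * Blowups *)

Section LLe.
Variables (k : numFieldType) (L : fieldType) (iota : {rmorphism k -> L}).
Implicit Types R : lring iota.

Definition lle R R' := forall h, R h -> R' h /\ lr_ev R' h = lr_ev R h.

Lemma lle_trans R1 R2 R3 : lle R1 R2 -> lle R2 R3 -> lle R1 R3.
Proof. by move=> h12 h23 h /h12[/h23[h3 ->] ->]. Qed.
Lemma lle_reflect R R' h : lle R R' -> R h -> lunit R' h -> lunit R h.
Proof. by move=> RR Rh [_ eh]; split=> //; rewrite -(RR h Rh).2. Qed.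

(* R is the quadratic transform of O in the direction w = c u *)
Definition isquad (O : lring iota) (u w : L) (c : k) R :=
  [/\ lle O R, R (w / u), lr_ev R (w / u) = c &
    forall R', lle O R' -> R' (w / u) -> lr_ev R' (w / u) = c -> lle R R'].

Lemma gen_lle R R' n (z : 'I_n -> L) : gen_by R z ->
  (forall i, R' (z i)) -> (forall i, lr_ev R' (z i) = lr_ev R (z i)) -> lle R R'.
Proof.
move=> [Rz zg] R'z ez h Rh; have [F [G [eG hE]]] := zg h Rh.
have ee P : lr_ev R' (mmap iota z P) = lr_ev R (mmap iota z P).
  by rewrite (lr_mmap P Rz).2 (lr_mmap P R'z).2; apply: mmap_ext.
have eG' : lr_ev R' (mmap iota z G) != 0 by rewrite ee.
have mR P := (lr_mmap P Rz).1; have mR' P := (lr_mmap P R'z).1.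
by rewrite hE; split; [exact: lr_div|rewrite !lr_evdiv // !ee].
Qed.
End LLe.

Section PointOf.
Variables (k : numClosedFieldType) (Z : pvar k) (L : fieldType) (iota : {rmorphism k -> L}).
Variables (phi : {rmorphism vfield Z -> L}) (R : lring iota).
Hypothesis pc : forall c, phi (viota Z c) = iota c.
Let idk : {rmorphism k -> k} := idfun.
Local Notation x := (@vgen k Z).

(** Regular affine coordinates reduce to a closed point, whose local ring R dominates through [phi];
    this produces images and lifts of points. *)
Lemma point_of i : x i != 0 -> (forall l, R (phi (x l / x i))) ->
  exists c : cpoint Z, (forall l, c l = lr_ev R (phi (x l / x i))) /\
    forall h, lr_at c h -> R (phi h) /\ lr_ev R (phi h) = lr_ev (lr_at c) h.
Proof.
move=> xi Rx; pose e l := lr_ev R (phi (x l / x i)).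
have ei : e i = 1 by rewrite /e divff // rmorph1 lr_ev1.
have pm F : phi (mmap (viota Z) (fun l => x l / x i) F) = mmap iota (fun l => phi (x l / x i)) F.
  exact: mmap_comp.
have Rm F : R (phi (mmap (viota Z) (fun l => x l / x i) F)) /\
    lr_ev R (phi (mmap (viota Z) (fun l => x l / x i) F)) = mmap idfun e F.
  by rewrite pm; apply: lr_mmap.
have e0 : exists l, e l != 0 by exists i; rewrite ei oner_neq0.
have on d (F : {mpoly k[vcoords Z]}) : F \is d.-homog -> mmap (viota Z) x F = 0 ->
    mmap idfun e F = 0.
  move=> hF; rewrite (homog_aff _ hF xi) => /eqP.
  rewrite mulf_eq0 expf_eq0 (negPf xi) andbF /= => /eqP F0.
  by rewrite -(Rm F).2 F0 rmorph0 lr_ev0.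
pose c : cpoint Z := Point e0 on; have ci : c i != 0 by rewrite /= ei oner_neq0.
exists c; split=> // h Oh; have [_ zg] := lr_at_gen ci.
have Oz := (lr_at_gen ci).1.
have [F [G [eG ->]]] := zg h Oh.
have ce F' : mmap idfun (fun l => c l / c i) F' = mmap idfun e F'.
  by apply: (mmap_ext idk) => l; rewrite /= ei divr1.
have ev F' : lr_ev (lr_at c) (mmap (viota Z) (fun l => x l / x i) F') =
    lr_ev R (phi (mmap (viota Z) (fun l => x l / x i) F')).
  rewrite (Rm F').2 (lr_mmap F' Oz).2 -ce; apply: (mmap_ext idk) => l.
  by apply: pt_evE; exact: (@eval_coord k Z k idk c i ci l).
have eG' : lr_ev R (phi (mmap (viota Z) (fun l => x l / x i) G)) != 0 by rewrite -ev.
have OF := (lr_mmap F Oz).1; have OG := (lr_mmap G Oz).1.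
have RF := (Rm F).1; have RG := (Rm G).1.
by rewrite fmorph_div (lr_evdiv OF OG eG) !ev; split; [exact: lr_div|rewrite lr_evdiv].
Qed.

(* a domination by the local ring of a closed point determines the point *)
Lemma point_uniq (a b : cpoint Z) :
  (forall h, lr_at a h -> R (phi h) /\ lr_ev R (phi h) = lr_ev (lr_at a) h) ->
  (forall h, lr_at b h -> R (phi h) /\ lr_ev R (phi h) = lr_ev (lr_at b) h) ->
  same_point a b.
Proof.
move=> ha hb; have [i ai] := pt_neq0 a; have [i' bi'] := pt_neq0 b.
have xi : x i != 0 := pt_gen (j := idk) (y := a) ai.
have xi' : x i' != 0 := pt_gen (j := idk) (y := b) bi'.
have Oa := (lr_at_gen ai).1; have Ob := (lr_at_gen bi').1.
have ea l : lr_ev R (phi (x l / x i)) = a l / a i.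
  by rewrite (ha _ (Oa l)).2; apply: pt_evE; exact: (@eval_coord k Z k idk a i ai l).
have eb l : lr_ev R (phi (x l / x i')) = b l / b i'.
  by rewrite (hb _ (Ob l)).2; apply: pt_evE; exact: (@eval_coord k Z k idk b i' bi' l).
have Ra l := (ha _ (Oa l)).1; have Rb l := (hb _ (Ob l)).1.
have bi : b i != 0.
  have e1 : phi (x i / x i') * phi (x i' / x i) = 1.
    by rewrite -rmorphM -(rmorph1 phi); congr (phi _); field; rewrite xi xi'.
  have := lr_ev1 R; rewrite -e1 lr_evM // eb.
  by apply: contra_eq_neq => ->; rewrite mul0r mul0r eq_sym oner_neq0.
exists (a i / b i); first by rewrite mulf_neq0 ?invr_eq0.
move=> l; have : lr_ev R (phi (x l / x i')) = lr_ev R (phi (x l / x i)) * lr_ev R (phi (x i / x i')).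
  rewrite -lr_evM // -rmorphM; congr (lr_ev _ (phi _)); field; by rewrite xi xi'.
rewrite ea !eb => e; have : a l = b l / b i' * a i / (b i / b i').
  by rewrite e; field; rewrite ai bi' bi.
by move=> ->; field; rewrite bi bi'.
Qed.
End PointOf.

Section SamePoint.
Variables (k : numClosedFieldType) (Z : pvar k).
Let idk : {rmorphism k -> k} := idfun.

Lemma same_point_lle (a b : cpoint Z) : same_point a b -> lle (lr_at a) (lr_at b).
Proof.
move=> [c c0 ab] h [t ht]; have e : eval_at b h t.
  have [d [F [G [hF hG G0 hE tE]]]] := ht; exists d, F, G.
  have cd : c ^+ d != 0 by rewrite expf_neq0.
  have aE F' : F' \is d.-homog -> mmap idfun a F' = c ^+ d * mmap idfun b F'.
    by move=> hF'; rewrite -(mmap_scale idk _ _ hF'); apply: (mmap_ext idk).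
  move: G0; rewrite aE // mulf_eq0 negb_or => /andP[_ G0].
  by split=> //; rewrite tE !aE // -mulf_div divff // mul1r.
split; [by exists t|exact: etrans (pt_evE e) (esym (pt_evE ht))].
Qed.

Lemma same_point_sym (a b : cpoint Z) : same_point a b -> same_point b a.
Proof.
move=> [c c0 ab]; exists c^-1; rewrite ?invr_eq0 // => i; by rewrite ab mulKf.
Qed.

Lemma lle_same_point (a b : cpoint Z) : lle (lr_at a) (lr_at b) -> same_point a b.
Proof.
by move=> ab; apply: (@point_uniq k Z _ (viota Z) idfun (lr_at b)).
Qed.
End SamePoint.

Section Blowup.
Variables (k : numClosedFieldType) (Y : surface k) (p : cpoint Y).
Let idk : {rmorphism k -> k} := idfun.
Local Notation y := (@vgen k Y).
Local Notation iota := (viota Y).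
Local Notation L := (vfield Y).
Local Notation Op := (lr_at p).
Local Notation B := (blowup_model p).
Local Notation I := ('I_(vcoords Y) * 'I_(vcoords Y) * 'I_(vcoords Y))%type.

Definition ell a b : L := iota (p a) * y b - iota (p b) * y a.

Lemma vgenB (i a b : 'I_(vcoords Y)) : @vgen k B (enum_rank (i, a, b)) = y i * ell a b.
Proof. by rewrite /= enum_rankK. Qed.

Lemma vgenBP (m : 'I_(vcoords B)) : exists i a b, m = enum_rank (i, a, b).
Proof. by case E: (enum_val m) => [[i a] b]; exists i, a, b; rewrite -E enum_valK. Qed.

Section Chart.
Variable i0 : 'I_(vcoords Y).
Hypothesis pi0 : p i0 != 0.
Let y0 : y i0 != 0. Proof. exact: (pt_gen (j := idk) (y := p) pi0). Qed.

(** Affine coordinates translated to vanish at p; [zc_gen] shows that they generate its maximal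
    ideal. *)
Definition zc b : L := y b / y i0 - iota (p b / p i0).

Lemma zc_max b : lmax Op (zc b).
Proof.
have Oz := (lr_at_gen pi0).1 b; have OC := lr_C Op (p b / p i0).
split; first exact: lr_B.
rewrite lr_evB // lr_evC; apply/eqP; rewrite subr_eq0; apply/eqP.
by apply: pt_evE; exact: (@eval_coord k Y k idk p i0 pi0 b).
Qed.

Lemma zc_gen h : Op h -> lr_ev Op h = 0 -> exists r : 'I_(vcoords Y) -> L,
  (forall b, Op (r b)) /\ h = \sum_b r b * zc b.
Proof.
move=> Oh eh; have [Oz zg] := lr_at_gen pi0.
pose z l := y l / y i0.
pose In h := exists r : 'I_(vcoords Y) -> L, (forall b, Op (r b)) /\ h = \sum_b r b * zc b.
have In0 : In 0.
  by exists (fun=> 0); split=> [b|]; [exact: lr_0|rewrite big1 // => b _; rewrite mul0r].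
have InD f g : In f -> In g -> In (f + g).
  move=> [r [Or ->]] [s [Os ->]]; exists (fun b => r b + s b).
  by split=> [b|]; [exact: lr_D|rewrite -big_split; apply: eq_bigr => b _; rewrite mulrDl].
have InM f g : Op f -> In g -> In (f * g).
  move=> Of [r [Or ->]]; exists (fun b => f * r b).
  by split=> [b|]; [exact: lr_M|rewrite mulr_sumr; apply: eq_bigr => b _; rewrite mulrA].
have mz F := lr_mmap F Oz.
have key F : In (mmap iota z F - iota (lr_ev Op (mmap iota z F))).
  elim/mpoly_ring_ind: F => [c|l|F G IF IG|F G IF IG].
  - by rewrite mmapC lr_evC subrr.
  - rewrite mmapX mmap1U; exists (fun b => (b == l)%:R); split=> [b|].
      by case: eqP => _; [exact: lr_1|exact: lr_0].
    rewrite (bigD1 l) //= eqxx mul1r big1 ?addr0 => [|b /negPf ->]; last by rewrite mul0r.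
    rewrite /zc /z; congr (_ - iota _); apply: pt_evE.
    exact: (@eval_coord k Y k idk p i0 pi0 l).
  - rewrite mmapD lr_evD; [|exact: (mz F).1|exact: (mz G).1].
    by rewrite rmorphD opprD addrACA; apply: InD.
  - have e : mmap iota z (F * G) = mmap iota z F * mmap iota z G by rewrite rmorphM.
    rewrite e lr_evM; [|exact: (mz F).1|exact: (mz G).1]; rewrite rmorphM.
    set f := mmap _ _ F; set g := mmap _ _ G; set f0 := iota _; set g0 := iota _.
    have -> : f * g - f0 * g0 = f * (g - g0) + g0 * (f - f0) by ring.
    by apply: InD; apply: InM => //; [exact: (mz F).1|exact: lr_C].
have [F [G [eG hE]]] := zg h Oh.
have OF := (mz F).1; have OG := (mz G).1.
have eF : lr_ev Op (mmap iota z F) = 0.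
  have := eh; rewrite hE lr_evdiv // => /eqP.
  by rewrite mulf_eq0 invr_eq0 (negPf eG) orbF => /eqP.
have := key F; rewrite eF rmorph0 subr0 => IF.
by rewrite -/(In h) hE mulrC; apply: InM => //; apply: lr_V.
Qed.

Lemma ellE a b : ell a b = y i0 * (iota (p a) * zc b - iota (p b) * zc a).
Proof.
rewrite /ell /zc !fmorph_div; field.
by rewrite y0 fmorph_eq0 pi0.
Qed.

Lemma ell0E b : ell i0 b = y i0 * iota (p i0) * zc b.
Proof.
rewrite /ell /zc !fmorph_div; field.
by rewrite y0 fmorph_eq0 pi0.
Qed.
End Chart.

(** Otherwise all coordinate ratios are constants and the function field is k, against transcendence
    degree two. *)
Lemma ell_neq0 : exists a b, ell a b != 0.
Proof.
apply: contrapT => ne; have [i0 pi0] := pt_neq0 p.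
have y0 : y i0 != 0 by exact: (pt_gen (j := idk) (y := p) pi0).
have yE b : y b = y i0 * iota (p b / p i0).
  have : ell i0 b = 0 by apply/eqP/negPn/negP => h; apply: ne; exists i0, b.
  rewrite (ell0E pi0) => /eqP; rewrite !mulf_eq0 fmorph_eq0 (negPf y0) (negPf pi0) /= subr_eq0.
  by move=> /eqP<-; rewrite mulrCA divff ?mulr1.
have mE d (F : {mpoly k[vcoords Y]}) : F \is d.-homog ->
    mmap iota y F = y i0 ^+ d * iota (mmap idk (fun l => p l / p i0) F).
  move=> hF; have -> : mmap iota y F = mmap iota (fun l => y i0 * iota (p l / p i0)) F.
    exact: mmap_ext.
  by rewrite (mmap_scale _ _ _ hF) (mmap_comp (j := idk) (g := iota) (j' := iota)).
have Lk h : exists c, h = iota c.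
  have [d [F [G [hF hG G0 ->]]]] := s_gen (s := Y) h.
  rewrite (mE d F hF) (mE d G hG) -mulf_div divff ?expf_neq0 // mul1r -fmorph_div.
  by eexists.
have [[z indep] _] := s_dim Y; have [c zc] := Lk (z o0).
have := indep ('X_o0 - c%:MP); rewrite mmapB mmapX mmap1U mmapC zc subrr => /(_ erefl) /eqP.
rewrite subr_eq0 => /eqP /(congr1 (fun F : {mpoly k[2]} => F@_U_(o0))).
rewrite mcoeffXU eqxx mcoeffC (_ : (U_(o0) == 0)%MM = false) ?mulr0; last by apply/negP => /eqP/mnmP/(_ o0); rewrite mnm1E mnm0E eqxx.
by move/eqP; rewrite oner_eq0.
Qed.

Lemma blowup_neq0 : vgen_neq0 B.
Proof.
have [a [b ab]] := ell_neq0; have [i yi] := s_neq0 Y.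
by exists (enum_rank (i, a, b)); rewrite vgenB mulf_neq0.
Qed.

Lemma blowup_gen : generates_field B.
Proof.
move=> h; have [a [b ab]] := ell_neq0; have [i yi] := s_neq0 Y.
have [d [F [G [hF hG G0 ->]]]] := s_gen (s := Y) h.
pose m0 : 'I_(vcoords B) := enum_rank (i, a, b).
have m00 : @vgen k B m0 != 0 by rewrite vgenB mulf_neq0.
pose s l : {mpoly k[vcoords B]} := 'X_(enum_rank (l, a, b)).
pose ren := mmap (@mpolyC (vcoords B) k) s.
have renE F' : mmap iota (fun m => @vgen k B m / @vgen k B m0) (ren F') = mmap iota (fun l => y l / y i) F'.
  rewrite /ren; elim/mpoly_ring_ind: F' => [c|l|F1 F2 I1 I2|F1 F2 I1 I2].
  - by rewrite !mmapC.
  - rewrite !mmapX !mmap1U /s mmapX mmap1U !vgenB -mulf_div divff ?mulr1 //.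
  - by rewrite !mmapD I1 I2.
  - by rewrite !rmorphM /= I1 I2.
have yd : y i ^+ d != 0 by rewrite expf_neq0.
have [d1 hF1] := homogenize m0 (ren F); have [d2 hG1] := homogenize m0 (ren G).
have [H [hH HE]] := hF1 (maxn d1 d2) (leq_maxl _ _).
have [K [hK KE]] := hG1 (maxn d1 d2) (leq_maxr _ _).
have md : @vgen k B m0 ^+ maxn d1 d2 != 0 by rewrite expf_neq0.
move: G0; rewrite (homog_aff iota hF yi) (homog_aff iota hG yi) mulf_eq0 negb_or => /andP[_ G0].
exists (maxn d1 d2), H, K; split=> //; first by rewrite (KE _ iota) // renE mulf_neq0.
by rewrite (HE _ iota) // (KE _ iota) // !renE -!mulf_div !divff ?mul1r.
Qed.

Lemma proportional (al : cpoint Y) : (forall c d, p c * al d = p d * al c) -> same_point al p.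
Proof.
move=> h; have [i pi] := pt_neq0 p; have [j aj] := pt_neq0 al.
have ai : al i != 0.
  apply: contraNneq aj => ai; have := h i j; rewrite ai mulr0 => /eqP.
  by rewrite mulf_eq0 (negPf pi).
exists (al i / p i); first by rewrite mulf_neq0 ?invr_eq0.
by move=> l; have := h i l => e; apply: (mulfI pi); rewrite e; field.
Qed.

Section OverPoint.
Variables (q : cpoint B) (i1 a1 b1 : 'I_(vcoords Y)).
Hypothesis q0 : q (enum_rank (i1, a1, b1)) != 0.
Local Notation R := (lr_at q : lring iota).
Let m0 : 'I_(vcoords B) := enum_rank (i1, a1, b1).

Let vm0 : y i1 * ell a1 b1 != 0.
Proof. by rewrite -vgenB; exact: (pt_gen (j := idk) (y := q) q0). Qed.
Let y1 : y i1 != 0. Proof. by apply: contra_neq vm0 => ->; rewrite mul0r. Qed.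
Let l1 : ell a1 b1 != 0. Proof. by apply: contra_neq vm0 => ->; rewrite mulr0. Qed.

Lemma blow_gen : gen_by R (fun m => @vgen k B m / (y i1 * ell a1 b1)).
Proof. by rewrite -vgenB; exact: (lr_at_gen q0). Qed.

Lemma blow_y i : R (y i / y i1).
Proof.
have := blow_gen.1 (enum_rank (i, a1, b1)); rewrite vgenB -mulf_div divff // mulr1.
by [].
Qed.

Lemma blow_ell c d : R (ell c d / ell a1 b1).
Proof.
have := blow_gen.1 (enum_rank (i1, c, d)); rewrite vgenB -mulf_div divff // mul1r.
by [].
Qed.

Lemma blow_below : exists al : cpoint Y, al i1 = 1 /\ lle (lr_at al) R.
Proof.
have [al [ai ah]] := @point_of k Y L iota idfun R (fun c => erefl) i1 y1 blow_y.
by exists al; split=> //; rewrite ai divff // rmorph1 lr_ev1.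
Qed.

(** Away from p some form [ell] is nonzero at the point, so the ratios of these forms are already
    regular below. *)
Lemma blow_off (al : cpoint Y) : al i1 != 0 -> lle (lr_at al) R -> ~ same_point al p -> lle R (lr_at al).
Proof.
move=> ai aR np; have Oa := (lr_at_gen ai).1.
have [c [d cd]] : exists c d, p c * al d - p d * al c != 0.
  apply: contrapT => nh; apply: np; apply: proportional => c d.
  apply/eqP; rewrite -subr_eq0; apply/negPn/negP => e; by apply: nh; exists c, d.
pose e a b := ell a b / y i1.
have eE a b : e a b = iota (p a) * (y b / y i1) - iota (p b) * (y a / y i1).
  by rewrite /e /ell mulrBl !mulrA.
have Oe a b : lr_at al (e a b).
  by rewrite eE; apply: lr_B; apply: lr_M => //; apply: lr_C.
have evy l : lr_ev (lr_at al) (y l / y i1) = al l / al i1.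
  by apply: pt_evE; exact: (@eval_coord k Y k idk al i1 ai l).
have OCy a b : lr_at al (iota a * (y b / y i1)) by apply: lr_M => //; apply: lr_C.
have ue : lunit (lr_at al) (e c d).
  split=> //; rewrite eE lr_evB // (lr_evM (lr_C _ (p c)) (Oa d)) (lr_evM (lr_C _ (p d)) (Oa c)) !lr_evC !evy.
  by rewrite !mulrA -mulrBl mulf_neq0 ?invr_eq0 //.
have e0 := lr_neq0 ue.2.
have lcd : ell c d != 0 by apply: contra_neq e0; rewrite /e => ->; rewrite mul0r.
have Or : lr_at al (ell a1 b1 / ell c d).
  have -> : ell a1 b1 / ell c d = e a1 b1 / e c d by rewrite /e; field; rewrite lcd y1.
  by case: ue => ? ?; apply: lr_div.
have ur : lunit (lr_at al) (ell a1 b1 / ell c d).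
  apply: (lle_reflect aR Or); split; first exact: (aR _ Or).1.
  have rr : ell a1 b1 / ell c d * (ell c d / ell a1 b1) = 1 by field; rewrite l1 lcd.
  apply: contra_eq_neq (lr_ev1 R) => z; rewrite -rr lr_evM ?z ?mul0r 1?eq_sym ?oner_neq0 //.
    exact: (aR _ Or).1.
  exact: blow_ell.
have Ot m : lr_at al (@vgen k B m / (y i1 * ell a1 b1)).
  have [i [a [b ->]]] := vgenBP m; rewrite vgenB -mulf_div; apply: lr_M => //.
  have -> : ell a b / ell a1 b1 = e a b / e c d / (ell a1 b1 / ell c d).
    by rewrite /e; field; rewrite l1 lcd y1.
  case: ue => O1 O2; case: ur => O3 O4.
  by do 2![apply: lr_div => //].
apply: (gen_lle blow_gen Ot) => m; exact/esym/(aR _ (Ot m)).2.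
Qed.

Section OverCenter.
Variables (al : cpoint Y) (i0 : 'I_(vcoords Y)).
Hypotheses (ai : al i1 != 0) (aR : lle (lr_at al) R) (alp : same_point al p) (pi0 : p i0 != 0).
Variables (u w : L).
Hypothesis uw : params Op u w.
Let y0 : y i0 != 0. Proof. exact: (pt_gen (j := idk) (y := p) pi0). Qed.

Let pR : lle Op R. Proof. exact: (lle_trans (same_point_lle (same_point_sym alp))). Qed.
Let ap : lle (lr_at al) Op. Proof. exact: same_point_lle. Qed.

Let E a b := iota (p a) * zc i0 b - iota (p b) * zc i0 a.
Let ellE' a b : ell a b = y i0 * E a b. Proof. exact: ellE. Qed.
Let E1 : E a1 b1 != 0.
Proof. by apply: contra_neq l1; rewrite ellE' => ->; rewrite mulr0. Qed.

Lemma E_max a b : lmax Op (E a b).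
Proof.
rewrite /E -mulNr -rmorphN; apply: lmaxD; apply: lmaxM; first [exact: lr_C|exact: zc_max].
Qed.

Lemma blow_max_div h : Op h -> lr_ev Op h = 0 -> R (h / E a1 b1).
Proof.
move=> Oh eh; have [r [Or ->]] := zc_gen pi0 Oh eh.
rewrite mulr_suml; apply: lr_sum => b; rewrite -mulrA; apply: lr_M; first exact: (pR (Or b)).1.
have -> : zc i0 b / E a1 b1 = iota (p i0)^-1 * (ell i0 b / ell a1 b1).
  have ip : iota (p i0) != 0 by rewrite fmorph_eq0.
  by rewrite ell0E // ellE' fmorphV; field; rewrite E1 y0 ip.
by apply: lr_M; [exact: lr_C|exact: blow_ell].
Qed.

(** Here u is an exceptional equation. With t = w/u, the coordinates of the blowup are y_i / y_i1
    times (g' + d' t)/(g + d t), with g, d, g', d' regular at p. So R is generated by the ring of p,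
    t and inverses of units, which gives minimality and the parameters. *)
Lemma blow_quad : lunit R (u / E a1 b1) -> exists c, isquad Op u w c R /\
  params R u (w / u - iota c).
Proof.
move=> [RuE evuE]; have [Ou Ow eu ew huw] := uw.
have uE0 := lr_neq0 evuE.
have u0 : u != 0 by apply: contra_neq uE0 => ->; rewrite mul0r.
have RwE := blow_max_div Ow ew.
have tE : w / u = w / E a1 b1 / (u / E a1 b1) by field; rewrite u0 E1.
have Rt : R (w / u) by rewrite tE; apply: lr_div.
pose t := w / u; rewrite -/t in Rt *; pose c := lr_ev R t.
have lin h : lmax Op h -> exists g d, [/\ Op g, Op d & h = (g + d * t) * u].
  move=> [Oh eh]; have [g [d [Og Od ->]]] := huw h Oh eh.
  by exists g, d; split=> //; rewrite mulrDl -mulrA /t divfK.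
have [g [d [Og Od EE]]] := lin _ (E_max a1 b1).
have Rg := (pR Og).1; have Rd := (pR Od).1.
have gd0 : g + d * t != 0 by apply: contra_neq E1; rewrite EE => ->; rewrite mul0r.
have Rgd : R (g + d * t) by apply: lr_D => //; apply: lr_M.
have gdu : lr_ev R (g + d * t) != 0.
  have e1 : u / E a1 b1 * (g + d * t) = 1 by rewrite EE; field; rewrite u0 gd0.
  apply: contra_eq_neq (lr_ev1 R) => z.
  by rewrite -e1 lr_evM // z mulr0 eq_sym oner_neq0.
have Oy i : Op (y i / y i1) by apply: (ap ((lr_at_gen ai).1 i)).1.
have gens m : exists i g' d', [/\ Op g', Op d' &
    @vgen k B m / (y i1 * ell a1 b1) = y i / y i1 * ((g' + d' * t) / (g + d * t))].
  have [i [a [b ->]]] := vgenBP m; have [g' [d' [Og' Od' EE']]] := lin _ (E_max a b).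
  exists i, g', d'; split=> //; rewrite vgenB -mulf_div; congr (_ * _).
  by rewrite !ellE' EE EE'; field; rewrite gd0 u0 y0.
exists c; split.
  split=> // R' pR' R't et.
  have R'gd g' d' : Op g' -> Op d' -> R' (g' + d' * t) /\ lr_ev R' (g' + d' * t) = lr_ev R (g' + d' * t).
    move=> Og' Od'; have [R1 e1] := pR' _ Og'; have [R2 e2] := pR' _ Od'.
    have [R3 e3] := pR Og'; have [R4 e4] := pR Od'.
    split; first by apply: lr_D => //; apply: lr_M.
    rewrite (lr_evD R1 (lr_M R2 R't)) (lr_evM R2 R't) (lr_evD R3 (lr_M R4 Rt)) (lr_evM R4 Rt).
    by rewrite e1 e2 e3 e4 et.
  have key m : R' (@vgen k B m / (y i1 * ell a1 b1)) /\
     lr_ev R' (@vgen k B m / (y i1 * ell a1 b1)) = lr_ev R (@vgen k B m / (y i1 * ell a1 b1)).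
    have [i [g' [d' [Og' Od' ->]]]] := gens m.
    have [R1 e1] := R'gd _ _ Og' Od'; have [R2 e2] := R'gd _ _ Og Od.
    have [R3 e3] := pR' _ (Oy i); have [R4 e4] := pR (Oy i).
    have R5 : R (g' + d' * t) by apply: lr_D; [exact: (pR Og').1|apply: lr_M => //; exact: (pR Od').1].
    have u2 : lr_ev R' (g + d * t) != 0 by rewrite e2.
    have R6 : R' ((g' + d' * t) / (g + d * t)) by apply: lr_div.
    have R7 : R ((g' + d' * t) / (g + d * t)) by apply: lr_div.
    split; first exact: lr_M.
    rewrite (lr_evM R3 R6) (lr_evM (pR (Oy i)).1 R7) (lr_evdiv R1 R2 u2) (lr_evdiv R5 Rgd gdu).
    by rewrite e1 e2 e3 e4.
  by apply: (gen_lle blow_gen) => m; case: (key m).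
have [Ru eu'] := pR Ou; rewrite eu in eu'.
have Rtc : R (t - iota c) by apply: lr_B => //; apply: lr_C.
have etc : lr_ev R (t - iota c) = 0 by rewrite lr_evB ?lr_evC ?subrr //; apply: lr_C.
pose In h := exists r s, [/\ R r, R s & h = r * u + s * (t - iota c)].
have InD f h : In f -> In h -> In (f + h).
  move=> [r [s [Rr Rs ->]]] [r' [s' [Rr' Rs' ->]]]; exists (r + r'), (s + s').
  by split; [exact: lr_D|exact: lr_D|ring].
have InM f h : R f -> In h -> In (f * h).
  move=> Rf [r [s [Rr Rs ->]]]; exists (f * r), (f * s).
  by split; [exact: lr_M|exact: lr_M|ring].
(* Functions congruent to their value modulo (u, t - c) are closed under the operations that
   generate R. *)
pose P h := R h /\ In (h - iota (lr_ev R h)).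
have PC e : P (iota e).
  split; [exact: lr_C|rewrite lr_evC subrr; exists 0, 0].
  by split; [exact: lr_0|exact: lr_0|ring].
have PD f h : P f -> P h -> P (f + h).
  move=> [Rf If] [Rh Ih]; split; first exact: lr_D.
  by rewrite lr_evD // rmorphD opprD addrACA; apply: InD.
have PM f h : P f -> P h -> P (f * h).
  move=> [Rf If] [Rh Ih]; split; first exact: lr_M.
  rewrite lr_evM // rmorphM; set f0 := iota _; set h0 := iota _.
  have -> : f * h - f0 * h0 = f * (h - h0) + h0 * (f - f0) by ring.
  by apply: InD; apply: InM => //; exact: lr_C.
have PV h : P h -> lr_ev R h != 0 -> P h^-1.
  move=> [Rh Ih] eh; split; first exact: lr_V.
  rewrite lr_evV // fmorphV; have h0 := lr_neq0 eh.
  have h0' : iota (lr_ev R h) != 0 by rewrite fmorph_eq0.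
  have -> : h^-1 - (iota (lr_ev R h))^-1 = - (h^-1 * iota (lr_ev R h)^-1) * (h - iota (lr_ev R h)).
    by rewrite fmorphV; field; rewrite h0 h0'.
  apply: InM => //; apply/lr_N/lr_M; [exact: lr_V|exact: lr_C].
have Pp h : Op h -> P h.
  move=> Oh; have [Rh eh] := pR Oh; split=> //.
  have [|g' [d' [Og' Od' ->]]] := lin (h - iota (lr_ev R h)).
    split; first by apply: lr_B => //; apply: lr_C.
    by rewrite lr_evB ?lr_evC ?eh ?subrr //; apply: lr_C.
  exists (g' + d' * t), 0; split; [|exact: lr_0|ring].
  by apply: lr_D; [exact: (pR Og').1|apply: lr_M => //; exact: (pR Od').1].
have Pt : P t.
  split=> //; exists 0, 1; split; [exact: lr_0|exact: lr_1|by rewrite mul0r add0r mul1r].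
have Pgen m : P (@vgen k B m / (y i1 * ell a1 b1)).
  have [i [g' [d' [Og' Od' ->]]]] := gens m.
  apply: (PM) => //; first exact: Pp.
  apply: (PM); first by apply: (PD); [exact: Pp|apply: PM => //; exact: Pp].
  by apply: PV => //; apply: PD; [exact: Pp|apply: PM => //; exact: Pp].
have Ppol F : P (mmap iota (fun m => @vgen k B m / (y i1 * ell a1 b1)) F).
  elim/mpoly_ring_ind: F => [e|l|F G IF IG|F G IF IG].
  - rewrite mmapC; exact: PC.
  - rewrite mmapX mmap1U; exact: Pgen.
  - by rewrite mmapD; apply: PD.
  - by rewrite rmorphM; apply: PM.
split=> // h Rh eh; have [F [G [eG hE]]] := blow_gen.2 h Rh.
have [_ Ih] : P h by rewrite hE; apply: PM => //; apply: PV.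
by rewrite eh rmorph0 subr0 in Ih.
Qed.
End OverCenter.
End OverPoint.
End Blowup.

(** * Modifications *)

Section BlowupSurface.
Variables (k : numClosedFieldType) (Y : surface k) (p : cpoint Y).
Hypothesis nz : two_ders (viota Y).
Let idk : {rmorphism k -> k} := idfun.
Local Notation y := (@vgen k Y).
Local Notation iota := (viota Y).
Local Notation L := (vfield Y).
Local Notation Op := (lr_at p).
Local Notation B := (blowup_model p).

(** Above p, write E = g u + d w; then g (u/E) + d (w/E) = 1, so u/E or w/E is a unit and u or w is
    an exceptional equation. When u/E is not a unit, u/w vanishes, which is why the second chart
    contributes only slope 0. *)
Lemma blow_cases (q : cpoint B) (R : lring iota := lr_at q) : exists al : cpoint Y, lle (lr_at al) R /\
  ((~ same_point al p /\ lle R (lr_at al)) \/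
   (same_point al p /\ forall u w, params Op u w ->
     (exists c, isquad Op u w c R /\ params R u (w / u - iota c)) \/
     (isquad Op w u 0 R /\ params R w (u / w - iota 0)))).
Proof.
have [m qm] := pt_neq0 q; have [i1 [a1 [b1 mE]]] := vgenBP m; rewrite mE in qm.
have [al [ai1 aR]] := blow_below qm; have ai : al i1 != 0 by rewrite ai1 oner_neq0.
exists al; split=> //; have [alp|nalp] := pselect (same_point al p); last first.
  by left; split=> //; exact: (blow_off qm ai aR nalp).
right; split=> // u w uw; have [i0 pi0] := pt_neq0 p.
have [Ou Ow eu ew huw] := uw.
have pR : lle Op R by exact: (lle_trans (same_point_lle (same_point_sym alp))).
pose E := iota (p a1) * zc p i0 b1 - iota (p b1) * zc p i0 a1.
have [OE eE] : lmax Op E by exact: E_max.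
have [g [d [Og Od EE]]] := huw _ OE eE.
have RuE : R (u / E) by exact: (blow_max_div qm aR alp pi0 Ou eu).
have RwE : R (w / E) by exact: (blow_max_div qm aR alp pi0 Ow ew).
have E0 : E != 0.
  have l0 : ell p a1 b1 != 0.
    have := pt_gen (j := idk) (y := q) qm; rewrite vgenB; apply: contra_neq => ->.
    by rewrite mulr0.
  by apply: contra_neq l0; rewrite (ellE pi0) -/E => ->; rewrite mulr0.
have e1 : g * (u / E) + d * (w / E) = 1 by rewrite !mulrA -mulrDl -EE divff.
have [euE|nuE] := eqVneq (lr_ev R (u / E)) 0; last first.
  by left; exact: (blow_quad qm ai aR alp pi0 uw).
have ewE : lr_ev R (w / E) != 0.
  have [Rg eg] := pR _ Og; have [Rd ed] := pR _ Od.
  apply: contra_eq_neq (lr_ev1 R) => z.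
  have := congr1 (lr_ev R) e1; rewrite (lr_evD (lr_M Rg RuE) (lr_M Rd RwE)).
  by rewrite (lr_evM Rg RuE) (lr_evM Rd RwE) euE z !mulr0 addr0 => <-; rewrite eq_sym oner_neq0.
right; have [c [hq hp]] := blow_quad qm ai aR alp pi0 (params_sym uw) (conj RwE ewE).
have c0 : c = 0.
  case: hq => _ _ <- _.
  have w0 : w != 0 by apply: contra_neq (lr_neq0 ewE) => ->; rewrite mul0r.
  have -> : u / w = u / E / (w / E) by field; rewrite w0 E0.
  by rewrite lr_evdiv // euE mul0r.
by rewrite -c0.
Qed.

Lemma blowup_smooth (q : cpoint B) : exists u w, local_params q u w.
Proof.
have [al [aR [[_ Ra]|[alp hq]]]] := blow_cases q.
  have [u [w [[Ou eu] [Ow ew] h]]] : exists u w, [/\ lr_at al u /\ lr_ev (lr_at al) u = 0,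
      lr_at al w /\ lr_ev (lr_at al) w = 0 & forall h, lr_at al h -> lr_ev (lr_at al) h = 0 ->
      exists r s, [/\ lr_at al r, lr_at al s & h = r * u + s * w]].
    by have [u [w /local_paramsP[]]] := s_smooth al; exists u, w.
  exists u, w; apply/local_paramsP.
  have [h1 e1] := aR _ Ou; have [h2 e2] := aR _ Ow; rewrite eu in e1; rewrite ew in e2.
  split=> // f Rf ef; have [h3 e3] := Ra _ Rf; rewrite ef in e3.
  have [r [s [Or Os fE]]] := h f h3 e3; exists r, s.
  by split=> //; [exact: (aR _ Or).1|exact: (aR _ Os).1].
have [u [w /local_paramsP uw]] := s_smooth p.
have [[c [_ hp]]|[_ hp]] := hq u w uw.
  by exists u, (w / u - iota c); apply/local_paramsP.
by exists w, (u / w - iota 0); apply/local_paramsP.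
Qed.

Definition blowup_surface : surface k :=
  @Surface k B (@blowup_neq0 k Y p) (@blowup_gen k Y p) (s_dim Y) blowup_smooth.

Lemma blowdown_dom : dom_by (blowdown p) (idfun : {rmorphism vfield Y -> vfield B}).
Proof. by split=> //; exists 1; rewrite ?oner_neq0 // => i; rewrite mul1r. Qed.

Lemma blowdown_below (q : cpoint B) : exists al : cpoint Y, @dominates k B Y idfun al q.
Proof. by have [al [aR _]] := blow_cases q; exists al. Qed.

Lemma blow_lift_off (al : cpoint Y) : ~ same_point al p -> exists q : cpoint B,
  lle (lr_at q : lring iota) (lr_at al) /\ lle (lr_at al) (lr_at q : lring iota).
Proof.
move=> np; have [j aj] := pt_neq0 al.
have [c [d cd]] : exists c d, p c * al d - p d * al c != 0.
  apply: contrapT => nh; apply: np; apply: proportional => c d.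
  apply/eqP; rewrite -subr_eq0; apply/negPn/negP => e; by apply: nh; exists c, d.
have Oa := (lr_at_gen aj).1.
have yj : y j != 0 := pt_gen (j := idk) (y := al) aj.
pose e a b := ell p a b / y j.
have eE a b : e a b = iota (p a) * (y b / y j) - iota (p b) * (y a / y j).
  by rewrite /e /ell mulrBl !mulrA.
have Oe a b : lr_at al (e a b).
  by rewrite eE; apply: lr_B; apply: lr_M => //; apply: lr_C.
have evy l : lr_ev (lr_at al) (y l / y j) = al l / al j.
  by apply: pt_evE; exact: (@eval_coord k Y k idk al j aj l).
have OCy a b : lr_at al (iota a * (y b / y j)) by apply: lr_M => //; apply: lr_C.
have ue : lr_ev (lr_at al) (e c d) != 0.
  rewrite eE lr_evB // (lr_evM (lr_C _ (p c)) (Oa d)) (lr_evM (lr_C _ (p d)) (Oa c)) !lr_evC !evy.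
  by rewrite !mulrA -mulrBl mulf_neq0 ?invr_eq0 //.
have lcd : ell p c d != 0 by apply: contra_neq (lr_neq0 ue); rewrite /e => ->; rewrite mul0r.
pose m0 : 'I_(vcoords B) := enum_rank (j, c, d).
have vm0 : @vgen k B m0 != 0 by rewrite vgenB mulf_neq0.
have [|q [_ hq]] := @point_of k B L iota (idfun : {rmorphism vfield B -> L}) (lr_at al) (fun c => erefl) m0 vm0.
  move=> m; have [i [a [b ->]]] := vgenBP m; rewrite !vgenB.
  suff h : lr_at al (y i * ell p a b / (y j * ell p c d)) by exact: h.
  rewrite -mulf_div; apply: lr_M => //.
  have -> : ell p a b / ell p c d = e a b / e c d by rewrite /e; field; rewrite lcd yj.
  exact: lr_div.
exists q; have qa : lle (lr_at q : lring iota) (lr_at al) by exact: hq.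
split=> //; have [al' [aR _]] := blow_cases q.
have aa := lle_same_point (lle_trans aR qa).
exact: (lle_trans (same_point_lle (same_point_sym aa))).
Qed.

(** Since w/u is regular, each [zc] is s_b u with s_b in R. As u is a combination of the [zc], some
    s_d is a unit, and its coordinate normalizes the point. *)
Lemma blow_lift_quad (R : lring iota) u w : params Op u w -> lle Op R -> R (w / u) ->
  exists q : cpoint B, lle (lr_at q : lring iota) R.
Proof.
move=> uw pR Rt; have [Ou Ow eu ew huw] := uw; have [i0 pi0] := pt_neq0 p.
have u0 := params_neq0 (surface_regular2 p nz) uw.
have y0 : y i0 != 0 := pt_gen (j := idk) (y := p) pi0.
pose t := w / u; rewrite -/t in Rt.
have lin h : lmax Op h -> exists g d, [/\ Op g, Op d & h = (g + d * t) * u].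
  move=> [Oh eh]; have [g [d [Og Od ->]]] := huw h Oh eh.
  by exists g, d; split=> //; rewrite mulrDl -mulrA /t divfK.
have /choice[s sP] : forall b, exists s, R s /\ zc p i0 b = s * u.
  move=> b; have [g [d [Og Od ->]]] := lin _ (zc_max pi0 b).
  exists (g + d * t); split=> //; apply: lr_D; first exact: (pR _ Og).1.
  by apply: lr_M => //; exact: (pR _ Od).1.
have [r [Or uE]] := zc_gen pi0 Ou eu.
have Rsum : \sum_b r b * s b = 1.
  apply: (mulIf u0); rewrite mul1r mulr_suml [RHS]uE; apply: eq_bigr => b _.
  by rewrite -mulrA -(sP b).2.
have [d sd] : exists d, lr_ev R (s d) != 0.
  apply: contrapT => ns.
  have z b : lr_ev R (s b) = 0.
    by apply/eqP/negPn/negP => h; apply: ns; exists b.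
  have : R (\sum_b r b * s b) /\ lr_ev R (\sum_b r b * s b) = 0.
    apply: (big_ind (fun h => R h /\ lr_ev R h = 0)); first by split; [exact: lr_0|exact: lr_ev0].
      by move=> f g [Rf ef] [Rg eg]; split; [exact: lr_D|rewrite lr_evD // ef eg addr0].
    move=> b _; have Rr := (pR _ (Or b)).1; have Rs := (sP b).1.
    by split; [exact: lr_M|rewrite lr_evM // z mulr0].
  by rewrite Rsum lr_ev1 => -[_ /eqP]; rewrite oner_eq0.
have sd0 := lr_neq0 sd.
have zd0 : zc p i0 d != 0 by rewrite (sP d).2 mulf_neq0.
have ip : iota (p i0) != 0 by rewrite fmorph_eq0.
pose m0 : 'I_(vcoords B) := enum_rank (i0, i0, d).
have l0 : ell p i0 d != 0 by rewrite (ell0E pi0) !mulf_neq0.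
have vm0 : @vgen k B m0 != 0 by rewrite vgenB mulf_neq0.
have [|q [_ hq]] := @point_of k B L iota (idfun : {rmorphism vfield B -> L}) R (fun c => erefl) m0 vm0.
  move=> m; have [i [a [b ->]]] := vgenBP m; rewrite !vgenB.
  suff h : R (y i * ell p a b / (y i0 * ell p i0 d)) by exact: h.
  rewrite -mulf_div; apply: lr_M => //.
    exact: (pR _ ((lr_at_gen pi0).1 i)).1.
  have -> : ell p a b / ell p i0 d = (iota (p a) * s b - iota (p b) * s a) * iota (p i0)^-1 / s d.
    rewrite (ellE pi0) (ell0E pi0) (sP a).2 (sP b).2 (sP d).2 fmorphV; field.
    by rewrite y0 ip sd0 u0.
  apply: lr_div; [|exact: (sP d).1|by []]; apply: lr_M; last exact: lr_C.
  by apply: lr_B; (apply: lr_M; [exact: lr_C|]); [exact: (sP b).1|exact: (sP a).1].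
by exists q; exact: hq.
Qed.
End BlowupSurface.

Section Modifications.
Variable k : numClosedFieldType.

Lemma isomorphismP (X Y : pvar k) (g : ratmap X Y) : generates_field X -> generates_field Y ->
  isomorphism g -> exists (phi : {rmorphism vfield Y -> vfield X})
    (psi : {rmorphism vfield X -> vfield Y}) (g' : ratmap Y X),
    [/\ birmor g phi, birmor g' psi, cancel phi psi & cancel psi phi].
Proof.
move=> gX gY [mg [g' mg' ig]]; have [phi [psi [dg dg' c1 c2]]] := inverse_maps_dom gX gY ig.
exists phi, psi, g'; split=> //; split=> //; [by exists psi|by exists phi].
Qed.

Lemma isomorphism_birmor (X Y : pvar k) (g : ratmap X Y) (g' : ratmap Y X) phi psi :
  vgen_neq0 X -> vgen_neq0 Y ->
  generates_field X -> generates_field Y -> birmor g phi -> birmor g' psi ->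
  cancel phi psi -> cancel psi phi -> isomorphism g.
Proof.
move=> nX nY gX gY [dg mg _] [dg' mg' _] c1 c2; split=> //; exists g' => //.
exact: (dom_inverse_maps gX gY dg dg' c1 c2 nX nY).
Qed.

Lemma birmor_comp (X Y Z : pvar k) (f : ratmap X Y) (g : ratmap Y Z) (h : ratmap X Z) pf pg :
  birmor f pf -> birmor g pg -> dom_by h (pf \o pg) -> birmor h (pf \o pg).
Proof.
move=> [df mf [qf [f1 f2]]] [dg mg [qg [g1 g2]]] dh; split=> //.
  apply/(morphism_dominates dh) => a.
  have [b ba] := (morphism_dominates df).1 mf a.
  have [c cb] := (morphism_dominates dg).1 mg b.
  by exists c; exact: (dominates_comp ba cb).
exists (qg \o qf); split=> u /=; first by rewrite f1 g1.
by rewrite g2 f2.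
Qed.

Lemma isomorphism_comp (X Y Z : pvar k) (f : ratmap X Y) (g : ratmap Y Z) (h : ratmap X Z) pf pg :
  vgen_neq0 X -> vgen_neq0 Z -> generates_field X -> generates_field Y -> generates_field Z ->
  isomorphism f -> isomorphism g -> dom_by f pf -> dom_by g pg -> dom_by h (pf \o pg) ->
  isomorphism h.
Proof.
move=> nX nZ gX gY gZ /(isomorphismP gX gY)[pf' [qf [f' [bf bf' f1 f2]]]].
move=> /(isomorphismP gY gZ)[pg' [qg [g' [bg bg' g1 g2]]]] df dg dh.
have [df' _ _] := bf; have [dg' _ _] := bg.
have ef := dom_by_inj gY df' df; have eg := dom_by_inj gZ dg' dg.
have dh' : dom_by h (pf' \o pg').
  have [hc [c c0 hE]] := dh; split=> [e|]; first by rewrite -hc /= ef eg.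
  by exists c => // i; rewrite hE /= ef eg.
have bh := birmor_comp bf bg dh'.
have [h' dh2] : exists h' : ratmap Z X, dom_by h' (qg \o qf).
  apply: dom_point => // c /=; have [dqf _ _] := bf'; have [dqg _ _] := bg'.
  by rewrite (dqf.1 c) (dqg.1 c).
have bh' := birmor_comp bg' bf' dh2.
apply: (isomorphism_birmor nX nZ gX gZ bh bh') => u /=; first by rewrite f1 g1.
by rewrite g2 f2.
Qed.

Lemma modification_birmor (S X : surface k) (pi : ratmap X S) : modification pi -> exists phi, birmor pi phi.
Proof.
elim=> {X pi} [X pi ipi|X Y p rho beta pi mrho [phi brho] [theta itheta cbeta] cpi].
  have [phi [psi [g' [bp _ _ _]]]] := isomorphismP (s_gen (s := X)) (s_gen (s := S)) ipi.
  by exists phi.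
have gB := @blowup_gen k Y p.
have [pt [_ [_ [bt _ _ _]]]] := isomorphismP (s_gen (s := X)) gB itheta.
have [dt mt [qt [t1 t2]]] := bt; have dd := blowdown_dom p.
have dbeta : dom_by beta (pt \o idfun) by apply/(comp_dom _ gB dt dd).
have bd : birmor (blowdown p) (idfun : {rmorphism vfield Y -> vfield (blowup_model p)}).
  split=> //; last by exists idfun.
  by apply/(morphism_dominates dd); exact: blowdown_below.
have bbeta := birmor_comp bt bd dbeta.
have [drho _ _] := brho.
exists ((pt \o idfun) \o phi); apply: (birmor_comp bbeta brho).
by apply/(comp_dom _ (s_gen (s := Y)) dbeta drho).
Qed.

Lemma modification_iso_comp (S X Z : surface k) (pi : ratmap X S) (f : ratmap Z X) (h : ratmap Z S) pf pp :
  modification pi -> isomorphism f -> dom_by f pf -> dom_by pi pp ->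
  dom_by h (pf \o pp) -> modification h.
Proof.
move=> mpi isf df dp dh; case: mpi f h pf pp isf df dp dh => {X pi}
  [X pi ipi|X Y p rho beta pi mrho [theta itheta cbeta] cpi] f h pf pp isf df dp dh.
  apply: modification_iso.
  exact: (isomorphism_comp (s_neq0 Z) (s_neq0 S) (s_gen (s:=Z)) (s_gen (s:=X)) (s_gen (s:=S)) isf ipi df dp dh).
have [prho brho] := modification_birmor mrho; have [drho _ _] := brho.
have gB := @blowup_gen k Y p; have gX := s_gen (s := X).
have [pt [_ [_ [bt _ _ _]]]] := isomorphismP gX gB itheta.
have [dt mt [qt [t1 t2]]] := bt; have dd := blowdown_dom p.
have dbeta : dom_by beta (pt \o idfun) by apply/(comp_dom _ gB dt dd).
have dpi' := (comp_dom pi (s_gen (s := Y)) dbeta drho).1 cpi.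
have pE := dom_by_inj (s_gen (s := S)) dp dpi'.
have [pfc _] := df; have [ptc _] := dt.
have [th dth] : exists th : ratmap Z (blowup_model p), dom_by th (pf \o pt).
  by apply: dom_point => [|c /=]; [exact: blowup_neq0|rewrite ptc pfc].
have [be dbe] : exists be : ratmap Z Y, dom_by be ((pf \o pt) \o idfun).
  by apply: dom_point => [|c /=]; [exact: s_neq0|rewrite (ptc c) pfc].
apply: (@modification_blowup k S Z Y p rho be h mrho).
  exists th; last by apply/(comp_dom _ gB dth dd).
  exact: (isomorphism_comp (s_neq0 Z) (@blowup_neq0 k Y p) (s_gen (s:=Z)) gX gB isf itheta df dt dth).
apply/(comp_dom _ (s_gen (s := Y)) dbe drho).
have [hc [c c0 hE]] := dh; split=> [e|]; first by rewrite -hc /= pE.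
by exists c => // i; rewrite hE /= pE.
Qed.

(** Induction on the upper tower; the isomorphism at its bottom is absorbed by
    [modification_iso_comp] into the last blowup of the lower one. *)
Lemma modification_comp (S X Z : surface k) (pi : ratmap X S) (f : ratmap Z X) (h : ratmap Z S) pf pp :
  modification pi -> modification f -> dom_by f pf -> dom_by pi pp ->
  dom_by h (pf \o pp) -> modification h.
Proof.
move=> mpi mf df dp dh.
have bpi : birmor pi pp.
  have [p' bp'] := modification_birmor mpi; have [dp' mp' [q [h1 h2]]] := bp'.
  have e := dom_by_inj (s_gen (s := S)) dp' dp.
  by split=> //; exists q; split=> u; rewrite -?e.
elim: mf h pf df dh => {Z f} [Z f isf|Z Y p rho beta f mrho IH [theta itheta cbeta] cf] h pf df dh.
  exact: (modification_iso_comp mpi isf df dp dh).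
have [prho brho] := modification_birmor mrho; have [drho _ _] := brho.
have gB := @blowup_gen k Y p.
have [pt [_ [_ [bt _ _ _]]]] := isomorphismP (s_gen (s := Z)) gB itheta.
have [dt mt [qt [t1 t2]]] := bt; have dd := blowdown_dom p.
have dbeta : dom_by beta (pt \o idfun) by apply/(comp_dom _ gB dt dd).
have df' := (comp_dom f (s_gen (s := Y)) dbeta drho).1 cf.
have fE := dom_by_inj (s_gen (s := X)) df df'.
have [prc _] := drho; have [ppc _] := dp.
have [g dg] : exists g : ratmap Y S, dom_by g (prho \o pp).
  by apply: dom_point => [|c /=]; [exact: s_neq0|rewrite ppc prc].
have mg := IH g prho drho dg.
apply: (@modification_blowup k S Z Y p g beta h mg); first by exists theta.
apply/(comp_dom _ (s_gen (s := Y)) dbeta dg).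
have [hc [c c0 hE]] := dh; split=> [e|]; first by rewrite -hc /= fE.
by exists c => // i; rewrite hE /= fE.
Qed.
End Modifications.

(** * Elimination of indeterminacy *)

Section KSpan.
Variables (k : numFieldType) (L : fieldType) (iota : {rmorphism k -> L}).

Fixpoint kspan (s : seq L) (v : L) : Prop :=
  if s is b :: s' then exists (c : k) v', kspan s' v' /\ v = iota c * b + v' else v = 0.

Definition ksub (U : L -> Prop) := [/\ U 0, forall x y, U x -> U y -> U (x + y)
  & forall c x, U x -> U (iota c * x)].

Lemma ksubB U x y : ksub U -> U x -> U y -> U (x - y).
Proof.
move=> [_ UD UM] Ux Uy; apply: UD => //.
by rewrite -mulN1r -(rmorph1 iota) -rmorphN; apply: UM.
Qed.

Lemma kspan_sub s : ksub (kspan s).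
Proof.
elim: s => [|b s [S0 SD SM]] /=.
  by split=> [//|x y -> ->|c x ->]; rewrite ?addr0 ?mulr0.
split=> [|x y [c [x' [sx ->]]] [d [y' [sy ->]]]|c x [d [x' [sx ->]]]].
- by exists 0, 0; rewrite rmorph0 mul0r addr0.
- exists (c + d), (x' + y'); split; first exact: SD.
  by rewrite rmorphD mulrDl addrACA.
- exists (c * d), (iota c * x'); split; first exact: SM.
  by rewrite rmorphM mulrDr mulrA.
Qed.

Definition modspan (I : L -> Prop) s v := exists a, kspan s a /\ I (v - a).

Lemma modspan_sub I s : ksub I -> ksub (modspan I s).
Proof.
move=> [I0 ID IM]; have [S0 SD SM] := kspan_sub s.
split=> [|x y [a [sa Ia]] [b [sb Ib]]|c x [a [sa Ia]]].
- by exists 0; rewrite subr0.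
- by exists (a + b); split; [exact: SD|rewrite opprD addrACA; exact: ID].
- by exists (iota c * a); split; [exact: SM|rewrite -mulrBr; exact: IM].
Qed.

Lemma modspan_I I s v : I v -> modspan I s v.
Proof. by move=> Iv; exists 0; split; [case: (kspan_sub s)|rewrite subr0]. Qed.

(** A proper subspace has smaller dimension modulo I, [size s] standing for a bound on the
    dimension. If some y in U involves the first vector b, it replaces b, and induction treats the
    part of U free of b. *)
Lemma subspace_span (I U : L -> Prop) s : ksub I -> ksub U -> (forall v, I v -> U v) ->
  (forall v, U v -> modspan I s v) -> (exists v, modspan I s v /\ ~ U v) ->
  exists s', (size s' < size s)%N /\ forall v, U v -> modspan I s' v.
Proof.
move=> kI; have [I0 ID IM] := kI; elim: s U => [|b s IH] U kU IU UV [v0 [Vv0 nUv0]].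
  by case: nUv0; apply: IU; case: Vv0 => a [/= ->]; rewrite subr0.
have [U0 UD UM] := kU.
have step v : modspan I (b :: s) v -> exists c, modspan I s (v - iota c * b).
  move=> [a [[c [a' [sa ->]]] Ia]]; exists c, a'; split=> //.
  by rewrite -addrA -opprD.
have [h|/existsNP[y /not_implyP[Uy ny]]] := pselect (forall v, U v -> modspan I s v).
  have [ex|nex] := pselect (exists v, modspan I s v /\ ~ U v).
    have [s' [ss' hs']] := IH U kU IU h ex.
    by exists s'; split=> //; apply: ltn_trans ss' _.
  by exists s.
have [c cy] := step _ (UV _ Uy).
have c0 : c != 0 by apply/eqP => c0; apply: ny; move: cy; rewrite c0 rmorph0 mul0r subr0.
have ic0 : iota c != 0 by rewrite fmorph_eq0.
pose U1 v := U v /\ modspan I s v.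
have [m0 mD mM] := modspan_sub s kI.
have kU1 : ksub U1.
  split=> [|x z [Ux sx] [Uz sz]|d x [Ux sx]]; first by split.
    by split; [exact: UD|exact: mD].
  by split; [exact: UM|exact: mM].
have [|||s' [ss' hs']] := IH U1 kU1.
- by move=> v Iv; split; [exact: IU|exact: modspan_I].
- by move=> v [].
- have [//|nex] := pselect (exists v, modspan I s v /\ ~ U1 v).
  have sU v : modspan I s v -> U v.
    by move=> sv; apply: contrapT => nU; apply: nex; exists v; split=> // -[].
  exfalso; apply: nUv0; have Ub : U b.
    have -> : b = iota c^-1 * (y - (y - iota c * b)) by rewrite fmorphV; field.
    by apply: UM; apply: ksubB => //; apply: sU.
  have [d dv] := step _ Vv0; rewrite -[v0](subrK (iota d * b)).
  by apply: UD; [exact: sU|exact: UM].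
exists (y :: s'); split=> // v Uv.
have [d dv] := step _ (UV _ Uv).
have [|a [sa Ia]] := hs' (v - iota (d / c) * y).
  split; first by apply: ksubB => //; apply: UM.
  have -> : v - iota (d / c) * y = (v - iota d * b) - iota (d / c) * (y - iota c * b).
    by rewrite fmorph_div; field.
  by apply: ksubB; [split|by []|exact: mM].
exists (iota (d / c) * y + a); split; first by exists (d / c), a.
by rewrite opprD addrA.
Qed.

Lemma modspan_dep (I : L -> Prop) s n (f : 'I_n -> L) : ksub I -> (size s < n)%N ->
  (forall i, modspan I s (f i)) ->
  exists c : 'I_n -> k, (exists i, c i != 0) /\ I (\sum_i iota (c i) * f i).
Proof.
move=> kI; have [I0 ID IM] := kI.
have kE (t : seq L) v : kspan t v -> exists c : nat -> k, v = \sum_(j < size t) iota (c j) * t`_j.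
  elim: t v => [|b t IH] v /=; first by move=> ->; exists (fun=> 0); rewrite big_ord0.
  move=> [d [v' [/IH[c ->] ->]]]; exists (fun j => if j is j'.+1 then c j' else d).
  by rewrite big_ord_recl.
move=> sn fs.
have /choice[T TP] : forall i, exists c : nat -> k, I (f i - \sum_(j < size s) iota (c j) * s`_j).
  by move=> i; have [a [/kE[c ->] Ia]] := fs i; exists c.
pose M := \matrix_(i < n, j < size s) T i j.
have : kermx M != 0.
  by rewrite kermx_eq0 -row_leq_rank -ltnNge (leq_ltn_trans (rank_leq_col M)).
move=> /rowV0Pn[v /sub_kermxP vM v0].
exists (fun i => v o0 i); split.
  apply: contrapT => nv; move/eqP: v0; apply; apply/rowP => i; rewrite mxE.
  by apply/eqP/negPn/negP => h; apply: nv; exists i.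
have -> : \sum_i iota (v o0 i) * f i =
    \sum_i iota (v o0 i) * (f i - \sum_(j < size s) iota (T i j) * s`_j).
  have z : \sum_i iota (v o0 i) * \sum_(j < size s) iota (T i j) * s`_j = 0.
    under eq_bigr do rewrite mulr_sumr.
    rewrite exchange_big /= big1 // => j _.
    have := congr1 (fun A : 'M_(_, _) => A o0 j) vM; rewrite !mxE => e.
    have -> : \sum_i iota (v o0 i) * (iota (T i j) * s`_j) = iota 0 * s`_j; last by rewrite rmorph0 mul0r.
    rewrite -e rmorph_sum mulr_suml /=.
    by apply: eq_bigr => i _; rewrite mxE rmorphM mulrA.
  by under [RHS]eq_bigr do rewrite mulrBr; rewrite sumrB z subr0.
by apply: (big_ind I) => // i _; apply: IM.
Qed.
End KSpan.

(** * Powers of the maximal ideal and leading forms *)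

Section IdealPowers.
Variables (k : numClosedFieldType) (L : fieldType) (iota : {rmorphism k -> L}).
Variable O : lring iota.
Local Notation ev := (lr_ev O).

(** The n-th power of the maximal ideal (u, w). *)
Fixpoint mp (u w : L) (n : nat) (h : L) : Prop :=
  if n is n'.+1 then exists r s, [/\ mp u w n' r, mp u w n' s & h = r * u + s * w] else O h.

Variables (u w : L).
Hypothesis uw : params O u w.
Let Ou : O u. Proof. by case: uw. Qed.
Let Ow : O w. Proof. by case: uw. Qed.

Lemma mp_lideal n : lideal O (mp u w n).
Proof.
elim: n => [|n [MO M0 MD MM]] /=.
  by split=> // *; [exact: lr_0|exact: lr_D|exact: lr_M].
split=> [h [r [s [/MO Or /MO Os ->]]]||h g [r [s [mr ms ->]]] [r' [s' [mr' ms' ->]]]|a h Oa [r [s [mr ms ->]]]].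
- by apply: lr_D; apply: lr_M.
- by exists 0, 0; split=> //; ring.
- by exists (r + r'), (s + s'); split; [exact: MD|exact: MD|ring].
- by exists (a * r), (a * s); split; [exact: MM|exact: MM|ring].
Qed.

Lemma mpS n h : mp u w n.+1 h -> mp u w n h.
Proof.
elim: n h => [|n IH] h.
  by move=> [r [s [Or Os ->]]] /=; apply: lr_D; apply: lr_M.
by move=> [r [s [mr ms ->]]]; exists r, s; split=> //; apply: IH.
Qed.

Lemma mp_le n m h : (n <= m)%N -> mp u w m h -> mp u w n h.
Proof. by move/subnK <-; elim: (m - n)%N => // d IH /mpS/IH. Qed.

Lemma mp_mulu n h : mp u w n h -> mp u w n.+1 (h * u).
Proof.
by move=> mh; exists h, 0; split=> //; [case: (mp_lideal n)|ring].
Qed.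

Lemma mp_mulw n h : mp u w n h -> mp u w n.+1 (h * w).
Proof.
by move=> mh; exists 0, h; split=> //; [case: (mp_lideal n)|ring].
Qed.

Lemma mp_gen n (J : L -> Prop) : lideal O J ->
  (forall i, (i <= n)%N -> J (u ^+ i * w ^+ (n - i))) -> forall h, mp u w n h -> J h.
Proof.
elim: n J => [|n IH] J lJ; have [JO J0 JD JM] := lJ.
  move=> /(_ 0%N isT); rewrite expr0 subnn expr0 mulr1 => J1 h Oh.
  by rewrite -[h]mulr1; apply: JM.
move=> Ji h [r [s [mr ms ->]]].
have lid a : O a -> lideal O (fun x => O x /\ J (x * a)).
  move=> Oa; split=> [x []//||x y [Ox Jx] [Oy Jy]|b x Ob [Ox Jx]].
  - by rewrite mul0r; split=> //; exact: lr_0.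
  - by split; [exact: lr_D|rewrite mulrDl; apply: JD].
  - by split; [exact: lr_M|rewrite -mulrA; apply: JM].
apply: JD.
  apply: (IH _ (lid u Ou) _ r mr).2 => i ilen; split; first by apply: lr_M; apply: lr_X.
  by rewrite mulrAC -exprSr -subSS; apply: Ji.
apply: (IH _ (lid w Ow) _ s ms).2 => i ilen; split; first by apply: lr_M; apply: lr_X.
by rewrite -mulrA -exprSr -subSn //; apply: Ji; apply: leqW.
Qed.

Lemma mp1 h : O h -> ev h = 0 -> mp u w 1 h.
Proof. by have [_ _ _ _ huw] := uw; move=> Oh eh; have [r [s [? ? ->]]] := huw h Oh eh; exists r, s. Qed.

Lemma mp_decomp n h : mp u w n.+1 h -> exists f y, [/\ O f, mp u w n y & h = f * w ^+ n.+1 + u * y].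
Proof.
elim: n h => [|n IH] h [r [s [mr ms ->]]].
  by exists s, r; split=> //; rewrite expr1; ring.
have [f [y [Of my ->]]] := IH s ms.
exists f, (r + w * y); split=> //; last by rewrite [in RHS]exprSr; ring.
have [_ _ MD _] := mp_lideal n.+1; apply: MD => //.
by rewrite mulrC; apply: mp_mulw.
Qed.

(* Q is the leading form of h, dehomogenized by w = 1 *)
Lemma leading_form n h : mp u w n h -> exists Q : {poly k},
  (Q = 0 -> mp u w n.+1 h) /\
  forall s : k, exists f y, [/\ O f, ev f = Q.[s], mp u w n.-1 y &
    h = f * w ^+ n + (u - iota s * w) * y].
Proof.
elim: n h => [|n IH] h mh.
  exists (ev h)%:P; split=> [/eqP|s].
    by rewrite polyC_eq0 => /eqP; apply: mp1.
  exists h, 0; rewrite hornerC expr0 mulr1 mulr0 addr0; split=> //; exact: lr_0.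
have [c [r [Oc mr hE]]] := mp_decomp mh; have [Q [Q0 QP]] := IH r mr.
exists (Q * 'X + (ev c)%:P); split=> [Qz|s].
  have cz : ev c = 0.
    by have := congr1 (fun P : {poly k} => P.[0]) Qz; rewrite !hornerE.
  have Qz' : Q = 0.
    move: Qz; rewrite cz polyC0 addr0 => /eqP; rewrite mulf_eq0 polyX_eq0 orbF => /eqP //.
  have [_ _ MD MM] := mp_lideal n.+2; rewrite hE; apply: MD; last first.
    by rewrite mulrC; apply: mp_mulu; apply: Q0.
  have wn m a : mp u w m a -> forall d, mp u w (m + d)%N (a * w ^+ d).
    move=> ma; elim=> [|d IHd]; first by rewrite addn0 expr0 mulr1.
    by rewrite addnS exprSr mulrA; apply: mp_mulw.
  by apply: (wn 1%N _ (mp1 Oc cz) n.+1).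
have [f [y [Of ef my rE]]] := QP s.
exists (c + iota s * f), (r + iota s * w * y); split.
- by apply: lr_D => //; apply: lr_M => //; apply: lr_C.
- rewrite lr_evD ?lr_evM ?lr_evC ?ef // ?hornerE; first by rewrite addrC mulrC.
    exact: lr_C.
  by apply: lr_M => //; exact: lr_C.
- have [_ _ MD MM] := mp_lideal n; apply: MD => //; rewrite -mulrA.
  apply: MM; first exact: lr_C.
  case: (n) my => [|m] my; first exact: lr_M.
  by rewrite mulrC; apply: mp_mulw.
- rewrite hE {1}rE exprS; ring: rE.
Qed.

End IdealPowers.

Section PowerDependence.
Variables (k : numFieldType) (L : fieldType) (iota : {rmorphism k -> L}).
Variables (R : lring iota) (I : L -> Prop).

Lemma lideal_ksub : lideal R I -> ksub iota I.
Proof. by move=> [_ I0 ID IM]; split=> // c x; apply: IM; apply: lr_C. Qed.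

(** The powers of x are dependent modulo I; dividing by the lowest nonzero coefficient leaves x^i (1
    + x q(x)). *)
Lemma pow_dep s x : lideal R I -> (forall i, modspan iota I s (x ^+ i)) ->
  exists i (q : {poly k}), I (x ^+ i * (1 + x * (map_poly iota q).[x])).
Proof.
move=> lI xs; have [_ _ _ IM] := lI.
have [c [[j cj] Ic]] := modspan_dep (f := fun i : 'I_(size s).+1 => x ^+ i)
  (lideal_ksub lI) (ltnSn _) (fun i => xs i).
pose P : {poly k} := \sum_(i < (size s).+1) c i *: 'X^i.
have P0 : P != 0.
  apply/eqP => /(congr1 (fun p : {poly k} => p`_j)) /eqP.
  rewrite coef0 coef_sum (bigD1 j) //= coefZ coefXn eqxx mulr1 big1 ?addr0 ?(negPf cj) //.
  by move=> i ij; rewrite coefZ coefXn eq_sym (inj_eq val_inj) (negPf ij) mulr0.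
have PE : (map_poly iota P).[x] = \sum_i iota (c i) * x ^+ i.
  rewrite rmorph_sum horner_sum; apply: eq_bigr => i _.
  by rewrite /= map_polyZ map_polyXn !hornerE.
have [m [q /implyP/(_ P0) q0 PqE]] := multiplicity_XsubC P 0.
have /factor_theorem[q2 q2E] : root (q - q.[0]%:P) 0 by rewrite /root !hornerE subrr.
have qE : q = q2 * 'X + q.[0]%:P by rewrite -[LHS](subrK q.[0]%:P) q2E subr0.
exists m, ((q.[0])^-1 *: q2).
have iq : iota q.[0] != 0 by rewrite fmorph_eq0.
have -> : x ^+ m * (1 + x * (map_poly iota (q.[0]^-1 *: q2)).[x]) =
   iota q.[0]^-1 * (map_poly iota P).[x].
  have qm : map_poly iota q = map_poly iota q2 * 'X + (iota q.[0])%:P.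
    by rewrite {1}qE rmorphD rmorphM /= map_polyX map_polyC.
  rewrite PqE polyC0 subr0 rmorphM rmorphXn /= map_polyX map_polyZ qm.
  rewrite !hornerE /= fmorphV; move: iq; move: (iota _) (_.[x]) => b z b0.
  by field.
by apply: (IM) => //; [exact: lr_C|rewrite PE].
Qed.

Lemma lr_horner q x : R x -> R (map_poly iota q).[x].
Proof.
move=> Rx; rewrite -[q]coefK poly_def rmorph_sum horner_sum; apply: lr_sum => i.
by rewrite /= map_polyZ map_polyXn !hornerE; apply: lr_M; [exact: lr_C|exact: lr_X].
Qed.

Lemma pow_in_ideal s x : lideal R I -> R x -> lr_ev R x = 0 ->
  (forall i, modspan iota I s (x ^+ i)) -> exists i, I (x ^+ i).
Proof.
move=> lI Rx ex xs; have [_ _ _ IM] := lI.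
have [i [q Iq]] := pow_dep lI xs; exists i.
have Rq := lr_horner q Rx.
have Rxq := lr_M Rx Rq.
have e1 : lr_ev R (1 + x * (map_poly iota q).[x]) != 0.
  by rewrite lr_evD ?lr_evM ?ex ?mul0r ?addr0 ?lr_ev1 ?oner_eq0 //; exact: lr_1.
have -> : x ^+ i = (1 + x * (map_poly iota q).[x])^-1 * (x ^+ i * (1 + x * (map_poly iota q).[x])).
  by rewrite mulrCA mulVf ?mulr1 //; exact: lr_neq0 e1.
by apply: IM => //; apply: lr_V => //; apply: lr_D => //; exact: lr_1.
Qed.
End PowerDependence.

Section GeneratedIdeal.
Variables (k : numClosedFieldType) (L : fieldType) (iota : {rmorphism k -> L}).
Variables (n : nat) (F : 'I_n -> L).
Implicit Types O R : lring iota.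

Definition idl (O : L -> Prop) (h : L) := exists a : 'I_n -> L,
  (forall j, O (a j)) /\ h = \sum_j a j * F j.

Lemma idl_lideal O : (forall j, O (F j)) -> lideal O (idl O).
Proof.
move=> OF; split=> [h [a [Oa ->]]||h g [a [Oa ->]] [b [Ob ->]]|c h Oc [a [Oa ->]]].
- by apply: lr_sum => j; apply: lr_M.
- exists (fun=> 0); split=> [j|]; first exact: lr_0.
  by rewrite big1 // => j _; rewrite mul0r.
- exists (fun j => a j + b j); split=> [j|]; first exact: lr_D.
  by rewrite -big_split; apply: eq_bigr => j _; rewrite mulrDl.
- exists (fun j => c * a j); split=> [j|]; first exact: lr_M.
  by rewrite mulr_sumr; apply: eq_bigr => j _; rewrite mulrA.
Qed.

Lemma idl_in O j : idl O (F j).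
Proof.
exists (fun i => (i == j)%:R); split=> [i|].
  by case: (i == j); [exact: lr_1|exact: lr_0].
by rewrite (bigD1 j) //= eqxx mul1r big1 ?addr0 // => i /negPf->; rewrite mul0r.
Qed.

Lemma idl_sub O J : lideal O J -> (forall j, J (F j)) -> forall h, idl O h -> J h.
Proof.
move=> [_ J0 JD JM] JF h [a [Oa ->]]; apply: (big_ind J) => // j _; exact: JM.
Qed.
End GeneratedIdeal.

Section MpMul.
Variables (k : numClosedFieldType) (L : fieldType) (iota : {rmorphism k -> L}).
Variable O : lring iota.
Variables (u w : L).
Hypothesis uw : params O u w.
Let Ou : O u. Proof. by case: uw. Qed.
Let Ow : O w. Proof. by case: uw. Qed.

Lemma mpX n h i j : mp O u w n h -> mp O u w (i + j + n) (u ^+ i * w ^+ j * h).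
Proof.
move=> mh; elim: i => [|i IH].
  rewrite expr0 mul1r; elim: j => [|j IH]; first by rewrite expr0 mul1r.
  by rewrite exprS -mulrA mulrC; apply: (mp_mulw uw).
by rewrite exprS -[u * _ * _ * _]mulrA -mulrA mulrC; apply: (mp_mulu uw); rewrite mulrA.
Qed.

Lemma mpM n m x y : mp O u w n x -> mp O u w m y -> mp O u w (n + m) (x * y).
Proof.
move=> mx my; have [_ M0 MD MM] := mp_lideal uw (n + m).
suff: O x /\ mp O u w (n + m) (x * y) by case.
move: x mx; apply: (mp_gen uw) => [|i ilen].
  split=> [x []//||x z [Ox mx] [Oz mz]|a x Oa [Ox mx]].
  - by rewrite mul0r; split=> //; exact: lr_0.
  - by rewrite mulrDl; split; [exact: lr_D|exact: MD].
  - by rewrite -mulrA; split; [exact: lr_M|exact: MM].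
split; first by apply: lr_M; apply: lr_X.
by rewrite -{1}(subnKC ilen); apply: mpX.
Qed.

Lemma mp_O n h : mp O u w n h -> O h.
Proof. by case: (mp_lideal uw n) => MO _ _ _; exact: MO. Qed.

Lemma mp_not_u (rO : regular2 O) n : ~ mp O u w n.+1 (u ^+ n).
Proof.
move=> mu; have wu := params_sym uw.
pose J h := exists a b, [/\ O a, O b & h = a * w + b * u ^+ n.+1].
have [a [b [Oa Ob E]]] : J (u ^+ n).
  apply: (mp_gen uw _ _ mu) => [|i].
    split=> [x [a [b [Oa Ob ->]]]||x y [a [b [Oa Ob ->]]] [c [d [Oc Od ->]]]|e x Oe [a [b [Oa Ob ->]]]].
    - by apply: lr_D; apply: lr_M => //; apply: lr_X.
    - by exists 0, 0; split; [exact: lr_0|exact: lr_0|ring].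
    - by exists (a + c), (b + d); split; [exact: lr_D|exact: lr_D|ring].
    - by exists (e * a), (e * b); split; [exact: lr_M|exact: lr_M|ring].
  rewrite leq_eqVlt => /orP[/eqP->|ilt].
    by exists 0, 1; split; [exact: lr_0|exact: lr_1|rewrite subnn expr0 mul0r mul1r mulr1 add0r].
  exists (u ^+ i * w ^+ (n - i)), 0; split; [by apply: lr_M; apply: lr_X|exact: lr_0|].
  by rewrite subSn // [w ^+ _.+1]exprSr mul0r addr0 mulrA.
have [_ _ eu _ _] := uw.
have Obu : O (b * u) by apply: lr_M.
have e1 : lr_ev O (1 - b * u) != 0 by apply: lr_unit1B; rewrite // lr_evM // eu mulr0.
apply: (pow_ndvd rO wu (n := n)); exists (a / (1 - b * u)).
  by apply: lr_div => //; apply: lr_B => //; exact: lr_1.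
have n1 : 1 - b * u != 0 := lr_neq0 e1.
apply: (mulIf n1); rewrite mulrBr mulr1 {1}E exprSr; field.
by [].
Qed.
End MpMul.

(** * Drop of the colength under a quadratic transform *)

Section QuadDrop.
Variables (k : numClosedFieldType) (L : fieldType) (iota : {rmorphism k -> L}).
Variables (O R : lring iota) (u w : L) (c : k).
Hypothesis rO : regular2 O.
Hypothesis uw : params O u w.
Hypothesis quad : isquad O u w c R.
Variables (n : nat) (F : 'I_n -> L) (m : nat).
Hypothesis Fm : forall j, mp O u w m (F j).
Variables (j0 : 'I_n) (f y : L).
Hypothesis m0 : (0 < m)%N.
Hypothesis Of : O f.
Hypothesis ef : lr_ev O f != 0.
Hypothesis my : mp O u w m.-1 y.
Hypothesis FE : F j0 = f * w ^+ m + u * y.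
Let u0 : u != 0 := params_neq0 rO uw.
Let Ou : O u. Proof. by case: uw. Qed.
Let Ow : O w. Proof. by case: uw. Qed.
Let f0 : f != 0 := lr_neq0 ef.

Lemma mp_quad i x : mp O u w i x -> R (x / u ^+ i).
Proof.
have [OR Rt _ _] := quad.
move=> mx; suff: O x /\ R (x / u ^+ i) by case.
move: x mx; apply: (mp_gen uw) => [|l ilen].
  split=> [x []//||x z [Ox mx] [Oz mz]|a x Oa [Ox mx]].
  - by rewrite mul0r; split; exact: lr_0.
  - by rewrite mulrDl; split; exact: lr_D.
  - by rewrite -mulrA; split; [exact: lr_M|apply: lr_M => //; case: (OR a Oa)].
split; first by apply: lr_M; apply: lr_X.
have -> : u ^+ l * w ^+ (i - l) / u ^+ i = (w / u) ^+ (i - l).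
  rewrite -{2}(subnKC ilen) exprD expr_div_n.
  by field; rewrite !expf_neq0.
exact: lr_X.
Qed.

Let I' := idl (fun j => F j / u ^+ m) R.
Let lI' : lideal R I'. Proof. by apply: idl_lideal => j; apply: mp_quad. Qed.
(** The polynomials of degree at most m in w/u, modulo the transformed ideal; [quad_drop] shows that
    they fill R. *)
Let W h := exists x z, [/\ mp O u w m x, I' z & h = x / u ^+ m + z].

Let WD h g : W h -> W g -> W (h + g).
Proof.
have [_ _ ID _] := lI'; have [_ _ MD _] := mp_lideal uw m.
move=> [x [z [mx Iz ->]]] [x' [z' [mx' Iz' ->]]]; exists (x + x'), (z + z').
by split; [exact: MD|exact: ID|ring].
Qed.

(** With t = w/u, the element F_j0 / u^m is f t^m plus terms of lower degree, f a unit, so it lowers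
    every degree above m. *)
Let Wmp i x : mp O u w i x -> W (x / u ^+ i).
Proof.
have [OR Rt _ _] := quad; have [_ I0 _ IM] := lI'.
elim: i x => [|i IH] x mx.
  exists (x * u ^+ m), 0; split=> //; last by rewrite expr0 divr1 addr0 mulfK // expf_neq0.
  by have := mpX uw m 0 mx; rewrite expr0 mulr1 addn0 addn0 mulrC.
have [ltmi|lemi] := leqP m i; last first.
  exists (x * u ^+ (m - i.+1)), 0; split=> //.
    by have := mpX uw (m - i.+1) 0 mx; rewrite expr0 mulr1 addn0 subnK // mulrC.
  by rewrite addr0 -{2}(subnKC lemi) exprD; field; rewrite !expf_neq0.
have [f' [y' [Of' my' ->]]] := mp_decomp uw mx.
have Off : O (f' / f) by apply: lr_div.
have [_ _ _ MM] := mp_lideal uw i.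
have -> : (f' * w ^+ i.+1 + u * y') / u ^+ i.+1 =
   f' / f * (w / u) ^+ (i.+1 - m) * (F j0 / u ^+ m) +
   (- (f' / f) * (w ^+ (i.+1 - m) * y)) / u ^+ i + y' / u ^+ i.
  have {1}-> : i.+1 = (i.+1 - m + m)%N by rewrite subnK // leqW.
  rewrite FE [u ^+ i.+1]exprS expr_div_n.
  have -> : u ^+ i = u ^+ (i - m) * u ^+ m by rewrite -exprD subnK.
  rewrite (subSn ltmi) [u ^+ (i - m).+1]exprS exprD.
  by field; rewrite ?expf_neq0 ?u0 ?f0.
apply: WD; last by apply: IH.
apply: WD.
  exists 0, (f' / f * (w / u) ^+ (i.+1 - m) * (F j0 / u ^+ m)); split; last by rewrite mul0r add0r.
    by case: (mp_lideal uw m).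
  apply: IM; last exact: (idl_in (fun j => F j / u ^+ m)).
  by apply: lr_M; [case: (OR _ Off)|apply: lr_X].
apply: IH; apply: MM; first exact: lr_N.
have := mpX uw 0 (i.+1 - m) my; rewrite expr0 mul1r add0n.
by rewrite -subn1 addnBA // subnK ?leqW // subn1.
Qed.

Let B h := exists i x, mp O u w i x /\ h = x / u ^+ i.

Let BD h g : B h -> B g -> B (h + g).
Proof.
move=> [i [x [mx ->]]] [j [z [mz ->]]]; exists (i + j)%N, (u ^+ j * x + u ^+ i * z).
have [_ _ MD _] := mp_lideal uw (i + j); split.
  apply: MD; last by have := mpX uw i 0 mz; rewrite expr0 mulr1 addn0.
  by have := mpX uw j 0 mx; rewrite expr0 mulr1 addn0 addnC.
by rewrite exprD; field; rewrite !expf_neq0.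
Qed.

Let BM h g : B h -> B g -> B (h * g).
Proof.
move=> [i [x [mx ->]]] [j [z [mz ->]]]; exists (i + j)%N, (x * z).
by split; [exact: mpM|rewrite exprD; field; rewrite !expf_neq0].
Qed.

Let BO h : O h -> B h.
Proof. by move=> Oh; exists 0%N, h; rewrite expr0 divr1. Qed.
Let Bt : B (w / u).
Proof.
exists 1%N, w; rewrite expr1; split=> //.
by have := mpX uw 0 1 (lr_1 O : mp O u w 0 1); rewrite expr0 expr1 mul1r mulr1.
Qed.
Let BR h : B h -> R h. Proof. by move=> [i [x [mx ->]]]; apply: mp_quad. Qed.
Let BX h i : B h -> B (h ^+ i).
Proof.
move=> Bh; elim: i => [|i IH]; first by rewrite expr0; apply: BO; exact: lr_1.
by rewrite exprS; apply: BM.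
Qed.

Let R'car h := exists a b, [/\ B a, B b, lr_ev R b != 0 & h = a / b].
Let R'R h : R'car h -> R h.
Proof. by move=> [a [b [/BR ? /BR ? ? ->]]]; apply: lr_div. Qed.
Let R'B h : B h -> R'car h.
Proof.
by move=> Bh; exists h, 1; rewrite divr1 lr_ev1 oner_neq0; split=> //; apply: BO; exact: lr_1.
Qed.

Let R'D h g : R'car h -> R'car g -> R'car (h + g).
Proof.
move=> [a [b [Ba Bb eb ->]]] [a' [b' [Ba' Bb' eb' ->]]].
exists (a * b' + b * a'), (b * b'); split.
- by apply: BD; apply: BM.
- exact: BM.
- by rewrite lr_evM ?mulf_neq0 //; exact: BR.
- by field; rewrite (lr_neq0 eb) (lr_neq0 eb').
Qed.

Let R'M h g : R'car h -> R'car g -> R'car (h * g).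
Proof.
move=> [a [b [Ba Bb eb ->]]] [a' [b' [Ba' Bb' eb' ->]]].
exists (a * a'), (b * b'); split; [exact: BM|exact: BM| |].
- by rewrite lr_evM ?mulf_neq0 //; exact: BR.
- by field; rewrite (lr_neq0 eb) (lr_neq0 eb').
Qed.

Let R'V h : R'car h -> lr_ev R h != 0 -> R'car h^-1.
Proof.
move=> [a [b [Ba Bb eb ->]]]; have [Ra Rb] := (BR Ba, BR Bb).
rewrite lr_evdiv // mulf_eq0 negb_or => /andP[ea _].
by exists b, a; split=> //; rewrite invf_div.
Qed.

Let R' : lring iota := LRing (fun c => R'B (BO (lr_C O c))) (lr_evC R) R'D
  (fun x y Rx Ry => lr_evD (R'R Rx) (R'R Ry)) R'M
  (fun x y Rx Ry => lr_evM (R'R Rx) (R'R Ry)) R'V.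

(** The fractions of O[w/u] whose denominator is a unit of R form a local ring; minimality of R
    makes it all of R. *)
Lemma quad_frac h : R h -> R'car h.
Proof.
have [OR Rt et min] := quad; move=> Rh.
have [|||//] := min R' _ _ _ h Rh.
- by move=> x Ox; split; [exact: R'B (BO Ox)|case: (OR x Ox)].
- exact: R'B Bt.
- exact: et.
Qed.

(** R modulo [I'] is the image, under division by u^m, of the m-th power of the maximal ideal modulo
    the ideal of the F_j. For m > 0 that power is a proper subspace of O, so the dimension drops. *)
Lemma quad_drop s : (forall h, O h -> modspan iota (idl F O) s h) ->
  exists s', (size s' < size s)%N /\ forall r, R r -> modspan iota I' s' r.
Proof.
have [OR Rt _ _] := quad.
move=> sO; have lm := mp_lideal uw m; have [_ I0 ID IM] := lI'.
have lI : lideal O (idl F O) by apply: idl_lideal => j; apply: mp_O (Fm j).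
have [|||||s' [ss' hs']] := @subspace_span _ _ iota (idl F O) (mp O u w m) s.
- exact: lideal_ksub lI.
- exact: lideal_ksub lm.
- exact: idl_sub lm Fm.
- by move=> v /(mp_O uw)/sO.
- exists 1; split; first by apply: sO; exact: lr_1.
  move=> /(mp_le uw m0) [r [t [Or Ot E]]]; have [_ _ eu ew _] := uw.
  have := lr_ev1 O; rewrite E lr_evD ?lr_evM ?eu ?ew ?mulr0 ?addr0; try by [|exact: lr_M].
  by move=> /esym/eqP; rewrite oner_eq0.
exists (map (fun x => x / u ^+ m) s'); rewrite size_map; split=> //.
have Ispan h : W h -> modspan iota I' [seq x / u ^+ m | x <- s'] h.
  move=> [x [z [/hs'[a [sa Ia]] Iz ->]]]; exists (a / u ^+ m); split.
    elim: (s') a sa {Ia} => [|b r IH] a /=; first by move=> ->; rewrite mul0r.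
    move=> [d [v [sv ->]]]; exists d, (v / u ^+ m); split; first exact: IH.
    by rewrite mulrDl mulrA.
  rewrite addrAC -mulrBl; apply: ID => //.
  have [b [Ob ->]] := Ia; rewrite mulr_suml; exists b; split=> [j|].
    by case: (OR _ (Ob j)).
  by apply: eq_bigr => j _; rewrite mulrA.
have BW h : B h -> W h by move=> [i [x [mx ->]]]; apply: Wmp.
move=> r /quad_frac[a [b [Ba Bb eb ->]]]; apply: (Ispan _).
have [Ra Rb] := (BR Ba, BR Bb).
have [|i [q Iq]] := pow_dep lI' (s := [seq x / u ^+ m | x <- s']) (x := b).
  by move=> i; apply: (Ispan _); apply: (BW _); apply: BX.
have b0 : b != 0 := lr_neq0 eb.
set qb := (map_poly iota q).[b] in Iq.
have Bqb : B qb.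
  rewrite /qb -[q]coefK poly_def rmorph_sum horner_sum /=; apply: (big_ind B) => //.
    by apply: BO; exact: lr_0.
  move=> j _; rewrite map_polyZ map_polyXn !hornerE.
  by apply: BM; [apply: BO; exact: lr_C|exact: BX].
(* Since b^i (1 + b q(b)) lies in [I'], the inverse of b is -q(b) modulo [I'], and no denominator
   remains. *)
have -> : a / b = (- a * qb) + a / b / b ^+ i * (b ^+ i * (1 + b * qb)).
  by field; rewrite expf_neq0.
apply: WD.
  apply: (BW _); apply: BM => //; have -> : - a = iota (-1) * a by rewrite rmorphN rmorph1 mulN1r.
  by apply: BM => //; apply: BO; exact: lr_C.
exists 0, (a / b / b ^+ i * (b ^+ i * (1 + b * qb))); split.
- by case: lm.
- apply: IM => //; apply: lr_div; [exact: lr_div|exact: lr_X|].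
  by rewrite lr_evX // expf_neq0.
- by rewrite mul0r add0r.
Qed.
End QuadDrop.

(** * Primitive families and the length of the base ideal *)

Section Primitive.
Variables (k : numClosedFieldType) (L : fieldType) (iota : {rmorphism k -> L}).
Variable O : lring iota.
Hypothesis rO : regular2 O.
Local Notation ev := (lr_ev O).

Lemma prime_dvd_unit p e : lprime O p -> lunit O e -> ~ ldvd O p e.
Proof.
move=> [Op p0 ep _] [Oe ee] [r Or eE]; move: ee.
by rewrite eE lr_evM // ep mulr0 eqxx.
Qed.

Lemma prime_assoc p q : lprime O p -> lprime O q -> ldvd O p q -> exists2 r, lunit O r & q = r * p.
Proof.
move=> [Op p0 ep pp] [Oq q0 eq qq] [r Or qE]; exists r => //; split=> //.
have [|[t Ot rE]|[t Ot pE]] := qq r p Or Op; first by rewrite -qE; exists 1; [exact: lr_1|rewrite mul1r].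
  have /(mulIf q0) E : (t * p) * q = 1 * q by rewrite mul1r {2}qE rE; ring.
  have := lr_ev1 O; rewrite -E lr_evM // ep mulr0 => /esym/eqP; by rewrite oner_eq0.
have /(mulIf p0) E : (r * t) * p = 1 * p by rewrite mul1r {2}pE qE; ring.
apply/eqP => er; have := lr_ev1 O; rewrite -E lr_evM // er mul0r => /esym/eqP.
by rewrite oner_eq0.
Qed.

Lemma prime_dvd_prod p s : lprime O p -> {in s, forall q, lprime O q} ->
  ldvd O p (\prod_(q <- s) q) -> exists2 q, q \in s & ldvd O p q.
Proof.
move=> pp; elim: s => [_|q s IH ps].
  by rewrite big_nil => /(prime_dvd_unit pp)[]; split; [exact: lr_1|rewrite lr_ev1 oner_neq0].
have ps' : {in s, forall q, lprime O q} by move=> x xs; apply: ps; rewrite inE xs orbT.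
rewrite big_cons; have [Op p0 ep ppr] := pp; move=> /ppr[].
- by have [] := ps q (mem_head _ _).
- rewrite big_seq; apply: (big_ind O) => [|x y|x /ps'[]//]; first exact: lr_1.
  exact: lr_M.
- by move=> d; exists q => //; rewrite mem_head.
- by move=> /(IH ps')[x xs d]; exists x => //; rewrite inE xs orbT.
Qed.

Variables (n : nat) (e : 'I_n -> L) (i0 : 'I_n).
Hypothesis e0 : e i0 != 0.

(** Denominators are cleared, then common primes divided out; each division removes a prime factor
    of c e_i0, so this ends. *)
Lemma primitive_ex : exists c, [/\ c != 0, forall j, O (c * e j)
  & forall p, lprime O p -> ~ forall j, ldvd O p (c * e j)].
Proof.
have ind N : forall c s a, (size s <= N)%N -> c != 0 -> (forall j, O (c * e j)) ->
    lunit O a -> {in s, forall p, lprime O p} -> c * e i0 = a * \prod_(p <- s) p ->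
    exists c, [/\ c != 0, forall j, O (c * e j)
      & forall p, lprime O p -> ~ forall j, ldvd O p (c * e j)].
  elim: N => [|N IH] c s a sN c0 Oc ua ps cE;
    (have [h|/existsNP[p /not_implyP[pp /contrapT dp]]] := pselect (forall p, lprime O p -> ~ forall j, ldvd O p (c * e j));
      first by exists c);
    (have [||d|/(prime_dvd_prod pp ps)[q qs pq]] := (let: And4 _ _ _ f := pp in f) a (\prod_(p <- s) p) ua.1);
    rewrite -?cE //; try by [case: (prime_dvd_unit pp ua)|
      rewrite big_seq; apply: (big_ind O) => [|x y|x /ps[]//]; [exact: lr_1|exact: lr_M]].
    by move: sN qs; case: s ps cE.
  have [r [Or er] qE] := prime_assoc pp (ps q qs) pq.
  have [Op p0 _ _] := pp; have [Oa ea] := ua.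
  apply: (IH (c / p) (rem q s) (a * r)).
  - by rewrite size_rem // -ltnS prednK //; case: (s) qs.
  - by rewrite mulf_neq0 // invr_eq0.
  - by move=> j; have [t Ot tE] := dp j; rewrite mulrAC tE mulfK.
  - by split; [exact: lr_M|rewrite lr_evM // mulf_neq0].
  - by move=> x /mem_rem; apply: ps.
  - rewrite mulrAC cE (perm_big _ (perm_to_rem qs)) big_cons.
    move: (\prod_(x <- rem q s) x) => P; by rewrite qE /=; field.
have /choice[G GP] : forall j, exists d, [/\ O d, d != 0 & O (d * e j)].
  move=> j; have [F [G [OF OG G0 ->]]] := r2_frac rO (e j).
  by exists G; rewrite mulrCA divff // mulr1.
pose d := \prod_j G j.
have d0 : d != 0 by apply/prodf_neq0 => j _; case: (GP j).
have Od j : O (d * e j).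
  rewrite /d (bigD1 j) //= mulrAC mulrC; apply: lr_M; last by case: (GP j).
  by apply: (big_ind O) => [|x y|i _]; [exact: lr_1|exact: lr_M|case: (GP i)].
have [a [s [ua ps E]]] := factorization rO (Od i0) (mulf_neq0 d0 e0).
exact: (ind (size s) d s a).
Qed.

(** The elements that some power of u carries into the ideal form an ideal saturated for u, hence
    principal. Its generator divides every c e_j, so it is a unit. *)
Lemma primitive_pow c u w : params O u w -> c != 0 -> (forall j, O (c * e j)) ->
  (forall p, lprime O p -> ~ forall j, ldvd O p (c * e j)) ->
  exists N, idl (fun j => c * e j) O (u ^+ N).
Proof.
move=> uw c0 Oc nc; have [Ou Ow _ _ _] := uw.
pose F j := c * e j; pose J h := O h /\ exists N, idl F O (u ^+ N * h).
have lI : lideal O (idl F O) by apply: idl_lideal.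
have [_ I0 ID IM] := lI.
have lJ : lideal O J.
  split=> [x []//||x y [Ox [N Ix]] [Oy [M Iy]]|a x Oa [Ox [N Ix]]].
  - by split; [exact: lr_0|exists 0%N; rewrite mulr0].
  - split; first exact: lr_D.
    exists (M + N)%N; rewrite exprD mulrDr.
    apply: ID; first by rewrite -mulrA; apply: IM => //; exact: lr_X.
    by rewrite mulrAC mulrC; apply: IM => //; exact: lr_X.
  - by split; [exact: lr_M|exists N; rewrite mulrCA; apply: IM].
have [|g Jg gJ] := sat_principal rO uw lJ.
  move=> x Ox [_ [N Ix]]; split=> //; exists N.+1; by rewrite exprSr -mulrA.
have JF j : J (F j).
  by split; [exact: Oc|exists 0%N; rewrite mul1r; exact: idl_in].
have [Og [N Ig]] := Jg.
have [eg|eg] := eqVneq (ev g) 0; last first.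
  exists N; have -> : u ^+ N = g^-1 * (u ^+ N * g).
    by rewrite mulrCA mulVf ?mulr1 //; exact: lr_neq0 eg.
  by apply: IM => //; exact: lr_V.
have g0 : g != 0.
  apply/eqP => g0; have [r _ E] := gJ _ (JF i0); move: E; rewrite g0 mulr0 => /eqP.
  by rewrite mulf_eq0 (negPf c0) (negPf e0).
have [a [s [ua ps E]]] := factorization rO Og g0.
case: s ps E => [_ E|p s ps E].
  by move: ua.2; rewrite -[a]mulr1; move: E; rewrite big_nil => <-; rewrite eg eqxx.
case: (nc p); first by apply: ps; rewrite mem_head.
move=> j; apply: (ldvd_trans (q := g)); last exact: (gJ _ (JF j)).
exists (a * \prod_(x <- s) x); last by rewrite E big_cons; ring.
apply: lr_M; first by case: ua.
rewrite big_seq; apply: (big_ind O) => [|x y|x xs]; [exact: lr_1|exact: lr_M|].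
by have [] : lprime O x by apply: ps; rewrite inE xs orbT.
Qed.
End Primitive.

Section Lam.
Variables (k : numClosedFieldType) (L : fieldType) (iota : {rmorphism k -> L}).
Variables (n : nat) (e : 'I_n -> L).
Implicit Types O R : lring iota.

(** The map with homogeneous coordinates e is defined at the point of O. *)
Definition good (O : L -> Prop) := exists i, e i != 0 /\ forall l, O (e l / e i).

(* the length of O modulo a multiple of the fractional ideal generated by e, at most N *)
Definition lam (O : L -> Prop) (N : nat) := exists c,
  [/\ c != 0, forall j, O (c * e j)
    & exists s, (size s <= N)%N /\ forall h, O h -> modspan iota (idl (fun j => c * e j) O) s h].

Lemma unit_good O c j : (forall i, O (c * e i)) -> lr_ev O (c * e j) != 0 -> good O.
Proof.
move=> Oc ej; have := lr_neq0 ej; rewrite mulf_eq0 negb_or => /andP[c0 ej0].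
exists j; split=> // l; have -> : e l / e j = (c * e l) / (c * e j) by field; rewrite ej0.
exact: lr_div.
Qed.

Lemma idl1_good O c : (forall i, O (c * e i)) -> idl (fun j => c * e j) O 1 -> good O.
Proof.
move=> Oc I1; have [j ej] : exists j, lr_ev O (c * e j) != 0.
  apply: contrapT => nj; have [a [Oa E]] := I1.
  have [_ M] : lmax O 1.
    rewrite E; apply: (big_ind (lmax O)) => [|x y|i _].
    - by split; [exact: lr_0|exact: lr_ev0].
    - exact: lmaxD.
    - apply: lmaxM => //; split=> //; apply/eqP/negPn/negP => h; by apply: nj; exists i.
  by move: M; rewrite lr_ev1 => /eqP; rewrite oner_eq0.
exact: unit_good ej.
Qed.

Lemma lam0_good O : lam O 0 -> good O.
Proof.
move=> [c [c0 Oc [s [/[!leqn0]/nilP-> h]]]].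
have [a [/= -> ]] := h 1 (lr_1 O); rewrite subr0; exact: idl1_good.
Qed.

Lemma mp_span O u w : params O u w -> forall M, exists s, forall h, O h ->
  modspan iota (mp O u w M) s h.
Proof.
move=> uw; have [Ou Ow eu ew _] := uw; elim=> [|M [s sP]].
  by exists [::] => h Oh; exists 0; rewrite subr0.
pose g i := u ^+ i * w ^+ (M - i).
have lm := mp_lideal uw M; have lm1 := mp_lideal uw M.+1; have [MO M0 MD MM] := lm1.
have gm i : (i <= M)%N -> mp O u w M (g i).
  move=> iM; have := mpX uw i (M - i) (lr_1 O : mp O u w 0 1).
  by rewrite mulr1 addn0 subnKC.
pose t := map g (seq.iota 0 M.+1).
have kcat a b (s1 s2 : seq L) : kspan iota s1 a -> kspan iota s2 b -> kspan iota (s1 ++ s2) (a + b).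
  move=> + sb; elim: s1 a => [|x s1 IH1] a /=; first by move=> ->; rewrite add0r.
  move=> [d [v [sv ->]]]; exists d, (v + b); rewrite addrA; split=> //; exact: IH1.
have kmem (s1 : seq L) x : x \in s1 -> kspan iota s1 x.
  elim: s1 => [//|z s1 IH1] /=; rewrite inE => /orP[/eqP->|xs].
    by exists 1, 0; rewrite rmorph1 mul1r addr0; split=> //; case: (kspan_sub iota s1).
  by exists 0, x; rewrite rmorph0 mul0r add0r; split=> //; apply: IH1.
have [t0 tD tM] := kspan_sub iota t.
have tm b : kspan iota t b -> mp O u w M b.
  have [_ N0 ND NM] := lm; rewrite /t; have : {in seq.iota 0 M.+1, forall i, (i <= M)%N}.
    by move=> i; rewrite mem_iota add0n ltnS.
  elim: (seq.iota 0 M.+1) b => [|i r IHr] b ri /=; first by move=> ->.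
  move=> [d [v [rv ->]]]; apply: ND.
    by apply: NM; [exact: lr_C|apply: gm; apply: ri; rewrite mem_head].
  by apply: IHr => // j jr; apply: ri; rewrite inE jr orbT.
exists (s ++ t) => h /sP[a [sa ma]].
suff [b [tb mb]] : exists b, kspan iota t b /\ mp O u w M.+1 (h - a - b).
  by exists (a + b); split; [exact: kcat|rewrite opprD addrA].
pose J x := O x /\ exists b, kspan iota t b /\ mp O u w M.+1 (x - b).
suff [_ //] : J (h - a).
apply: (mp_gen uw _ _ ma) => [|i iM]; last first.
  split; first by apply: lr_M; apply: lr_X.
  exists (g i); split; last by rewrite subrr.
  by apply: kmem; apply: map_f; rewrite mem_iota add0n ltnS.
split=> [x []//||x y [Ox [b [tb mb]]] [Oy [b' [tb' mb']]]|x y Ox [Oy [b [tb mb]]]].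
- by split; [exact: lr_0|exists 0; split=> //; rewrite subrr].
- split; [exact: lr_D|exists (b + b'); split; first exact: tD].
  by rewrite opprD addrACA; apply: MD.
- split; [exact: lr_M|exists (iota (lr_ev O x) * b); split; first exact: tM].
  have -> : x * y - iota (lr_ev O x) * b = (x - iota (lr_ev O x)) * b + x * (y - b) by ring.
  apply: MD; last exact: MM.
  apply: (mpM (n := 1) uw); last exact: tm.
  apply: (mp1 uw); first by apply: lr_B => //; exact: lr_C.
  by rewrite lr_evB // ?lr_evC ?subrr //; exact: lr_C.
Qed.

Lemma lam_ex O i0 : regular2 O -> e i0 != 0 -> exists N, lam O N.
Proof.
move=> rO ei0; have [c [c0 Oc nc]] := primitive_ex rO ei0.
have [u [w uw]] := r2_params rO; have [Ou Ow _ _ _] := uw.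
have [N uN] := primitive_pow rO ei0 uw c0 Oc nc.
have [M wM] := primitive_pow rO ei0 (params_sym uw) c0 Oc nc.
have [s sP] := mp_span uw (N + M).
exists (size s), c; split=> //; exists s; split=> // h /sP[a [sa ma]].
exists a; split=> //; have lI := idl_lideal Oc; have [_ _ _ IM] := lI.
apply: (mp_gen uw lI _ ma) => i iNM.
have [Ni|iN] := leqP N i.
  rewrite -(subnK Ni) exprD mulrAC; apply: IM => //.
  by apply: lr_M; apply: lr_X.
have Mi : (M <= N + M - i)%N by rewrite -addnBAC ?leq_addl // ltnW.
rewrite -(subnK Mi) exprD mulrA; apply: IM => //.
by apply: lr_M; apply: lr_X.
Qed.

Lemma ideal_order O u w c s : regular2 O -> params O u w -> (forall j, O (c * e j)) ->
  (forall h, O h -> modspan iota (idl (fun j => c * e j) O) s h) ->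
  (forall j, lr_ev O (c * e j) = 0) ->
  exists m, [/\ (0 < m)%N, forall j, mp O u w m (c * e j)
    & exists j, ~ mp O u w m.+1 (c * e j)].
Proof.
move=> rO uw Oc sO ev0; have [Ou Ow eu ew _] := uw.
have lI := idl_lideal Oc.
have [N uN] := pow_in_ideal lI Ou eu (fun i => sO _ (lr_X i Ou)).
have : exists m, ~ (forall j, mp O u w m.+1 (c * e j)).
  exists N => h; apply: (mp_not_u uw rO (n := N)).
  exact: idl_sub (mp_lideal uw _) h _ uN.
move=> [m]; elim: m => [|m IH] nm.
  by case: nm => j; apply: (mp1 uw).
have [h|/IH//] := pselect (forall j, mp O u w m.+1 (c * e j)).
exists m.+1; split=> //; exact/existsNP.
Qed.

Lemma poly_nonroot (Q : {poly k}) : Q != 0 -> exists s, Q.[s] != 0.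
Proof.
move=> Q0; apply: contrapT => h.
have := @max_poly_roots _ Q [seq i%:R | i <- seq.iota 0 (size Q)] Q0.
rewrite size_map size_iota ltnn map_inj_uniq ?iota_uniq; last first.
  by move=> i j /eqP; rewrite eqr_nat => /eqP.
suff -> : all (root Q) [seq i%:R | i <- seq.iota 0 (size Q)] by move=> /(_ isT isT).
by apply/allP => x _; apply/negPn/negP => nx; apply: h; exists x.
Qed.

Lemma params_shift O u w s : params O u w -> params O (u - iota s * w) w.
Proof.
move=> [Ou Ow eu ew huw]; have Osw : O (iota s * w) by apply: lr_M => //; exact: lr_C.
split=> //; first exact: lr_B.
  by rewrite lr_evB // lr_evM ?ew ?mulr0 ?eu ?subrr //; exact: lr_C.
move=> x Ox ex; have [r [t [Or Ot ->]]] := huw x Ox ex.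
exists r, (t + r * iota s); split=> //; last by ring.
by apply: lr_D => //; apply: lr_M => //; exact: lr_C.
Qed.

Lemma mp_shift O u w s m h : params O u w -> mp O u w m h -> mp O (u - iota s * w) w m h.
Proof.
move=> uw mh; have uw' := params_shift s uw; have [Ou Ow _ _ _] := uw.
suff H i j : mp O (u - iota s * w) w (i + j) (u ^+ i * w ^+ j).
  apply: (mp_gen uw (mp_lideal uw' m) _ mh) => i im.
  by have := H i (m - i)%N; rewrite subnKC.
have := mpX uw' 0 j (lr_1 O : mp O _ w 0 1); rewrite expr0 mul1r mulr1 addn0 add0n => wj.
elim: i => [|i IH]; first by rewrite expr0 mul1r add0n.
have -> : u ^+ i.+1 * w ^+ j = (u ^+ i * w ^+ j) * u by rewrite exprSr mulrAC.
rewrite addSn -addn1; apply: (mpM uw' IH).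
by exists 1, (iota s); split; [exact: lr_1|exact: lr_C|ring].
Qed.

(** Let m be the order of the ideal, attained by F_j0. The parameters are changed to u' = u - t w, w
    with t not a root of the leading form, so that F_j0 = f w^m + u' y with f a unit. [quad_drop]
    applies at all points of slope w/u'; at the remaining one F_j0 / w^m is a unit. *)
Lemma lam_drop O N : regular2 O -> lam O N.+1 -> ~ good O ->
  exists u w, params O u w /\ forall R,
    ((exists c, isquad O u w c R) -> lam R N) /\ (isquad O w u 0 R -> good R).
Proof.
move=> rO [c [c0 Oc [s [sN sO]]]] ng; have [u [w uw]] := r2_params rO.
have ev0 j : lr_ev O (c * e j) = 0.
  by apply/eqP/negPn/negP => /(unit_good Oc).
have [m [m0 Fm [j0 nF]]] := ideal_order rO uw Oc sO ev0.
have [Q [Q0 QP]] := leading_form uw (Fm j0).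
have [t Qt] : exists t, Q.[t] != 0 by apply: poly_nonroot; apply/eqP => /Q0.
have [f [y [Of ef my FE]]] := QP t.
have uw' := params_shift t uw; have my' := mp_shift t uw my.
have Fm' j := mp_shift t uw (Fm j).
exists (u - iota t * w), w; split=> // R; set u' := u - iota t * w in FE uw' my' Fm' *.
have ef0 : lr_ev O f != 0 by rewrite ef.
have u0 := params_neq0 rO uw'; have w0 := params_neq0 rO (params_sym uw').
have [Ou' Ow _ _ _] := uw'.
have ff0 := lr_neq0 ef0.
split=> [[a qd]|qd].
  have [s' [ss' hs']] := quad_drop rO uw' qd Fm' m0 Of ef0 my' FE sO.
  have eE : (fun j => c / u' ^+ m * e j) = (fun j => c * e j / u' ^+ m).
    by apply: funext => j; rewrite mulrAC.
  exists (c / u' ^+ m); split.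
  - by rewrite mulf_neq0 // invr_eq0 expf_neq0.
  - by move=> j; rewrite mulrAC; exact: (mp_quad rO uw' qd (Fm' j)).
  - exists s'; split; last by rewrite eE.
    by rewrite -ltnS; apply: leq_trans ss' sN.
have wu' := params_sym uw'.
have mw i x : mp O u' w i x -> R (x / w ^+ i).
  move=> mx; apply: (mp_quad rO wu' qd).
  apply: (mp_gen uw' (mp_lideal wu' i) _ mx) => l li.
  have := mpX wu' (i - l) l (lr_1 O : mp O w u' 0 1).
  by rewrite mulr1 addn0 subnK // mulrC.
have [OR Rt et _] := qd.
have Rc j : R (c / w ^+ m * e j) by rewrite mulrAC; apply: mw.
have [Rf efR] := OR f Of.
apply: (unit_good (j := j0) Rc).
have -> : c / w ^+ m * e j0 = f + u' / w * (y / w ^+ m.-1).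
  rewrite mulrAC FE -{1 2 3}(prednK m0) exprS; field.
  by rewrite expf_neq0 ?w0.
have Ry := mw _ _ my'; have Rty := lr_M Rt Ry.
by rewrite (lr_evD Rf Rty) (lr_evM Rt Ry) et mul0r addr0 efR.
Qed.
End Lam.

Section BadFinite.
Variables (k : numClosedFieldType) (X : surface k).
Hypothesis nX : two_ders (viota X).
Let idk : {rmorphism k -> k} := idfun.

Lemma near_same_point (a : cpoint X) u w : params (lr_at a) u w ->
  near a (fun b : cpoint X => lr_ev (lr_at b) u = 0 -> lr_ev (lr_at b) w = 0 ->
    same_point (X := X) b a).
Proof.
move=> [Ou Ow eu ew huw]; have [i ai] := pt_neq0 a.
pose z l := @vgen k X l / @vgen k X i.
have zE (b : cpoint X) l : b i != 0 -> lr_at b (z l) /\ lr_ev (lr_at b) (z l) = b l / b i.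
  by move=> bi; apply/lr_at_evalP; exact: (@eval_coord k X k idk b i bi l).
have /choice[r] : forall l, exists r, [/\ lr_at a r.1, lr_at a r.2 &
    z l - viota X (a l / a i) = r.1 * u + r.2 * w].
  move=> l; have [Oz ez] := zE a l ai.
  have [||r [s [Or Os E]]] := huw (z l - viota X (a l / a i)).
  - by apply: lr_B => //; exact: lr_C.
  - by rewrite lr_evB ?lr_evC ?ez ?subrr //; exact: lr_C.
  - by exists (r, s).
move=> rP.
have h : near a (fun b => [/\ b i != 0, lr_at b u, lr_at b w &
    forall l, lr_at b (r l).1 /\ lr_at b (r l).2]).
  have h1 : near a (fun b : cpoint X => b i != 0) by apply: near_coord.
  have h4 : near a (fun b => forall l, lr_at b (r l).1 /\ lr_at b (r l).2).
    by apply: near_ord => l; have [? ? _] := rP l; apply: near_and; apply: near_regular.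
  have h' := near_and (near_and h1 h4) (near_and (near_regular Ou) (near_regular Ow)).
  by apply: near_mono h' => b [[? ?] [? ?]].
apply: near_mono h => b [bi bu bw br] eub ewb.
have bE l : b l / b i = a l / a i.
  have [br1 br2] := br l; have [_ _ E] := rP l; have [Ob <-] := zE b l bi.
  have -> : z l = viota X (a l / a i) + (r l).1 * u + (r l).2 * w.
    by rewrite -addrA -E addrC subrK.
  have Oc := lr_C (lr_at b) (a l / a i); have M1 := lr_M br1 bu; have M2 := lr_M br2 bw.
  rewrite (lr_evD (lr_D Oc M1) M2) (lr_evD Oc M1) lr_evC (lr_evM br1 bu) (lr_evM br2 bw).
  by rewrite eub ewb !mulr0 !addr0.
exists (b i / a i) => [|l]; first by rewrite mulf_neq0 // invr_eq0.
by rewrite -[LHS](divfK bi) bE; field.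
Qed.

Variables (n : nat) (e : 'I_n -> vfield X) (i0 : 'I_n).
Hypothesis e0 : e i0 != 0.

(** The identities that put u^N and w^M in the ideal persist near a, so the family is good wherever
    u or w is nonzero; near a they vanish together only at a. *)
Lemma bad_finite : exists l : seq (cpoint X), forall b : cpoint X,
  good e (lr_at b) \/ exists2 a, lin a l & same_point (X := X) b a.
Proof.
suff /near_cover[l lP] : forall a : cpoint X, near a (fun b : cpoint X =>
    good e (lr_at b) \/ same_point (X := X) b a).
  exists l => b; have [a la [g|s]] := lP b; [by left|by right; exists a].
move=> a; have rO := surface_regular2 a nX; have [u [w uw]] := r2_params rO.
have [c [c0 Oc nc]] := primitive_ex rO e0.
have [N [p [Op pE]]] := primitive_pow rO e0 uw c0 Oc nc.
have [M [q [Oq qE]]] := primitive_pow rO e0 (params_sym uw) c0 Oc nc.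
have [Ou Ow eu ew _] := uw.
have h1 : near a (fun b => lr_at b u /\ lr_at b w) by apply: near_and; apply: near_regular.
have h2 : near a (fun b => forall j, lr_at b (c * e j) /\ (lr_at b (p j) /\ lr_at b (q j))).
  by apply: near_ord => j; do 2?[apply: near_and]; apply: near_regular.
apply: near_mono (near_and (near_same_point uw) (near_and h1 h2)).
move=> b [sp [[bu bw] br]].
have bc j : lr_at b (c * e j) by case: (br j).
have lI := idl_lideal bc; have [_ _ _ IM] := lI.
have key x K (t : 'I_n -> vfield X) : lr_at b x -> (forall j, lr_at b (t j)) ->
    x ^+ K = \sum_j t j * (c * e j) -> lr_ev (lr_at b) x != 0 -> good e (lr_at b).
  move=> bx bt E ex; apply: (idl1_good bc).
  have x0 := lr_neq0 ex.
  have -> : 1 = (x ^+ K)^-1 * x ^+ K :> vfield X by rewrite mulVf // expf_neq0.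
  apply: (IM); last by exists t.
  by apply: lr_V; [exact: lr_X|rewrite lr_evX // expf_neq0].
have [eub|eub] := eqVneq (lr_ev (lr_at b) u) 0; last first.
  by left; apply: key bu _ pE eub => j; case: (br j) => _ [].
have [ewb|ewb] := eqVneq (lr_ev (lr_at b) w) 0; last first.
  by left; apply: key bw _ qE ewb => j; case: (br j) => _ [].
by right; apply: sp.
Qed.
End BadFinite.

Section Elimination.
Variable k : numClosedFieldType.

Lemma birmor_id (X : pvar k) (g : ratmap X X) : dom_by g idfun -> birmor g idfun.
Proof.
move=> dg; split=> //; last by exists idfun.
by apply/(morphism_dominates dg) => a; exists a.
Qed.

Lemma isomorphism_id (X : surface k) (g : ratmap X X) : dom_by g idfun -> isomorphism g.
Proof.
move=> dg; have b := birmor_id dg; have [gX nX] := (s_gen (s := X), s_neq0 X).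
exact: (isomorphism_birmor nX nX gX gX b b (fun _ => erefl) (fun _ => erefl)).
Qed.

Lemma id_dom_ex (X : surface k) : exists g : ratmap X X, dom_by g idfun.
Proof. by apply: dom_point => //; exact: s_neq0. Qed.

Lemma blowdown_modification (Y : surface k) (p : cpoint Y) :
  @modification k Y (blowup_surface p) (blowdown p).
Proof.
have [g dg] := id_dom_ex Y; have [t dt] := id_dom_ex (blowup_surface p).
apply: (@modification_blowup k Y (blowup_surface p) Y p g (blowdown p)).
- exact: modification_iso (isomorphism_id dg).
- exists t; first exact: isomorphism_id dt.
  by apply/(comp_dom _ (@blowup_gen k Y p) dt (blowdown_dom p)); exact: (blowdown_dom p).
- by apply/(comp_dom _ (s_gen (s := Y)) (blowdown_dom p) dg); exact: (blowdown_dom p).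
Qed.

Lemma blowdown_birmor (Y : surface k) (p : cpoint Y) :
  birmor (X := blowup_surface p) (blowdown p)
    (idfun : {rmorphism vfield Y -> vfield (blowup_surface p)}).
Proof.
split; first exact: (blowdown_dom p); last by exists idfun.
by apply/(morphism_dominates (blowdown_dom p)) => q; exact: blowdown_below.
Qed.

Definition resolved (Y : surface k) n (e : 'I_n -> vfield Y) :=
  exists (G : surface k) (rho : ratmap G Y) (phi : {rmorphism vfield Y -> vfield G}),
  [/\ modification rho, birmor rho phi
    & forall a : cpoint G, good (fun j => phi (e j)) (lr_at a)].

Lemma resolved_good (Y : surface k) n (e : 'I_n -> vfield Y) :
  (forall a : cpoint Y, good e (lr_at a)) -> resolved e.
Proof.
move=> h; have [g dg] := id_dom_ex Y; exists Y, g, idfun; split=> //.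
  exact: modification_iso (isomorphism_id dg).
exact: birmor_id.
Qed.

Lemma resolved_blowup (Y : surface k) (p : cpoint Y) n
  (e : 'I_n -> vfield Y) : @resolved (blowup_surface p) n e -> resolved e.
Proof.
move=> [G [rho [phi [mr br gd]]]]; have [dr _ _] := br.
have bd := blowdown_birmor p; have [dd _ _] := bd.
have [h dh] : exists h : ratmap G Y, dom_by h (phi \o idfun).
  have [e1 _] := dr; apply: dom_point => [|c]; first exact: s_neq0.
  exact: (e1 c).
exists G, h, (phi \o idfun); split=> //.
- exact: (modification_comp (blowdown_modification p) mr dr dd dh).
- exact: (birmor_comp br bd dh).
Qed.

Lemma lle_eq (L : fieldType) (iota : {rmorphism k -> L}) (R R' : lring iota) :
  lle R R' -> lle R' R -> lr_car R = lr_car R'.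
Proof. by move=> h h'; apply: funext => x; apply: propext; split=> [/h[]|/h'[]]. Qed.

Lemma lam_mono (L : fieldType) (iota : {rmorphism k -> L}) n (e : 'I_n -> L) (O : L -> Prop) N M :
  (N <= M)%N -> lam iota e O N -> lam iota e O M.
Proof.
move=> NM [c [c0 Oc [s [sN sP]]]]; exists c; split=> //; exists s; split=> //.
exact: leq_trans NM.
Qed.

(** Induction on the bound N of the lengths, then on the number of points where only N + 1 is known;
    blowing one up puts good points or points of length at most N over it. Those points are listed
    by their local rings, which keep their meaning while the surface changes and the function field
    does not. *)
Lemma resolved_lam N : forall (Y : surface k) n (e : 'I_n -> vfield Y) i0,
  two_ders (viota Y) -> e i0 != 0 ->
  (forall a : cpoint Y, good e (lr_at a) \/ lam (viota Y) e (lr_at a) N) -> resolved e.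
Proof.
elim: N => [|N IH] Y n e i0 nY e0 h.
  by apply: resolved_good => a; case: (h a) => // /lam0_good.
suff inner m : forall (Y : surface k) (e : 'I_n -> vfield Y) (s : seq (lring (viota Y))),
    two_ders (viota Y) -> e i0 != 0 -> (size s <= m)%N ->
    (forall a : cpoint Y, [\/ good e (lr_at a), lam (viota Y) e (lr_at a) N
      | lam (viota Y) e (lr_at a) N.+1 /\ exists A, [/\ lin A s, lle A (lr_at a) & lle (lr_at a) A]]) ->
    resolved e.
  have [l lP] := bad_finite nY e0.
  apply: (inner (size (map (@lr_at k Y) l)) Y e (map (@lr_at k Y) l)) => // a.
  have [g|[b lb ab]] := lP a; first exact: Or31.
  have [g|la] := h a; first exact: Or31.
  apply: Or33; split=> //; exists (lr_at b); split.
  - elim: (l) lb => //= x r IHr [->|/IHr]; by [left|right].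
  - by apply: same_point_lle; apply: same_point_sym.
  - exact: same_point_lle.
elim: m => [|m IHm] {Y e nY e0 h} Y e s nY e0 sm h.
  apply: (IH Y n e i0) => // a; case: (h a) => [|| [_ [A [+ _ _]]]]; [by left|by right|].
  by case: s sm h.
case: s sm h => [_ h|A s sm h].
  apply: (IH Y n e i0) => // a; case: (h a) => [|| [_ [B [[]]]]]; [by left|by right].
(* If the first ring listed belongs to no point that is still bad, it is dropped from the list. *)
have [[p [pA Ap lp ng nl]]|nex] := pselect (exists p : cpoint Y, [/\ lle A (lr_at p),
    lle (lr_at p) A, lam (viota Y) e (lr_at p) N.+1, ~ good e (lr_at p) & ~ lam (viota Y) e (lr_at p) N]);
  last first.
  apply: (IHm Y e s) => // a; case: (h a) => [g|la|[la [B [/= [AB|Bs] B1 B2]]]].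
  - exact: Or31.
  - exact: Or32.
  - have [g|ng] := pselect (good e (lr_at a)); first exact: Or31.
    have [l|nl] := pselect (lam (viota Y) e (lr_at a) N); first exact: Or32.
    by case: nex; exists a; split; rewrite ?AB.
  - by apply: Or33; split=> //; exists B.
have [u [w [uw drop]]] := lam_drop (surface_regular2 p nY) lp ng.
apply: (@resolved_blowup _ p); apply: (IHm (blowup_surface p) e s) => // q.
have [al [alq [[nsp qal]|[_ cs]]]] := blow_cases q; last first.
  have [[c [qd _]]|[qd _]] := cs u w uw.
    by apply: Or32; apply: (drop (lr_at q)).1; exists c.
  by apply: Or31; apply: (drop (lr_at q)).2.
have E := lle_eq alq qal.
case: (h al) => [g|la|[la [B [AB B1 B2]]]].
- by apply: Or31; rewrite -E.
- by apply: Or32; rewrite -E.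
apply: Or33; rewrite -E; split=> //; exists B; split.
- case: AB => // AB; case: nsp; apply: lle_same_point; subst B.
  exact: lle_trans B2 pA.
- exact: lle_trans B1 alq.
- exact: lle_trans qal B2.
Qed.

Lemma resolved_ex (Y : surface k) n (e : 'I_n -> vfield Y) i0 :
  two_ders (viota Y) -> e i0 != 0 -> resolved e.
Proof.
move=> nY e0; have [l lP] := bad_finite nY e0.
have [N NP] : exists N, forall b, lin b l -> lam (viota Y) e (lr_at b) N.
  elim: l {lP} => [|a l [N NP]]; first by exists 0%N.
  have [M MP] := lam_ex (surface_regular2 a nY) e0.
  exists (maxn M N) => b /= [<-|/NP lb]; first by apply: lam_mono MP; exact: leq_maxl.
  by apply: lam_mono lb; exact: leq_maxr.
apply: (resolved_lam (N := N) nY e0) => a; have [g|[b lb ab]] := lP a; first by left.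
right; rewrite (lle_eq (same_point_lle ab) (same_point_lle (same_point_sym ab))).
exact: NP.
Qed.

(* a good system of coordinates of g \o rho at a yields, by [point_of], the image of a *)
Lemma indeterminacy (X : surface k) (g : ratmap X X) (phi : {rmorphism vfield X -> vfield X}) :
  two_ders (viota X) -> dom_by g phi ->
  exists (G : surface k) (pi1 pi2 : ratmap G X),
    [/\ modification pi1, morphism pi2 & is_comp g pi1 pi2].
Proof.
move=> nX dg; have [i xi] := s_neq0 X.
have ei : phi (@vgen k X i) != 0 by rewrite fmorph_eq0.
have [G [rho [r [mr br gd]]]] := resolved_ex (e := fun j => phi (@vgen k X j)) nX ei.
have [dr _ _] := br; have [rc _] := dr; have [pc _] := dg.
have rpc c : (r \o phi) (viota X c) = viota G c by rewrite /= pc rc.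
have [p2 d2] : exists p2 : ratmap G X, dom_by p2 (r \o phi).
  by apply: dom_point => //; exact: s_neq0.
exists G, rho, p2; split=> //; last by apply/(comp_dom _ (s_gen (s := X)) dr dg).
apply/(morphism_dominates d2) => a; have [j [ej gj]] := gd a.
have xj : @vgen k X j != 0 by move: ej; rewrite !fmorph_eq0.
have [|b [_ bP]] := @point_of k X _ _ (r \o phi) (lr_at a) rpc j xj.
  by move=> l; rewrite fmorph_div; exact: gj.
by exists b.
Qed.
End Elimination.

(** * Two-forms *)

Section RationalForms.
Variables (k : numFieldType) (L : fieldType) (iota : {rmorphism k -> L}).

(* ((h, a), b) stands for the form h da /\ db *)
Definition fval (w : L * L * L) (D E : L -> L) : L := w.1.1 * det2 D E w.1.2 w.2.
Definition feq (w w' : L * L * L) := forall D E, der_on iota D -> der_on iota E ->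
  fval w D E = fval w' D E.
Definition fnz (w : L * L * L) := exists D E,
  [/\ der_on iota D, der_on iota E & fval w D E != 0].
(** Positive order along v without reference to a model, so that it makes sense for v o phi, which
    need not be a normalized valuation. *)
Definition fpos (v : L -> int) (w : L * L * L) := exists c x y,
  [/\ 0 < v c, 0 <= v x, 0 <= v y & feq w (c, x, y)].

Lemma feq_sym w w' : feq w w' -> feq w' w. Proof. by move=> h D E dD dE; rewrite h. Qed.
Lemma feq_trans w1 w2 w3 : feq w1 w2 -> feq w2 w3 -> feq w1 w3.
Proof. by move=> h h' D E dD dE; rewrite h ?h'. Qed.

Lemma fnz_two_ders w : fnz w -> two_ders iota.
Proof.
move=> [D [E [dD dE]]]; rewrite /fval mulf_eq0 negb_or => /andP[_ ne].
by exists D, E, w.1.2, w.2.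
Qed.

Hypothesis n3 : no_indep3 iota.

Section Coefficient.
Variable O : lring iota.
Hypothesis rO : regular2 O.
Variables u w : L.
Hypothesis uw : params O u w.

Lemma coef_ex t : exists c, feq t (c, u, w).
Proof.
have [d1 [d2 [dd1 dd2 [d1u d1w] [d2u d2w] _]]] := r2_der rO uw.
exists (fval t d1 d2) => D E dD dE; rewrite /fval /=.
by rewrite (det2_dual dd1 dd2 d1u d1w d2u d2w n3 _ _ dD dE) mulrA.
Qed.

(* J is the Jacobian of x, y with respect to u, w *)
Lemma jacobian x y : exists J,
  [/\ feq (1, x, y) (J, u, w), forall c c', feq (c, u, w) (c', x, y) -> c = c' * J,
    (forall R : lring iota, (forall h, O h -> R h) -> O x -> O y -> R J) &
    forall v, isdiv O v -> 0 <= v x -> 0 <= v y -> 0 <= v J].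
Proof.
have [d1 [d2 [dd1 dd2 [d1u d1w] [d2u d2w] Od]]] := r2_der rO uw.
exists (det2 d1 d2 x y); split.
- by move=> D E dD dE; rewrite /fval /= mul1r (det2_dual dd1 dd2 d1u d1w d2u d2w n3 _ _ dD dE).
- move=> c c' /(_ _ _ dd1 dd2); rewrite /fval /= => <-.
  by rewrite /det2 d1u d1w d2u d2w mulr1 mulr0 subr0 mulr1.
- move=> R OR Ox Oy; apply: OR; have [? ?] := Od _ Ox; have [? ?] := Od _ Oy.
  by apply: lr_B; apply: lr_M.
- move=> v dv; have nv := idv dv.
  have key d : der_on iota d -> (forall h, O h -> O (d h)) -> forall h, 0 <= v h -> 0 <= v (d h).
    move=> dd dO h /(id_loc dv)[F [G [OF OG G0 vG ->]]].
    have OFG : O (d F * G - F * d G) by apply: lr_B; apply: lr_M => //; apply: dO.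
    have -> : d (F / G) = (d F * G - F * d G) / (G * G) by rewrite (gder_div _ dd G0) /=; field.
    apply: (nvM_ge0 nv); first exact: (id_ge0 dv).
    by rewrite (nvV nv) ?mulf_neq0 // (nvM nv) // vG.
  have k1 := key d1 dd1 (fun h Oh => (Od h Oh).1); have k2 := key d2 dd2 (fun h Oh => (Od h Oh).2).
  move=> vx vy; apply: (nvD_ge0 nv); first by apply: (nvM_ge0 nv); [exact: k1|exact: k2].
  by rewrite (nvN nv); apply: (nvM_ge0 nv); [exact: k1|exact: k2].
Qed.

Lemma coef_neq0 t c : fnz t -> feq t (c, u, w) -> c != 0.
Proof.
move=> [D [E [dD dE nz]]] tc; apply: contra_neq nz => c0.
by rewrite tc // c0 /fval /= mul0r.
Qed.

Lemma fpos_coef v t c : isdiv O v -> fnz t -> feq t (c, u, w) -> (fpos v t <-> 0 < v c).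
Proof.
move=> dv nt tc; have nv := idv dv; have [Ou Ow _ _ _] := uw.
split=> [[c' [x [y [vc' vx vy txy]]]]|vc]; last first.
  by exists c, u, w; split=> //; exact: (id_ge0 dv).
have [J [_ cJ _ vJ]] := jacobian x y.
have cE := cJ _ _ (feq_trans (feq_sym tc) txy).
have := coef_neq0 nt tc; rewrite cE mulf_eq0 negb_or => /andP[c'0 J0].
by rewrite (nvM nv) // ltr_wpDr // vJ.
Qed.
End Coefficient.

Lemma coef_val (O O' : lring iota) v t u w c u' w' c' : regular2 O -> regular2 O' -> params O u w ->
  params O' u' w' -> isdiv O v -> isdiv O' v -> fnz t -> feq t (c, u, w) -> feq t (c', u', w') ->
  v c = v c'.
Proof.
suff half (O1 O2 : lring iota) u1 w1 c1 u2 w2 c2 : regular2 O1 -> params O1 u1 w1 -> params O2 u2 w2 ->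
    isdiv O1 v -> isdiv O2 v -> fnz t -> feq t (c1, u1, w1) -> feq t (c2, u2, w2) -> v c2 <= v c1.
  move=> rO rO' uw uw' dv dv' nt tc tc'; apply/eqP; rewrite eq_le.
  by rewrite (half O O' u w c u' w' c') // (half O' O u' w' c' u w c).
move=> rO1 uw1 [Ou2 Ow2 _ _ _] d1 d2 nt t1 t2; have nv := idv d1.
have [J [_ cJ _ vJ]] := jacobian rO1 uw1 u2 w2.
have cE := cJ _ _ (feq_trans (feq_sym t1) t2).
have := coef_neq0 nt t1; rewrite cE mulf_eq0 negb_or => /andP[c20 J0].
by rewrite (nvM nv) // lerDl; apply: vJ => //; exact: (id_ge0 d2).
Qed.

Lemma coef_dom (R : lring iota) t x y c u w c' : regular2 R -> params R u w -> R x -> R y ->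
  feq t (c, x, y) -> feq t (c', u, w) -> exists2 J, R J & c' = c * J.
Proof.
move=> rR uw Rx Ry tc tc'; have [J [_ cJ RJ _]] := jacobian rR uw x y.
by exists J; [exact: RJ|exact: (cJ _ _ (feq_trans (feq_sym tc') tc))].
Qed.
End RationalForms.

Section FormMap.
Variables (k : numFieldType) (L M : fieldType) (iota : {rmorphism k -> L}) (j : {rmorphism k -> M}).
Variable phi : {rmorphism L -> M}.
Hypothesis pc : forall c, phi (iota c) = j c.

Definition fmap (w : L * L * L) : M * M * M := (phi w.1.1, phi w.1.2, phi w.2).

(** Pullback of forms is well defined: for a vector field T on M, T o phi is a derivation along phi,
    determined by two values through [gder_eq0], so a form pulls back through its one
    coefficient. *)
Lemma feq_map w w' : two_ders iota -> no_indep3 iota -> feq iota w w' -> feq j (fmap w) (fmap w').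
Proof.
move=> [D0 [E0 [a [b [dD0 dE0 ab]]]]] n3 ww'.
have [d1 [d2 [dd1 dd2 [d1a d1b] [d2a d2b]]]] := dual_ders dD0 dE0 ab.
have [A1 M1 C1] := dd1; have [A2 M2 C2] := dd2.
have chain T x : der_on j T -> T (phi x) = phi (d1 x) * T (phi a) + phi (d2 x) * T (phi b).
  move=> [AT MT CT].
  have dT : gder iota phi (fun x => T (phi x) - (phi (d1 x) * T (phi a) + phi (d2 x) * T (phi b))).
    split=> [f g|f g|c].
    - by rewrite !rmorphD AT A1 A2 !rmorphD /=; ring.
    - by rewrite !rmorphM MT M1 M2 !rmorphD !rmorphM /=; ring.
    - by rewrite pc CT C1 C2 !rmorph0; ring.
  apply/eqP; rewrite -subr_eq0; apply/eqP.
  apply: (gder_eq0 dd1 dd2 d1a d1b d2a d2b n3 dT).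
    by rewrite d1a d2a rmorph1 rmorph0; ring.
  by rewrite d1b d2b rmorph1 rmorph0; ring.
have key t T U : der_on j T -> der_on j U ->
    fval (fmap t) T U = phi (fval t d1 d2) * det2 T U (phi a) (phi b).
  move=> dT dU; rewrite /fval /det2 /= (chain T t.1.2 dT) (chain U t.1.2 dU) (chain T t.2 dT) (chain U t.2 dU).
  by rewrite !(rmorphM, rmorphB) /=; ring.
by move=> T U dT dU; rewrite !key // (ww' _ _ dd1 dd2).
Qed.
End FormMap.

Section Pull.
Variables (k : numClosedFieldType) (L M : fieldType).
Variables (iota : {rmorphism k -> L}) (j : {rmorphism k -> M}) (m : {rmorphism L -> M}).
Hypothesis mc : forall c, m (iota c) = j c.
Variable R : lring j.

Let pC c : R (m (iota c)). Proof. by rewrite mc; exact: lr_C. Qed.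
Let pevC c : lr_ev R (m (iota c)) = c. Proof. by rewrite mc lr_evC. Qed.
Let pD x y : R (m x) -> R (m y) -> R (m (x + y)).
Proof. by rewrite rmorphD; exact: lr_D. Qed.
Let pevD x y : R (m x) -> R (m y) -> lr_ev R (m (x + y)) = lr_ev R (m x) + lr_ev R (m y).
Proof. by rewrite rmorphD; exact: lr_evD. Qed.
Let pM x y : R (m x) -> R (m y) -> R (m (x * y)).
Proof. by rewrite rmorphM; exact: lr_M. Qed.
Let pevM x y : R (m x) -> R (m y) -> lr_ev R (m (x * y)) = lr_ev R (m x) * lr_ev R (m y).
Proof. by rewrite rmorphM; exact: lr_evM. Qed.
Let pV x : R (m x) -> lr_ev R (m x) != 0 -> R (m x^-1).
Proof. by rewrite fmorphV; exact: lr_V. Qed.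

Definition lr_pull : lring iota := LRing pC pevC pD pevD pM pevM pV.

Lemma lr_pullE x : lr_pull x = R (m x). Proof. by []. Qed.
Lemma lr_pull_ev x : lr_ev lr_pull x = lr_ev R (m x). Proof. by []. Qed.

Variable mi : M -> L.
Hypothesis miK : cancel mi m.
Variable O : lring iota.

Lemma params_pull u w : (forall h, R (m h) <-> O h) ->
  (forall h, O h -> lr_ev R (m h) = lr_ev O h) -> params O u w -> params R (m u) (m w).
Proof.
move=> RO eR [Ou Ow eu ew huw]; split; try by [apply/RO|rewrite eR].
move=> h; rewrite -[h]miK => /RO Oh; rewrite eR // => eh.
have [r [s [Or Os ->]]] := huw _ Oh eh.
by exists (m r), (m s); split; [apply/RO|apply/RO|rewrite rmorphD !rmorphM].
Qed.

Lemma isdiv_pull v : (forall h, R (m h) <-> O h) -> isdiv R v -> isdiv O (v \o m).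
Proof.
move=> RO dv; have nv := idv dv; split.
- split=> /=; first by rewrite rmorph0 (nv0 nv).
  + by move=> g h g0 h0; rewrite rmorphM (nvM nv) // fmorph_eq0.
  + move=> g h g0 h0; rewrite -(fmorph_eq0 m) rmorphD => gh0.
    by apply: (nvD nv) => //; rewrite fmorph_eq0.
  + by have [t vt] := nv_norm nv; exists (mi t); rewrite /= miK.
- by move=> h /RO; exact: (id_ge0 dv).
- move=> h /(id_loc dv)[F [G []]]; rewrite -[F]miK -[G]miK => /RO OF /RO OG.
  rewrite fmorph_eq0 => G0 vG E; exists (mi F), (mi G); split=> //.
  by apply: (fmorph_inj m); rewrite E fmorph_div.
Qed.
End Pull.

Section PullFpos.
Variables (k : numFieldType) (L M : fieldType).
Variables (iota : {rmorphism k -> L}) (j : {rmorphism k -> M}) (m : {rmorphism L -> M}).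
Hypothesis mc : forall c, m (iota c) = j c.
Hypothesis n3 : no_indep3 iota.
Hypothesis nL : two_ders iota.

Lemma fpos_map (v : M -> int) w : fpos iota (v \o m) w -> fpos j v (fmap m w).
Proof.
move=> [c [x [y [vc vx vy wE]]]]; exists (m c), (m x), (m y); split=> //.
exact: (feq_map mc nL n3 wE).
Qed.

End PullFpos.

Lemma fnz_iso (k : numFieldType) (L M : fieldType) (iota : {rmorphism k -> L})
  (j : {rmorphism k -> M}) (m : {rmorphism L -> M}) (mi : {rmorphism M -> L}) w :
  (forall c, m (iota c) = j c) -> cancel m mi -> cancel mi m -> no_indep3 j ->
  fnz iota w -> fnz j (fmap m w).
Proof.
move=> mc K K' n3 nw; apply: contrapT => nf.
have z : feq j (fmap m w) (0, 0, 0).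
  move=> D E dD dE; rewrite [RHS]mul0r; apply/eqP/negPn/negP => ne.
  by apply: nf; exists D, E.
have nM := two_ders_iso mc K K' (fnz_two_ders nw).
have mic c : mi (j c) = iota c by rewrite -mc K.
have [D [E [dD dE]]] := nw; have := feq_map mic nM n3 z dD dE.
by rewrite /fval /fmap /= !K rmorph0 mul0r => ->; rewrite eqxx.
Qed.

(** * Behaviour of a form under a point blowup *)

Section LocalForms.
Variables (k : numClosedFieldType) (L : fieldType) (iota : {rmorphism k -> L}).
Implicit Types O R : lring iota.
Hypothesis n3 : no_indep3 iota.
Variable t : L * L * L.
Hypothesis nt : fnz iota t.

(** The divisor of c du /\ dw is locally that of c: [lpole] says that 1/c vanishes at the point,
    [lanti] that 1/c is regular there, that is, -Div is effective nearby. *)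
Definition lpole O := exists u w c, [/\ params O u w, feq iota t (c, u, w) & lmax O c^-1].
Definition lanti O := forall u w c, params O u w -> feq iota t (c, u, w) -> O c^-1.

Lemma params_lle O R u w : lle O R -> lle R O -> params O u w -> params R u w.
Proof.
move=> OR RO [Ou Ow eu ew huw].
have [Ru eRu] := OR u Ou; have [Rw eRw] := OR w Ow.
split; rewrite ?eRu ?eRw // => h /RO[Oh eOh] eh.
have [|r [s [Or Os ->]]] := huw h Oh; first by rewrite eOh.
by exists r, s; split=> //; [case: (OR r Or)|case: (OR s Os)].
Qed.

Lemma lpole_lle O R : lle O R -> lle R O -> lpole O -> lpole R.
Proof.
move=> OR RO [u [w [c [uw tc [Oc ec]]]]]; exists u, w, c; split=> //.
  exact: params_lle uw.
by have [Rc eRc] := OR _ Oc; split; rewrite ?eRc.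
Qed.

Lemma lanti_lle O R : lle O R -> lle R O -> lanti O -> lanti R.
Proof. by move=> OR RO aO u w c uw tc; case: (OR c^-1) => //; apply: (aO u w) => //; exact: params_lle uw. Qed.

Lemma lanti_one R u w c : regular2 R -> params R u w -> feq iota t (c, u, w) -> R c^-1 -> lanti R.
Proof.
move=> rR uw tc Rc u' w' c' uw' tc'; have [Ru Rw _ _ _] := uw'.
have [J RJ cE] := coef_dom n3 rR uw Ru Rw tc' tc.
have := coef_neq0 nt tc; rewrite cE mulf_eq0 negb_or => /andP[c'0 J0].
have -> : c'^-1 = c^-1 * J by rewrite cE; field; rewrite J0 c'0.
exact: lr_M.
Qed.

Lemma lanti_free O u w c : lanti O -> ~ lpole O -> params O u w -> feq iota t (c, u, w) -> O c.
Proof.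
move=> aO np uw tc; have Oc := aO u w c uw tc; rewrite -[c]invrK; apply: lr_V => //.
by apply/eqP => ec; apply: np; exists u, w, c.
Qed.

(** From du /\ dw = u du /\ d(w/u): the coefficient gains the exceptional equation once. *)
Lemma feq_blow u w c e : u != 0 -> feq iota t (c, u, w) -> feq iota t (c * u, u, w / u - iota e).
Proof.
move=> u0 tc D E dD dE; rewrite (tc _ _ dD dE) /fval /det2 /=.
have key T : der_on iota T -> T (w / u - iota e) = (u * T w - w * T u) / u ^+ 2.
  by move=> dT; have [TA _ TC] := dT; rewrite TA (gderN _ dT) TC oppr0 addr0 (gder_div _ dT u0).
by rewrite !key //; field.
Qed.

Lemma feq_swap u w c : feq iota t (c, u, w) -> feq iota t (- c, w, u).
Proof. by move=> tc D E dD dE; rewrite (tc _ _ dD dE) /fval /det2 /=; ring. Qed.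

(** A curve on which u has value 0 is not exceptional; the denominators u^i being units for it, it
    is a curve through the center. *)
Lemma quad_isdiv O R u w e v : regular2 O -> params O u w -> isquad O u w e R ->
  isdiv R v -> v u = 0 -> isdiv O v.
Proof.
move=> rO uw qd dv vu; have nv := idv dv; have [OR _ _ _] := qd; have u0 := params_neq0 rO uw.
split=> // [h /OR[Rh _]|h /(id_loc dv)[F [G [RF RG G0 vG ->]]]]; first exact: (id_ge0 dv).
have key x : R x -> exists a b, [/\ O a, O b, b != 0, v b = 0 & x = a / b].
  move=> /(quad_frac rO uw qd)[_ [_ [[i [a [ma ->]]] [j [b [mb ->]]] eb ->]]].
  have Oa := mp_O uw ma; have Ob := mp_O uw mb.
  have Rb : R (b / u ^+ j) := mp_quad rO uw qd mb.
  have := lr_neq0 eb; rewrite mulf_eq0 negb_or => /andP[b0 _].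
  have vb : v b = 0.
    have := isdiv_unit dv (conj Rb eb); rewrite (nvdiv nv) ?expf_neq0 //.
    by rewrite (nvX nv) vu mul0rn subr0.
  exists (a * u ^+ j), (b * u ^+ i); have [Ou _ _ _ _] := uw; split.
  - by apply: lr_M => //; exact: lr_X.
  - by apply: lr_M => //; exact: lr_X.
  - by rewrite mulf_neq0 // expf_neq0.
  - by rewrite (nvM nv) ?expf_neq0 // vb (nvX nv) vu mul0rn.
  - by field; rewrite b0 !expf_neq0.
have [a [b [Oa Ob b0 vb E]]] := key F RF; have [a' [b' [Oa' Ob' b'0 vb' E']]] := key G RG.
have a'0 : a' != 0 by apply: contra_neq G0 => a'0; rewrite E' a'0 mul0r.
exists (a * b'), (b * a'); split.
- exact: lr_M.
- exact: lr_M.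
- by rewrite mulf_neq0.
- by move: vG; rewrite E' (nvdiv nv) // vb' subr0 (nvM nv) // vb => ->.
- by rewrite E E'; field; rewrite a'0 b0 b'0.
Qed.

(** With c regular, the new coefficient c u is positive wherever u is, so a curve that is not
    positive is not exceptional. *)
Lemma exceptional_case O R u w c e v : regular2 O -> params O u w -> isquad O u w e R ->
  isdiv R v -> feq iota t (c, u, w) -> O c -> ~ fpos iota v t ->
  R u -> R (w / u - iota e) -> isdiv O v.
Proof.
move=> rO uw qd dv tc Oc nf Ru Rt; have nv := idv dv; have [OR _ _ _] := qd.
have u0 := params_neq0 rO uw; have c0 := coef_neq0 nt tc.
apply: (quad_isdiv rO uw qd dv); have vu := id_ge0 dv Ru.
apply/eqP; rewrite eq_le vu andbT leNgt; apply/negP => pu; apply: nf.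
exists (c * u), u, (w / u - iota e); split=> //; last exact: feq_blow.
- by rewrite (nvM nv) // ltr_wpDl //; apply: (id_ge0 dv); case: (OR c Oc).
- exact: (id_ge0 dv).
Qed.

(** At a pole 1/c = r u + s w, hence 1/(c u) = r + s (w/u) is still regular. *)
Lemma lanti_blow O R u w c e : regular2 O -> regular2 R -> params O u w -> isquad O u w e R ->
  params R u (w / u - iota e) -> feq iota t (c, u, w) -> lmax O c^-1 -> lanti R.
Proof.
move=> rO rR uw qd uw' tc [Oc ec]; have [OR Rt _ _] := qd; have u0 := params_neq0 rO uw.
apply: (lanti_one rR uw' (feq_blow e u0 tc)).
have [_ _ _ _ huw] := uw; have [r [s [Or Os E]]] := huw _ Oc ec.
rewrite invfM E; have -> : (r * u + s * w) * u^-1 = r + s * (w / u) by field.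
have [Rr _] := OR r Or; have [Rs _] := OR s Os.
by apply: lr_D => //; apply: lr_M.
Qed.
End LocalForms.

(** * Contracting the zeros of the form *)

Section Adapted.
Variables (k : numClosedFieldType) (S : surface k).
Variable om : vfield S * vfield S * vfield S.

Lemma surface_n3 (Y : surface k) : no_indep3 (viota Y).
Proof. by case: (s_dim Y). Qed.

(* X' is X with the curves of positive order of the form contracted *)
Definition adapted (X : surface k) (p : {rmorphism vfield S -> vfield X}) : Prop :=
  exists (X' : surface k) (pi' : ratmap X' S) (p' : {rmorphism vfield S -> vfield X'})
      (m : {rmorphism vfield X' -> vfield X}) (mi : {rmorphism vfield X -> vfield X'}),
    [/\ [/\ modification pi', birmor pi' p', cancel m mi /\ cancel mi m
        , forall c, m (viota X' c) = viota X c & forall x, m (p' x) = p x],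
      forall a : cpoint X, exists b : cpoint X', dominates m b a /\
        (lpole (fmap p' om) (lr_at b) -> forall h, lr_at a (m h) -> lr_at b h),
      forall b : cpoint X', lanti (fmap p' om) (lr_at b)
    & forall v : primediv X, ~ fpos (viota X) v (fmap p om) ->
        exists v' : primediv X', forall h, v' h = v (m h)].

Lemma adapted_id : (forall a : cpoint S, lanti om (lr_at a)) -> adapted (idfun : {rmorphism _ -> vfield S}).
Proof.
move=> an; have [g dg] := id_dom_ex S.
have omE : fmap idfun om = om by case: (om) => [[]].
exists S, g, idfun, idfun, idfun; split.
- split=> //; first exact: modification_iso (isomorphism_id dg).
  exact: birmor_id.
- by move=> a; exists a; split=> // h.
- by rewrite omE.
- by move=> v _; exists v.
Qed.

Lemma iso_ring (X Y : surface k) (th : ratmap X Y) (g : ratmap Y X)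
  (t : {rmorphism vfield Y -> vfield X}) (s : {rmorphism vfield X -> vfield Y}) :
  birmor th t -> birmor g s -> cancel t s -> cancel s t ->
  forall a : cpoint X, exists b : cpoint Y, dominates t b a /\ forall h, lr_at a (t h) -> lr_at b h.
Proof.
move=> [dt mt _] [ds ms _] ts st a.
have [b ba] := (morphism_dominates dt).1 mt a; have [a2 a2b] := (morphism_dominates ds).1 ms b.
exists b; split=> // h ah; have [sc _] := ds; have [tc _] := dt.
have le : lle (lr_at a2) (lr_at a).
  by move=> x /a2b[/ba[]]; rewrite st => ax -> ->.
have [a2h _] := same_point_lle (same_point_sym (lle_same_point le)) ah.
by have [] := a2b _ a2h; rewrite ts.
Qed.

Lemma adapted_iso (X B : surface k) (th : ratmap X B) (g : ratmap B X)
  (t : {rmorphism vfield B -> vfield X}) (s : {rmorphism vfield X -> vfield B})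
  (q : {rmorphism vfield S -> vfield B}) (p : {rmorphism vfield S -> vfield X}) :
  birmor th t -> birmor g s -> cancel t s -> cancel s t -> (forall x, p x = t (q x)) ->
  two_ders (viota B) -> adapted q -> adapted p.
Proof.
move=> bt bs ts st pE nB [X' [pi' [q' [m [mi [[mpi bpi [mK miK] mc mq] lift an nonpos]]]]]].
have [[tc _] _ _] := bt; have [[sc _] _ _] := bs.
exists X', pi', q', (t \o m), (mi \o s); split=> //.
- split=> //; first by split=> h /=; [rewrite ts mK|rewrite miK st].
  + by move=> c /=; rewrite mc tc.
  + by move=> x /=; rewrite mq pE.
- move=> a; have [b [ba bE]] := iso_ring bt bs ts st a; have [b' [b'b b'E]] := lift b.
  exists b'; split; first by move=> h /b'b[/ba[? ->] ->].
  by move=> po h /bE; apply: b'E.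
- move=> v nv; have [a va] := primediv_point v; have [b [ba bE]] := iso_ring bt bs ts st a.
  have dv : isdiv (lr_at b) (v \o t).
    apply: (isdiv_pull (R := lr_at a) st); last exact: pass_isdiv.
    by move=> h; split=> [/bE|/ba[]].
  have [v1 v1E] := isdiv_primediv dv.
  have v1E' : (v1 : vfield B -> int) = v \o t by apply: funext.
  have [|v' v'E] := nonpos v1; last by exists v' => h; rewrite v'E v1E.
  rewrite v1E' => fp; apply: nv; have := fpos_map tc (surface_n3 (Y := B)) nB fp.
  by rewrite /fmap /= !pE.
Qed.

Section Blow.
Variables (Y : surface k) (p : cpoint Y) (q : {rmorphism vfield S -> vfield Y}).
Let B := blowup_surface p.
Let n3 := surface_n3 (Y := Y).
Hypothesis nt : fnz (viota Y) (fmap q om).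
Let nY : two_ders (viota Y) := fnz_two_ders nt.
Let t := fmap q om.

Variables (Y' : surface k) (rho' : ratmap Y' S) (q' : {rmorphism vfield S -> vfield Y'}).
Variables (m : {rmorphism vfield Y' -> vfield Y}) (mi : {rmorphism vfield Y -> vfield Y'}).
Hypothesis mrho : modification rho'.
Hypothesis brho : birmor rho' q'.
Hypothesis mK : cancel m mi.
Hypothesis miK : cancel mi m.
Hypothesis mc : forall c, m (viota Y' c) = viota Y c.
Hypothesis mq : forall x, m (q' x) = q x.
Hypothesis lift : forall a : cpoint Y, exists b : cpoint Y', dominates m b a /\
  (lpole (fmap q' om) (lr_at b) -> forall h, lr_at a (m h) -> lr_at b h).
Hypothesis anti : forall b : cpoint Y', lanti (fmap q' om) (lr_at b).
Hypothesis nonpos : forall v : primediv Y, ~ fpos (viota Y) v (fmap q om) ->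
  exists v' : primediv Y', forall h, v' h = v (m h).
Variable p' : cpoint Y'.
Hypothesis p'p : dominates m p' p.
Let t' := fmap q' om.
Let tE : fmap m t' = t. Proof. by rewrite /t /t' /fmap /= !mq. Qed.
Let n3' := surface_n3 (Y := Y').
Let mic c : mi (viota Y c) = viota Y' c. Proof. by rewrite -mc mK. Qed.
Let nt' : fnz (viota Y') t'.
Proof.
have -> : t' = fmap mi t by rewrite /t' /t /fmap /= -!mq !mK.
exact: fnz_iso mic miK mK n3' nt.
Qed.
Let nY' : two_ders (viota Y') := fnz_two_ders nt'.

Let dom_uniq (a : cpoint Y) (b b' : cpoint Y') : dominates m b a -> dominates m b' a ->
  same_point (X := Y') b b'.
Proof. by move=> ba b'a; apply: (@point_uniq k Y' _ (viota Y) m (lr_at a)). Qed.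

Lemma over_p (al : cpoint Y) (b : cpoint Y') : same_point (X := Y) al p ->
  dominates m b al -> same_point (X := Y') b p'.
Proof.
move=> alp ba; apply: (dom_uniq ba) => h /p'p[ph <-].
exact: (same_point_lle (same_point_sym alp)).
Qed.

Let nonpos_al (al : cpoint Y) v : isdiv (lr_at al) v -> ~ fpos (viota Y) v t ->
  exists v' : primediv Y', forall h, v' h = v (m h).
Proof.
move=> dv nv; have [v1 v1E] := isdiv_primediv dv.
have E : (v1 : vfield Y -> int) = v by apply: funext.
have [|v' v'E] := nonpos (v := v1); first by rewrite E.
by exists v' => h; rewrite v'E E.
Qed.

(** Y' is kept. Without a pole at p', the coefficient c is regular at p, so the exceptional curve is
    positive and may be lost on Y'. *)
Lemma adapted_free : ~ lpole t' (lr_at p') -> adapted (X := B) q.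
Proof.
move=> np; exists Y', rho', q', m, mi; split=> //.
- move=> a; have [al [ala cs]] := blow_cases a; have [b [bal bE]] := lift al.
  exists b; split; first by move=> h /bal[/ala[? ->] ->].
  move=> po h; case: cs => [[_ aal] /aal[alh _]|[alp _]]; first exact: bE.
  case: np; have bp := over_p alp bal.
  exact: (lpole_lle (same_point_lle bp) (same_point_lle (same_point_sym bp)) po).
move=> v nv; have [a va] := primediv_point v; have dv := pass_isdiv va.
have [al [ala cs]] := blow_cases a.
case: cs => [[_ aal]|[_ cs]].
  have E := lle_eq ala aal; apply: (nonpos_al (al := al)) => //.
  split; first exact: (idv dv).
    by rewrite E => h; exact: (id_ge0 dv).
  by move=> h /(id_loc dv); rewrite E.
have rO := surface_regular2 p nY; have [u [w uw]] := r2_params rO; have [Ou Ow _ _ _] := uw.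
have [c tc] := coef_ex n3 rO uw t.
have [u' [w' uw']] := r2_params (surface_regular2 p' nY'); have [Ou' Ow' _ _ _] := uw'.
have [c' tc'] := coef_ex n3' (surface_regular2 p' nY') uw' t'.
have Oc : lr_at p c.
  have := feq_map mc nY' n3' tc'; rewrite tE => tmc'.
  have [J OJ ->] := coef_dom n3 rO uw (p'p Ou').1 (p'p Ow').1 tmc' tc.
  have Oc' : lr_at p' c' := lanti_free (@anti p') np uw' tc'.
  by apply: lr_M => //; case: (p'p Oc').
apply: (nonpos_al (al := p)) (nv).
have [[e [qd uwR]]|[qd uwR]] := cs u w uw; have [Ru Rt _ _ _] := uwR.
  exact: (exceptional_case nt rO uw qd dv tc Oc nv Ru Rt).
apply: (exceptional_case nt rO (params_sym uw) qd dv (feq_swap tc) _ nv Ru Rt).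
exact: lr_N.
Qed.

Hypothesis pole : lpole t' (lr_at p').
Hypothesis ringp : forall h, lr_at p (m h) -> lr_at p' h.
Let B' := blowup_surface p'.

Let quad_le (a : cpoint B) (b : cpoint B') x y e :
  isquad (lr_at p) (m x) (m y) e (lr_at a) -> lle (lr_at b) (lr_pull mc (lr_at a)) ->
  lr_at b (y / x) -> forall h, lr_at a (m h) -> lr_at b h.
Proof.
move=> [OR Rt et minR] bR bt h; have [_ ebt] := bR _ bt.
have [al [alb cs]] := blow_cases b.
have alp : same_point (X := Y') al p'.
  have le1 : lle (lr_at al) (lr_pull mc (lr_at a)) by exact: lle_trans alb bR.
  have le2 : lle (lr_at p') (lr_pull mc (lr_at a)).
    by move=> g /p'p[/OR[ag eag] <-].
  exact: (@point_uniq k Y' _ (viota Y') idfun (lr_pull mc (lr_at a))).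
have lepb : lle (lr_at p') (lr_at b).
  exact: lle_trans (same_point_lle (same_point_sym alp)) alb.
move=> ah; have [|||bmh _] := minR (lr_pull mic (lr_at b)) _ _ _ (m h) ah.
- move=> g pg; have p'g : lr_at p' (mi g) by apply: ringp; rewrite miK.
  have [_ eg] := p'p p'g; have [bg ebg] := lepb _ p'g.
  by split; [exact: bg|rewrite lr_pull_ev ebg -eg miK].
- by rewrite lr_pullE fmorph_div !mK.
- by rewrite lr_pull_ev fmorph_div !mK -ebt lr_pull_ev fmorph_div.
by move: bmh; rewrite lr_pullE mK.
Qed.

Let eqp h : lr_at p (m h) <-> lr_at p' h.
Proof. by split=> [/ringp|/p'p[]]. Qed.

(** [ringp] makes the local rings of p and p' equal, so parameters at p' are parameters at p, and
    the slope of a tells in which chart of B' its image lies. Minimality of quadratic transforms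
    ([quad_le]) then identifies the rings. *)
Lemma lift_over (a : cpoint B) (al : cpoint Y) :
  same_point (X := Y) al p -> lle (lr_at al) (lr_at a) ->
  (forall u w, params (lr_at p) u w ->
    (exists c, isquad (lr_at p) u w c (lr_at a) /\ params (lr_at a) u (w / u - viota Y c)) \/
    isquad (lr_at p) w u 0 (lr_at a) /\ params (lr_at a) w (u / w - viota Y 0)) ->
  exists b : cpoint B', lle (lr_at b) (lr_pull mc (lr_at a)) /\
    forall h, lr_at a (m h) -> lr_at b h.
Proof.
move=> alp ala cs.
have rO' := surface_regular2 p' nY'; have [u [w uw]] := r2_params rO'.
have uwm : params (lr_at p) (m u) (m w).
  by apply: (params_pull miK eqp _ uw) => h /p'p[].
have u0 := params_neq0 rO' uw; have w0 := params_neq0 rO' (params_sym uw).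
have lep : lle (lr_at p') (lr_pull mc (lr_at a)).
  move=> g /p'p[pg <-]; have [alg <-] := same_point_lle (same_point_sym alp) pg.
  exact: ala.
have contra x y : x != 0 -> y != 0 -> lr_at a (m (x / y)) -> lr_ev (lr_at a) (m (x / y)) = 0 ->
    ~ lr_at a (m (y / x)).
  move=> x0 y0 axy exy ayx.
  have := lr_ev1 (lr_at a); have -> : 1 = m (x / y) * m (y / x).
    by rewrite -rmorphM (_ : x / y * (y / x) = 1) ?rmorph1 //; field; rewrite x0 y0.
  by rewrite (lr_evM axy ayx) exy mul0r => /esym/eqP; rewrite oner_eq0.
have over (b : cpoint B') : lle (lr_at b) (lr_pull mc (lr_at a)) ->
    lr_at b (w / u) \/ lr_at b (u / w) /\ lr_ev (lr_at b) (u / w) = 0.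
  move=> ba; have [be [beb cb]] := blow_cases b.
  have bep : same_point (X := Y') be p'.
    apply: (@point_uniq k Y' _ (viota Y') idfun (lr_pull mc (lr_at a))) => //.
    exact: lle_trans beb ba.
  case: cb => [[]//|[_ cb]].
  by have [[c [[_ ? _ _] _]]|[[_ ? ? _] _]] := cb u w uw; [left|right].
have [[c [qd _]]|[qd _]] := cs _ _ uwm; have [_ Rt et _] := qd.
  have [|b ba] := blow_lift_quad nY' uw lep; first by rewrite /= fmorph_div.
  exists b; split=> //; apply: (quad_le qd ba); case: (over b ba) => // -[bt ebt].
  have [abt eabt] := ba _ bt.
  have e0 : lr_ev (lr_at a) (m (u / w)) = 0 by rewrite -(lr_pull_ev mc) eabt.
  by case: (contra u w u0 w0 abt e0); rewrite fmorph_div.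
have [|b ba] := blow_lift_quad nY' (params_sym uw) lep; first by rewrite /= fmorph_div.
exists b; split=> //; apply: (quad_le qd ba); case: (over b ba) => [bwu|[]//].
have [abt _] := ba _ bwu; case: (contra u w u0 w0) => //.
  by rewrite fmorph_div.
by rewrite fmorph_div.
Qed.

(** Both surfaces are blown up, at p and p'. Over the centers [lift_over] applies; elsewhere the
    blowdowns are local isomorphisms. *)
Lemma adapted_pole : adapted (X := B) q.
Proof.
have [h2 dh2] : exists h2 : ratmap B' S, dom_by h2 ((idfun : {rmorphism vfield Y' -> vfield B'}) \o q').
  have [[qc _] _ _] := brho; apply: dom_point; [exact: s_neq0|exact: qc].
have bd := blowdown_birmor p'; have [dd _ _] := bd; have [drho _ _] := brho.
have lift_all (a : cpoint B) : exists b : cpoint B', @dominates k B B' m b a /\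
    ((forall h, lr_at a (m h) -> lr_at b h) \/
     exists (al : cpoint Y) (b1 : cpoint Y'), [/\ lle (lr_at al) (lr_at a), lle (lr_at a) (lr_at al),
       dominates m b1 al, lle (lr_at b) (lr_at b1) /\ lle (lr_at b1) (lr_at b) &
       lpole t' (lr_at b1) -> forall h, lr_at al (m h) -> lr_at b1 h]).
  have [al [ala [[nal aal]|[alp cs]]]] := blow_cases a; last first.
    have [b [ba bE]] := lift_over alp ala cs; exists b; split; last by left.
    by move=> h /ba.
  have [b1 [b1al b1E]] := lift al.
  (* A point of Y over the pole p' has the local ring of p', hence is p. *)
  have nb1 : ~ same_point (X := Y') b1 p'.
    move=> b1p; apply: nal; apply: lle_same_point => h; rewrite -[h]miK => alh.
    have pb1 : lpole t' (lr_at b1).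
      exact: lpole_lle (same_point_lle (same_point_sym b1p)) (same_point_lle b1p) pole.
    have b1h := b1E pb1 _ alh; have [p'h e1] := same_point_lle b1p b1h.
    have [ph e2] := p'p p'h; have [_ e3] := b1al _ b1h.
    by split; [exact: ph|rewrite e2 e3 e1].
  have [b [bb1 b1b]] := blow_lift_off nb1; exists b; split.
    by move=> h /bb1[/b1al[/ala[? ->] ->] ->].
  by right; exists al, b1.
exists B', h2, (idfun \o q'), m, mi; split.
- split=> //.
  + exact: (modification_comp mrho (blowdown_modification p') dd drho dh2).
  + exact: (birmor_comp bd brho dh2).
- move=> a; have [b [ba cs]] := lift_all a; exists b; split=> // po h ah.
  case: cs => [bE|[al [b1 [ala aal b1al [bb1 b1b] b1E]]]]; first exact: bE.
  have [alh _] := aal _ ah; have po1 : lpole t' (lr_at b1) by apply: (lpole_lle bb1 b1b) po.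
  by have [] := b1b _ (b1E po1 _ alh).
- move=> b; have [be [beb [[_ bbe]|[bep cb]]]] := blow_cases b.
    exact: lanti_lle beb bbe (@anti be).
  have [u [w [c [uw tc ca]]]] := pole; have rO' := surface_regular2 p' nY'.
  have rR := surface_regular2 (X := B') b nY'.
  have [[e [qd uwR]]|[qd uwR]] := cb u w uw.
    exact: (lanti_blow n3' nt' rO' rR uw qd uwR tc ca).
  apply: (lanti_blow n3' nt' rO' rR (params_sym uw) qd uwR (feq_swap tc)).
  have [Oc ec] := ca; rewrite invrN; split; first exact: lr_N.
  by rewrite lr_evN // ec oppr0.
move=> v nv; have [a va] := primediv_point v; have dv := pass_isdiv va.
have [b [ba cs]] := lift_all a.
case: cs => [bE|[al [b1 [ala aal b1al [bb1 b1b] b1E]]]].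
  have db : isdiv (lr_at b) (v \o m).
    apply: (isdiv_pull (R := lr_at a) miK) dv => h; split=> [|/ba[]//]; exact: bE.
  by have [v' v'E] := isdiv_primediv db; exists v'.
have dal : isdiv (lr_at al) v by split; rewrite ?(lle_eq ala aal); case: dv.
have [v1 v1E] := nonpos_al dal nv.
have d1 : isdiv (lr_at b1) v1.
  apply/pass_isdivP => h b1h; rewrite v1E; apply: (id_ge0 dal).
  by have [] := b1al _ b1h.
have db : isdiv (lr_at b) v1 by split; rewrite ?(lle_eq bb1 b1b); case: d1.
by have [v' v'E] := isdiv_primediv db; exists v' => h; rewrite v'E v1E.
Qed.
End Blow.
End Adapted.

Section AdaptedModification.
Variables (k : numClosedFieldType) (S : surface k).
Variable om : vfield S * vfield S * vfield S.
Hypothesis nom : fnz (viota S) om.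

Lemma birmor_fnz (Y : surface k) (rho : ratmap Y S) q : birmor rho q -> fnz (viota Y) (fmap q om).
Proof.
by move=> [[qc _] _ [qi [h1 h2]]]; apply: (fnz_iso qc h1 h2 (surface_n3 (Y := Y)) nom).
Qed.

Lemma adapted_blowup (Y : surface k) (rho : ratmap Y S) q (p : cpoint Y) :
  birmor rho q -> adapted om q -> adapted om (X := blowup_surface p) q.
Proof.
move=> bq [X' [pi' [q' [m [mi [[mpi bpi [mK miK] mc mq] lift an nonpos]]]]]].
have nt := birmor_fnz bq; have [p' [p'p pE]] := lift p.
have [po|np] := pselect (lpole (fmap q' om) (lr_at p')).
  exact: (adapted_pole nt mpi bpi mK miK mc mq lift an nonpos p'p po (pE po)).
exact: (adapted_free nt mpi bpi mK miK mc mq lift an nonpos p'p np).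
Qed.

Lemma adapted_modification (X : surface k) (pi : ratmap X S) p :
  (forall a : cpoint S, lanti om (lr_at a)) -> modification pi -> dom_by pi p -> adapted om p.
Proof.
move=> an; have nS := fnz_two_ders nom; move=> mpi.
elim: mpi p => {X pi} [X pi ipi|X Y p rho beta pi mrho IH [theta itheta cbeta] cpi] q dq.
  have [phi [psi [g [bphi bpsi h1 h2]]]] := isomorphismP (s_gen (s := X)) (s_gen (s := S)) ipi.
  have [dphi _ _] := bphi; have e := dom_by_inj (s_gen (s := S)) dq dphi.
  have ad := adapted_id an.
  exact: (@adapted_iso k S om X S pi g phi psi idfun q bphi bpsi h1 h2 e nS ad).
have [r br] := modification_birmor mrho; have [dr _ _] := br.
have gB := @blowup_gen k Y p; have nB := fnz_two_ders (birmor_fnz br).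
have [t [s [g [bt bs ts st]]]] := isomorphismP (s_gen (s := X)) gB itheta.
have [dt _ _] := bt; have dd := blowdown_dom p.
have dbeta : dom_by beta (t \o idfun) by apply/(comp_dom _ gB dt dd).
have dpi := (comp_dom pi (s_gen (s := Y)) dbeta dr).1 cpi.
have e := dom_by_inj (s_gen (s := S)) dq dpi.
have ad := adapted_blowup p br (IH r dr).
have e' x : q x = t (r x) by rewrite e.
exact (@adapted_iso k S om X (blowup_surface p) theta g t s r q bt bs ts st e' nB ad).
Qed.
End AdaptedModification.

Section FormDivisor.
Variables (k : numClosedFieldType) (Y : surface k).
Variable t : vfield Y * vfield Y * vfield Y.
Hypothesis nt : fnz (viota Y) t.
Let nY := fnz_two_ders nt.
Let n3 := surface_n3 (Y := Y).

(** At a nearby b both Jacobians between (u, w) and parameters at b are regular: one by [coef_dom],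
    the other because d/du and d/dw preserve regularity at b once they do so on the chart
    coordinates. *)
Lemma near_coef (a : cpoint Y) u w c : params (lr_at a) u w -> feq (viota Y) t (c, u, w) ->
  near a (fun b : cpoint Y => forall u' w' c', params (lr_at b) u' w' ->
    feq (viota Y) t (c', u', w') -> forall v : primediv Y, passes_through v b -> v c = v c').
Proof.
move=> uw tc; have rO := surface_regular2 a nY.
have [d1 [d2 [dd1 dd2 [d1u d1w] [d2u d2w] Od]]] := r2_der rO uw.
have [i ai] := pt_neq0 a; pose z l := @vgen k Y l / @vgen k Y i.
have [Ou Ow _ _ _] := uw; have [Oz _] := lr_at_gen ai.
have h1 : near a (fun b : cpoint Y => b i != 0) by apply: near_coord.
have h2 : near a (fun b => lr_at b u /\ lr_at b w) by apply: near_and; apply: near_regular.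
have h3 : near a (fun b => forall l, lr_at b (d1 (z l)) /\ lr_at b (d2 (z l))).
  by apply: near_ord => l; have [? ?] := Od _ (Oz l); apply: near_and; apply: near_regular.
apply: near_mono (near_and h1 (near_and h2 h3)) => b [bi [[bu bw] bz]] u' w' c' uw' tc' v vb.
have rb := surface_regular2 b nY; have [Oz' gz] := lr_at_gen bi.
have pres d : der_on (viota Y) d -> (forall l, lr_at b (d (z l))) -> forall h, lr_at b h -> lr_at b (d h).
  move=> dd dz h /gz[F [G [eG ->]]].
  have key P : lr_at b (d (mmap (viota Y) z P)).
    rewrite (gder_chain z P dd); apply: lr_sum => l; apply: lr_M => //.
    exact: (lr_mmap _ Oz').1.
  have OF := (lr_mmap F Oz').1; have OG := (lr_mmap G Oz').1.
  have KF := key F; have KG := key G.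
  move: (mmap _ _ F) (mmap _ _ G) eG OF OG KF KG => f g eg Of Og Kf Kg.
  have -> : d (f / g) = (g * d f - f * d g) / g ^+ 2 := gder_div f dd (lr_neq0 eg).
  apply: lr_div.
  - by apply: lr_B; apply: lr_M.
  - exact: lr_X.
  - by rewrite lr_evX // expf_neq0.
have [Ou' Ow' _ _ _] := uw'.
have Oj : lr_at b (det2 d1 d2 u' w').
  have p1 := pres d1 dd1 (fun l => (bz l).1); have p2 := pres d2 dd2 (fun l => (bz l).2).
  by apply: lr_B; apply: lr_M; auto.
have cE : c = c' * det2 d1 d2 u' w'.
  have := feq_trans (feq_sym tc) tc' dd1 dd2; rewrite /fval /= => <-.
  by rewrite /det2 d1u d1w d2u d2w mulr1 mulr0 subr0 mulr1.
have [J OJ c'E] := coef_dom n3 rb uw' bu bw tc tc'.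
have c0 := coef_neq0 nt tc; have c'0 := coef_neq0 nt tc'.
have nv := primediv_nval v.
apply/eqP; rewrite eq_le; apply/andP; split.
  have J0 : J != 0 by move: c'0; rewrite c'E mulf_eq0 negb_or => /andP[].
  by rewrite c'E (nvM nv) // lerDl; exact: vb.
have j0 : det2 d1 d2 u' w' != 0 by move: c0; rewrite cE mulf_eq0 negb_or => /andP[].
by rewrite cE (nvM nv) // lerDl; exact: vb.
Qed.

Lemma form_divisor : exists D : divisor Y, forall (a : cpoint Y) u w c,
  params (lr_at a) u w -> feq (viota Y) t (c, u, w) -> local_equation D a c.
Proof.
have /choice[f fP] : forall v : primediv Y, exists n : int, forall (a : cpoint Y) u w c,
    passes_through v a -> params (lr_at a) u w -> feq (viota Y) t (c, u, w) -> v c = n.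
  move=> v; have [a va] := primediv_point v; have rO := surface_regular2 a nY.
  have [u [w uw]] := r2_params rO; have [c tc] := coef_ex n3 rO uw t.
  exists (v c) => b u' w' c' vb uw' tc'.
  by apply: (coef_val n3 (surface_regular2 b nY) rO uw' uw _ _ nt tc' tc); exact: pass_isdiv.
have /choice[C CP] : forall a : cpoint Y, exists c, c != 0 /\
    near a (fun b : cpoint Y => forall v : primediv Y, passes_through v b -> v c = f v).
  move=> a; have rO := surface_regular2 a nY; have [u [w uw]] := r2_params rO.
  have [c tc] := coef_ex n3 rO uw t; exists c; split; first exact: coef_neq0 nt tc.
  apply: near_mono (near_coef uw tc) => b h v vb.
  have rb := surface_regular2 b nY; have [u' [w' uw']] := r2_params rb.
  have [c' tc'] := coef_ex n3 rb uw' t.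
  by rewrite (h _ _ _ uw' tc' v vb); exact: (fP v b u' w').
have [l lP] := near_cover (fun a => (CP a).2).
have fin : finite_set [set v | f v <> 0]%classic.
  apply/finite_lin.
  have [r rP] : exists r : seq (primediv Y), forall a (v : primediv Y), lin a l -> v (C a) != 0 -> lin v r.
    elim: (l) => [|a s [r rP]]; first by exists [::].
    have [r' r'P] := finite_support nY (CP a).1.
    exists (r' ++ r) => b v /= [<-|bs] vb; rewrite lin_cat; first by left; exact: r'P.
    by right; apply: rP vb.
  exists r => v /eqP fv; have [b vb] := primediv_point v; have [a al h] := lP b.
  by apply: (rP a v al); rewrite h.
exists (Divisor fin) => a u w c uw tc; split; first exact: coef_neq0 nt tc.
by move=> v va; rewrite /= (fP v a u w c).
Qed.
End FormDivisor.

(** * Algebraic stability under contraction *)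

Section LinEquiv.
Variables (k : numClosedFieldType) (X : surface k).
Implicit Types D E : divisor X.

Lemma lin_equiv_ext D E : (forall v : primediv X, D v = E v) -> lin_equiv D E.
Proof.
move=> h; exists 1; first exact: oner_neq0.
by move=> v; rewrite h (nv1 (primediv_nval v)) addr0.
Qed.

Lemma lin_equiv_sym D E : lin_equiv D E -> lin_equiv E D.
Proof.
move=> [h h0 DE]; exists h^-1; first by rewrite invr_eq0.
by move=> v; rewrite DE (nvV (primediv_nval v)) addrK.
Qed.

Lemma lin_equiv_trans D E F : lin_equiv D E -> lin_equiv E F -> lin_equiv D F.
Proof.
move=> [h h0 DE] [g g0 EF]; exists (g * h); first by rewrite mulf_neq0.
by move=> v; rewrite DE EF (nvM (primediv_nval v)) // addrA.
Qed.

Variable phi : {rmorphism vfield X -> vfield X}.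
Hypothesis nX : two_ders (viota X).

Lemma pull_rel_lin D D1 E E1 : lin_equiv D D1 -> lin_equiv E E1 -> pull_rel phi D1 E1 -> pull_rel phi D E.
Proof.
move=> [h h0 DD1] EE1 [F FE hF].
have fin : finite_set [set v : primediv X | F v + v (phi h) <> 0]%classic.
  have fh0 : phi h != 0 by rewrite fmorph_eq0.
  have [l lP] := finite_support nX fh0; have /finite_lin[r rP] := mult_finite F.
  apply/finite_lin; exists (r ++ l) => v ne; apply/lin_cat.
  have [F0|/eqP Fv] := eqVneq (F v) 0; last by left; exact: rP.
  by right; apply: lP; apply/eqP => z; apply: ne; rewrite F0 z.
exists (Divisor fin).
  apply: lin_equiv_trans (lin_equiv_sym EE1); apply: lin_equiv_trans FE.
  by exists (phi h); rewrite ?fmorph_eq0.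
by move=> v; exact: (gval_lin (primediv_nval v) h0 DD1 (hF v)).
Qed.

Lemma pull_rel_fun D E E1 : pull_rel phi D E -> pull_rel phi D E1 -> lin_equiv E E1.
Proof.
move=> [F FE hF] [F1 F1E hF1]; apply: lin_equiv_trans F1E; apply: lin_equiv_trans (lin_equiv_sym FE) _.
by apply: lin_equiv_ext => v; apply: (gval_uniq nX (primediv_nval v) (hF v) (hF1 v)).
Qed.

Variable g : ratmap X X.
Hypothesis dg : dom_by g phi.

Lemma pullback_PicP D E : pullback_Pic g D E <-> pull_rel phi D E.
Proof.
split=> [[G [p1 [p2 [m1 m2 cg [D1 [D2 [D3 [h1 h2 h3 h4]]]]]]]]|h].
  have [psi b1] := modification_birmor m1.
  exact: (pullback_Pic_rel nX dg b1 m2 cg h1 h2 h3 h4).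
have [G [p1 [p2 [m1 m2 cg]]]] := indeterminacy nX dg; have [psi b1] := modification_birmor m1.
exact: (rel_pullback_Pic nX dg b1 m2 cg m1 h).
Qed.

Lemma pull_rel_total D : exists E, pull_rel phi D E.
Proof.
have [G [p1 [p2 [m1 m2 cg]]]] := indeterminacy nX dg; have [psi b1] := modification_birmor m1.
have [E hE] := gval_total nX dg b1 m2 cg D.
by exists E; exists E => //; exact: lin_equiv_ext.
Qed.
End LinEquiv.

(** This makes the factor delta harmless; it is inherited by v o phi, which the induction over
    iterates requires. *)
Definition scale_invariant (k : numClosedFieldType) (X : surface k) (v : vfield X -> int) :=
  forall c x, c != 0 -> v (viota X c * x) = v x.

Lemma primediv_scale (k : numClosedFieldType) (X : surface k) (v : primediv X) : scale_invariant v.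
Proof.
move=> c x c0; have nv := primediv_nval v; have [->|x0] := eqVneq x 0; first by rewrite mulr0.
have [a va] := primediv_point v.
have cu : lunit (lr_at a) (viota X c) by split; [exact: lr_C|rewrite lr_evC].
by rewrite (nvM nv) ?fmorph_eq0 // (isdiv_unit (pass_isdiv va) cu) add0r.
Qed.

Section Iterates.
Variables (k : numClosedFieldType) (X : surface k) (phi : {rmorphism vfield X -> vfield X}).

Fixpoint iter_mor (n : nat) : {rmorphism vfield X -> vfield X} :=
  if n is n'.+1 then (iter_mor n' \o phi : {rmorphism _ -> _}) else idfun.

Lemma iter_mor_const n : (forall c, phi (viota X c) = viota X c) ->
  forall c, iter_mor n (viota X c) = viota X c.
Proof. by move=> pc c; elim: n => //= n IH; rewrite pc. Qed.

Variable g : ratmap X X.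
Hypothesis dg : dom_by g phi.

Lemma iter_mor_dom_ex n : exists gn : ratmap X X, dom_by gn (iter_mor n).
Proof.
by apply: dom_point; [exact: s_neq0|apply: iter_mor_const; case: dg].
Qed.

Lemma is_iter_dom n gn : is_iter g n gn <-> dom_by gn (iter_mor n).
Proof.
elim: n gn => [|n IH] gn /=; first exact: is_id_dom.
split=> [[h /IH dh c]|d]; first by apply/(comp_dom gn (s_gen (s := X)) dh dg).
have [h dh] := iter_mor_dom_ex n; exists h; first exact/IH.
by apply/(comp_dom gn (s_gen (s := X)) dh dg).
Qed.

Lemma iter_Pic_ext (T T' : divisor X -> divisor X -> Prop) n D E :
  (forall D E, T D E <-> T' D E) -> iter_Pic T n D E <-> iter_Pic T' n D E.
Proof.
move=> TT; elim: n E => [//|n IH] E /=.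
by split=> -[F /IH itF /TT t]; exists F.
Qed.
End Iterates.

(** * Descent of stability along a contraction *)

Section Contraction.
Variables (k : numClosedFieldType) (X X' : surface k).
Variables (m : {rmorphism vfield X' -> vfield X}) (mi : {rmorphism vfield X -> vfield X'}).
Hypothesis mK : cancel m mi.
Hypothesis miK : cancel mi m.
Hypothesis mc : forall c, m (viota X' c) = viota X c.
Variable t' : vfield X' * vfield X' * vfield X'.
Hypothesis nt' : fnz (viota X') t'.
Let t := fmap m t'.
Hypothesis lift : forall a : cpoint X, exists b : cpoint X', dominates m b a /\
  (lpole t' (lr_at b) -> forall h, lr_at a (m h) -> lr_at b h).
Hypothesis anti : forall b : cpoint X', lanti t' (lr_at b).
Hypothesis nonpos : forall v : primediv X, ~ fpos (viota X) v t ->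
  exists v' : primediv X', forall h, v' h = v (m h).
Let n3 := surface_n3 (Y := X).
Let n3' := surface_n3 (Y := X').
Let mic c : mi (viota X c) = viota X' c. Proof. by rewrite -mc mK. Qed.
Let nt : fnz (viota X) t. Proof. exact: fnz_iso mc mK miK n3 nt'. Qed.
Let nX : two_ders (viota X) := fnz_two_ders nt.
Let nX' : two_ders (viota X') := fnz_two_ders nt'.

(** Zeros and poles of the form on X never meet: over a pole of X' the local rings agree, so 1/c is
    regular; elsewhere the coefficient on X' is regular and c is its pullback times a Jacobian. *)
Lemma coef_or_inv (a : cpoint X) u w c : params (lr_at a) u w -> feq (viota X) t (c, u, w) ->
  lr_at a c \/ lr_at a c^-1.
Proof.
move=> uw tc; have ra := surface_regular2 a nX; have [b [ba bE]] := lift a.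
have rb := surface_regular2 b nX'; have [u' [w' uw']] := r2_params rb.
have [c' tc'] := coef_ex n3' rb uw' t'; have tmc' := feq_map mc nX' n3' tc'.
have [Ou' Ow' _ _ _] := uw'.
have [po|np] := pselect (lpole t' (lr_at b)); [right|left].
  have E h : lr_at a (m h) <-> lr_at b h by split=> [|/ba[]//]; exact: bE.
  have uwm : params (lr_at a) (m u') (m w') by apply: (params_pull miK E _ uw') => h /ba[].
  have Oc' : lr_at b c'^-1 := @anti b _ _ _ uw' tc'.
  have Omc' : lr_at a (m c')^-1 by rewrite -fmorphV; case: (ba _ Oc').
  exact: (lanti_one n3 nt ra uwm tmc' Omc' uw tc).
have Oc' : lr_at b c' := lanti_free (@anti b) np uw' tc'.
have [J OJ ->] := coef_dom n3 ra uw (ba _ Ou').1 (ba _ Ow').1 tmc' tc.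
by apply: lr_M => //; case: (ba _ Oc').
Qed.

Section Pullback.
Variables (phi : {rmorphism vfield X -> vfield X}) (phi' : {rmorphism vfield X' -> vfield X'}).
Hypothesis phiE : forall h, m (phi' h) = phi (m h).
Hypothesis fphi : forall v : primediv X, fpos (viota X) (v \o phi) t -> fpos (viota X) v t.

(* Curves along which the form vanishes are not seen by the pullback along the others: *)
(* if phi maps v into such a curve then the form vanishes along v too.                  *)
Lemma pullback_nonpos (v : primediv X) (b : cpoint X) x : ~ fpos (viota X) v t ->
  (forall h, lr_at b h -> 0 <= v (phi h)) -> x != 0 ->
  (forall w : primediv X, passes_through w b -> ~ fpos (viota X) w t -> 0 <= w x) ->
  0 <= v (phi x).
Proof.
move=> nv vb x0 wx; have rb := surface_regular2 b nX; have nva := primediv_nval v.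
have nuM g h : g != 0 -> h != 0 -> (v \o phi) (g * h) = (v \o phi) g + (v \o phi) h.
  by move=> g0 h0; rewrite /= rmorphM (nvM nva) // fmorph_eq0.
have nu0 : (v \o phi) 0 = 0 by rewrite /= rmorph0 (nv0 nva).
apply: (hartogs_gen rb nuM nu0 vb x0) => p v1 pp dv1 v1p vp.
have [w wE] := isdiv_primediv dv1; have wE' : (w : vfield X -> int) = v1 by apply: funext.
rewrite -wE'; apply: wx.
  by apply/pass_isdivP; rewrite wE'.
rewrite wE' => fp; apply: nv; apply: fphi.
have [u [s us]] := r2_params rb; have [c tc] := coef_ex n3 rb us t; have [Ou Os _ _ _] := us.
have v1c := (fpos_coef n3 rb us dv1 nt tc).1 fp.
have c0 := coef_neq0 nt tc.
(* The curve of p is a zero through b, so c rather than 1/c is regular there. Then p divides c, and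
   v o phi is positive on c du /\ ds. *)
have Oc : lr_at b c.
  have [//|Oc] := coef_or_inv us tc; have := id_ge0 dv1 Oc.
  by rewrite (nvV (idv dv1)) oppr_ge0 leNgt v1c.
have [r Or cE] := isdiv_pos dv1 pp v1p Oc v1c.
exists c, u, s; split=> //; [|exact: vb|exact: vb].
have := c0; rewrite cE mulf_eq0 negb_or => /andP[r0 p0].
by rewrite nuM // ltr_wpDl //; exact: vb.
Qed.

(** D' is the pushforward of D: nothing is asked along curves of positive order. *)
Definition compatible (D : divisor X) (D' : divisor X') := forall (v : primediv X) (v' : primediv X'),
  ~ fpos (viota X) v t -> (forall h, v' h = v (m h)) -> D v = D' v'.

(** Equations of D at b and of D' at its image b' agree along the non-positive curves through b;
    [pullback_nonpos] on their ratio and its inverse makes the pullbacks agree along v. *)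
Lemma gval_compatible D D' (v : primediv X) (v' : primediv X') n : compatible D D' ->
  ~ fpos (viota X) v t -> (forall h, v' h = v (m h)) ->
  gval phi D v n -> gval phi' D' v' n.
Proof.
move=> DD' nv v'v [b [h [vb [h0 hD] ->]]]; have [b' [b'b _]] := lift b.
have [h' h'D] := local_equation_ex nX' D' b'; have [h'0 h'E] := h'D.
exists b', h'; split=> //.
  by move=> r /b'b[br _]; rewrite v'v phiE; exact: vb.
have mh0 : m h' != 0 by rewrite fmorph_eq0.
rewrite v'v phiE; have nva := primediv_nval v.
have key (w : primediv X) : passes_through w b -> ~ fpos (viota X) w t -> w h = w (m h').
  move=> wb nw; have [w' w'w] := nonpos nw; rewrite -(hD w wb) (DD' w w' nw w'w) (h'E w') ?w'w //.
  by move=> r /b'b[br _]; rewrite w'w; exact: wb.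
have half (x y : vfield X) : x != 0 -> y != 0 -> (forall w : primediv X, passes_through w b ->
    ~ fpos (viota X) w t -> w x = w y) -> v (phi x) <= v (phi y).
  move=> x0 y0 xy; rewrite -subr_ge0 -(nvdiv nva) ?fmorph_eq0 // -fmorph_div.
  apply: (pullback_nonpos nv vb); first by rewrite mulf_neq0 // invr_eq0.
  by move=> w wb nw; rewrite (nvdiv (primediv_nval w)) // (xy w wb nw) subrr.
apply/eqP; rewrite eq_le !half // => w wb nw; by rewrite (key w wb nw).
Qed.
End Pullback.

Lemma contraction_birmor : exists mu : ratmap X X', birmor mu m.
Proof.
have [mu dmu] := dom_point (s_neq0 X') mc; exists mu; split=> //; last by exists mi.
by apply/(morphism_dominates dmu) => a; have [b [ba _]] := lift a; exists b.
Qed.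

Lemma strict_transform : exists L : primediv X' -> primediv X,
  [/\ forall v' h, L v' (m h) = v' h, forall v', ~ fpos (viota X) (L v') t
    & forall (v : primediv X) (v' : primediv X'), (forall h, v' h = v (m h)) -> L v' = v].
Proof.
have [mu bmu] := contraction_birmor.
have /choice[L LP] := primediv_lift bmu; exists L; split=> //.
  move=> v' fp; have LE : (L v' : vfield X -> int) = v' \o mi.
    by apply: funext => h /=; rewrite -LP miK.
  have := fp; rewrite LE => /(fpos_map mic n3 nX).
  have -> : fmap mi t = t' by rewrite /t /fmap /= !mK; case: (t') => [[]].
  have [b v'b] := primediv_point v'; have rb := surface_regular2 b nX'.
  have [u [w uw]] := r2_params rb; have [c tc] := coef_ex n3' rb uw t'.
  have dv := pass_isdiv v'b.
  move=> /(fpos_coef n3' rb uw dv nt' tc); have := id_ge0 dv (@anti b _ _ _ uw tc).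
  by rewrite (nvV (idv dv)) oppr_ge0 leNgt => /negP.
by move=> v v' E; apply: (primediv_lift_uniq bmu) => h; rewrite LP.
Qed.

(** [mu] reads multiplicities along strict transforms and [sg] provides preimages, so pullbacks on
    X' are induced from those on X through a surjection of class groups. *)
Lemma divisor_transfer : exists (mu : divisor X -> divisor X') (sg : divisor X' -> divisor X),
  [/\ forall D, compatible D (mu D), forall D', lin_equiv (mu (sg D')) D',
    forall D E, lin_equiv D E -> lin_equiv (mu D) (mu E)
  & forall (phi : {rmorphism vfield X -> vfield X}) (phi' : {rmorphism vfield X' -> vfield X'}), (forall h, m (phi' h) = phi (m h)) ->
      (forall v : primediv X, fpos (viota X) (v \o phi) t -> fpos (viota X) v t) ->
      forall D E, pull_rel phi D E -> pull_rel phi' (mu D) (mu E)].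
Proof.
have [L [LP Ln Lu]] := strict_transform.
have finL (D : divisor X) : finite_set [set v' | D (L v') <> 0]%classic.
  apply: (finite_preimage (f := L) (B := [set v | D v <> 0]%classic)); last exact: mult_finite.
  by move=> v1 v2 _ _ e; apply: primediv_ext => h; rewrite -!LP e.
pose mu D := Divisor (finL D).
have muE D v' : mu D v' = D (L v') by [].
have sgP (D' : divisor X') : exists D : divisor X, forall v', D (L v') = D' v'.
  have /choice[f fP] : forall v : primediv X, exists n : int,
      (forall v', L v' = v -> n = D' v') /\ (n <> 0 -> exists2 v', D' v' <> 0 & L v' = v).
    move=> v; have [[v' Lv]|nv] := pselect (exists v', L v' = v); last first.
      by exists 0; split=> // v' Lv; case: nv; exists v'.
    exists (D' v'); split=> [v2 Lv2|n0]; last by exists v'.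
    by congr (D' _); apply: primediv_ext => h; rewrite -!LP Lv Lv2.
  have fin : finite_set [set v | f v <> 0]%classic.
    apply: (sub_finite_set _ (finite_image L (mult_finite D'))).
    by move=> v /= /(fP v).2[v' n0 <-]; exists v'.
  by exists (Divisor fin) => v'; rewrite /= ((fP _).1 v').
have /choice[sg sgE] := sgP.
have muc D : compatible D (mu D) by move=> v v' nv E; rewrite muE (Lu v v' E).
have mulin D E : lin_equiv D E -> lin_equiv (mu D) (mu E).
  move=> [h h0 DE]; exists (mi h); first by rewrite fmorph_eq0.
  by move=> v'; rewrite !muE DE -LP miK.
exists mu, sg; split=> //.
  by move=> D'; apply: lin_equiv_ext => v'; rewrite muE sgE.
move=> phi phi' pE fp D E [F FE hF]; exists (mu F); first exact: mulin.
move=> v'; rewrite muE; exact: (gval_compatible pE fp (muc D) (Ln v')).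
Qed.

Variables (phi : {rmorphism vfield X -> vfield X}) (phi' : {rmorphism vfield X' -> vfield X'}).
Variables (g : ratmap X X) (g' : ratmap X' X').
Hypothesis phiE : forall h, m (phi' h) = phi (m h).
Hypothesis dg : dom_by g phi.
Hypothesis dg' : dom_by g' phi'.
Hypothesis fphi : forall v : vfield X -> int, scale_invariant v ->
  fpos (viota X) (v \o phi) t -> fpos (viota X) v t.

(** Both the pullback by an iterate of g' and the iterated pullback of D' are obtained by pulling
    [sg D'] back on X and pushing forward, so their equality on X suffices. *)
Lemma alg_stable_contraction : alg_stable g -> alg_stable g'.
Proof.
have pc : forall c, phi (viota X c) = viota X c by case: dg.
move=> st; have [mu [sg [muc musg mulin tr]]] := divisor_transfer.
have phiEn n h : m (iter_mor phi' n h) = iter_mor phi n (m h).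
  by elim: n h => //= n IH h; rewrite IH phiE.
have fphin n (v : vfield X -> int) : scale_invariant v ->
    fpos (viota X) (v \o iter_mor phi n) t -> fpos (viota X) v t.
  elim: n v => [//|n IH] v sv fp; apply: IH => //.
  apply: (fphi (v := v \o iter_mor phi n)) => // c x c0 /=.
  by rewrite rmorphM iter_mor_const // sv.
have trn n D' E' : pull_rel (iter_mor phi' n) D' E' <->
    exists E, pull_rel (iter_mor phi n) (sg D') E /\ lin_equiv (mu E) E'.
  split=> [h|[E [h e]]]; last first.
    apply: (pull_rel_lin nX' (lin_equiv_sym (musg D')) (lin_equiv_sym e)).
    exact: (tr _ _ (phiEn n) (fun v => fphin n v (primediv_scale v)) _ _ h).
  have [gn dgn] := iter_mor_dom_ex dg n.
  have [E hE] := pull_rel_total nX dgn (sg D'); exists E; split=> //.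
  have h2 := tr _ _ (phiEn n) (fun v => fphin n v (primediv_scale v)) _ _ hE.
  exact: (pull_rel_fun nX' (pull_rel_lin nX' (lin_equiv_sym (musg D')) (lin_equiv_ext (fun _ => erefl)) h2) h).
have tr1 D E' : pull_rel phi' (mu D) E' <-> exists E, pull_rel phi D E /\ lin_equiv (mu E) E'.
  split=> [h|[E [h e]]]; last first.
    apply: (pull_rel_lin nX' (lin_equiv_ext (fun _ => erefl)) (lin_equiv_sym e)).
    exact: (tr _ _ phiE (fun v => fphi (primediv_scale v)) _ _ h).
  have [E hE] := pull_rel_total nX dg D; exists E; split=> //.
  exact: (pull_rel_fun nX' (tr _ _ phiE (fun v => fphi (primediv_scale v)) _ _ hE) h).
have itn n D' E' : iter_Pic (pull_rel phi') n D' E' <->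
    exists E, iter_Pic (pull_rel phi) n (sg D') E /\ lin_equiv (mu E) E'.
  elim: n E' => [|n IH] E' /=.
    split=> [h|[E [h e]]].
      exists (sg D'); split; first exact: lin_equiv_ext.
      exact: lin_equiv_trans (musg D') h.
    apply: lin_equiv_trans (lin_equiv_sym (musg D')) _.
    exact: lin_equiv_trans (mulin _ _ h) e.
  split=> [[D1 /IH[E1 [it1 e1]] h]|[E [[E1 it1 h1] e]]].
    have /tr1[E [hE e]] := pull_rel_lin nX' e1 (lin_equiv_ext (fun _ => erefl)) h.
    by exists E; split=> //; exists E1.
  exists (mu E1); first by apply/IH; exists E1; split=> //; exact: lin_equiv_ext.
  by apply/tr1; exists E.
have stX n D E : pull_rel (iter_mor phi n) D E <-> iter_Pic (pull_rel phi) n D E.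
  have [gn /(is_iter_dom dg) dgn h] := st n.
  rewrite -(pullback_PicP nX dgn) h; apply: iter_Pic_ext => F F'; exact: pullback_PicP.
move=> n; have [gn dgn] := iter_mor_dom_ex dg' n; exists gn; first exact/(is_iter_dom dg').
move=> D E; rewrite (pullback_PicP nX' dgn).
rewrite (iter_Pic_ext (T' := pull_rel phi')); last by move=> F F'; exact: pullback_PicP.
by rewrite trn itn; split=> -[F [h e]]; exists F; split=> //; apply/stX.
Qed.
End Contraction.

(** * Dominance *)

Section Dominance.
Variables (k : numClosedFieldType) (X Y : surface k) (f : ratmap X Y).

Lemma eval_mmap n (z : 'I_n -> vfield Y) (z' : 'I_n -> vfield X) (P : {mpoly k[n]}) :
  (forall i, eval_at f (z i) (z' i)) -> eval_at f (mmap (viota Y) z P) (mmap (viota X) z' P).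
Proof.
move=> zz; elim/mpoly_ring_ind: P => [c|i|F G IF IG|F G IF IG].
- by rewrite !mmapC; exact: eval_C.
- by rewrite !mmapX !mmap1U.
- by rewrite !mmapD; exact: eval_D.
- have e : mmap (viota Y) z (F * G) = mmap (viota Y) z F * mmap (viota Y) z G by rewrite rmorphM.
  have e' : mmap (viota X) z' (F * G) = mmap (viota X) z' F * mmap (viota X) z' G by rewrite rmorphM.
  by rewrite e e'; exact: eval_M.
Qed.

Variables (a b : vfield Y) (a' b' : vfield X).
Hypotheses (aa : eval_at f a a') (bb : eval_at f b b').
Hypothesis indep : forall F : {mpoly k[2]},
  mmap (viota X) (fun i : 'I_2 => if i == 0 then a' else b') F = 0 -> F = 0.

Let triple (T : Type) (x y w : T) (i : 'I_3) := nth w [:: x; y] i.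

(* a, b, g satisfy a polynomial relation; dividing it by the power of g it contains *)
(* and specializing g to 0 yields a relation between a' and b'                        *)
Lemma eval0_eq0 g : eval_at f g 0 -> g = 0.
Proof.
move=> eg; apply/eqP/negPn/negP => g0.
have [P P0 zP] : exists2 P : {mpoly k[3]}, P != 0 & mmap (viota Y) (triple a b g) P = 0.
  apply: contrapT => nP; apply: (surface_n3 (Y := Y)); exists (triple a b g) => F F0.
  by apply/eqP/negPn/negP => nz; apply: nP; exists F.
pose i2 : 'I_3 := ord_max; pose w0 : 'I_2 -> 'I_3 := widen_ord (leqnSn 2).
have ex : exists N, has (fun m : 'X_{1..3} => m i2 == N) (msupp P).
  have : msupp P != [::] by rewrite msupp_eq0.
  by case: (msupp P) => // m s _; exists (m i2); rewrite /= eqxx.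
case: (ex_minnP ex) => N /hasP[ms msP /eqP msN] minN.
have Nle m : m \in msupp P -> (N <= m i2)%N by move=> mP; apply: minN; apply/hasP; exists m.
pose R := \sum_(m <- msupp P) P@_m *: 'X_[(m - U_(i2) *+ N)%MM].
have term (K : fieldType) (x y w : K) (m : 'X_{1..3}) :
    mmap1 (triple x y w) m = x ^+ m (w0 o0) * y ^+ m (w0 ord_max) * w ^+ m i2.
  rewrite /mmap1 big_ord_recl big_ord_recl big_ord_recl big_ord0 mulr1 mulrA /triple /=.
  by congr (_ ^+ m _ * _ ^+ m _ * _ ^+ m _); apply: val_inj.
have RE (K : fieldType) (j : {rmorphism k -> K}) (x y w : K) : mmap j (triple x y w) R =
    \sum_(m <- msupp P) j P@_m * (x ^+ m (w0 o0) * y ^+ m (w0 ord_max) * w ^+ (m i2 - N)).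
  rewrite /R raddf_sum /=; apply: eq_bigr => m _.
  have mE i : ((m - U_(i2) *+ N)%MM : 'X_{1..3}) i = (m i - (i2 == i) * N)%N.
    by rewrite mnmBE mulmnE mnm1E.
  by rewrite mmapZ mmapX term !mE !mul0n mul1n !subn0.
have PE : mmap (viota Y) (triple a b g) P = g ^+ N * mmap (viota Y) (triple a b g) R.
  rewrite RE mulr_sumr /mmap big_seq [RHS]big_seq; apply: eq_bigr => m /Nle Nm.
  by rewrite term -{1}(subnKC Nm) exprD; ring.
have R0 : mmap (viota X) (triple a' b' 0) R = 0.
  have e : eval_at f (mmap (viota Y) (triple a b g) R) (mmap (viota X) (triple a' b' 0) R).
    by apply: eval_mmap => -[[|[|[|//]]] ilt].
  have z : mmap (viota Y) (triple a b g) R = 0.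
    by move: zP; rewrite PE => /eqP; rewrite mulf_eq0 expf_eq0 (negPf g0) andbF => /eqP.
  rewrite z in e; apply: (eval_uniq e); have := eval_C f 0; by rewrite !rmorph0.
pose pr (m : 'X_{1..3}) : 'X_{1..2} := [multinom m (w0 i) | i < 2].
pose Q := \sum_(m <- msupp P | m i2 == N) P@_m *: 'X_[pr m].
have Q0 : Q = 0.
  apply: indep; rewrite -[RHS]R0 RE /Q raddf_sum big_mkcond /= big_seq [RHS]big_seq.
  apply: eq_bigr => m /Nle Nm; case: eqVneq => [->|ne].
    rewrite mmapZ mmapX subnn expr0 mulr1; congr (_ * _).
    rewrite /mmap1 big_ord_recl big_ord_recl big_ord0 mulr1 !mnmE /=.
    by congr (_ * _ ^+ fun_of_multinom m _); apply: val_inj.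
  rewrite expr0n (_ : (m i2 - N == 0)%N = false) ?mulr0 //.
  by apply/negP; rewrite subn_eq0 => h; case/negP: ne; rewrite eqn_leq h Nm.
have := congr1 (fun F : {mpoly k[2]} => F@_(pr ms)) Q0.
rewrite mcoeff0 /Q raddf_sum /= big_mkcond /= (bigD1_seq ms) ?msupp_uniq //= msN eqxx big1_seq.
  rewrite addr0 mcoeffZ mcoeffX eqxx mulr1 => /eqP.
  by apply/negP; rewrite -mcoeff_msupp.
move=> m /andP[ne mP]; case: eqP => // mN; rewrite mcoeffZ mcoeffX.
rewrite (_ : (pr m == pr ms) = false) ?mulr0 //; apply/negP => /eqP e; case/negP: ne.
apply/eqP/mnmP => i; have [->|] := eqVneq i i2; first by rewrite mN msN.
case: i => [[|[|[|//]]] ilt] // _.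
  have := congr1 (fun n : 'X_{1..2} => n o0) e; rewrite !mnmE.
  by congr (_ = _); congr (fun_of_multinom _ _); apply: val_inj.
have := congr1 (fun n : 'X_{1..2} => n ord_max) e; rewrite !mnmE.
by congr (_ = _); congr (fun_of_multinom _ _); apply: val_inj.
Qed.

(** A denominator vanishing along f would be a nonzero function of value 0 at f, excluded by
    [eval0_eq0]. *)
Lemma dominant : exists phi : {rmorphism vfield Y -> vfield X}, dom_by f phi.
Proof.
apply: dom_by_ex => h; have [d [F [G [hF hG G0 ->]]]] := s_gen (s := Y) h.
have [Gf|Gf] := eqVneq (mmap (viota X) f G) 0; last first.
  by exists (mmap (viota X) f F / mmap (viota X) f G), d, F, G.
have [i fi] := pt_neq0 f; have xi := pt_gen fi.
suff z : mmap (viota Y) (fun l => @vgen k Y l / @vgen k Y i) G = 0.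
  by move: G0; rewrite (homog_aff (viota Y) hG xi) z mulr0 eqxx.
apply: eval0_eq0; apply/(eval_affP fi); exists G, 1.
rewrite !(rmorph1 (mmap _ _)) !divr1 oner_neq0; split=> //; apply/esym/eqP.
move/eqP: Gf; rewrite (homog_aff (viota X) hG fi) mulf_eq0 expf_eq0 (negPf fi) andbF.
by move=> /eqP ->.
Qed.
End Dominance.

(** * Conclusion *)

Section FormRecords.
Variables (k : numClosedFieldType) (X : surface k).

Lemma derivation_der_on (D : derivation X) : der_on (viota X) D.
Proof. by split; [exact: derD|exact: derM|exact: derC]. Qed.

Lemma der_on_derivation (d : vfield X -> vfield X) : der_on (viota X) d ->
  exists D : derivation X, (D : vfield X -> vfield X) = d.
Proof. by move=> [dD dM dC]; exists (Derivation dD dM dC). Qed.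

Lemma form_isP (eta : two_form X) h a b h' a' b' : form_is eta h a b ->
  form_is eta h' a' b' <-> feq (viota X) (h, a, b) (h', a', b').
Proof.
move=> fe; split=> [fe' d1 d2 /der_on_derivation[D <-] /der_on_derivation[E <-]|fq D E].
  by rewrite /fval /det2 /= -fe -fe'.
by rewrite fe; exact: (fq _ _ (derivation_der_on D) (derivation_der_on E)).
Qed.

Variable t : vfield X * vfield X * vfield X.

Lemma triple_form : exists eta : two_form X, form_is eta t.1.1 t.1.2 t.2.
Proof.
have l1 (c : vfield X) (D1 D2 D3 E : derivation X) : (forall h, D3 h = c * D1 h + D2 h) ->
    fval t D3 E = c * fval t D1 E + fval t D2 E.
  by move=> h; rewrite /fval /det2 !h; ring.
have l2 (c : vfield X) (D1 D2 D3 E : derivation X) : (forall h, D3 h = c * D1 h + D2 h) ->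
    fval t E D3 = c * fval t E D1 + fval t E D2.
  by move=> h; rewrite /fval /det2 !h; ring.
have l3 (D : derivation X) : fval t D D = 0 by rewrite /fval /det2; ring.
by exists (TwoForm l1 l2 l3) => D E.
Qed.
End FormRecords.

Lemma surface_point (k : numClosedFieldType) (X : surface k) : exists a : cpoint X, True.
Proof.
pose y : point X (viota X) := @Point k X (vfield X) (viota X) (@vgen k X) (s_neq0 X) (fun d F _ F0 => F0).
by have [a _] := specialization y; exists a.
Qed.

Section AntiEffective.
Variables (k : numClosedFieldType) (X : surface k) (eta : two_form X) (h a b : vfield X).
Hypothesis nX : two_ders (viota X).
Hypothesis fe : form_is eta h a b.
Let t := (h, a, b).

(** [hartogs] turns nonnegativity of 1/c along the curves through p into regularity at p; a local
    equation is nonzero, so the form is too. *)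
Lemma neg_Div_lanti : neg_Div_effective eta ->
  fnz (viota X) t /\ forall p : cpoint X, lanti t (lr_at p).
Proof.
move=> [D dD Dv].
have coef p u w c : params (lr_at p) u w -> feq (viota X) t (c, u, w) ->
    local_equation D p c.
  move=> uw tc; have [g /(form_isP _ _ _ fe) tg lg] := dD p u w ((local_paramsP p u w).2 uw).
  suff -> : c = g by [].
  have [d1 [d2 [dd1 dd2 [d1u d1w] [d2u d2w] _]]] := r2_der (surface_regular2 p nX) uw.
  have := feq_trans (feq_sym tc) tg dd1 dd2.
  by rewrite /fval /det2 /= d1u d1w d2u d2w !mulr0 !mulr1 !subr0 !mulr1.
split.
  have [p _] := surface_point X; have rp := surface_regular2 p nX; have [u [w uw]] := r2_params rp.
  have [c tc] := coef_ex (surface_n3 (Y := X)) rp uw t; have [c0 _] := coef _ _ _ _ uw tc.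
  have [d1 [d2 [dd1 dd2 [d1u d1w] [d2u d2w] _]]] := r2_der rp uw.
  exists d1, d2; split=> //; rewrite (tc _ _ dd1 dd2).
  by rewrite /fval /det2 /= d1u d1w d2u d2w mulr0 mulr1 subr0 mulr1.
move=> p u w c uw tc; have [c0 cE] := coef _ _ _ _ uw tc.
apply: (hartogs (surface_regular2 p nX)); first by rewrite invr_eq0.
move=> v dv; have [v1 v1E] := isdiv_primediv dv.
have E : (v1 : vfield X -> int) = v by apply: funext.
have pv : passes_through v1 p by apply/pass_isdivP; rewrite E.
by have := Dv v1; rewrite (cE v1 pv) E (nvV (idv dv)).
Qed.
End AntiEffective.

Section Main.
Variables (k : numClosedFieldType) (S : surface k) (f : ratmap S S) (eta : two_form S).

Lemma anti_effective_model : preserves f eta -> neg_Div_effective eta ->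
  (exists (X : surface k) (pi : ratmap X S) (fX : ratmap X X),
     [/\ modification pi, is_lift pi f fX & alg_stable fX]) ->
  exists (X : surface k) (pi : ratmap X S) (fX : ratmap X X) (pi_eta : two_form X),
    [/\ modification pi, is_lift pi f fX, alg_stable fX,
        pullback_form pi eta pi_eta & neg_Div_effective pi_eta].
Proof.
move=> [delta d0 [eta' [h [a [b [h' [a' [b' [fe [eh ea eb] fe']]]]]]] etaE]] ne.
move=> [X [pi [fX [mpi lf st]]]].
have [phi0 bpi0] := modification_birmor mpi.
have [pii [g1 [inv cfp cg]]] := lf.
have [p [q [dp dq pK qK]]] := inverse_maps_dom (s_gen (s := X)) (s_gen (s := S)) inv.
(* If all determinants of derivations vanish, every two-form equals 1 du /\ dw, so the zero divisor
   is its divisor and X itself serves. *)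
have [nS|nnS] := pselect (two_ders (viota S)); last first.
  have zS (D E : vfield S -> vfield S) x y : der_on (viota S) D -> der_on (viota S) E -> det2 D E x y = 0.
    by move=> dD dE; apply/eqP/negPn/negP => nz; apply: nnS; exists D, E, x, y.
  have zX (D E : vfield X -> vfield X) x y : der_on (viota X) D -> der_on (viota X) E -> det2 D E x y = 0.
    move=> dD dE; apply/eqP/negPn/negP => nz; apply: nnS; apply/(birmor_two_ders bpi0).
    by exists D, E, x, y.
  have [eX eXP] := triple_form (0, 0, 0 : vfield X).
  exists X, pi, fX, eX; split=> //.
    exists 0, 0, 0, 0, 0, 0; split=> //.
      by move=> D E; rewrite fe mul0r -[X in _ * X]/(det2 D E a b) zS ?mulr0 //; exact: derivation_der_on.
    have e0 : eval_at pi 0 0 by rewrite -(rmorph0 p); apply: eval_dom => //; exact: s_gen.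
    by [].
  have fin : finite_set [set v : primediv X | (0 : int) <> 0]%classic.
    by apply/finite_lin; exists [::] => v.
  exists (Divisor fin); last by move=> v; rewrite /= oppr0.
  move=> c u w _; exists 1.
    by move=> D E; rewrite eXP mul0r mul1r -[RHS]/(det2 D E u w) zX //; exact: derivation_der_on.
  split; first exact: oner_neq0.
  by move=> v _; rewrite (nv1 (primediv_nval v)).
have [nom an] := neg_Div_lanti nS fe ne; set om := (h, a, b) in nom an.
have n3 := surface_n3 (Y := S).
(* As delta is nonzero, so is the pulled back form; hence a' and b' have a nonzero determinant and
   are algebraically independent. *)
have [phi dphi] : exists phi : {rmorphism vfield S -> vfield S}, dom_by f phi.
  apply: (dominant ea eb) => F; have [D [E [dD dE nz]]] := nom.
  have [D' D'E] := der_on_derivation dD; have [E' E'E] := der_on_derivation dE.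
  have nz' : det2 D E a' b' != 0.
    apply: contra_neq nz => z; rewrite -D'E -E'E; have := etaE D' E'.
    rewrite fe' fe -[X in _ * X]/(det2 D' E' a' b') D'E E'E z mulr0 => /esym/eqP.
    by rewrite mulf_eq0 fmorph_eq0 (negPf d0) /= => /eqP.
  have [d1 [d2 [dd1 dd2 [d1a d1b] [d2a d2b]]]] := dual_ders dD dE nz'.
  exact: (alg_indep_ab dd1 dd2 d1a d1b d2a d2b).
have gS := s_gen (s := S); have [phc _] := dphi; have [pc _] := dp; have [qc _] := dq.
have omphi : feq (viota S) (fmap phi om) (viota S delta * h, a, b).
  rewrite /fmap /= -(eval_domE gS dphi eh) -(eval_domE gS dphi ea) -(eval_domE gS dphi eb).
  move=> D E /der_on_derivation[D' <-] /der_on_derivation[E' <-].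
  by have := etaE D' E'; rewrite fe' fe /fval /det2 /= mulrA.
have dg1 := (comp_dom g1 (s_gen (s := S)) dp dphi).1 cfp.
have dfX := (comp_dom fX (s_gen (s := S)) dg1 dq).1 cg.
have [X' [pi' [p' [m [mi [[mpi' bpi' [mK miK] mc mp] lift anti nonpos]]]]]] :=
  adapted_modification nom an mpi dp.
have nt' := birmor_fnz nom bpi'.
have tE : fmap m (fmap p' om) = fmap p om by rewrite /fmap /= !mp.
have [dp' _ [q' [q'K p'K]]] := bpi'; have [p'c _] := dp'.
have [fX' dfX'] : exists fX' : ratmap X' X', dom_by fX' ((p' \o phi) \o q').
  apply: dom_point; first exact: s_neq0.
  by move=> c /=; rewrite -(p'c c) q'K phc.
have qm x : q (m x) = q' x by rewrite -{1}[x]p'K mp pK.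
have phiE x : m ((p' \o phi \o q') x) = (p \o phi \o q) (m x) by rewrite /= mp qm.
(* Pulling the form back by the lift of f multiplies it by delta, so a presentation of positive
   order for v composed with the lift becomes, divided by delta, one for v. *)
have fphi (v : vfield X -> int) : scale_invariant v ->
    fpos (viota X) (v \o (p \o phi \o q)) (fmap m (fmap p' om)) -> fpos (viota X) v (fmap m (fmap p' om)).
  rewrite tE => sv fp; have nX : two_ders (viota X) by apply/(birmor_two_ders bpi0).
  have fXc c : (p \o phi \o q) (viota X c) = viota X c by rewrite /= qc phc pc.
  have [c [x [y [vc vx vy cE]]]] := fpos_map fXc (surface_n3 (Y := X)) nX fp.
  have e1 := feq_map pc nS n3 omphi.
  exists (viota X delta^-1 * c), x, y; split=> //; first by rewrite sv // invr_eq0.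
  have e2 : feq (viota X) (fmap p (viota S delta * h, a, b)) (c, x, y).
    apply: feq_trans (feq_sym e1) _; move: cE; rewrite /fmap /= !pK; exact.
  move=> D E dD dE; have := e2 D E dD dE; rewrite /fval /fmap /= rmorphM pc fmorphV => e3.
  have vd0 : viota X delta != 0 by rewrite fmorph_eq0.
  by rewrite -[RHS]mulrA -e3; field.
have [pi'' dpi''] : exists pi'' : ratmap S X', dom_by pi'' q'.
  by apply: dom_point => [|c]; [exact: s_neq0|rewrite -(p'c c) q'K].
have [h'' dh''] : exists h'' : ratmap X' S, dom_by h'' (p' \o phi).
  by apply: dom_point => [|c /=]; [exact: s_neq0|rewrite phc p'c].
have [pe peP] := triple_form (fmap p' om).
exists X', pi', fX', pe; split=> //.
- exists pi'', h''; split.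
  + exact: (dom_inverse_maps (s_gen (s := X')) gS dp' dpi'' q'K p'K (s_neq0 X') (s_neq0 S)).
  + by apply/(comp_dom h'' gS dp' dphi).
  + by apply/(comp_dom fX' gS dh'' dpi'').
- apply: (alg_stable_contraction mK miK mc nt' lift anti _ phiE dfX dfX' fphi st).
  by rewrite tE.
- exists h, a, b, (p' h), (p' a), (p' b); split=> //.
  by split; apply: eval_dom.
have nX' := fnz_two_ders nt'; have [D DP] := form_divisor nt'.
exists D.
  move=> c u w /local_paramsP uw.
  have [e tc] := coef_ex (surface_n3 (Y := X')) (surface_regular2 c nX') uw (fmap p' om).
  by exists e; [apply/(form_isP _ _ _ peP)|exact: DP uw tc].
move=> v; have [c vc] := primediv_point v.
have rc := surface_regular2 c nX'; have [u [w uw]] := r2_params rc.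
have [e tc] := coef_ex (surface_n3 (Y := X')) rc uw (fmap p' om).
have [_ eE] := DP _ _ _ _ uw tc; rewrite (eE v vc) -(nvV (primediv_nval v)).
exact: (vc _ (anti c u w e uw tc)).
Qed.
End Main.

Theorem theoremC (R : realType) (S : surface R[i]) (f : ratmap S S)
    (eta : two_form S) :
  preserves f eta ->
  neg_Div_effective eta ->
  (exists (X : surface R[i]) (pi : ratmap X S) (fX : ratmap X X),
     [/\ modification pi, is_lift pi f fX & alg_stable fX]) ->
  exists (X : surface R[i]) (pi : ratmap X S) (fX : ratmap X X)
         (pi_eta : two_form X),
    [/\ modification pi, is_lift pi f fX, alg_stable fX,
        pullback_form pi eta pi_eta & neg_Div_effective pi_eta].
Proof. exact: anti_effective_model. Qed.
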